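(* For any compact interval $I$ in $(0,\infty)\times\mathbb R^N$ there exists a constant $0<C<\infty$ such that $$\lim_{\varepsilon\to0}\ \sup_{\substack{(t,x),(s,y)\in I,\\ 0<|t-s|+|x-y|\le\varepsilon}}\frac{|u(t,x)-u(s,y)|}{(|t-s|+|x-y|)^\alpha\sqrt{\log\big[1+(|t-s|+|x-y|)^{-1}\big]}}=C\quad\text{a.s.}$$
   Context: Fix integers $N\ge1$, $d\ge1$, and $H\in[1/2,1)$, $\beta\in(0,N)$. Let $h_\beta:\mathbb R^N\to[0,\infty)$ be measurable with $c_1|\xi|^{-\beta}\le h_\beta(\xi)\le c_2|\xi|^{-\beta}$ for constants $0<c_1\le c_2<\infty$. Assume $N-2H-1<\beta<N-2H+1$ and set $\alpha=\frac{2H+1-N+\beta}{2}\in(0,1)$. For $t\ge0$, $x\in\mathbb R^N$, $\tau\in\mathbb R$, $\xi\in\mathbb R^N$ let $\mathcal F g_{t,x}(\tau,\xi)=\frac{e^{-ix\cdot\xi}}{2|\xi|}\Big(\frac{e^{-it\tau}-e^{it|\xi|}}{\tau+|\xi|}-\frac{e^{-it\tau}-e^{-it|\xi|}}{\tau-|\xi|}\Big)$. The field $u=(u_1,\dots,u_d)$ is the (continuous version of the) random field solution of $\partial_t^2u_j=\Delta u_j+\dot W_j$ on $[0,\infty)\times\mathbb R^N$ with zero initial data, where $\dot W_j$ are i.i.d. centered Gaussian noises with formal covariance $\rho_H(t-s)f_\beta(x-y)$ ($\rho_H=\delta$ if $H=1/2$, $\rho_H(r)=|r|^{2H-2}$ if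 $H>1/2$, $f_\beta$ the Fourier transform of $h_\beta(\xi)d\xi$). Concretely, $u_1,\dots,u_d$ are i.i.d. centered Gaussian random fields with $\mathbb E[u_1(t,x)u_1(s,y)]=c_H\int_{\mathbb R}\int_{\mathbb R^N}\mathcal F g_{t,x}(\tau,\xi)\overline{\mathcal F g_{s,y}(\tau,\xi)}\,|\tau|^{1-2H}h_\beta(\xi)\,d\xi\,d\tau$ for a constant $c_H>0$. *)

(* Defs.v *)
From HB Require Import structures.
From mathcomp Require Import all_boot all_order all_algebra.
From mathcomp Require Import all_classical all_reals all_analysis.
From mathcomp Require Import complex.

Set Implicit Arguments.
Unset Strict Implicit.
Unset Printing Implicit Defensive.

Import Order.TTheory GRing.Theory Num.Theory.
Import numFieldNormedType.Exports.

Local Open Scope classical_set_scope.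
Local Open Scope ring_scope.

Section defs.
Variable R : realType.

Definition dotp (N : nat) (x y : 'rV[R]_N) : R := \sum_(i < N) x 0 i * y 0 i.
Definition enorm (N : nat) (x : 'rV[R]_N) : R := Num.sqrt (\sum_(i < N) x 0 i ^+ 2).
Definition enormf (d : nat) (v : 'I_d -> R) : R := Num.sqrt (\sum_(j < d) v j ^+ 2).

Definition tup2row (N : nat) (t : N.-tuple R) : 'rV[R]_N := \row_(i < N) tnth t i.

(** Lebesgue integral over R^n (n-tuples), as iterated one-dimensional
    Lebesgue integrals (equal to the product-measure integral by Fubini for
    the absolutely integrable integrands used below). *)
Fixpoint int_Rn (n : nat) : (n.-tuple R -> \bar R) -> \bar R :=
  match n return (n.-tuple R -> \bar R) -> \bar R with
  | 0 => fun f => f [tuple]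
  | n'.+1 => fun f =>
      (\int[@lebesgue_measure R]_(a in [set: R])
          int_Rn (fun t : n'.-tuple R => f [tuple of a :: t]))%E
  end.

Definition cexpi (th : R) : R[i] := (cos th +i* sin th)%C.

(** The Fourier transform F g_{t,x}(tau, xi) of the fundamental solution. *)
Definition Fg (N : nat) (t : R) (x : 'rV[R]_N) (tau : R) (xi : 'rV[R]_N) : R[i] :=
  let r := enorm xi in
  cexpi (- dotp x xi) / (2 * r)%:C%C *
  ((cexpi (- (t * tau)) - cexpi (t * r)) / (tau + r)%:C%C
   - (cexpi (- (t * tau)) - cexpi (- (t * r))) / (tau - r)%:C%C).

Definition cov_kernel (N : nat) (H cH : R) (h : 'rV[R]_N -> R)
    (p q : R * 'rV[R]_N) : \bar R :=
  (cH%:E * \int[@lebesgue_measure R]_(tau in [set: R])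
     int_Rn (fun t : N.-tuple R =>
       (complex.Re (Fg p.1 p.2 tau (tup2row t) * (Fg q.1 q.2 tau (tup2row t))^*%C)
        * powR `|tau| (1 - 2 * H) * h (tup2row t))%:E))%E.

Definition gaussian_rv d (Om : measurableType d) (P : probability Om R)
    (Y : Om -> R) : Prop :=
  (exists m s : R, 0 < s /\
     forall A : set R, measurable A -> P (Y @^-1` A) = normal_prob m s A)
  \/ (exists c : R, {ae P, forall w, Y w = c}).

Definition centered_gaussian_field d (Om : measurableType d) (P : probability Om R)
    (T : Type) (D : set T) (v : T -> Om -> R) (K : T -> T -> \bar R) : Prop :=
  (forall p, D p -> measurable_fun [set: Om] (v p))
  /\ (forall (m : nat) (pts : 'I_m -> T) (a : 'I_m -> R),
        (forall k, D (pts k)) ->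
        gaussian_rv P (fun w => \sum_(k < m) a k * v (pts k) w))
  /\ (forall p, D p -> ('E_P[v p])%E = 0%E)
  /\ (forall p q, D p -> D q -> ('E_P[fun w => (v p w * v q w)%R])%E = K p q).

Definition independent_fields d (Om : measurableType d) (P : probability Om R)
    (n : nat) (T : Type) (D : set T) (v : 'I_n -> T -> Om -> R) : Prop :=
  forall (m : nat) (pts : 'I_m -> T) (B : 'I_n -> 'I_m -> set R),
    (forall k, D (pts k)) -> (forall j k, measurable (B j k)) ->
    let E := fun j => \bigcap_(k in [set: 'I_m]) (v j (pts k) @^-1` B j k) in
    P (\bigcap_(j in [set: 'I_n]) E j) = (\prod_(j < n) P (E j))%E.

Definition pdist (N : nat) (p q : R * 'rV[R]_N) : R :=
  `|p.1 - q.1| + enorm (p.2 - q.2).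

Definition box (N : nat) (a b : R) (ax bx : 'rV[R]_N) : set (R * 'rV[R]_N) :=
  [set p : R * 'rV[R]_N | a <= p.1 <= b /\ forall i, ax 0 i <= p.2 0 i <= bx 0 i].

Definition mod_sup (N d : nat) (alpha : R) (I : set (R * 'rV[R]_N))
    (U : 'I_d -> R * 'rV[R]_N -> R) (eps : R) : \bar R :=
  ereal_sup [set (enormf (fun j => U j pq.1 - U j pq.2) /
                   (powR (pdist pq.1 pq.2) alpha *
                    Num.sqrt (ln (1 + (pdist pq.1 pq.2)^-1))))%:E
            | pq in [set pq | I pq.1 /\ I pq.2 /\ 0 < pdist pq.1 pq.2 <= eps]].

End defs.

(* Main.v *)
Require Import Defs.
From HB Require Import structures.
From mathcomp Require Import all_boot all_order all_algebra.
From mathcomp Require Import all_classical all_reals all_analysis.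
From mathcomp Require Import measurable_realfun complex.
From mathcomp Require Import ring lra.

(** Read along dyadic grids, the modulus is a functional of a countable Gaussian family.  Subtracting from
    the field its regression on one of its finite linear combinations changes increments by a multiple of a covariance
    of size [O(pdist ^ al)], which is negligible against the gauge; so the event "the modulus is below [c]" is
    independent of each such combination, therefore of itself, and has probability 0 or 1.  The constant is the
    infimum of the [c] of probability 1.  It is finite by dyadic chaining from [E |u p - u q|^2 <= C pdist^(2 al)].  It is
    positive by a second moment argument: along a line in a space direction the increments of step [e = 2^-n] form a
    stationary family whose spectral measure has mass at least [c e^(2 al)], while its mass near any frequency in that
    direction is at most [C e^(1 + al)].
    Since [e^(1 + al) << e^(2 al)], averaging the squared correlation against a Gaussian weight yields
    exponentially many (in [n]) points with pairwise correlation at most [1/n], which is as good as independence. *)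

Import Order.TTheory GRing.Theory Num.Theory.
Import numFieldNormedType.Exports.

Local Open Scope classical_set_scope.
Local Open Scope ring_scope.

Set Implicit Arguments.
Unset Strict Implicit.
Unset Printing Implicit Defensive.

(** * Trigonometric moments and generated sigma-algebras *)

(** A field is known only through the laws of its linear combinations, and the family of fields only
    through independence on rectangles, so no joint density is at hand. Everything joint is read
    from trigonometric moments instead: a bounded variable orthogonal to all [cos (eta + th)] is
    orthogonal to every event generated by the family, and for Gaussian combinations these moments
    depend on the covariance alone. This is how vanishing covariance becomes independence. The
    zero-one law does double duty. Besides making the modulus constant, it allows the lower bound to
    stop at events of probability at least [1/16] at every small scale: a limsup event of positive
    probability already excludes probability 1. A Paley-Zygmund argument on averages of exponentials
    of increments is then enough, and it involves moment generating functions only. The spectral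
    integrals that define the covariance are finite for a probabilistic reason: Gaussian variables
    have second moments, so the covariance hypothesis itself forces convergence. *)

Ltac mfun := repeat first [exact: measurable_cst | exact: measurable_id | assumption
  | apply: measurable_funB | apply: measurable_funD | apply: measurable_funM | apply: measurable_funX ].

Lemma measurable_cos (R : realType) : measurable_fun [set: R] (@cos R).
Proof. by apply: continuous_measurable_fun; exact: continuous_cos. Qed.

Lemma measurable_sin (R : realType) : measurable_fun [set: R] (@sin R).
Proof. by apply: continuous_measurable_fun; exact: continuous_sin. Qed.

Section bounded_expectation.
Context d (Om : measurableType d) (R : realType) (P : probability Om R).
Implicit Types f g V W X : Om -> R.

(** Boundedness replaces integrability: sums, products and powers stay in the class, so linearity of
    [Ex] on trigonometric polynomials carries no integrability side conditions. *)
Definition bmeas f := measurable_fun [set: Om] f /\ exists M : R, forall w, `|f w| <= M.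

Definition Ex f : R := (\int[P]_w f w)%R.

Lemma bmeas_int f : bmeas f -> P.-integrable [set: Om] (EFin \o f).
Proof.
move=> [mf [M fM]]; apply: measurable_bounded_integrable => //.
  exact: le_lt_trans (probability_le1 P measurableT) (ltry _).
exists M; split; first exact: num_real.
by move=> x Mx w _ /=; rewrite (le_trans (fM w)) // ltW.
Qed.

Lemma bmeas_cst (c : R) : bmeas (fun=> c).
Proof. by split; [exact: measurable_cst|exists `|c|]. Qed.

Lemma bmeasD f g : bmeas f -> bmeas g -> bmeas (fun w => f w + g w).
Proof.
move=> [mf [M fM]] [mg [N gN]]; split; first exact: measurable_funD.
by exists (M + N) => w; rewrite (le_trans (ler_normD _ _))// lerD.
Qed.

Lemma bmeasM f g : bmeas f -> bmeas g -> bmeas (fun w => f w * g w).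
Proof.
move=> [mf [M fM]] [mg [N gN]]; split; first exact: measurable_funM.
by exists (M * N) => w; rewrite normrM ler_pM.
Qed.

Lemma bmeasZ (c : R) f : bmeas f -> bmeas (fun w => c * f w).
Proof. exact/bmeasM/bmeas_cst. Qed.

Lemma bmeasB f g : bmeas f -> bmeas g -> bmeas (fun w => f w - g w).
Proof.
move=> bf bg; have := bmeasD bf (bmeasZ (-1) bg).
by under eq_fun do rewrite mulN1r.
Qed.

Lemma bmeasX n f : bmeas f -> bmeas (fun w => f w ^+ n).
Proof.
move=> bf; elim: n => [|n IH]; first by under eq_fun do rewrite expr0; exact: bmeas_cst.
by under eq_fun do rewrite exprS; exact: bmeasM.
Qed.

Lemma bmeas_sum (I : Type) (r : seq I) (F : I -> Om -> R) :
  (forall i, bmeas (F i)) -> bmeas (fun w => \sum_(i <- r) F i w).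
Proof.
move=> bF; elim: r => [|i r IH].
  by under eq_fun do rewrite big_nil; exact: bmeas_cst.
by under eq_fun do rewrite big_cons; exact: bmeasD.
Qed.

Lemma bmeas_cos X : measurable_fun [set: Om] X -> bmeas (fun w => cos (X w)).
Proof.
move=> mX; split; first exact: measurableT_comp (@measurable_cos R) mX.
by exists 1 => w; rewrite ler_norml cos_geN1 cos_le1.
Qed.

Lemma bmeas_sin X : measurable_fun [set: Om] X -> bmeas (fun w => sin (X w)).
Proof.
move=> mX; split; first exact: measurableT_comp (@measurable_sin R) mX.
by exists 1 => w; rewrite ler_norml sin_geN1 sin_le1.
Qed.

Lemma bmeas_indic (A : set Om) : measurable A -> bmeas (\1_A : Om -> R).
Proof.
move=> mA; split; first exact: measurable_indic.
by exists 1 => w; rewrite indicE; case: (_ \in _); rewrite ?normr1 ?normr0.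
Qed.

Lemma eq_Ex f g : (forall w, f w = g w) -> Ex f = Ex g.
Proof. by move=> fg; apply: eq_Rintegral => w _; exact: fg. Qed.

Lemma Ex_cst (c : R) : Ex (fun=> c) = c.
Proof. rewrite /Ex Rintegral_cst// -[RHS]mulr1; congr (_ * _).
by rewrite -[RHS]/(fine 1%E) -(probability_setT P). Qed.

Lemma ExD f g : bmeas f -> bmeas g -> Ex (fun w => f w + g w) = Ex f + Ex g.
Proof. by move=> /bmeas_int bf /bmeas_int bg; rewrite /Ex RintegralD. Qed.

Lemma ExB f g : bmeas f -> bmeas g -> Ex (fun w => f w - g w) = Ex f - Ex g.
Proof. by move=> /bmeas_int bf /bmeas_int bg; rewrite /Ex RintegralB. Qed.

Lemma ExZ (c : R) f : bmeas f -> Ex (fun w => c * f w) = c * Ex f.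
Proof. by move=> /bmeas_int bf; rewrite /Ex RintegralZl. Qed.

Lemma Ex_sum (I : Type) (r : seq I) (F : I -> Om -> R) : (forall i, bmeas (F i)) ->
  Ex (fun w => \sum_(i <- r) F i w) = \sum_(i <- r) Ex (F i).
Proof.
move=> bF; elim: r => [|i r IH].
  by rewrite big_nil; under [LHS]eq_Ex do rewrite big_nil; exact: Ex_cst.
rewrite big_cons -IH -ExD//; last exact: bmeas_sum.
by apply: eq_Ex => w; rewrite big_cons.
Qed.

Lemma le_Ex f g : bmeas f -> bmeas g -> (forall w, f w <= g w) -> Ex f <= Ex g.
Proof. by move=> /bmeas_int bf /bmeas_int bg fg; exact: le_Rintegral. Qed.

Lemma Ex_indic (A : set Om) : measurable A -> Ex (\1_A) = fine (P A).
Proof. by move=> mA; rewrite /Ex /Rintegral integral_indic// setIT. Qed.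

(** Bounded convergence. The limit is returned as a [bmeas] function because such limits are taken
    several times in a row. *)
Lemma Ex_cvg (F : nat -> Om -> R) f (M : R) :
  (forall n, measurable_fun [set: Om] (F n)) ->
  (forall n w, `|F n w| <= M) ->
  (forall w, F ^~ w @ \oo --> f w) ->
  bmeas f /\ (fun n => Ex (F n)) @ \oo --> Ex f.
Proof.
move=> mF bF cF.
have mf : measurable_fun [set: Om] f.
  by apply: (measurable_fun_cvg (h:=F)) => // w _; exact: cF.
have bf : bmeas f.
  split=> //; exists M => w.
  have h : (fun n => `|F n w|) @ \oo --> `|f w| by exact: cvg_norm.
  rewrite -(cvg_lim _ h)//; apply: limr_le; first by apply: cvgP h.
  by near=> n; exact: bF.
split=> //.
have ig : P.-integrable [set: Om] (EFin \o (fun=> M)) by exact/bmeas_int/bmeas_cst.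
have [] := @dominated_convergence _ _ _ P setT measurableT
  (fun n => EFin \o F n) (EFin \o f) (EFin \o (fun=> M)).
- by move=> n; exact/measurable_EFinP.
- exact/measurable_EFinP.
- by apply: aeW => w _; apply: cvg_EFin; [exact: nearW|exact: cF].
- exact: ig.
- by apply: aeW => w n _ /=; rewrite lee_fin.
move=> _ _ h.
rewrite /Ex /Rintegral.
have fi : (\int[P]_w (f w)%:E)%E \is a fin_num by exact: integrable_fin_num (bmeas_int bf).
by apply: (fine_cvg (f:=fun n => (\int[P]_x (F n x)%:E)%E)); rewrite fineK.
Unshelve. all: end_near. Qed.

End bounded_expectation.

Section trig_uniqueness.
Context d (Om : measurableType d) (R : realType) (P : probability Om R).
Implicit Types f g V W X : Om -> R.
Local Notation Ex := (@Ex _ _ R P).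

(* Iterating [z |-> 3 z^2 - 2 z^3] pushes [[0, 1/2[] to [0] and []1/2, 1]] to [1]. *)
Definition sstep (z : R) : R := 3 * z ^+ 2 - 2 * z ^+ 3.

Lemma sstep01 n (z : R) : 0 <= z <= 1 -> 0 <= iter n sstep z <= 1.
Proof.
move=> z01; elim: n => //= n; move: (iter n sstep z) => y y01; rewrite /sstep.
have -> : 3 * y ^+ 2 - 2 * y ^+ 3 = y ^+ 2 * (3 - 2 * y) by ring.
apply/andP; split; first by rewrite mulr_ge0 ?sqr_ge0//; lra.
rewrite -subr_ge0.
have -> : 1 - y ^+ 2 * (3 - 2 * y) = (1 - y) ^+ 2 * (1 + 2 * y) by ring.
by rewrite mulr_ge0 ?sqr_ge0//; lra.
Qed.

Lemma sstepC n (z : R) : iter n sstep (1 - z) = 1 - iter n sstep z.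
Proof. by elim: n => //= n ->; rewrite /sstep; ring. Qed.

(** One has [sstep y = y (3 - 2 y) * y], and for [0 <= y <= z] the factor is at most
    [rho = z (3 - 2 z)], where [1 - rho = (1 - 2 z) (1 - z) > 0]. The iterates decrease
    geometrically. *)
Lemma cvg_sstep0 (z : R) : 0 <= z -> z < 1/2 -> (fun n => iter n sstep z) @ \oo --> (0 : R).
Proof.
move=> z0 z1; pose rho := 3 * z - 2 * z ^+ 2.
have rho1 : 0 <= rho < 1.
  have -> : rho = z * (3 - 2 * z) by rewrite /rho; ring.
  apply/andP; split; first by rewrite mulr_ge0//; lra.
  rewrite -subr_gt0; have -> : 1 - z * (3 - 2 * z) = (1 - 2 * z) * (1 - z) by ring.
  by rewrite mulr_gt0//; lra.
have bnd n : 0 <= iter n sstep z <= rho ^+ n * z /\ iter n sstep z <= z.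
  elim: n => [|n [/andP[IH0 IH1] IH2]] /=; first by rewrite expr0 mul1r z0 lexx.
  move: (iter n sstep z) IH0 IH1 IH2 => y y0 y1 y2.
  have e : sstep y = (3 * y - 2 * y ^+ 2) * y by rewrite /sstep; ring.
  have r0 : 0 <= 3 * y - 2 * y ^+ 2.
    have -> : 3 * y - 2 * y ^+ 2 = y * (3 - 2 * y) by ring.
    by rewrite mulr_ge0//; lra.
  have r1 : 3 * y - 2 * y ^+ 2 <= rho.
    rewrite -subr_ge0; have -> : rho - (3 * y - 2 * y ^+ 2) = (z - y) * (3 - 2 * (z + y)) by rewrite /rho; ring.
    by rewrite mulr_ge0//; lra.
  rewrite e; split; last first.
    by apply: le_trans y2; rewrite -[leRHS]mul1r ler_wpM2r//; lra.
  apply/andP; split; first exact: mulr_ge0.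
  have -> : rho ^+ n.+1 * z = rho * (rho ^+ n * z) by rewrite exprS; ring.
  exact: ler_pM.
have h : (fun n => rho ^+ n * z) @ \oo --> (0 : R).
  rewrite -[X in _ --> X](mul0r z); apply: cvgMl; apply: cvg_expr.
  by rewrite ger0_norm; lra.
apply: (squeeze_cvgr _ (cvg_cst _) h); near=> n; exact: (bnd n).1.
Unshelve. all: end_near. Qed.

(** The centre [1/2] is a fixed point, so the limit keeps the weight [1/2] there; points beyond it
    are reflected by [sstepC]. *)
Lemma cvg_sstep (z : R) : 0 <= z <= 1 ->
  (fun n => iter n sstep z) @ \oo --> (((1/2 < z)%R%:R + (z == 1/2)%:R / 2) : R).
Proof.
move=> z01; have [z2|z2|->] := ltgtP z (1/2).
- by rewrite mul0r addr0; apply: cvg_sstep0; lra.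
- rewrite mul0r addr0.
  have -> : (fun n => iter n sstep z) = (fun n => 1 - iter n sstep (1 - z)).
    by apply/funext => n; rewrite sstepC; ring.
  rewrite -[X in _ --> X]subr0; apply: cvgB; first exact: cvg_cst.
  by apply: cvg_sstep0; lra.
- rewrite add0r; suff -> : (fun n => iter n sstep (1 / 2)) = (fun=> 1 / 2) by exact: cvg_cst.
  apply/funext; elim=> //= n ->; by rewrite /sstep; field.
Qed.

(** A factor [(1 + sin) / 2] times a cosine is again a combination of cosines of affine functions of
    [X], by the product formulas. Quantifying over every frequency and every phase makes the
    hypothesis stable under this step. *)
Lemma trig_power V X (l a : R) n : bmeas V -> measurable_fun [set: Om] X ->
  (forall m th : R, Ex (fun w => V w * cos (m * X w + th)) = 0) ->
  forall m th : R, Ex (fun w => V w * ((1 + sin (l * (X w - a))) / 2) ^+ n * cos (m * X w + th)) = 0.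
Proof.
move=> bV mX hV.
have bc (m th : R) : bmeas (fun w => cos (m * X w + th)).
  by apply: bmeas_cos; mfun.
have bs : bmeas (fun w => sin (l * (X w - a))).
  by apply: bmeas_sin; mfun.
have bz : bmeas (fun w => (1 + sin (l * (X w - a))) / 2).
  by apply: bmeasM; [apply: bmeasD => //|]; exact: bmeas_cst.
elim: n => [|n IH] m th; first by under eq_Ex do rewrite expr0 mulr1.
have bVz : bmeas (fun w => V w * ((1 + sin (l * (X w - a))) / 2) ^+ n).
  by apply: bmeasM => //; exact: bmeasX.
rewrite (@eq_Ex _ _ _ _ _ (fun w => 2^-1 * (V w * ((1 + sin (l * (X w - a))) / 2) ^+ n * cos (m * X w + th))
   + (4^-1 * (V w * ((1 + sin (l * (X w - a))) / 2) ^+ n * cos ((l + m) * X w + (th - l * a - pi / 2)))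
   + 4^-1 * (V w * ((1 + sin (l * (X w - a))) / 2) ^+ n * cos ((l - m) * X w + (- l * a - th - pi / 2)))))).
  rewrite ExD; [|by apply/bmeasZ/bmeasM|by apply: bmeasD; apply/bmeasZ/bmeasM].
  rewrite ExD; [|by apply/bmeasZ/bmeasM..].
  by rewrite !ExZ; [|exact: bmeasM..]; rewrite !IH !mulr0 !addr0.
move=> w.
have cosmpi2 (x : R) : cos (x - pi / 2) = sin x.
  by rewrite cosB cos_pihalf sin_pihalf mulr0 add0r mulr1.
rewrite exprSr.
have -> : (l + m) * X w + (th - l * a - pi / 2) = (l * (X w - a) + (m * X w + th)) - pi / 2 by ring.
have -> : (l - m) * X w + (- l * a - th - pi / 2) = (l * (X w - a) - (m * X w + th)) - pi / 2 by ring.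
rewrite !cosmpi2 sinD sinB.
set s := sin _; by set c := cos (m * _ + _); field.
Qed.

(* [sstep] is applied to [(1 + sin (l (X - a))) / 2] and then [l] tends to [0]: iterates are trigonometric
   polynomials in [X], and they converge to an indicator. *)
Lemma trig_uniq V X : bmeas V -> measurable_fun [set: Om] X ->
  (forall m th : R, Ex (fun w => V w * cos (m * X w + th)) = 0) ->
  forall a, Ex (fun w => V w * (X w <= a)%R%:R) = 0.
Proof.
move=> bV mX hV a.
have [M VM] := bV.2.
pose z (l b : R) w := (1 + sin (l * (X w - b))) / 2.
have z01 l b w : 0 <= z l b w <= 1.
  have := sin_geN1 (l * (X w - b)); have := sin_le1 (l * (X w - b)); rewrite /z; lra.
have bz l b : bmeas (z l b).
  apply: bmeasM; last exact: bmeas_cst.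
  apply: bmeasD; first exact: bmeas_cst.
  by apply: bmeas_sin; mfun.
have hz l b n : Ex (fun w => V w * z l b w ^+ n) = 0.
  have := trig_power l b n bV mX hV 0 0.
  by under eq_Ex do rewrite mul0r addr0 cos0 mulr1.
have hq l b n : Ex (fun w => V w * iter n sstep (z l b w)) = 0.
  pose p : {poly R} := iter n (fun p => 3%:P * (p * p) - 2%:P * (p * (p * p))) 'X.
  rewrite (@eq_Ex _ _ _ _ _ (fun w => \sum_(i < size p) p`_i * (V w * z l b w ^+ i))).
    rewrite Ex_sum; last by move=> i; apply: bmeasZ; apply: bmeasM => //; exact: bmeasX.
    rewrite big1// => i _; rewrite ExZ ?hz ?mulr0//; apply: bmeasM => //; exact: bmeasX.
  move=> w; have -> : iter n sstep (z l b w) = p.[z l b w].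
    rewrite /p; elim: n {p} => [|n IH] /=; first by rewrite hornerX.
    by rewrite hornerD hornerN !hornerM !hornerC -IH /sstep; ring.
  rewrite horner_coef mulr_sumr; apply: eq_bigr => i _; ring.
have bq l b n : bmeas (fun w => iter n sstep (z l b w)).
  elim: n => [|n IH] //=; rewrite /sstep; apply: bmeasB; apply: bmeasZ; exact: bmeasX.
pose g1 l b w : R := (1/2 < z l b w)%R%:R + (z l b w == 1/2)%:R / 2.
have g11 l b w : `|g1 l b w| <= 1.
  rewrite /g1; case: ltgtP => _; rewrite ?mul0r ?add0r ?addr0 ?normr0 ?normr1//.
  by rewrite /= ger0_norm; lra.
have hlim (F : nat -> Om -> R) (G : Om -> R) (B : R) : (forall n, bmeas (F n)) ->
    (forall n w, `|F n w| <= B) -> (forall w, F ^~ w @ \oo --> G w) ->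
    (forall n, Ex (fun w => V w * F n w) = 0) ->
    bmeas G /\ Ex (fun w => V w * G w) = 0.
  move=> bF FB FG E0; have [bG _] := Ex_cvg P (fun n => (bF n).1) FB FG.
  split=> //.
  have h1 n w : `|V w * F n w| <= M * B by rewrite normrM ler_pM.
  have h2 w : (fun n => V w * F n w) @ \oo --> V w * G w by apply: cvgMr; exact: FG.
  have [_ h] := Ex_cvg P (fun n => (bmeasM bV (bF n)).1) h1 h2.
  by move/cvg_lim : h => /(_ _)/= <-//; under eq_fun do rewrite E0; rewrite lim_cst.
have h1 l b : bmeas (g1 l b) /\ Ex (fun w => V w * g1 l b w) = 0.
  apply: (hlim (fun n w => iter n sstep (z l b w)) _ 1) => //.
  - by move=> n w; have := sstep01 n (z01 l b w); move=> ?; rewrite ger0_norm; lra.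
  - by move=> w; apply: cvg_sstep; exact: z01.
pose g2 (b x : R) : R := (b < x)%R%:R + (x == b)%:R / 2.
have g21 b x : `|g2 b x| <= 1.
  rewrite /g2 eq_sym; case: ltgtP => _; rewrite ?mul0r ?add0r ?addr0 ?normr0 ?normr1//.
  by rewrite /= ger0_norm; lra.
(* For a small frequency [l], the argument [l * (X w - b)] lies within []-pi, pi[], where the sine
   has the sign of [X w - b]: the periodic indicator [g1] becomes that of a half-line. *)
have h2 b : bmeas (fun w => g2 b (X w)) /\ Ex (fun w => V w * g2 b (X w)) = 0.
  apply: (hlim (fun k => g1 (k.+1%:R^-1) b) _ 1) => //; [|move=> w|].
  - by move=> k; exact: (h1 _ _).1.
  - have [xb|xb|xb] := ltgtP (X w) b; last first.
    + rewrite /g1 /z xb subrr; under eq_fun do rewrite mulr0 sin0 addr0 ltxx eqxx.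
      rewrite /g2 ltxx eqxx; exact: cvg_cst.
    + rewrite /g2 xb gt_eqF//; apply: cvg_near_cst.
      near=> k; have : sin (k.+1%:R^-1 * (X w - b)) > 0.
        apply: sin_gt0_pi; rewrite mulr_gt0 ?invr_gt0 ?subr_gt0//=.
        rewrite mulrC ltr_pdivrMr//.
        have : X w - b < k%:R by near: k; exact: nbhs_infty_gtr.
        move=> h; apply: (lt_le_trans h).
        rewrite -[leLHS]mul1r; apply: ler_pM => //; last by rewrite ler_nat.
        by have := @pi_ge2 R; lra.
      move=> s0; rewrite /g1; have -> : 1 / 2 < z k.+1%:R^-1 b w by rewrite /z; lra.
      by have -> : (z k.+1%:R^-1 b w == 1/2) = false by apply/negP => /eqP; rewrite /z; lra.
    + rewrite /g2 ltNge ltW//= lt_eqF//; apply: cvg_near_cst.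
      near=> k; have : sin (k.+1%:R^-1 * (b - X w)) > 0.
        apply: sin_gt0_pi; rewrite mulr_gt0 ?invr_gt0 ?subr_gt0//=.
        rewrite mulrC ltr_pdivrMr//.
        have : b - X w < k%:R by near: k; exact: nbhs_infty_gtr.
        move=> h; apply: (lt_le_trans h).
        rewrite -[leLHS]mul1r; apply: ler_pM => //; last by rewrite ler_nat.
        by have := @pi_ge2 R; lra.
      rewrite -opprB mulrN sinN => s0.
      rewrite /g1; have -> : (1 / 2 < z k.+1%:R^-1 b w) = false by apply/negP; rewrite /z; lra.
      by have -> : (z k.+1%:R^-1 b w == 1/2) = false by apply/negP => /eqP; rewrite /z; lra.
  - by move=> k; exact: (h1 _ _).2.
(* Letting [b] decrease to [a] removes the half weight carried by the endpoint. *)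
have [bg h3] : bmeas (fun w => (a < X w)%R%:R : R) /\ Ex (fun w => V w * (a < X w)%R%:R) = 0.
  apply: (hlim (fun k w => g2 (a + k.+1%:R^-1) (X w)) _ 1) => //; [|move=> w|].
  - by move=> k; exact: (h2 _).1.
  - apply: cvg_near_cst; have [xa|xa] := ltP a (X w).
    + near=> k; have : a + k.+1%:R^-1 < X w.
        rewrite addrC -ltrBrDr; near: k.
        have h0 : 0 < X w - a by rewrite subr_gt0.
        exact: (near_infty_natSinv_lt (PosNum h0)).
      by move=> h; rewrite /g2 h gt_eqF// mul0r addr0.
    + near=> k; have h : X w < a + k.+1%:R^-1 by rewrite (le_lt_trans xa)// ltrDl invr_gt0.
      by rewrite /g2 lt_eqF// ltNge ltW//= mul0r addr0.
  - by move=> k; exact: (h2 _).2.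
have V0 : Ex V = 0 by rewrite -(hV 0 0); apply: eq_Ex => w; rewrite mul0r addr0 cos0 mulr1.
rewrite (@eq_Ex _ _ _ _ _ (fun w => V w - V w * (a < X w)%R%:R)).
  by rewrite ExB ?V0 ?h3 ?subrr//; exact: bmeasM.
by move=> w; rewrite leNgt; case: (a < X w); rewrite ?mulr0 ?mulr1 ?subrr ?subr0.
Unshelve. all: end_near. Qed.

(** The constraints are added one at a time by [trig_uniq], whose weight is the product of [W], the
    earlier indicators and the cosine. Multiplying by a cosine of [m * fam] shifts [eta] by
    [m * fam] in both directions, which is why [S] has to be stable under such shifts. *)
Lemma trig_multi (I : Type) (fam : I -> Om -> R) (S : set (Om -> R)) W : bmeas W ->
  (forall i, measurable_fun [set: Om] (fam i)) ->
  (forall eta, S eta -> measurable_fun [set: Om] eta) ->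
  (forall eta l i, S eta -> S (fun w => eta w + l * fam i w)) ->
  (forall eta th, S eta -> Ex (fun w => W w * cos (eta w + th)) = 0) ->
  forall (s : seq (I * R)) eta th, S eta ->
  Ex (fun w => W w * (all (fun x => fam x.1 w <= x.2) s)%:R * cos (eta w + th)) = 0.
Proof.
move=> bW mfam mS SD W0; elim=> [|x s IH] eta th Seta.
  by rewrite -[RHS](W0 _ th Seta); apply: eq_Ex => w; rewrite /= mulr1.
have ball : bmeas (fun w => (all (fun x => fam x.1 w <= x.2) s)%:R : R).
  elim: s {IH} => [|y s IH]; first exact: bmeas_cst.
  under eq_fun do rewrite /= -mulnb natrM; apply: bmeasM => //.
  have -> : (fun w => (fam y.1 w <= y.2)%R%:R : R) = \1_[set w | fam y.1 w <= y.2].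
    by apply/funext => w; rewrite indicE; congr (nat_of_bool _)%:R; apply/idP/idP; rewrite inE.
  apply: bmeas_indic; rewrite -[X in measurable X]setTI.
  have -> : [set w | fam y.1 w <= y.2] = fam y.1 @^-1` `]-oo, y.2]%classic.
    by apply/seteqP; split => w; rewrite /= in_itv.
  by apply: mfam => //; exact: measurable_itv.
have bc (eta' : Om -> R) th' : S eta' -> bmeas (fun w => cos (eta' w + th')).
  by move=> S'; apply: bmeas_cos; have := mS _ S'; move=> ?; mfun.
have bV := bmeasM (bmeasM bW ball) (bc eta th Seta).
have := trig_uniq bV (mfam x.1) _ x.2; rewrite /=.
rewrite (@eq_Ex _ _ _ _ _ (fun w => W w * (all (fun x => fam x.1 w <= x.2) (x :: s))%:R * cos (eta w + th))).
  apply=> m th'.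
  rewrite (@eq_Ex _ _ _ _ _ (fun w => 2^-1 * (W w * (all (fun x => fam x.1 w <= x.2) s)%:R * cos ((eta w + m * fam x.1 w) + (th + th')))
    + 2^-1 * (W w * (all (fun x => fam x.1 w <= x.2) s)%:R * cos ((eta w + (- m) * fam x.1 w) + (th - th'))))).
    have b1 (m' th'' : R) := bmeasM (bmeasM bW ball) (bc _ th'' (SD eta m' x.1 Seta)).
    by rewrite ExD ?ExZ; try exact: bmeasZ; rewrite ?IH ?mulr0 ?addr0//; exact: SD.
  move=> w.
  have -> : eta w + m * fam x.1 w + (th + th') = (eta w + th) + (m * fam x.1 w + th') by ring.
  have -> : eta w + - m * fam x.1 w + (th - th') = (eta w + th) - (m * fam x.1 w + th') by ring.
  by set A := eta w + th; set B := _ + th'; rewrite cosD cosB; field.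
by move=> w /=; rewrite -mulnb natrM; ring.
Qed.

End trig_uniqueness.

(** * Orthogonality and independence extended from a pi-system *)

Section pi_lambda.
Context d (Om : measurableType d) (R : realType) (P : probability Om R).
Local Notation Ex := (@Ex _ _ R P).

(** The events orthogonal to [W] form a lambda-system: proper differences by linearity, increasing
    unions by bounded convergence. *)
Lemma pi_lambda_Ex0 (W : Om -> R) (G : set (set Om)) : bmeas W ->
  setI_closed G -> (forall A, G A -> measurable A) -> G setT ->
  (forall A, G A -> Ex (fun w => W w * \1_A w) = 0) ->
  forall A, <<s G >> A -> measurable A /\ Ex (fun w => W w * \1_A w) = 0.
Proof.
move=> bW GI mG GT G0 A sA.
pose H := [set A : set Om | measurable A /\ Ex (fun w => W w * \1_A w) = 0].
apply: (@lambda_system_subset _ G GI setT H) sA => //.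
split=> //.
- by split=> //; exact: G0.
- move=> B C CB [mB B0] [mC C0]; split; first exact: measurableD.
  rewrite (@eq_Ex _ _ _ _ _ (fun w => W w * \1_B w - W w * \1_C w)).
    by rewrite ExB ?B0 ?C0 ?subrr//; apply: bmeasM => //; exact: bmeas_indic.
  move=> w; rewrite !indicE -mulrBr; congr (_ * _).
  have [wC|wC] := boolP (w \in C).
    have wB : w \in B by rewrite inE; apply: CB; rewrite inE in wC.
    by rewrite wB subrr memNset//= => -[_]; rewrite inE in wC.
  rewrite subr0; congr (nat_of_bool _)%:R; apply/idP/idP; rewrite !inE; first by case.
  by move=> wB; split=> //= wC'; move/negP : wC; apply; rewrite inE.
- move=> F ndF FH.
  have mU : measurable (\bigcup_i F i) by apply: bigcup_measurable => k _; exact: (FH k).1.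
  split=> //.
  have [M WM] := bW.2.
  have h1 n w : `|W w * \1_(F n) w| <= M.
    rewrite normrM indicE; case: (_ \in _); rewrite ?normr1 ?normr0 ?mulr1 ?mulr0//.
    exact: le_trans (WM w).
  have h2 w : (fun n => W w * \1_(F n) w) @ \oo --> W w * \1_(\bigcup_i F i) w.
    apply: cvgMr; apply: cvg_near_cst; rewrite !indicE.
    have [/set_mem[k _ Fk]|wF] := boolP (w \in \bigcup_i F i).
      near=> n; rewrite indicE mem_set//; apply: (_ : F k `<=` F n) => //.
      by apply/subsetPset/ndF; near: n; exact: nbhs_infty_ge.
    near=> n; rewrite indicE memNset// => Fn; move/negP : wF; apply.
    by rewrite inE; exists n.
  have [_ h] := Ex_cvg P (fun n => (bmeasM bW (bmeas_indic R (FH n).1)).1) h1 h2.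
  move/cvg_lim : h => /(_ (@Rhausdorff _)) <-.
  by under eq_fun do rewrite (FH _).2; rewrite lim_cst.
- by move=> B GB; split; [exact: mG|exact: G0].
Unshelve. all: end_near. Qed.

(** The sum counts the positive integers up to [x], so it is the integer part of [x]. This provides
    uniform step approximations of functions with values in [[0, 1]]. *)
Lemma count_le_approx (m : nat) (x : R) : 0 <= x <= m%:R ->
  `|\sum_(k < m) (k.+1%:R <= x)%R%:R - x| <= 1.
Proof.
elim: m => [|m IH] x01; first by rewrite big_ord0 sub0r normrN ger0_norm; lra.
rewrite big_ord_recr /=; have [xm|xm] := leP x m%:R.
  have -> : (m.+1%:R <= x) = false by apply/negP; rewrite -natr1; lra.
  by rewrite addr0; apply: IH; lra.
rewrite (eq_bigr (fun=> 1)).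
  rewrite sumr_const card_ord; rewrite -natr1 in x01 *.
  have [h|h] := leP (m%:R + 1) x; rewrite /= ler_norml; lra.
move=> k _; rewrite (le_trans _ (ltW xm))// ler_nat; exact: ltn_ord.
Qed.

(** Passage from events of the pi-system to a bounded function: after centring [Z] by [kappa] the
    claim is an orthogonality, and [g] is, up to an affine map, a uniform limit of averages of
    indicators of events of the sigma-algebra. *)
Lemma pi_lambda_Ex (Z : Om -> R) (G : set (set Om)) (kappa : R) : bmeas Z ->
  setI_closed G -> (forall A, G A -> measurable A) -> G setT ->
  (forall A, G A -> Ex (fun w => Z w * \1_A w) = kappa * Ex (\1_A)) ->
  forall g : Om -> R, (exists M : R, forall w, `|g w| <= M) ->
  @measurable_fun _ _ (g_sigma_algebraType G) R setT g ->
  bmeas g /\ Ex (fun w => Z w * g w) = kappa * Ex g.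
Proof.
move=> bZ GI mG GT G0 g [M gM] mg.
pose W w := Z w - kappa.
have bW : bmeas W by apply: bmeasB => //; exact: bmeas_cst.
have W0 A : G A -> Ex (fun w => W w * \1_A w) = 0.
  move=> GA; have b1 := bmeas_indic R (mG _ GA).
  rewrite (@eq_Ex _ _ _ _ _ (fun w => Z w * \1_A w - kappa * \1_A w)).
    by rewrite ExB ?G0 ?ExZ ?subrr//; [exact: bmeasM|exact: bmeasZ].
  by move=> w; rewrite mulrBl.
have W1 := pi_lambda_Ex0 bW GI mG GT W0.
have M0 : 0 <= M by exact: le_trans (normr_ge0 _) (gM point).
(* An affine rescaling into [[0, 1]]; the [+ 1] keeps the denominator positive when [M = 0]. *)
pose q w := (g w + M) / (2 * (M + 1)).
have q01 w : 0 <= q w <= 1.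
  have := gM w; rewrite ler_norml => /andP[g1 g2].
  rewrite /q; apply/andP; split; first by rewrite divr_ge0//; lra.
  rewrite ler_pdivrMr; lra.
have mq : @measurable_fun _ _ (g_sigma_algebraType G) R setT q by rewrite /q; mfun.
pose F n w : R := n.+1%:R^-1 * \sum_(k < n.+1) \1_[set w | k.+1%:R <= n.+1%:R * q w] w.
have sS n (k : 'I_n.+1) : <<s G >> [set w | k.+1%:R <= n.+1%:R * q w].
  have mnq : @measurable_fun _ _ (g_sigma_algebraType G) R setT (fun w => n.+1%:R * q w) by mfun.
  have := mnq measurableT `[k.+1%:R, +oo[%classic (measurable_itv _).
  rewrite setTI; congr (<<s G >> _).
  by apply/seteqP; split => w; rewrite /= in_itv/= andbT.
have bF n : bmeas (F n).
  apply: bmeasZ; apply: bmeas_sum => k; apply: bmeas_indic; exact: (W1 _ (sS n k)).1.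
have WF n : Ex (fun w => W w * F n w) = 0.
  rewrite (@eq_Ex _ _ _ _ _ (fun w => n.+1%:R^-1 * \sum_(k < n.+1) (W w * \1_[set w | k.+1%:R <= n.+1%:R * q w] w))).
    have bk (k : 'I_n.+1) : bmeas (fun w => W w * \1_[set w | k.+1%:R <= n.+1%:R * q w] w).
      by apply: bmeasM => //; apply: bmeas_indic; exact: (W1 _ (sS n k)).1.
    rewrite ExZ; last exact: bmeas_sum.
    by rewrite Ex_sum// big1 ?mulr0// => k _; exact: (W1 _ (sS n k)).2.
  by move=> w; rewrite /F mulrCA; congr (_ * _); rewrite mulr_sumr.
have Fq n w : `|F n w - q w| <= n.+1%:R^-1.
  have n0 : 0 < n.+1%:R :> R by rewrite ltr0n.
  have -> : F n w - q w = n.+1%:R^-1 * (\sum_(k < n.+1) (k.+1%:R <= n.+1%:R * q w)%R%:R - n.+1%:R * q w).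
    rewrite mulrBr mulKf ?gt_eqF//; congr (_ * _ - _); apply: eq_bigr => k _.
    by rewrite indicE; congr (nat_of_bool _)%:R; apply/idP/idP; rewrite inE.
  rewrite normrM ger0_norm ?invr_ge0// -[leRHS]mulr1 ler_wpM2l ?invr_ge0//.
  apply: count_le_approx; have := q01 w => /andP[q0 q1].
  by rewrite mulr_ge0//= -[leRHS]mulr1 ler_wpM2l.
have Fq' w : F ^~ w @ \oo --> q w.
  apply/cvgrPdist_le => e e0; near=> n; rewrite distrC (le_trans (Fq n w))//.
  apply: ltW; near: n; exact: (near_infty_natSinv_lt (PosNum e0)).
have FB n w : `|F n w| <= 2.
  have -> : F n w = (F n w - q w) + q w by ring.
  rewrite (le_trans (ler_normD _ _))//.
  have := q01 w => q01w; rewrite [X in _ + X <= _]ger0_norm; last by lra.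
  have : n.+1%:R^-1 <= 1 :> R by rewrite invf_le1// ?ler1n ?ltr0n.
  move=> h; rewrite (_ : 2 = 1 + 1 :> R)//; apply: lerD; last by lra.
  exact: le_trans (Fq n w) h.
have [bq _] := Ex_cvg P (fun n => (bF n).1) FB Fq'.
have Wq : Ex (fun w => W w * q w) = 0.
  have [B WB] := bW.2.
  have h1 n w : `|W w * F n w| <= B * 2 by rewrite normrM ler_pM.
  have h2 w : (fun n => W w * F n w) @ \oo --> W w * q w by apply: cvgMr; exact: Fq'.
  have [_ h] := Ex_cvg P (fun n => (bmeasM bW (bF n)).1) h1 h2.
  move/cvg_lim : h => /(_ (@Rhausdorff _)) <-.
  by under eq_fun do rewrite WF; rewrite lim_cst.
have qg w : g w = 2 * (M + 1) * q w - M by rewrite /q; field; lra.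
have bg : bmeas g.
  by rewrite (_ : g = fun w => 2 * (M + 1) * q w - M); [apply: bmeasB; [exact: bmeasZ|exact: bmeas_cst]|apply/funext].
split=> //.
have WT : Ex W = 0.
  by rewrite -[RHS](W0 _ GT); apply: eq_Ex => w; rewrite indicT mulr1.
have Wg : Ex (fun w => W w * g w) = 0.
  rewrite (@eq_Ex _ _ _ _ _ (fun w => 2 * (M + 1) * (W w * q w) - M * W w)).
    by rewrite ExB ?ExZ ?Wq ?WT ?mulr0 ?subrr//; try exact: bmeasM; apply: bmeasZ => //; exact: bmeasM.
  by move=> w; rewrite qg; ring.
apply/eqP; rewrite -subr_eq0 -Wg -ExZ// -ExB; [|exact: bmeasM|exact: bmeasZ].
by apply/eqP/eq_Ex => w; rewrite /W mulrBl.
Unshelve. all: end_near. Qed.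

End pi_lambda.

(** * Gaussian variables *)

Section density.
Local Open Scope ereal_scope.
Import HBNNSimple.
Context d (T : measurableType d) (R : realType) (mu nu : {measure set T -> \bar R}) (p : T -> R).
Hypothesis mp : measurable_fun [set: T] p.
Hypothesis p0 : forall x, (0 <= p x)%R.
Hypothesis nuE : forall A, measurable A -> nu A = \int[mu]_(x in A) (p x)%:E.

(** Both sides commute with monotone limits of simple functions, and [nuE] is the case of an
    indicator. *)
Lemma ge0_integral_density (f : T -> \bar R) :
  measurable_fun [set: T] f -> (forall x, 0 <= f x) ->
  \int[nu]_x f x = \int[mu]_x (f x * (p x)%:E).
Proof.
move=> mf f0.
pose f_ := nnsfun_approx measurableT mf.
transitivity (limn (fun n => \int[nu]_x (f_ n x)%:E)).
  rewrite -monotone_convergence//.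
  - by apply: eq_integral => y _; apply/esym/cvg_lim => //; apply: cvg_nnsfun_approx.
  - by move=> n; exact/measurable_EFinP/measurable_funP.
  - by move=> n y _; rewrite lee_fin.
  - by move=> y _ m n mn; rewrite lee_fin; exact/lefP/nd_nnsfun_approx.
have -> : (fun n => \int[nu]_x (f_ n x)%:E) = (fun n => \int[mu]_x ((f_ n x)%:E * (p x)%:E)).
  apply/funext => n.
  transitivity (\sum_(k \in range (f_ n)) \int[nu]_x (k * \1_(f_ n @^-1` [set k]) x)%:E).
    under eq_integral do rewrite fimfunE -fsumEFin//.
    rewrite ge0_integral_fsum//.
    - by move=> y; exact/measurable_EFinP/measurable_funM.
    - by move=> y x _; rewrite nnfun_muleindic_ge0.
  transitivity (\sum_(k \in range (f_ n)) \int[mu]_x ((k * \1_(f_ n @^-1` [set k]) x)%:E * (p x)%:E)).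
    apply: eq_fsbigr => r _.
    rewrite (integralZl_indic measurableT (fun r => f_ n @^-1` [set r]))//; last by move=> r0; rewrite preimage_nnfun0.
    rewrite integral_indic// setIT nuE//.
    have [r0|r0] := leP 0%R r; last first.
      rewrite preimage_nnfun0// integral_set0 mule0; apply/esym/integral0_eq => x _.
      by rewrite indic0 mulr0 mul0e.
    transitivity (\int[mu]_x (r%:E * ((\1_(f_ n @^-1` [set r]) x)%:E * (p x)%:E))).
      rewrite ge0_integralZl_EFin//.
      - congr (_ * _); rewrite integral_mkcond; apply: eq_integral => x _.
        by rewrite patchE indicE; case: ifPn => _; rewrite ?mul1e ?mul0e.
      - by move=> x _; rewrite -EFinM lee_fin mulr_ge0.
      - by apply/measurable_EFinP; exact: measurable_funM.
    by apply: eq_integral => x _; rewrite muleA -EFinM.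
  rewrite -ge0_integral_fsum//.
  - apply: eq_integral => x _; rewrite fimfunE -fsumEFin// ge0_mule_fsuml// => r.
    by rewrite nnfun_muleindic_ge0.
  - by move=> r; apply: emeasurable_funM; apply/measurable_EFinP => //; exact: measurable_funM.
  - by move=> r x _; rewrite mule_ge0 ?lee_fin// -lee_fin nnfun_muleindic_ge0.
rewrite -monotone_convergence//.
- apply: eq_integral => x _; apply/cvg_lim => //.
  by apply: cvgeZr => //; exact: cvg_nnsfun_approx.
- by move=> n; apply: emeasurable_funM; apply/measurable_EFinP.
- by move=> n y _; rewrite mule_ge0// lee_fin.
- by move=> y _ m n mn; rewrite lee_wpmul2r ?lee_fin//; exact/lefP/nd_nnsfun_approx.
Qed.

End density.

Section normal_shift.
Context (R : realType).
Local Notation leb := (@lebesgue_measure R).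
Local Open Scope ereal_scope.

Lemma integral_normal_pdf_shift (m c s : R) (G : R -> R) : (0 < s)%R ->
  continuous G -> (forall x, 0 <= G x)%R ->
  \int[leb]_x (G x * normal_pdf (m + c) s x)%:E = \int[leb]_x (G (x + c) * normal_pdf m s x)%:E.
Proof.
move=> s0 cG G0.
have sn0 : s != 0%R by rewrite gt_eqF.
have dF (x : R) : is_derive x 1%R (fun y : R => y + c)%R 1%R.
  by rewrite -[1%R in X in is_derive _ _ _ X]addr0; apply: is_deriveD.
have F' : (fun y : R => y + c)%R^`()%classic = cst 1%R.
  by apply/funext => x; rewrite derive1E; exact: derive_val.
rewrite (@increasing_ge0_integration_by_substitutionT _ (fun y : R => y + c)%R).
- apply: eq_integral => x _; rewrite F' !fctE mulr1; congr (_ * _)%:E.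
  by rewrite !normal_pdfE// /normal_fun opprD addrACA subrr addr0.
- by move=> x y; rewrite ltrD2r.
- by rewrite F' => x; exact: cvg_cst.
- by rewrite F'; exact: is_cvg_cst.
- by rewrite F'; exact: is_cvg_cst.
- by [].
- exact: cvg_addrr_Ny.
- exact: cvg_addrr.
- move=> x; apply: continuousM; first exact: cG.
  exact: continuous_normal_pdf.
- by move=> x; rewrite mulr_ge0// normal_pdf_ge0.
Qed.

End normal_shift.

Notation Int P f := ((P).-integrable [set: _] (EFin \o f)).

Section expectation_tools.
Context d (Om : measurableType d) (R : realType) (P : probability Om R).
Local Notation Ex := (@Ex _ _ R P).

Lemma Int_dom (f g : Om -> R) : measurable_fun [set: Om] f -> Int P g ->
  (forall w, `|f w| <= g w) -> Int P f.
Proof.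
move=> mf ig fg; apply: (le_integrable measurableT _ _ ig); first exact/measurable_EFinP.
by move=> w _ /=; rewrite lee_fin (le_trans (fg w))// ler_norm.
Qed.

Lemma IntD (f g : Om -> R) : Int P f -> Int P g -> Int P (fun w => f w + g w).
Proof. by move=> fi gi; have := integrableD measurableT fi gi; apply: eq_integrable => // w _; rewrite /= EFinD. Qed.

Lemma IntZ (c : R) (f : Om -> R) : Int P f -> Int P (fun w => c * f w).
Proof. by move=> fi; have := integrableZl measurableT c fi; apply: eq_integrable => // w _; rewrite /= EFinM. Qed.

Lemma Ex_EFin (f : Om -> R) (c : R) : (\int[P]_w (f w)%:E = c%:E)%E -> Ex f = c.
Proof. by rewrite /Ex /Rintegral => ->. Qed.

Lemma EFin_Ex (f : Om -> R) : Int P f -> (\int[P]_w (f w)%:E)%E = (Ex f)%:E.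
Proof. by move=> fi; rewrite /Ex /Rintegral fineK//; exact: integrable_fin_num fi. Qed.

(** Domination is asked for only on a window of radius 1 around [a], since exponentials of a
    Gaussian variable are dominated only locally in the parameter. *)
Lemma Ex_is_derive (f df : R -> Om -> R) (a : R) (G : Om -> R) :
  (forall x, `|x - a| < 1 -> Int P (f x)) ->
  (forall (x : R) w, is_derive x 1 (f ^~ w) (df x w)) ->
  (forall w, 0 <= G w) -> Int P G ->
  (forall x w, `|x - a| < 1 -> `|df x w| <= G w) ->
  is_derive a 1 (fun x => Ex (f x)) (Ex (df a)).
Proof.
move=> fi fd G0 Gi fG.
have Ia : `]a - 1, a + 1[%classic a by rewrite /= in_itv/=; apply/andP; split; lra.
have Ix x : `]a - 1, a + 1[%classic x -> `|x - a| < 1.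
  by rewrite /= in_itv/= ltr_norml => ?; lra.
have d1 x y : partial1of2 f x y = df x y.
  by rewrite partial1of2E; have := fd x y; move=> ?; exact: derive_val.
have h1 x : `]a - 1, a + 1[%classic x -> P.-integrable setT (EFin \o f x) by move/Ix; exact: fi.
have h2 x y : `]a - 1, a + 1[%classic x -> setT y -> derivable (f ^~ y) x 1.
  by move=> _ _; have := fd x y; move=> ?; exact: ex_derive.
have h3 x y : `]a - 1, a + 1[%classic x -> setT y -> `|partial1of2 f x y| <= G y.
  by move=> /Ix xa _; rewrite d1; exact: fG.
apply: DeriveDef; first exact: (derivable_under_integral measurableT Ia h1 h2 G0 Gi h3).
rewrite -derive1E (differentiation_under_integral measurableT Ia h1 h2 G0 Gi h3).
by apply: eq_Rintegral => w _; rewrite d1.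
Qed.

Lemma is_derive_uniq (f g : R -> R) (a c c' : R) : (forall x, f x = g x) ->
  is_derive a 1 f c -> is_derive a 1 g c' -> c = c'.
Proof.
move=> fg fc gc; have <- := @derive_val _ _ _ _ _ _ _ fc.
by have -> : f = g by [apply/funext]; exact: derive_val.
Qed.

End expectation_tools.

Section normal_law.
Context d (Om : measurableType d) (R : realType) (P : probability Om R).
Local Notation Ex := (@Ex _ _ R P).
Local Notation leb := (@lebesgue_measure R).
Variables (Y : Om -> R) (m s : R).
Hypothesis mY : measurable_fun [set: Om] Y.
Hypothesis s0 : 0 < s.
Hypothesis law : forall A : set R, measurable A -> P (Y @^-1` A) = normal_prob m s A.

Lemma law_int (f : R -> R) : measurable_fun [set: R] f -> (forall x, 0 <= f x) ->
  (\int[P]_w (f (Y w))%:E = \int[leb]_x (f x * normal_pdf m s x)%:E)%E.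
Proof.
move=> mf f0.
have mY' : @measurable_fun _ _ Om (measurableTypeR R) setT Y := mY.
have := ge0_integral_pushforward mY' P measurableT (f:=fun x => (f x)%:E) => <- //; last 2 first.
- exact/measurable_EFinP.
- by move=> y _; rewrite lee_fin.
transitivity (\int[normal_prob m s]_x (f x)%:E)%E.
  by apply: eq_measure_integral => A mA _; exact: (law mA).
rewrite (@ge0_integral_density _ _ _ leb _ (normal_pdf m s))//.
- exact: measurable_normal_pdf.
- by move=> x; exact: normal_pdf_ge0.
- exact/measurable_EFinP.
Qed.

(** Completing the square: an exponential tilt only moves the mean of a normal law, by [t * s ^+ 2].
    Both the moment generating function and [normal_cos_shift] come from this identity. *)
Lemma expR_normal_pdf (t x : R) : expR (t * x) * normal_pdf m s x =
  expR (t * m + t ^+ 2 * s ^+ 2 / 2) * normal_pdf (m + t * s ^+ 2) s x.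
Proof.
have sn0 : s != 0 by rewrite gt_eqF.
rewrite !normal_pdfE// mulrCA [RHS]mulrCA; congr (_ * _).
rewrite /normal_fun -!expRD; congr expR; field; exact: sn0.
Qed.

Lemma normal_mgf_int (t : R) :
  (\int[P]_w (expR (t * Y w))%:E = (expR (t * m + t ^+ 2 * s ^+ 2 / 2))%:E)%E.
Proof.
rewrite (law_int (f := fun x => expR (t * x))); last by move=> x; exact: expR_ge0.
  under eq_integral do rewrite expR_normal_pdf EFinM.
  rewrite integralZl//; last exact: integrable_normal_pdf.
  by rewrite integral_normal_pdf mule1.
by apply: measurableT_comp; [exact: measurable_expR|mfun].
Qed.

Lemma mexpY (t : R) : measurable_fun [set: Om] (fun w => expR (t * Y w)).
Proof. by apply: measurableT_comp; [exact: measurable_expR|mfun]. Qed.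

Lemma normal_expInt (t : R) : Int P (fun w => expR (t * Y w)).
Proof.
apply/integrableP; split; first exact/measurable_EFinP/mexpY.
under eq_integral do rewrite /= ger0_norm ?expR_ge0//.
by rewrite normal_mgf_int ltry.
Qed.

Lemma normal_mgf (t : R) : Ex (fun w => expR (t * Y w)) = expR (t * m + t ^+ 2 * s ^+ 2 / 2).
Proof. exact/Ex_EFin/normal_mgf_int. Qed.

Let G (b : R) w := expR (b * Y w) + expR (- b * Y w).

Let GInt b : Int P (G b).
Proof. by apply: IntD; exact: normal_expInt. Qed.

Let expG (b y : R) : expR (b * `|y|) <= expR (b * y) + expR (- b * y).
Proof.
have [y0|y0] := leP 0 y; first by rewrite ger0_norm// lerDl expR_ge0.
by rewrite ltr0_norm// mulrN mulNr lerDr expR_ge0.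
Qed.

Let absb (y : R) : `|y| <= expR `|y|.
Proof. by rewrite (le_trans _ (expR_ge1Dx _))// lerDr. Qed.

Let is_derive_exp (x y : R) : is_derive x 1 (fun h : R => expR (h * y)) (y * expR (x * y)).
Proof.
have h : is_derive x 1 (fun h : R => h * y) y.
  by apply: is_derive_eq; rewrite scaler0 add0r /GRing.scale/= mulr1.
have := @is_derive1_comp R expR (fun h => h * y) x _ _ (is_derive_expR _) h.
by rewrite mulrC.
Qed.

Lemma normal_derive_exp (g : R -> R) (h0 : R) : measurable_fun [set: R] g ->
  (forall y, `|g y| <= expR `|y|) ->
  is_derive h0 1 (fun h => Ex (fun w => g (Y w) * expR (h * Y w)))
    (Ex (fun w => g (Y w) * (Y w * expR (h0 * Y w)))).
Proof.
move=> mg gb.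
pose b := `|h0| + 1.
have h2 (x y : R) : `|x - h0| < 1 -> expR (x * y) <= expR (b * `|y|).
  move=> xh; rewrite ler_expR (le_trans (ler_norm _))// normrM ler_wpM2r//.
  have -> : x = (x - h0) + h0 by ring.
  by rewrite (le_trans (ler_normD _ _))// /b; lra.
have mgY : measurable_fun [set: Om] (fun w => g (Y w)) by exact: measurableT_comp.
(* The exponent [b + 2] pays for three factors: [b] for the window around [h0], and one unit each
   for [g] and for the factor [Y] of the derivative, both at most [expR |Y|]. *)
apply: (@Ex_is_derive _ _ _ _ (fun h w => g (Y w) * expR (h * Y w))
  (fun h w => g (Y w) * (Y w * expR (h * Y w))) h0 (G (b + 2))).
- move=> x xh; apply: (Int_dom _ (GInt (b + 2))); first by have := mexpY x; move=> ?; mfun.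
  move=> w; rewrite normrM [X in _ * X]ger0_norm ?expR_ge0//.
  apply: le_trans (expG _ _).
  apply: (@le_trans _ _ (expR `|Y w| * expR (b * `|Y w|))).
    by apply: ler_pM; rewrite ?expR_ge0//; exact: h2.
  by rewrite -expRD ler_expR; have := normr_ge0 (Y w); lra.
- move=> x w; have := is_derive_exp x (Y w) => hd.
  exact: is_deriveZ.
- by move=> w; rewrite addr_ge0 ?expR_ge0.
- exact: GInt.
- move=> x w xh; apply: le_trans (expG _ _).
  rewrite !normrM (ger0_norm (expR_ge0 _)).
  apply: (@le_trans _ _ (expR `|Y w| * (expR `|Y w| * expR (b * `|Y w|)))).
    apply: ler_pM; rewrite ?mulr_ge0 ?expR_ge0//.
    by apply: ler_pM; rewrite ?expR_ge0//; exact: h2.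
  by rewrite -!expRD ler_expR; have := normr_ge0 (Y w); lra.
Qed.

Let is_derive_quad (c q h : R) : is_derive h 1 (fun h => c * h + h ^+ 2 * q / 2) (c + h * q).
Proof.
have -> : (fun h : R => c * h + h ^+ 2 * q / 2) = (fun h : R => c *: h + (q / 2) *: h ^+ 2).
  by apply/funext => x; rewrite /GRing.scale/=; ring.
by apply: is_derive_eq; rewrite /GRing.scale/= /GRing.scale/=; field.
Qed.

Let is_derive_equad (c q h : R) : is_derive h 1 (fun h => expR (c * h + h ^+ 2 * q / 2))
   ((c + h * q) * expR (c * h + h ^+ 2 * q / 2)).
Proof.
have := @is_derive1_comp R expR _ h _ _ (is_derive_expR _) (is_derive_quad c q h).
by rewrite mulrC.
Qed.

Lemma normal_mean_exp (h0 : R) :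
  Ex (fun w => Y w * expR (h0 * Y w)) = (m + h0 * s ^+ 2) * expR (m * h0 + h0 ^+ 2 * s ^+ 2 / 2).
Proof.
have b (y : R) : `|1 : R| <= expR `|y|.
  by rewrite normr1 (le_trans _ (expR_ge1Dx _))// lerDl.
have H1 := @normal_derive_exp (fun=> 1) h0 (measurable_cst _) b.
rewrite (_ : Ex _ = Ex (fun w => 1 * (Y w * expR (h0 * Y w)))); last by apply: eq_Ex => w; rewrite mul1r.
apply: (is_derive_uniq _ H1 (is_derive_equad m (s ^+ 2) h0)).
move=> x /=; rewrite (@eq_Ex _ _ _ _ _ (fun w => expR (x * Y w))); last by move=> w; rewrite mul1r.
by rewrite normal_mgf; congr expR; ring.
Qed.

Lemma normal_mean : Ex Y = m.
Proof.
have := @normal_mean_exp 0.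
rewrite !mul0r mulr0 expr0n/= !mul0r !addr0 expR0 mulr1 => <-.
by apply: eq_Ex => w; rewrite mul0r expR0 mulr1.
Qed.

Lemma normal_var : Ex (fun w => Y w ^+ 2) = s ^+ 2 + m ^+ 2.
Proof.
have H1 := @normal_derive_exp id 0 (@measurable_id _ _ _) absb.
have H2 : is_derive (0:R) 1 (fun h : R => (m + h * s ^+ 2) * expR (m * h + h ^+ 2 * s ^+ 2 / 2)) (s ^+ 2 + m ^+ 2).
  have e := is_derive_equad m (s ^+ 2) 0.
  have -> : (fun h : R => (m + h * s ^+ 2) * expR (m * h + h ^+ 2 * s ^+ 2 / 2)) =
    (fun h : R => m + (s ^+ 2) *: h) * (fun h : R => expR (m * h + h ^+ 2 * s ^+ 2 / 2)).
    by apply/funext => x; rewrite /= [in RHS]/GRing.mul/= /GRing.scale/=; congr (_ * _); ring.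
  apply: is_derive_eq => /=.
  rewrite /GRing.scale/= !(mulr0, mul0r, expr0n, addr0)/= expR0; ring.
rewrite (_ : Ex _ = Ex (fun w => id (Y w) * (Y w * expR (0 * Y w)))); last first.
  by apply: eq_Ex => w; rewrite mul0r expR0 mulr1 expr2.
exact: (is_derive_uniq (fun x => normal_mean_exp x) H1 H2).
Qed.

Hypothesis m0 : m = 0.

Let C (l th : R) := Ex (fun w => cos (l * Y w + th)).

Let mlin (l th : R) : measurable_fun [set: Om] (fun w => l * Y w + th).
Proof. by mfun. Qed.

Let is_derive_cos_lin (y th l : R) : is_derive l 1 (fun l => cos (l * y + th)) (- (y * sin (l * y + th))).
Proof.
have h : is_derive l 1 (fun l : R => l * y + th) y.
  by apply: is_derive_eq; rewrite scaler0 add0r addr0 /GRing.scale/= mulr1.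
have := @is_derive1_comp R cos _ l _ _ (is_derive_cos _) h.
by rewrite mulNr mulrC.
Qed.

(** The Cameron-Martin formula in dimension one. Since [law_int] treats nonnegative functions, it is
    applied to [1 + cos], and the moment generating function is subtracted afterwards. *)
Lemma normal_cos_shift (l th h : R) :
  Ex (fun w => cos (l * Y w + th) * expR (h * Y w)) =
  expR (h ^+ 2 * s ^+ 2 / 2) * C l (th + l * (h * s ^+ 2)).
Proof.
pose F (x : R) := 1 + cos (l * x + th).
have F0 x : 0 <= F x by rewrite /F; have := cos_geN1 (l * x + th); lra.
have mF : measurable_fun [set: R] F.
  apply: measurable_funD; first exact: measurable_cst.
  by apply: measurableT_comp; [exact: measurable_cos|mfun].
have cF : continuous F.
  move=> x; apply: continuousD; first exact: cvg_cst.
  apply: continuous_comp; last exact: continuous_cos.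
  by apply: continuousD; [apply: continuousM; [exact: cvg_cst|exact: cvg_id]|exact: cvg_cst].
have bc th' : bmeas (fun w => cos (l * Y w + th')) by exact: bmeas_cos.
have ice : Int P (fun w => cos (l * Y w + th) * expR (h * Y w)).
  apply: (Int_dom _ (normal_expInt h)).
    by apply: measurable_funM; [exact: (bc th).1|exact: mexpY].
  move=> w; rewrite normrM [X in _ * X]ger0_norm ?expR_ge0//.
  by rewrite -[leRHS]mul1r ler_wpM2r ?expR_ge0// ler_norml cos_geN1 cos_le1.
have E1 : (\int[P]_w (F (Y w) * expR (h * Y w))%:E =
    (expR (h ^+ 2 * s ^+ 2 / 2))%:E * \int[P]_w (F (Y w + h * s ^+ 2))%:E)%E.
  rewrite (law_int (f := fun x => F x * expR (h * x))); last by move=> x; rewrite mulr_ge0 ?expR_ge0.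
    rewrite (law_int (f := fun x => F (x + h * s ^+ 2))); last by move=> x; exact: F0.
      rewrite -integral_normal_pdf_shift//.
      rewrite -ge0_integralZl_EFin ?expR_ge0//; first last.
      - apply/measurable_EFinP; apply: measurable_funM => //; exact: measurable_normal_pdf.
      - by move=> x _; rewrite lee_fin mulr_ge0// normal_pdf_ge0.
      apply: eq_integral => x _; rewrite -EFinM -mulrA expR_normal_pdf m0 mulr0 add0r; congr EFin.
      by rewrite mulrCA.
    by apply: measurableT_comp => //; mfun.
  apply: measurable_funM => //; apply: measurableT_comp; [exact: measurable_expR|by mfun].
have iF : bmeas (fun w => F (Y w + h * s ^+ 2)).
  apply: bmeasD; first exact: bmeas_cst.
  by apply: bmeas_cos; mfun.
have iFe : Int P (fun w => F (Y w) * expR (h * Y w)).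
  have := IntD (normal_expInt h) ice; apply: eq_integrable => // w _.
  by rewrite /= /F; congr EFin; ring.
move: E1; rewrite (EFin_Ex iFe) (EFin_Ex (bmeas_int P iF)) -EFinM => -[E1].
have E2 : Ex (fun w => F (Y w) * expR (h * Y w)) =
  Ex (fun w => expR (h * Y w)) + Ex (fun w => cos (l * Y w + th) * expR (h * Y w)).
  rewrite /Ex -RintegralD//; first by apply: eq_Ex => w; rewrite /F; ring.
  exact: normal_expInt.
have E3 : Ex (fun w => F (Y w + h * s ^+ 2)) = 1 + C l (th + l * (h * s ^+ 2)).
  rewrite -[X in X + _](Ex_cst P 1) -ExD//; last exact: bmeas_cst.
  by apply: eq_Ex => w; rewrite /F; congr (1 + cos _); ring.
move: E1; rewrite E2 E3 normal_mgf m0 mulr0 add0r mulrDr mulr1 => /addrI; exact.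
Qed.

(** Gaussian integration by parts, obtained by differentiating [normal_cos_shift] in [h] at 0 after
    writing the sine as a cosine with shifted phase. *)
Lemma normal_cos_mul (l th : R) : Ex (fun w => Y w * sin (l * Y w + th)) = l * s ^+ 2 * C l th.
Proof.
have sinE x : sin x = cos (x - pi / 2) :> R by rewrite cosB cos_pihalf sin_pihalf mulr0 add0r mulr1.
have H1 := @normal_derive_exp (fun y => sin (l * y + th)) 0.
have mg : measurable_fun [set: R] (fun y => sin (l * y + th)).
  by apply: measurableT_comp; [exact: measurable_sin|mfun].
have gb (y : R) : `|sin (l * y + th)| <= expR `|y|.
  apply: (@le_trans _ _ 1); first by rewrite ler_norml sin_geN1 sin_le1.
  by rewrite (le_trans _ (expR_ge1Dx _))// lerDl.
have {H1} := H1 mg gb.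
have e1 (x : R) : Ex (fun w => sin (l * Y w + th) * expR (x * Y w)) =
   expR (0 * x + x ^+ 2 * s ^+ 2 / 2) * C l (l * s ^+ 2 * x + (th - pi / 2)).
  under eq_Ex do rewrite sinE -addrA.
  by rewrite normal_cos_shift; congr (expR _ * C _ _); ring.
have dC : is_derive (0:R) 1 (fun x : R => C l (l * s ^+ 2 * x + (th - pi / 2))) (l * s ^+ 2 * C l th).
  have dth : is_derive (th - pi / 2) 1 (C l) (Ex (fun w => - (1 * sin (l * Y w + (th - pi / 2))))).
    apply: (@Ex_is_derive _ _ _ _ (fun t w => cos (l * Y w + t)) (fun t w => - (1 * sin (l * Y w + t))) _ (fun=> 1)) => //.
    - by move=> x _; apply/bmeas_int/bmeas_cos.
    - move=> x w; have := is_derive_cos_lin 1 (l * Y w) x.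
      rewrite mulr1 addrC; have -> : (fun l0 : R => cos (l0 * 1 + l * Y w)) = (fun t => cos (l * Y w + t)); last by [].
      by apply/funext => t; rewrite mulr1 addrC.
    - exact/bmeas_int/bmeas_cst.
    - by move=> x w _; rewrite mul1r normrN ler_norml sin_geN1 sin_le1.
  have lin : is_derive (0:R) 1 (fun x : R => l * s ^+ 2 * x + (th - pi / 2)) (l * s ^+ 2).
    have -> : (fun x : R => l * s ^+ 2 * x + (th - pi / 2)) = (fun x : R => (l * s ^+ 2) *: x + (th - pi / 2)) by [].
    by apply: is_derive_eq; rewrite addr0 /GRing.scale/= mulr1.
  have {}dth : is_derive (l * s ^+ 2 * 0 + (th - pi / 2)) 1 (C l) (Ex (fun w => - (1 * sin (l * Y w + (th - pi / 2))))).
    by rewrite mulr0 add0r.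
  have -> : l * s ^+ 2 * C l th = Ex (fun w => - (1 * sin (l * Y w + (th - pi / 2)))) * (l * s ^+ 2); last first.
    exact: (@is_derive1_comp R (C l) _ 0 _ _ dth lin).
  rewrite mulrC; congr (_ * _); apply: eq_Ex => w; rewrite mul1r -mulN1r addrA sinB cos_pihalf sin_pihalf; ring.
have H2 : is_derive (0:R) 1 (fun x : R => expR (0 * x + x ^+ 2 * s ^+ 2 / 2) * C l (l * s ^+ 2 * x + (th - pi / 2)))
    (l * s ^+ 2 * C l th).
  have e := is_derive_equad 0 (s ^+ 2) 0.
  have -> : (fun x : R => expR (0 * x + x ^+ 2 * s ^+ 2 / 2) * C l (l * s ^+ 2 * x + (th - pi / 2))) =
    (fun x : R => expR (0 * x + x ^+ 2 * s ^+ 2 / 2)) * (fun x : R => C l (l * s ^+ 2 * x + (th - pi / 2))) by [].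
  apply: is_derive_eq => /=.
  rewrite /GRing.scale/= !(mulr0, mul0r, expr0n, addr0)/= expR0. ring.
move=> H1; have := is_derive_uniq e1 H1 H2 => <-.
by apply: eq_Ex => w; rewrite mul0r expR0; ring.
Qed.

(** By [normal_cos_mul], [C l th] solves [C' = - l s^2 C] in the variable [l], so its product with
    [expR (l^2 s^2 / 2)] keeps its value [cos th] at [l = 0]. *)
Lemma normal_cf (l th : R) : Ex (fun w => cos (l * Y w + th)) = cos th * expR (- (l ^+ 2 * s ^+ 2 / 2)).
Proof.
pose F (x : R) := C x th * expR (0 * x + x ^+ 2 * s ^+ 2 / 2).
have dF (x : R) : is_derive x 1 F 0.
  have dC : is_derive x 1 (fun x => C x th) (- (x * s ^+ 2 * C x th)).
    rewrite -normal_cos_mul.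
    have -> : - Ex (fun w => Y w * sin (x * Y w + th)) = Ex (fun w => - (Y w * sin (x * Y w + th))).
      rewrite -mulN1r; rewrite [RHS](@eq_Ex _ _ _ _ _ (fun w => -1 * (Y w * sin (x * Y w + th)))); last by move=> w; rewrite mulN1r.
      rewrite /Ex RintegralZl//; apply: (Int_dom _ (GInt 1)).
        by apply: measurable_funM => //; exact: (bmeas_sin (mlin x th)).1.
      move=> w; apply: le_trans (expG _ _); rewrite mul1r normrM -[leRHS]mulr1 ler_pM//.
      by rewrite ler_norml sin_geN1 sin_le1.
    apply: (@Ex_is_derive _ _ _ _ (fun x w => cos (x * Y w + th)) (fun x w => - (Y w * sin (x * Y w + th))) _ (G 1)).
    - by move=> y _; exact/bmeas_int/bmeas_cos.
    - by move=> y w; exact: is_derive_cos_lin.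
    - by move=> w; rewrite addr_ge0 ?expR_ge0.
    - exact: GInt.
    - move=> y w _; apply: le_trans (expG _ _); rewrite mul1r normrN normrM -[leRHS]mulr1 ler_pM//.
      by rewrite ler_norml sin_geN1 sin_le1.
  have e := is_derive_equad 0 (s ^+ 2) x.
  have -> : F = (fun x => C x th) * (fun x : R => expR (0 * x + x ^+ 2 * s ^+ 2 / 2)) by [].
  by apply: is_derive_eq => /=; rewrite /GRing.scale/=; ring.
have cst (x : R) : F x = F 0.
  have MV (a b : R) : a <= b -> F b = F a.
    move=> ab; have [] := @MVT_segment R F (fun=> 0) a b ab (fun x _ => dF x).
      apply: derivable_within_continuous => y _; have := dF y; move=> ?; exact: ex_derive.
    by move=> c _; rewrite mul0r => /eqP; rewrite subr_eq0 => /eqP.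
  by have [h|h] := leP 0 x; [exact: MV|rewrite (MV x 0)// ltW].
have := cst l; rewrite /F !mul0r expr0n/= !mul0r !add0r expR0 mulr1.
have -> : C 0 th = cos th.
  by rewrite -[RHS](Ex_cst P); apply: eq_Ex => w; rewrite mul0r add0r.
move=> <-; rewrite -mulrA -expRD subrr expR0 mulr1 //.
Qed.

End normal_law.

Section gaussian.
Context d (Om : measurableType d) (R : realType) (P : probability Om R).
Local Notation Ex := (@Ex _ _ R P).
Variables (Y : Om -> R) (v : R).
Hypothesis mY : measurable_fun [set: Om] Y.
Hypothesis gY : gaussian_rv P Y.
Hypothesis EY : ('E_P[Y])%E = 0%E.
Hypothesis EY2 : ('E_P[fun w => (Y w * Y w)%R])%E = v%:E.

Let const_int (c : R) (f : R -> R) : {ae P, forall w, Y w = c} -> measurable_fun [set: R] f ->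
  (\int[P]_w (f (Y w))%:E = (f c)%:E)%E.
Proof.
move=> Yc mf; rewrite (@ae_eq_integral _ _ _ P _ (fun=> (f c)%:E))//.
- rewrite integral_cst// -[RHS]mule1; congr (_ * _)%E; exact: probability_setT.
- by apply/measurable_EFinP; exact: measurableT_comp.
- by apply: filterS Yc => w -> _.
Qed.

Let const_case (c : R) : {ae P, forall w, Y w = c} -> c = 0 /\ v = 0.
Proof.
move=> Yc; move: EY EY2; rewrite unlock.
rewrite (const_int (f := id) Yc)// => -[c0].
rewrite (const_int (f := fun x => x * x) Yc)//; last by mfun.
by rewrite c0 mul0r => -[].
Qed.

Let normal_case (m s : R) : 0 < s ->
  (forall A : set R, measurable A -> P (Y @^-1` A) = normal_prob m s A) ->
  m = 0 /\ v = s ^+ 2.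
Proof.
move=> s0 law; have m0 : m = 0.
  rewrite -(normal_mean mY s0 law); apply: Ex_EFin.
  by move: EY; rewrite unlock.
split=> //; have := normal_var mY s0 law; rewrite m0 expr0n addr0 => <-.
by apply/esym/Ex_EFin; rewrite -EY2 unlock; apply: eq_integral => w _; rewrite expr2.
Qed.

(** Both cases of [gaussian_rv] obey one formula: a degenerate centred variable is almost surely 0,
    and then [v = 0]. *)
Lemma gaussian_mgf (t : R) : Int P (fun w => expR (t * Y w)) /\
  Ex (fun w => expR (t * Y w)) = expR (t ^+ 2 * v / 2).
Proof.
case: gY => [[m [s [s0 law]]]|[c Yc]].
  have [m0 ->] := normal_case s0 law; split; first exact: (normal_expInt mY s0 law).
  by rewrite (normal_mgf mY s0 law) m0 mulr0 add0r.
have [c0 ->] := const_case Yc.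
have mf : measurable_fun [set: R] (fun x => expR (t * x)).
  by apply: measurableT_comp; [exact: measurable_expR|mfun].
have h := const_int Yc mf; split; last first.
  by rewrite (Ex_EFin h) c0 !mulr0 mul0r.
apply/integrableP; split; first by apply/measurable_EFinP; exact: measurableT_comp mf mY.
under eq_integral do rewrite /= ger0_norm ?expR_ge0//.
by rewrite h ltry.
Qed.

Lemma gaussian_cf (l th : R) :
  Ex (fun w => cos (l * Y w + th)) = cos th * expR (- (l ^+ 2 * v / 2)).
Proof.
case: gY => [[m [s [s0 law]]]|[c Yc]].
  have [m0 ->] := normal_case s0 law; exact: (normal_cf mY s0 law m0).
have [c0 ->] := const_case Yc.
have mf : measurable_fun [set: R] (fun x => cos (l * x + th)).
  by apply: measurableT_comp; [exact: measurable_cos|mfun].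
by rewrite (Ex_EFin (const_int Yc mf)) c0 !mulr0 mul0r oppr0 expR0 mulr1 add0r.
Qed.

Lemma gaussian_sqInt : Int P (fun w => Y w * Y w).
Proof.
apply/integrableP; split; first by apply/measurable_EFinP; mfun.
under eq_integral do rewrite /= ger0_norm -?expr2 ?sqr_ge0// expr2.
move: EY2; rewrite unlock; by move=> ->; rewrite ltry.
Qed.

End gaussian.

(** * Linear combinations of independent Gaussian fields *)

(** The source of every Cauchy-Schwarz inequality below; the sign of [C] is part of what has to be
    derived. *)
Lemma discriminant_le (R : realType) (A B C : R) :
  (forall t, 0 <= A + 2 * t * B + t ^+ 2 * C) -> B ^+ 2 <= A * C.
Proof.
move=> h; have A0 : 0 <= A by have := h 0; rewrite mulr0 mul0r expr0n/= mul0r !addr0.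
have [C0|C0|C0] := ltgtP C 0.
- have := h ((1 + `|B| + A) / - C).
  have N0 : 0 < - C by rewrite oppr_gt0.
  set t := _ / _ => ht.
  have tC : t * C = - (1 + `|B| + A) by rewrite /t; field; rewrite lt_eqF.
  have t0 : 0 < t by rewrite divr_gt0//; have := normr_ge0 B; lra.
  have B1 : B <= `|B| by exact: ler_norm.
  have h1 : t * (2 * B - (1 + `|B| + A)) + A < 0 \/ 0 <= t by right; exact: ltW.
  exfalso.
  (* With this value, [s >= 1] and [s * C <= - (1 + 2 |B| + A)], so the quadratic form is at most
     [A - s (1 + A) <= -1], and [C < 0] is impossible. *)
  have := h ((1 + 2 * `|B| + A) / - C + 1).
  set s := _ + 1 => hs.
  have sC : s * C <= - (1 + 2 * `|B| + A).
    have -> : s * C = - (1 + 2 * `|B| + A) + C by rewrite /s; field; rewrite lt_eqF.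
    lra.
  have s1 : 1 <= s.
    rewrite /s lerDr divr_ge0//; last exact: ltW.
    by have := normr_ge0 B; lra.
  have : A + 2 * s * B + s ^+ 2 * C = A + s * (2 * B + s * C) by ring.
  have : s * (2 * B + s * C) <= s * (- (1 + A)) by rewrite ler_wpM2l; lra.
  have : s * (- (1 + A)) <= - (1 + A) by rewrite mulrN lerN2 -[leLHS]mul1r ler_wpM2r; lra.
  lra.
- have := h (- B / C).
  have -> : A + 2 * (- B / C) * B + (- B / C) ^+ 2 * C = (A * C - B ^+ 2) / C by field; rewrite gt_eqF.
  by rewrite pmulr_lge0 ?invr_gt0// subr_ge0.
- rewrite C0 mulr0; have [->|B0] := eqVneq B 0; first by rewrite expr0n.
  have := h (- (A + 1) / (2 * B)); rewrite C0 mulr0 addr0.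
  have -> : A + 2 * (- (A + 1) / (2 * B)) * B = -1 by field; rewrite B0.
  lra.
Qed.

Section gaussian_field.
Context d0 (Om : measurableType d0) (R : realType) (P : probability Om R).
Local Notation Ex := (@Ex _ _ R P).
Variables (T : Type) (D : set T) (v : T -> Om -> R) (K : T -> T -> \bar R) (k : T -> T -> R).
Hypothesis gv : centered_gaussian_field P D v K.
Hypothesis Kk : forall p q, D p -> D q -> K p q = (k p q)%:E.

Let mv p : D p -> measurable_fun [set: Om] (v p). Proof. exact: gv.1. Qed.

Lemma field_sqInt p : D p -> Int P (fun w => v p w * v p w).
Proof.
move=> Dp; apply: (@gaussian_sqInt _ _ _ P (v p) (k p p)).
- exact: mv.
- by rewrite gv.2.2.2// Kk.
Qed.

Lemma field_mulInt p q : D p -> D q -> Int P (fun w => v p w * v q w).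
Proof.
move=> Dp Dq; apply: (Int_dom _ (IntD (field_sqInt Dp) (field_sqInt Dq))).
  by have := mv Dp; have := mv Dq; move=> ? ?; mfun.
move=> w; rewrite normrM -!expr2 -[X in _ <= X + _]real_normK ?num_real//.
rewrite -[X in _ <= _ + X]real_normK ?num_real//.
have := sqr_ge0 (`|v p w| - `|v q w|).
have := sqr_ge0 (`|v p w| + `|v q w|).
by rewrite sqrrB sqrrD => *; lra.
Qed.

Lemma field_Int p : D p -> Int P (v p).
Proof.
move=> Dp; apply: (Int_dom _ (IntD (bmeas_int P (@bmeas_cst _ Om R 1)) (field_sqInt Dp))); first exact: mv.
move=> w; rewrite -expr2 -[X in _ <= _ + X]real_normK ?num_real//.
by have := sqr_ge0 (`|v p w| - 1); rewrite sqrrB expr1n; have := sqr_ge0 `|v p w|; lra.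
Qed.

Lemma field_cov p q : D p -> D q -> Ex (fun w => v p w * v q w) = k p q.
Proof. by move=> Dp Dq; apply: Ex_EFin; have := gv.2.2.2 _ _ Dp Dq; rewrite unlock Kk. Qed.

Lemma IntS (I : Type) (r : seq I) (F : I -> Om -> R) :
  (forall i, Int P (F i)) -> Int P (fun w => \sum_(i <- r) F i w).
Proof.
move=> iF; elim: r => [|i r IH].
  by under eq_fun do rewrite big_nil; apply/bmeas_int/bmeas_cst.
by under eq_fun do rewrite big_cons; exact: IntD.
Qed.

Lemma Ex_sumInt (I : Type) (r : seq I) (F : I -> Om -> R) : (forall i, Int P (F i)) ->
  Ex (fun w => \sum_(i <- r) F i w) = \sum_(i <- r) Ex (F i).
Proof.
move=> iF; elim: r => [|i r IH].
  by rewrite big_nil; under [LHS]eq_Ex do rewrite big_nil; exact: Ex_cst.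
rewrite big_cons -IH /Ex -RintegralD//; first by apply: eq_Ex => w; rewrite big_cons.
exact: IntS.
Qed.

Section comb.
Variables (m : nat) (pts : 'I_m -> T) (a : 'I_m -> R).
Hypothesis Dpts : forall i, D (pts i).
Let xi w := \sum_(i < m) a i * v (pts i) w.

Lemma comb_meas : measurable_fun [set: Om] xi.
Proof.
apply: measurable_sum => i; apply: measurable_funM; first exact: measurable_cst.
exact: mv.
Qed.

Lemma comb_mean : ('E_P[xi])%E = 0%E.
Proof.
have ii i : Int P (fun w => a i * v (pts i) w) by apply: IntZ; exact: field_Int.
rewrite unlock EFin_Ex; last exact: IntS.
rewrite Ex_sumInt// big1// => i _.
have E0 : Ex (v (pts i)) = 0 by apply: Ex_EFin; have := gv.2.2.1 _ (Dpts i); rewrite unlock.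
by rewrite /Ex RintegralZl//; [rewrite -/(Ex _) E0 mulr0|exact: field_Int].
Qed.

Lemma comb_var : ('E_P[fun w => (xi w * xi w)%R])%E =
  (\sum_(i < m) \sum_(j < m) a i * a j * k (pts i) (pts j))%:E.
Proof.
have ii (i j : 'I_m) : Int P (fun w => a i * a j * (v (pts i) w * v (pts j) w)).
  by apply: IntZ; exact: field_mulInt.
have xE w : xi w * xi w = \sum_(i < m) \sum_(j < m) a i * a j * (v (pts i) w * v (pts j) w).
  rewrite /xi mulr_suml; apply: eq_bigr => i _; rewrite mulr_sumr; apply: eq_bigr => j _; ring.
rewrite unlock; under eq_integral do rewrite xE.
rewrite EFin_Ex; last by apply: IntS => i; exact: IntS.
congr EFin; rewrite Ex_sumInt; last by move=> i; exact: IntS.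
apply: eq_bigr => i _; rewrite Ex_sumInt//; apply: eq_bigr => j _.
by rewrite /Ex RintegralZl//; [rewrite -/(Ex _) field_cov|exact: field_mulInt].
Qed.

Lemma comb_mgf (t : R) : Int P (fun w => expR (t * xi w)) /\
  Ex (fun w => expR (t * xi w)) =
  expR (t ^+ 2 * (\sum_(i < m) \sum_(j < m) a i * a j * k (pts i) (pts j)) / 2).
Proof. exact: (gaussian_mgf comb_meas (gv.2.1 _ _ _ Dpts) comb_mean comb_var). Qed.

Lemma comb_cf (th : R) : Ex (fun w => cos (xi w + th)) =
  cos th * expR (- ((\sum_(i < m) \sum_(j < m) a i * a j * k (pts i) (pts j)) / 2)).
Proof.
have := gaussian_cf comb_meas (gv.2.1 _ _ _ Dpts) comb_mean comb_var 1 th.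
by rewrite expr1n mul1r => <-; apply: eq_Ex => w; rewrite mul1r.
Qed.

End comb.
End gaussian_field.

Section independent_family.
Context d0 (Om : measurableType d0) (R : realType) (P : probability Om R).
Local Notation Ex := (@Ex _ _ R P).
Variables (T : Type) (D : set T) (d : nat) (u : 'I_d -> T -> Om -> R).
Variables (K : T -> T -> \bar R) (k : T -> T -> R).
Hypothesis gu : forall j, centered_gaussian_field P D (u j) K.
Hypothesis Kk : forall p q, D p -> D q -> K p q = (k p q)%:E.
Hypothesis indep : independent_fields P D u.

Section joint.
Variables (m : nat) (pts : 'I_m -> T) (a : 'I_d -> 'I_m -> R).
Hypothesis Dpts : forall i, D (pts i).
Let xi j w := \sum_(i < m) a j i * u j (pts i) w.
Let Q j := \sum_(i < m) \sum_(l < m) a j i * a j l * k (pts i) (pts l).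

Let G (j : 'I_d) : set (set Om) := [set A | exists B : 'I_m -> set R,
  (forall i, measurable (B i)) /\ A = \bigcap_(i in [set: 'I_m]) (u j (pts i) @^-1` B i)].

Let mpre j i (B : set R) : measurable B -> measurable (u j (pts i) @^-1` B).
Proof. by move=> mB; rewrite -[X in measurable X]setTI; exact: (gu j).1. Qed.

Let GI j : setI_closed (G j).
Proof.
move=> A1 A2 [B1 [mB1 ->]] [B2 [mB2 ->]]; exists (fun i => B1 i `&` B2 i); split.
  by move=> i; exact: measurableI.
rewrite -bigcapI; apply: eq_bigcapr => i _; by rewrite preimage_setI.
Qed.

Let mG j A : G j A -> measurable A.
Proof. by move=> [B [mB ->]]; apply: fin_bigcap_measurable => // i _; exact: mpre. Qed.

Let GT j : G j setT.
Proof.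
exists (fun=> setT); split => //; apply/seteqP; split => // w _ i _ //.
Qed.

Let mxiG j : @measurable_fun _ _ (g_sigma_algebraType (G j)) R setT (xi j).
Proof.
apply: measurable_sum => i; apply: measurable_funM; first exact: measurable_cst.
move=> _ B mB; rewrite setTI; apply: sub_sigma_algebra.
exists (fun i' => if i' == i then B else setT); split.
  by move=> i'; case: ifP.
apply/seteqP; split => w /=.
  by move=> Bw i' _ /=; case: eqP => // ->.
by move=> /(_ i I) /=; rewrite eqxx.
Qed.

(** The hypothesis [indep] speaks of rectangles only, so the fields are converted one at a time:
    those of index below [l] already enter through a cosine, the others still through an indicator.
    The case [l = 0] is [indep], and [l = d] is the characteristic function of the whole sum. *)
Lemma joint_cf_part (l : nat) : (l <= d)%N -> forall (E : 'I_d -> set Om) (th : R), (forall j, G j (E j)) ->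
  Ex (fun w => cos (\sum_(j < d | (j < l)%N) xi j w + th) * \prod_(j < d | (l <= j)%N) \1_(E j) w) =
  cos th * expR (- ((\sum_(j < d | (j < l)%N) Q j) / 2)) * \prod_(j < d | (l <= j)%N) fine (P (E j)).
Proof.
have mxi j : measurable_fun [set: Om] (xi j) by exact: (comb_meas (gu j)).
have bprod (Q' : pred 'I_d) (E : 'I_d -> set Om) : (forall j, G j (E j)) ->
    bmeas (fun w => \prod_(j < d | Q' j) \1_(E j) w : R).
  move=> GE; elim: (index_enum _) => [|j r IH].
    by under eq_fun do rewrite big_nil; exact: bmeas_cst.
  under eq_fun do rewrite big_cons; case: (Q' j) => //.
  by apply: bmeasM => //; apply: bmeas_indic; apply: mG (GE j).
elim: l => [|l IH] ld E th GE.
  rewrite [X in expR (- (X / 2))]big_pred0// mul0r oppr0 expR0 mulr1.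
  rewrite (@eq_Ex _ _ _ _ _ (fun w => cos th * \1_(\bigcap_(j in [set: 'I_d]) E j) w)).
    have mE : measurable (\bigcap_(j in [set: 'I_d]) E j).
      by apply: fin_bigcap_measurable => // j _; exact: mG (GE j).
    rewrite ExZ; last exact: bmeas_indic.
    rewrite Ex_indic//; congr (_ * _).
    pose B j := projT1 (cid (GE j)).
    have BE j : (forall i, measurable (B j i)) /\ E j = \bigcap_(i in [set: 'I_m]) (u j (pts i) @^-1` B j i).
      exact: projT2 (cid (GE j)).
    have := indep Dpts (fun j i => (BE j).1 i) => /=.
    have -> : \bigcap_(j in [set: 'I_d]) E j =
      \bigcap_(j in [set: 'I_d]) \bigcap_(i in [set: 'I_m]) (u j (pts i) @^-1` B j i).
      by apply: eq_bigcapr => j _; exact: (BE j).2.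
    move=> ->; under eq_bigr do rewrite -(BE _).2.
    have fE j : P (E j) = (fine (P (E j)))%:E by rewrite fineK// fin_num_measure//; exact: mG (GE j).
    by under eq_bigr do rewrite fE; rewrite prodEFin.
  move=> w; rewrite [X in cos (X + _)]big_pred0// add0r; congr (_ * _).
  rewrite indicE; have [wE|wE] := boolP (w \in _).
    rewrite big1// => j _; rewrite indicE mem_set//.
    by move/set_mem : wE => /(_ j I).
  have [j wEj] : exists j, ~ E j w.
    apply: contrapT => h; move/negP : wE; apply; rewrite inE => j _.
    by apply: contrapT => h'; apply: h; exists j.
  by rewrite (bigD1 j)//= indicE memNset// mul0r.
pose j0 := Ordinal ld.
have lj (j : 'I_d) : (l <= j)%N = ((l.+1 <= j)%N || (j == j0)).
  by rewrite leq_eqVlt orbC; congr orb; rewrite eq_sym; apply/eqP/eqP => [h|->//]; exact/val_inj.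
have lj' (j : 'I_d) : (j < l.+1)%N = ((j < l)%N || (j == j0)).
  by rewrite ltnS leq_eqVlt orbC; congr orb; apply/eqP/eqP => [h|->//]; exact/val_inj.
have sumD (F : 'I_d -> R) : \sum_(j < d | (j < l.+1)%N) F j = \sum_(j < d | (j < l)%N) F j + F j0.
  rewrite (bigD1 j0)//= addrC; congr (_ + _); apply: eq_bigl => j.
  by rewrite lj'; case: eqP => [->|_]; rewrite ?ltnn ?andbF//= orbF andbT.
have prodD (F : 'I_d -> R) : \prod_(j < d | (l <= j)%N) F j = F j0 * \prod_(j < d | (l.+1 <= j)%N) F j.
  rewrite (bigD1 j0)//=; congr (_ * _); apply: eq_bigl => j.
  by rewrite lj; case: eqP => [->|_]; rewrite ?ltnn ?andbF//= orbF andbT.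
pose S w := \sum_(j < d | (j < l)%N) xi j w.
pose M w : R := \prod_(j < d | (l.+1 <= j)%N) \1_(E j) w.
pose kap th := cos th * expR (- ((\sum_(j < d | (j < l)%N) Q j) / 2)) * \prod_(j < d | (l.+1 <= j)%N) fine (P (E j)).
have mS : measurable_fun [set: Om] S.
  rewrite /S; under eq_fun do rewrite big_mkcond.
  by apply: measurable_sum => j; case: (j < l)%N; [exact: mxi|exact: measurable_cst].
have bcS th' : bmeas (fun w => cos (S w + th')) by apply: bmeas_cos; mfun.
have bM : bmeas M by exact: bprod.
have bcx th' : bmeas (fun w => cos (xi j0 w + th')) by apply: bmeas_cos; have := mxi j0; move=> ?; mfun.
(* The induction hypothesis with [E j0] replaced by an arbitrary rectangle [A] says that the first
   two factors are independent of [A]; [pi_lambda_Ex] then permits a cosine of [xi j0] in place of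
   the indicator. *)
have key th' phi : Ex (fun w => cos (S w + th') * M w * cos (xi j0 w + phi)) =
    kap th' * (cos phi * expR (- (Q j0 / 2))).
  rewrite -(comb_cf (gu j0) Kk (a j0) Dpts).
  apply: (pi_lambda_Ex (bmeasM (bcS th') bM) (@GI j0) (@mG j0) (@GT j0) _ _ _).2.
  - move=> A GA; rewrite Ex_indic; last exact: mG GA.
    pose E' j := if j == j0 then A else E j.
    have GE' j : G j (E' j) by rewrite /E'; case: eqP => [->|_].
    have E'0 : E' j0 = A by rewrite /E' eqxx.
    have := IH (ltnW ld) E' th' GE'; rewrite [in RHS]prodD E'0 => H.
    transitivity (cos th' * expR (- ((\sum_(j < d | (j < l)%N) Q j) / 2)) *
       (fine (P A) * \prod_(j < d | (l < j)%N) fine (P (E' j)))).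
      rewrite -H; apply: eq_Ex => w; rewrite prodD E'0 /M.
      rewrite (eq_bigr (fun j => \1_(E' j) w)); last first.
        by move=> j jl; rewrite /E' (_ : j == j0 = false)//; apply/eqP => jj; rewrite jj ltnn in jl.
      by rewrite /S; ring.
    have -> : \prod_(j < d | (l < j)%N) fine (P (E' j)) = \prod_(j < d | (l < j)%N) fine (P (E j)).
      apply: eq_bigr => j jl.
      by rewrite /E' (_ : j == j0 = false)//; apply/eqP => jj; rewrite jj ltnn in jl.
    rewrite /kap; ring.
  - by exists 1 => w; rewrite ler_norml cos_geN1 cos_le1.
  - apply: measurableT_comp; first exact: measurable_cos.
    by apply: measurable_funD; [exact: mxiG|exact: measurable_cst].
have sinE x : sin x = cos (x - pi / 2) :> R by rewrite cosB cos_pihalf sin_pihalf mulr0 add0r mulr1.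
rewrite (@eq_Ex _ _ _ _ _ (fun w => cos (S w + th) * M w * cos (xi j0 w + 0) -
   cos (S w + (th - pi / 2)) * M w * cos (xi j0 w + (- (pi / 2))))); last first.
  by move=> w; rewrite sumD -/(S w) -/(M w) addrAC cosD !sinE addr0 addrA; ring.
have bb th' phi : bmeas (fun w => cos (S w + th') * M w * cos (xi j0 w + phi)).
  by apply: bmeasM => //; exact: bmeasM.
rewrite ExB// !key cos0 cosN cos_pihalf mul0r mulr0 subr0 mul1r /kap sumD.
rewrite mulrDl opprD expRD; ring.
Qed.

Lemma joint_cf (th : R) : Ex (fun w => cos (\sum_(j < d) xi j w + th)) =
  cos th * expR (- ((\sum_(j < d) Q j) / 2)).
Proof.
have := @joint_cf_part d (leqnn d) (fun=> setT) th (fun j => GT j).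
have e0 (j : 'I_d) : (d <= j)%N = false by apply/negbTE; rewrite -ltnNge.
rewrite [X in _ = _ * X -> _]big_pred0// mulr1.
rewrite (eq_bigl (fun=> true)); last by move=> j; rewrite ltn_ord.
move=> <-; apply: eq_Ex => w; rewrite [X in _ = _ * X]big_pred0// mulr1.
by congr (cos (_ + _)); apply: eq_bigl => j; rewrite ltn_ord.
Qed.

End joint.
End independent_family.

Section linear_combinations.
Context d0 (Om : measurableType d0) (R : realType) (P : probability Om R).
Local Notation Ex := (@Ex _ _ R P).
Variables (T : Type) (D : set T) (d : nat) (u : 'I_d -> T -> Om -> R).
Variables (K : T -> T -> \bar R) (k : T -> T -> R).
Hypothesis gu : forall j, centered_gaussian_field P D (u j) K.
Hypothesis Kk : forall p q, D p -> D q -> K p q = (k p q)%:E.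
Hypothesis indep : independent_fields P D u.

(** Combinations are lists of terms (coefficient, field, point), so that addition is concatenation
    and points of [T] never have to be compared. *)
Definition lin (c : seq (R * ('I_d * T))) (w : Om) : R := \sum_(x <- c) x.1 * u x.2.1 x.2.2 w.

Definition linD (c : seq (R * ('I_d * T))) := forall i : 'I_(size c), D (tnth (in_tuple c) i).2.2.

(** The covariance of two combinations; the Kronecker factor expresses the independence of different
    fields. *)
Definition linQ (c c' : seq (R * ('I_d * T))) : R :=
  \sum_(x <- c) \sum_(y <- c') (x.2.1 == y.2.1)%:R * (x.1 * y.1 * k x.2.2 y.2.2).

Lemma lin_cf c (th : R) : linD c ->
  Ex (fun w => cos (lin c w + th)) = cos th * expR (- (linQ c c / 2)).
Proof.
move=> Dc; pose t := tnth (in_tuple c).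
pose a (j : 'I_d) (i : 'I_(size c)) := (j == (t i).2.1)%:R * (t i).1.
have := joint_cf gu Kk indep a Dc th.
have -> : linQ c c = \sum_(j < d) \sum_(i < size c) \sum_(l < size c) a j i * a j l * k (t i).2.2 (t l).2.2.
  rewrite /linQ big_tnth [RHS]exchange_big; apply: eq_bigr => i _ /=.
  rewrite big_tnth [RHS]exchange_big; apply: eq_bigr => l _ /=.
  rewrite (bigD1 (t i).2.1)//= big1 ?addr0.
    by rewrite /a eqxx mul1r -/(t i) -/(t l); ring.
  by move=> j ji; rewrite /a (negbTE ji) !mul0r.
move=> <-; apply: eq_Ex => w; congr (cos (_ + _)).
rewrite /lin big_tnth [RHS]exchange_big; apply: eq_bigr => i _ /=.
rewrite (bigD1 (t i).2.1)//= big1 ?addr0; first by rewrite /a eqxx mul1r.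
by move=> j ji; rewrite /a (negbTE ji) !mul0r.
Qed.

Lemma lin_cat c c' w : lin (c ++ c') w = lin c w + lin c' w.
Proof. by rewrite /lin big_cat. Qed.

Definition linZ (l : R) (c : seq (R * ('I_d * T))) := [seq (l * x.1, x.2) | x <- c].

Lemma lin_Z l c w : lin (linZ l c) w = l * lin c w.
Proof. by rewrite /lin big_map mulr_sumr; apply: eq_bigr => x _ /=; ring. Qed.

Lemma linQ_catl c c' e : linQ (c ++ c') e = linQ c e + linQ c' e.
Proof. by rewrite /linQ big_cat. Qed.

Lemma linQ_catr c e e' : linQ c (e ++ e') = linQ c e + linQ c e'.
Proof. by rewrite /linQ -big_split; apply: eq_bigr => x _; rewrite big_cat. Qed.

Lemma linQ_Zl l c e : linQ (linZ l c) e = l * linQ c e.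
Proof.
rewrite /linQ big_map mulr_sumr; apply: eq_bigr => x _ /=; rewrite mulr_sumr.
by apply: eq_bigr => y _; ring.
Qed.

Lemma linQ_Zr l c e : linQ c (linZ l e) = l * linQ c e.
Proof.
rewrite /linQ mulr_sumr; apply: eq_bigr => x _; rewrite big_map mulr_sumr.
by apply: eq_bigr => y _ /=; ring.
Qed.

Lemma linD_all c : linD c <-> (forall x, List.In x c -> D x.2.2).
Proof.
elim: c => [|x c IH]; first by split => // _ [].
split=> [h y [<-|yc]|h].
- exact: (h ord0).
- apply: (IH.1 _ y yc) => i; have := h (lift ord0 i).
  by rewrite !(tnth_nth x).
- case=> -[|i] hi; rewrite (tnth_nth x)/=; first by apply: h; left.
  have /IH hc : forall y, List.In y c -> D y.2.2 by move=> y yc; apply: h; right.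
  by have := hc (Ordinal (hi : (i < size c)%N)); rewrite (tnth_nth x).
Qed.

Lemma linD_cat c c' : linD c -> linD c' -> linD (c ++ c').
Proof.
move=> /linD_all h /linD_all h'; apply/linD_all => x xc.
by case: (List.in_app_or _ _ _ xc) => [/h|/h'].
Qed.

Lemma linD_Z l c : linD c -> linD (linZ l c).
Proof.
move=> /linD_all h; apply/linD_all => x xc.
by have [y [<- yc]] := (List.in_map_iff _ _ _).1 xc; exact: (h _ yc).
Qed.

Lemma linD1 a j p : D p -> linD [:: (a, (j, p))].
Proof. by move=> Dp; apply/linD_all => x [<-|[]]. Qed.

Hypothesis ksym : forall p q, k p q = k q p.

Lemma linQC c e : linQ c e = linQ e c.
Proof.
rewrite /linQ exchange_big; apply: eq_bigr => x _; apply: eq_bigr => y _.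
by rewrite eq_sym ksym; ring.
Qed.

Lemma lin_meas c : linD c -> measurable_fun [set: Om] (lin c).
Proof.
move=> Dc; rewrite /lin; under eq_fun do rewrite big_tnth.
apply: measurable_sum => i; apply: measurable_funM; first exact: measurable_cst.
exact: (gu _).1 (Dc i).
Qed.

(** Positivity is read from the characteristic function at phase 0, which equals
    [expR (- (linQ k c c / 2))] and cannot exceed 1. *)
Lemma linQ_ge0 c : linD c -> 0 <= linQ c c.
Proof.
move=> Dc; have := lin_cf 0 Dc; rewrite cos0 mul1r => h.
have : expR (- (linQ c c / 2)) <= 1.
  rewrite -h -[leRHS](Ex_cst P); apply: le_Ex; last by move=> w; exact: cos_le1.
    by apply: bmeas_cos; have := lin_meas Dc; move=> ?; mfun.
  exact: bmeas_cst.
by rewrite -[leRHS]expR0 ler_expR; lra.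
Qed.

Lemma linQ_CS c e : linD c -> linD e -> linQ c e ^+ 2 <= linQ c c * linQ e e.
Proof.
move=> Dc De; apply: discriminant_le => t.
have := linQ_ge0 (linD_cat Dc (linD_Z (l:=t) De)).
rewrite !linQ_catl !linQ_catr !linQ_Zl !linQ_Zr (linQC e c).
lra.
Qed.

(** Zero covariance makes the quadratic form additive both on [c ++ e] and on [c ++ linZ (-1) e], so
    the product formula for cosines factorises the expectation. *)
Lemma lin_indep (c e : seq (R * ('I_d * T))) (th ph : R) : linD c -> linD e -> linQ c e = 0 ->
  Ex (fun w => (cos (lin c w + th) - cos th * expR (- (linQ c c / 2))) * cos (lin e w + ph)) = 0.
Proof.
move=> Dc De ce0.
have mc := lin_meas Dc; have me := lin_meas De.
have bc c' th' : linD c' -> bmeas (fun w => cos (lin c' w + th')).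
  by move=> /lin_meas mc'; apply: bmeas_cos; mfun.
have Dm := linD_Z (l:=-1) De.
rewrite (@eq_Ex _ _ _ _ _ (fun w => 2^-1 * (cos (lin (c ++ e) w + (th + ph)) + cos (lin (c ++ linZ (-1) e) w + (th - ph)))
   - cos th * expR (- (linQ c c / 2)) * cos (lin e w + ph))).
  have b1 := bc _ (th + ph) (linD_cat Dc De); have b2 := bc _ (th - ph) (linD_cat Dc Dm).
  rewrite ExB; [|by apply: bmeasZ; exact: bmeasD|by apply: bmeasZ; exact: bc].
  rewrite (ExZ P 2^-1 (bmeasD b1 b2)) (ExD P b1 b2) (ExZ P _ (bc _ ph De)).
  rewrite !lin_cf//; [|exact: linD_cat..].
  rewrite !linQ_catl !linQ_catr !linQ_Zl !linQ_Zr (linQC e c) ce0 !mulr0 !addr0 !add0r.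
  have -> : -1 * (-1 * linQ e e) = linQ e e by ring.
  have -> : - ((linQ c c + linQ e e) / 2) = - (linQ c c / 2) + - (linQ e e / 2) by ring.
  by rewrite expRD cosD cosB; field.
move=> w; rewrite !lin_cat lin_Z mulrBl; congr (_ - _).
have -> : lin c w + lin e w + (th + ph) = (lin c w + th) + (lin e w + ph) by ring.
have -> : lin c w + -1 * lin e w + (th - ph) = (lin c w + th) - (lin e w + ph) by ring.
set A := lin c w + th; set B := lin e w + ph.
by rewrite cosD cosB; field.
Qed.

End linear_combinations.

(** * The zero-one law *)

Section euclidean_norm.
Context (R : realType).

Lemma measurable_sqrt : measurable_fun [set: R] (@Num.sqrt R).
Proof. by apply: continuous_measurable_fun; exact: sqrt_continuous. Qed.

Lemma sum_CS (n : nat) (a b : 'I_n -> R) :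
  (\sum_(i < n) a i * b i) ^+ 2 <= (\sum_(i < n) a i ^+ 2) * (\sum_(i < n) b i ^+ 2).
Proof.
apply: discriminant_le => t.
have -> : \sum_(i < n) a i ^+ 2 + 2 * t * \sum_(i < n) a i * b i + t ^+ 2 * \sum_(i < n) b i ^+ 2 =
  \sum_(i < n) (a i + t * b i) ^+ 2.
  by rewrite !mulr_sumr -!big_split; apply: eq_bigr => i _ /=; ring.
by apply: sumr_ge0 => i _; exact: sqr_ge0.
Qed.

Lemma enormf_ge0 n (a : 'I_n -> R) : 0 <= enormf a.
Proof. exact: sqrtr_ge0. Qed.

Lemma enormf_sqr n (a : 'I_n -> R) : enormf a ^+ 2 = \sum_(i < n) a i ^+ 2.
Proof. by rewrite sqr_sqrtr// sumr_ge0// => i _; exact: sqr_ge0. Qed.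

Lemma enormfD n (a b : 'I_n -> R) : enormf (fun i => a i + b i) <= enormf a + enormf b.
Proof.
rewrite -(ler_pXn2r (n:=2))// ?nnegrE ?addr_ge0 ?enormf_ge0//.
rewrite sqrrD !enormf_sqr.
have -> : \sum_(i < n) (a i + b i) ^+ 2 = \sum_(i < n) a i ^+ 2 + (\sum_(i < n) a i * b i) *+ 2 + \sum_(i < n) b i ^+ 2.
  by rewrite -sumrMnl -!big_split; apply: eq_bigr => i _ /=; ring.
rewrite lerD2r lerD2l lerMn2r/= (le_trans (ler_norm _))//.
rewrite -(ler_pXn2r (n:=2))// ?nnegrE ?mulr_ge0 ?enormf_ge0//.
by rewrite real_normK ?num_real// exprMn !enormf_sqr sum_CS.
Qed.

Lemma enormf_coord n (a : 'I_n -> R) i : `|a i| <= enormf a.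
Proof.
rewrite -(ler_pXn2r (n:=2))// ?nnegrE ?enormf_ge0// real_normK ?num_real// enormf_sqr.
by rewrite (bigD1 i)//= lerDl sumr_ge0// => j _; exact: sqr_ge0.
Qed.

Lemma enormf_le_sum n (a : 'I_n -> R) : enormf a <= \sum_(i < n) `|a i|.
Proof.
have s0 : 0 <= \sum_(i < n) `|a i| by apply: sumr_ge0.
rewrite -(ler_pXn2r (n:=2))// ?nnegrE ?enormf_ge0// enormf_sqr expr2 mulr_suml.
apply: ler_sum => i _; rewrite -[leLHS]real_normK ?num_real// expr2 ler_wpM2l//.
by rewrite (bigD1 i)//= lerDl sumr_ge0.
Qed.

Lemma enormf_meas d (T : measurableType d) n (f : 'I_n -> T -> R) :
  (forall i, measurable_fun [set: T] (f i)) -> measurable_fun [set: T] (fun w => enormf (fun i => f i w)).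
Proof.
move=> mf; apply: (measurableT_comp measurable_sqrt).
by apply: measurable_sum => i; apply: measurable_funX; exact: mf.
Qed.

End euclidean_norm.

Section sigma_orthogonal.
Context d0 (Om : measurableType d0) (R : realType) (P : probability Om R).
Local Notation Ex := (@Ex _ _ R P).
Variables (I : Type) (fam : I -> Om -> R) (S : set (Om -> R)) (W : Om -> R).

(** A pi-system that generates the sigma-algebra of [fam] and whose members are exactly the events
    handled by [trig_multi]. *)
Definition rays : set (set Om) :=
  [set A | exists s : seq (I * R), A = [set w | all (fun x => fam x.1 w <= x.2) s]].

Lemma rays_meas i : @measurable_fun _ _ (g_sigma_algebraType rays) R setT (fam i).
Proof.
apply: (measurability _ (RGenOInfty.measurableE R)) => _ [_ [x ->] <-].
rewrite setTI; have -> : fam i @^-1` `]x, +oo[%classic = ~` [set w | all (fun y => fam y.1 w <= y.2) [:: (i, x)]].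
  apply/seteqP; split => w /=; rewrite in_itv/= !andbT; first by move=> h; apply/negP; rewrite -ltNge.
  by move/negP; rewrite -ltNge.
apply: (@measurableC _ (g_sigma_algebraType rays)); apply: sub_sigma_algebra.
by exists [:: (i, x)].
Qed.

Hypothesis bW : bmeas W.
Hypothesis mfam : forall i, measurable_fun [set: Om] (fam i).
Hypothesis mS : forall eta, S eta -> measurable_fun [set: Om] eta.
Hypothesis SD : forall eta l i, S eta -> S (fun w => eta w + l * fam i w).
Hypothesis S0 : S (fun=> 0).
Hypothesis W0 : forall eta th, S eta -> Ex (fun w => W w * cos (eta w + th)) = 0.

Lemma sigma_orthogonal A : <<s rays >> A -> Ex (fun w => W w * \1_A w) = 0.
Proof.
have mray s : measurable [set w | all (fun x => fam x.1 w <= x.2) s].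
  elim: s => [|x s IH] /=.
    by have -> : [set w : Om | true] = setT by apply/seteqP.
  have -> : [set w | (fam x.1 w <= x.2) && all (fun x0 => fam x0.1 w <= x0.2) s] =
     (fam x.1 @^-1` `]-oo, x.2]%classic) `&` [set w | all (fun x0 => fam x0.1 w <= x0.2) s].
    apply/seteqP; split => w /=; rewrite in_itv/=; first by move/andP.
    by move=> [-> ->].
  apply: measurableI => //; rewrite -[X in measurable X]setTI; apply: mfam => //.
move=> sA; apply: (@pi_lambda_Ex0 _ _ _ P W rays bW _ _ _ _ A sA).2.
- move=> _ _ [s1 ->] [s2 ->]; exists (s1 ++ s2); apply/seteqP; split => w /=; rewrite all_cat.
    by move=> [-> ->].
  by move/andP.
- by move=> _ [s ->]; exact: mray.
- by exists [::]; apply/seteqP.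
- move=> _ [s ->]; rewrite -[RHS](trig_multi bW mfam mS SD W0 s 0 S0).
  apply: eq_Ex => w; rewrite addr0 cos0 mulr1 indicE; congr (_ * (nat_of_bool _)%:R).
  by apply/idP/idP; rewrite inE.
Qed.

End sigma_orthogonal.

Section zero_one.
Context (R : realType) (T : Type) (d : nat) (pt : nat -> T).
Variables (dist : T -> T -> R) (phi psi : R -> R).
Hypothesis dist_ge0 : forall p q, 0 <= dist p q.
Hypothesis phi_ge0 : forall x : R, 0 <= x -> 0 <= phi x.
Hypothesis small : forall eta : R, 0 < eta -> exists N : nat, forall x : R, 0 <= x -> x < 2^-1 ^+ N -> phi x <= eta * psi x.

(** The slack [m.+1%:R^-1] makes the bound strict up to the choice of [m], so a perturbation
    negligible against [psi] leaves the event unchanged. Countably many points and dyadic radii make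
    it measurable. *)
Definition mod_event (Om : Type) (v : 'I_d -> nat -> Om -> R) (c : R) : set Om :=
  [set w | exists n m : nat, forall i j : nat, dist (pt i) (pt j) < 2^-1 ^+ n ->
    enormf (fun l => v l i w - v l j w) <= (c - m.+1%:R^-1) * psi (dist (pt i) (pt j))].

Lemma mod_event_meas d1 (Om : measurableType d1) (v : 'I_d -> nat -> Om -> R) c :
  (forall l i, measurable_fun [set: Om] (v l i)) -> measurable (mod_event v c).
Proof.
move=> mv.
have -> : mod_event v c = \bigcup_n \bigcup_m \bigcap_i \bigcap_j
   [set w | dist (pt i) (pt j) < 2^-1 ^+ n ->
    enormf (fun l => v l i w - v l j w) <= (c - m.+1%:R^-1) * psi (dist (pt i) (pt j))].
  apply/seteqP; split => w.
    by move=> [n [m h]]; exists n => //; exists m => // i _ j _; exact: h.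
  by move=> [n _ [m _ h]]; exists n, m => i j; exact: (h i I j I).
apply: bigcup_measurable => n _; apply: bigcup_measurable => m _.
apply: bigcap_measurable; first by exists 0%N.
move=> i _; apply: bigcap_measurable; first by exists 0%N.
move=> j _; have [h|h] := boolP (dist (pt i) (pt j) < 2^-1 ^+ n); last first.
  by rewrite (_ : [set w | _] = setT)//; apply/seteqP; split.
have me : measurable_fun [set: Om] (fun w => enormf (fun l => v l i w - v l j w)).
  by apply: enormf_meas => l; have := mv l i; have := mv l j; move=> ? ?; mfun.
have := me measurableT `]-oo, (c - m.+1%:R^-1) * psi (dist (pt i) (pt j))]%classic (measurable_itv _).
rewrite setTI; congr measurable; apply/seteqP; split => w /=; rewrite in_itv/=; first by [].
by apply.
Qed.

(* [phi] is negligible against [psi] near 0, so the slack [m.+1%:R^-1] absorbs the perturbation [b * z]. *)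
Lemma mod_event_invar (Om : Type) (v v' : 'I_d -> nat -> Om -> R) (b : 'I_d -> nat -> R) (z : Om -> R) (B c : R) :
  (forall l i w, v' l i w = v l i w - b l i * z w) ->
  (forall l i j, `|b l i - b l j| <= B * phi (dist (pt i) (pt j))) ->
  mod_event v c `<=` mod_event v' c.
Proof.
move=> v'E bB w [n [m h]].
pose Z := d%:R * (`|B| * `|z w|) + 1.
have Z0 : 0 < Z by rewrite ltr_wpDl// !mulr_ge0.
pose eta := (m.+1%:R^-1 - m.+2%:R^-1) / Z.
have dm : 0 < m.+1%:R^-1 - m.+2%:R^-1 :> R.
  by rewrite subr_gt0 ltf_pV2 ?posrE ?ltr0n// ltr_nat.
have [N hN] := small (divr_gt0 dm Z0).
exists (maxn n N), m.+1 => i j dij.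
have d1 : dist (pt i) (pt j) < 2^-1 ^+ n.
  apply: lt_le_trans dij _; apply: ler_wiXn2l; rewrite ?leq_maxl//; lra.
have d2 : dist (pt i) (pt j) < 2^-1 ^+ N.
  apply: lt_le_trans dij _; apply: ler_wiXn2l; rewrite ?leq_maxr//; lra.
have hphi := hN _ (dist_ge0 _ _) d2.
have -> : (fun l => v' l i w - v' l j w) =
  (fun l => (v l i w - v l j w) + - ((b l i - b l j) * z w)).
  by apply/funext => l; rewrite !v'E; ring.
apply: (le_trans (enormfD _ _)).
have p0 := phi_ge0 (dist_ge0 (pt i) (pt j)).
have e2 : enormf (fun l => - ((b l i - b l j) * z w)) <= Z * phi (dist (pt i) (pt j)).
  apply: (le_trans (enormf_le_sum _)).
  apply: (@le_trans _ _ (\sum_(l < d) `|B| * `|z w| * phi (dist (pt i) (pt j)))).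
    apply: ler_sum => l _; rewrite normrN normrM mulrAC ler_wpM2r//.
    by rewrite (le_trans (bB l i j))// ler_wpM2r// ler_norm.
  by rewrite sumr_const card_ord -mulr_natl mulrA ler_wpM2r// /Z mulrA lerDl.
have e3 : Z * phi (dist (pt i) (pt j)) <= (m.+1%:R^-1 - m.+2%:R^-1) * psi (dist (pt i) (pt j)).
  apply: le_trans (ler_wpM2l (ltW Z0) hphi) _.
  by rewrite mulrA (mulrC Z) divfK ?gt_eqF.
apply: (le_trans (lerD (h i j d1) (le_trans e2 e3))).
by rewrite -mulrDl addrA subrK.
Qed.

Section field.
Context d0 (Om : measurableType d0) (P : probability Om R).
Local Notation Ex := (@Ex _ _ R P).
Variables (D : set T) (u : 'I_d -> T -> Om -> R).
Variables (K : T -> T -> \bar R) (k : T -> T -> R).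
Hypothesis gu : forall j, centered_gaussian_field P D (u j) K.
Hypothesis Kk : forall p q, D p -> D q -> K p q = (k p q)%:E.
Hypothesis indep : independent_fields P D u.
Hypothesis ksym : forall p q, k p q = k q p.
Hypothesis Dpt : forall i, D (pt i).
Hypothesis kphi : forall i j, k (pt i) (pt i) - 2 * k (pt i) (pt j) + k (pt j) (pt j) <= phi (dist (pt i) (pt j)) ^+ 2.

Let fam (x : 'I_d * nat) : Om -> R := u x.1 (pt x.2).
Let mfam x : measurable_fun [set: Om] (fam x). Proof. exact: (gu _).1. Qed.
Let e1 (l : 'I_d) (i : nat) : seq (R * ('I_d * T)) := [:: (1, (l, pt i))].
Let De1 l i : linD D (e1 l i). Proof. exact: linD1. Qed.

Let lin_e1 l i w : lin u (e1 l i) w = u l (pt i) w.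
Proof. by rewrite /lin big_seq1 mul1r. Qed.

Let e1_diff l i j : linQ k (e1 l i ++ linZ (-1) (e1 l j)) (e1 l i ++ linZ (-1) (e1 l j)) <=
  phi (dist (pt i) (pt j)) ^+ 2.
Proof.
have E (i' j' : nat) : linQ k (e1 l i') (e1 l j') = k (pt i') (pt j').
  by rewrite /linQ !big_seq1 eqxx !mul1r.
rewrite !linQ_catl !linQ_catr !linQ_Zl !linQ_Zr !E (ksym (pt j)).
by apply: le_trans (kphi i j); lra.
Qed.

Lemma zero_one c : P (mod_event (fun l i => u l (pt i)) c) = 0%E \/
                   P (mod_event (fun l i => u l (pt i)) c) = 1%E.
Proof.
set A := mod_event _ c.
have mA : measurable A by apply: mod_event_meas => l i; exact: (gu _).1.
have PA : P A = (fine (P A))%:E by rewrite fineK// fin_num_measure.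
set a := fine (P A).
have bA : bmeas (\1_A : Om -> R) by exact: bmeas_indic.
have bcos e th : linD D e -> bmeas (fun w => cos (lin u e w + th)).
  by move=> /(lin_meas gu) me; apply: bmeas_cos; mfun.
(* Regression on [lin u e]: the residuals [r] are uncorrelated with [e], and [A] is unchanged when
   the field is replaced by them. So [A] is generated by variables whose combinations are all
   uncorrelated with [e]. *)
have ortho e th : linD D e -> Ex (fun w => (\1_A w - a) * cos (lin u e w + th)) = 0.
  move=> De; pose q := linQ k e e.
  pose b l i := linQ k (e1 l i) e / q.
  pose c' (x : 'I_d * nat) := e1 x.1 x.2 ++ linZ (- b x.1 x.2) e.
  have Dc' x : linD D (c' x) by apply: linD_cat; [exact: De1|exact: linD_Z].
  pose r (x : 'I_d * nat) := lin u (c' x).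
  have q0 : 0 <= q by exact: (linQ_ge0 gu Kk indep).
  have Qe0 x : linQ k e (c' x) = 0.
    rewrite /c' linQ_catr linQ_Zr (linQC ksym e (e1 _ _)) /b -/q.
    (* For [q = 0] the correction term is zero, and Cauchy-Schwarz shows that the covariance with
       [e] vanishes by itself. *)
    have [qz|qnz] := eqVneq q 0; last by field.
    have := linQ_CS gu Kk indep ksym (@De1 x.1 x.2) De; rewrite -/q qz mulr0 mulr0 addr0.
    by move=> h; apply/eqP; rewrite -sqrf_eq0 eq_le h sqr_ge0.
  pose Sr : set (Om -> R) := [set eta | exists e', [/\ linD D e', linQ k e e' = 0 & eta = lin u e']].
  have bW : bmeas (fun w => cos (lin u e w + th) - cos th * expR (- (q / 2))).
    by apply: bmeasB; [exact: bcos|exact: bmeas_cst].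
  have rA : A = mod_event (fun l i => r (l, i)) c.
    have rE l i w : r (l, i) w = u l (pt i) w - b l i * lin u e w.
      by rewrite /r /c' lin_cat lin_Z lin_e1 mulNr.
    (* A difference of two regression coefficients is the covariance of an increment with [e],
       divided by [q]; Cauchy-Schwarz bounds it by the standard deviation of the increment. *)
    have bB l i j : `|b l i - b l j| <= (Num.sqrt q / q) * phi (dist (pt i) (pt j)).
      have -> : b l i - b l j = linQ k (e1 l i ++ linZ (-1) (e1 l j)) e / q.
        by rewrite linQ_catl linQ_Zl /b; ring.
      have p0 := phi_ge0 (dist_ge0 (pt i) (pt j)).
      rewrite normrM [X in _ * X <= _]ger0_norm ?invr_ge0// mulrAC ler_wpM2r ?invr_ge0//.
      rewrite -(ler_pXn2r (n:=2))// ?nnegrE ?mulr_ge0 ?sqrtr_ge0// real_normK ?num_real//.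
      apply: (le_trans (linQ_CS gu Kk indep ksym (linD_cat (@De1 l i) (linD_Z (@De1 l j))) De)).
      by rewrite exprMn sqr_sqrtr// mulrC ler_wpM2l//; exact: e1_diff.
    apply/seteqP; split.
      by apply: (mod_event_invar (b := b) (z := lin u e) _ bB); exact: rE.
    apply: (mod_event_invar (b := fun l i => - b l i) (z := lin u e) (B := Num.sqrt q / q)).
      by move=> l i w; rewrite rE; ring.
    by move=> l i j; rewrite -opprD normrN; exact: bB.
  have sA : <<s rays r >> A.
    rewrite rA; apply: (@mod_event_meas _ (g_sigma_algebraType (rays r))) => l i.
    exact: rays_meas.
  have := @sigma_orthogonal _ Om R P ('I_d * nat)%type r Sr _ bW _ _ _ _ _ A sA.
  have -> : Ex (fun w => (cos (lin u e w + th) - cos th * expR (- (q / 2))) * \1_A w) =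
    Ex (fun w => (\1_A w - a) * cos (lin u e w + th)).
    rewrite (@eq_Ex _ _ _ _ _ (fun w => cos (lin u e w + th) * \1_A w - cos th * expR (- (q / 2)) * \1_A w)); last first.
      by move=> w; rewrite mulrBl.
    rewrite [RHS](@eq_Ex _ _ _ _ _ (fun w => cos (lin u e w + th) * \1_A w - a * cos (lin u e w + th))); last first.
      by move=> w; ring.
    have b1 := bcos _ th De; have b2 := bmeasM b1 bA.
    rewrite (ExB P b2 (bmeasZ _ bA)) (ExB P b2 (bmeasZ _ b1)) (ExZ P _ bA) (ExZ P _ b1) (Ex_indic P mA).
    by rewrite (lin_cf gu Kk indep _ De) -/q -/a [a * _]mulrC.
  apply.
  - by move=> x; exact: (lin_meas gu).
  - by move=> _ [e' [De' _ ->]]; exact: (lin_meas gu).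
  - move=> _ l x [e' [De' Q0 ->]]; exists (e' ++ linZ l (c' x)); split.
    + by apply: linD_cat => //; exact: linD_Z.
    + by rewrite linQ_catr linQ_Zr Q0 Qe0 mulr0 addr0.
    + by apply/funext => w; rewrite lin_cat lin_Z.
  - exists [::]; split.
    + by case.
    + by rewrite /linQ exchange_big big_nil.
    + by apply/funext => w; rewrite /lin big_nil.
  - by move=> _ ph [e' [De' Q0 ->]]; exact: (lin_indep gu Kk indep ksym).
(* Second pass: [1_A - a] is orthogonal to all combinations by [ortho], hence to every event they
   generate, in particular to [A] itself. *)
pose Su : set (Om -> R) := [set eta | exists2 e', linD D e' & eta = lin u e'].
have bW : bmeas (fun w => \1_A w - a : R) by apply: bmeasB => //; exact: bmeas_cst.
have sA : <<s rays fam >> A.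
  apply: (@mod_event_meas _ (g_sigma_algebraType (rays fam))) => l i.
  exact: (rays_meas (fam:=fam) (l, i)).
have := @sigma_orthogonal _ Om R P ('I_d * nat)%type fam Su _ bW mfam _ _ _ _ A sA.
have E : Ex (fun w => (\1_A w - a) * \1_A w) = a - a ^+ 2.
  rewrite (@eq_Ex _ _ _ _ _ (fun w => \1_A w - a * \1_A w)).
    by rewrite (ExB P bA (bmeasZ _ bA)) (ExZ P _ bA) (Ex_indic P mA) -/a expr2.
  by move=> w; rewrite indicE; case: (_ \in _); rewrite /= ?mulr1 ?mulr0 ?subr0.
rewrite E => H.
have /eqP : a - a ^+ 2 = 0.
  apply: H.
  - by move=> _ [e' De' ->]; exact: (lin_meas gu).
  - move=> _ l x [e' De' ->]; exists (e' ++ linZ l (e1 x.1 x.2)).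
      by apply: linD_cat => //; exact: linD_Z.
    by apply/funext => w; rewrite lin_cat lin_Z lin_e1.
  - by exists [::]; [case|apply/funext => w; rewrite /lin big_nil].
  - by move=> _ th [e' De' ->]; exact: ortho.
rewrite subr_eq0 => /eqP aa.
have : a * (1 - a) = 0 by rewrite mulrBr mulr1 -expr2 -aa subrr.
move=> /eqP; rewrite mulf_eq0 subr_eq0 => /orP[/eqP a0|/eqP a1].
  by left; rewrite PA -/a a0.
by right; rewrite PA -/a -a1.
Qed.

End field.
End zero_one.

(** * Dyadic grids on the box and chaining *)

Section increments.
Context d0 (Om : measurableType d0) (R : realType) (P : probability Om R).
Local Notation Ex := (@Ex _ _ R P).
Variables (T : Type) (D : set T) (v : T -> Om -> R) (K : T -> T -> \bar R) (k : T -> T -> R).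
Hypothesis gv : centered_gaussian_field P D v K.
Hypothesis Kk : forall p q, D p -> D q -> K p q = (k p q)%:E.
Hypothesis ksym : forall p q, k p q = k q p.

Definition incr_var p q := k p p - 2 * k p q + k q q.

Lemma incr_mgf p q (t : R) : D p -> D q ->
  Int P (fun w => expR (t * (v p w - v q w))) /\
  Ex (fun w => expR (t * (v p w - v q w))) = expR (t ^+ 2 * incr_var p q / 2).
Proof.
move=> Dp Dq; pose pts (i : 'I_2) := if i == ord0 then p else q.
pose a (i : 'I_2) : R := if i == ord0 then 1 else -1.
have Dpts i : D (pts i) by rewrite /pts; case: ifP.
have := comb_mgf gv Kk a Dpts t.
have -> : (fun w => expR (t * \sum_(i < 2) a i * v (pts i) w)) = (fun w => expR (t * (v p w - v q w))).
  apply/funext => w; rewrite !big_ord_recl big_ord0 /a /pts /=.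
  by congr expR; ring.
rewrite !big_ord_recl !big_ord0 /a /pts /= /incr_var (ksym q p).
by have -> : 1 * 1 * k p p + (1 * -1 * k p q + 0) + (-1 * 1 * k p q + (-1 * -1 * k q q + 0) + 0) =
  k p p - 2 * k p q + k q q by ring.
Qed.

Lemma chernoff (X : Om -> R) (t x : R) : measurable_fun [set: Om] X ->
  Int P (fun w => expR (t * X w)) -> 0 <= t ->
  fine (P [set w | x <= X w]) <= expR (- (t * x)) * Ex (fun w => expR (t * X w)).
Proof.
move=> mX iX t0.
have mA : measurable [set w | x <= X w].
  have := mX measurableT `[x, +oo[%classic (measurable_itv _).
  by rewrite setTI; congr measurable; apply/seteqP; split => w; rewrite /= in_itv/= andbT.
rewrite -Ex_indic// /Ex -RintegralZl//.
apply: le_Rintegral => //; first exact/bmeas_int/bmeas_indic.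
  exact: IntZ.
move=> w _; rewrite indicE; case: (boolP (w \in _)) => [|_]; last by rewrite mulr_ge0 ?expR_ge0.
rewrite inE /= => xX; rewrite -expRD -[leLHS]expR0 ler_expR.
by have := ler_wpM2l t0 xX; lra.
Qed.

(** Chernoff's bound with the optimal parameter [x / V], applied to both signs of the increment. *)
Lemma incr_tail p q (x V : R) : D p -> D q -> 0 <= x -> incr_var p q <= V -> 0 < V ->
  fine (P [set w | x < `|v p w - v q w|]) <= 2 * expR (- (x ^+ 2 / (2 * V))).
Proof.
move=> Dp Dq x0 vV V0.
have mp := gv.1 _ Dp; have mq := gv.1 _ Dq.
have half p' q' : D p' -> D q' -> incr_var p' q' <= V ->
    fine (P [set w | x <= v p' w - v q' w]) <= expR (- (x ^+ 2 / (2 * V))).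
  move=> Dp' Dq' vV'; have [iX EX] := incr_mgf (x / V) Dp' Dq'.
  have mp' := gv.1 _ Dp'; have mq' := gv.1 _ Dq'.
  have t0 : 0 <= x / V by rewrite divr_ge0// ltW.
  apply: (le_trans (chernoff x _ iX t0)); first by mfun.
  rewrite EX -expRD ler_expR.
  have h : (x / V) ^+ 2 * incr_var p' q' <= (x / V) ^+ 2 * V by rewrite ler_wpM2l// sqr_ge0.
  have -> : - (x ^+ 2 / (2 * V)) = - (x / V * x) + (x / V) ^+ 2 * V / 2 by field; rewrite gt_eqF.
  lra.
have mh p' q' : D p' -> D q' -> measurable [set w | x <= v p' w - v q' w].
  move=> Dp' Dq'.
  have mp' := gv.1 _ Dp'; have mq' := gv.1 _ Dq'.
  have mX : measurable_fun [set: Om] (fun w => v p' w - v q' w) by mfun.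
  have := mX measurableT `[x, +oo[%classic (measurable_itv _).
  by rewrite setTI; congr measurable; apply/seteqP; split => w; rewrite /= in_itv/= andbT.
have fP A : measurable A -> P A = (fine (P A))%:E by move=> mA; rewrite fineK// fin_num_measure.
have sub : (P [set w | (x < `|v p w - v q w|)%R] <=
   P [set w | (x <= v p w - v q w)%R] + P [set w | (x <= v q w - v p w)%R])%E.
  apply: le_trans (measureU2 _ _ _); [|exact: mh|exact: mh].
  apply: le_measure; rewrite ?inE; [|exact: measurableU (mh _ _ Dp Dq) (mh _ _ Dq Dp)|].
    have mX : measurable_fun [set: Om] (fun w => `|v p w - v q w|).
      by apply: measurableT_comp => //; mfun.
    have := mX measurableT `]x, +oo[%classic (measurable_itv _).
    by rewrite setTI; congr measurable; apply/seteqP; split => w; rewrite /= in_itv/= andbT.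
  move=> w /= h; have [h'|h'] := leP 0 (v p w - v q w).
    by left; rewrite ger0_norm// in h; exact: ltW.
  by right; rewrite ltr0_norm// opprB in h; exact: ltW.
have := half _ _ Dp Dq vV.
have : incr_var q p <= V by move: vV; rewrite /incr_var (ksym q p); lra.
move=> /(half _ _ Dq Dp).
rewrite (fP _ (mh _ _ Dp Dq)) (fP _ (mh _ _ Dq Dp)) -EFinD in sub.
move=> h1 h2.
have : fine (P [set w | x < `|v p w - v q w|]) <=
  fine (P [set w | x <= v p w - v q w]) + fine (P [set w | x <= v q w - v p w]).
  rewrite -lee_fin fineK// ge0_fin_numE//; exact: le_lt_trans sub (ltry _).
lra.
Qed.

End increments.

Section box_param.
Context (R : realType) (N : nat) (a b : R) (ax bx : 'rV[R]_N).
Hypothesis ab : a < b.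
Hypothesis abx : forall i, ax 0 i < bx 0 i.

Definition Gam (s : 'I_N.+1 -> R) : R * 'rV[R]_N :=
  (a + (b - a) * s ord0, \row_i (ax 0 i + (bx 0 i - ax 0 i) * s (lift ord0 i))).

Definition coords (p : R * 'rV[R]_N) (i : 'I_N.+1) : R :=
  if unlift ord0 i is Some j then (p.2 0 j - ax 0 j) / (bx 0 j - ax 0 j) else (p.1 - a) / (b - a).

Lemma coords_lift p j : coords p (lift ord0 j) = (p.2 0 j - ax 0 j) / (bx 0 j - ax 0 j).
Proof. by rewrite /coords liftK. Qed.

Lemma coords0 p : coords p ord0 = (p.1 - a) / (b - a).
Proof. by rewrite /coords unlift_none. Qed.

Lemma GamK p : Gam (coords p) = p.
Proof.
case: p => t x; rewrite /Gam coords0; congr pair.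
  by rewrite /= mulrC divfK ?subr_eq0 ?gt_eqF//; ring.
apply/rowP => j; rewrite !mxE coords_lift /= mulrC divfK; first by ring.
by rewrite subr_eq0 gt_eqF.
Qed.

Lemma coords01 p i : box a b ax bx p -> 0 <= coords p i <= 1.
Proof.
move=> [/andP[p1 p2] px]; case: (unliftP ord0 i) => [j ->|->].
  have /andP[h1 h2] := px j; have hb := abx j.
  rewrite coords_lift divr_ge0 ?ler_pdivrMr ?mul1r ?subr_gt0 ?subr_ge0 ?lerB//; last exact: ltW.
rewrite coords0 divr_ge0 ?ler_pdivrMr ?mul1r ?subr_gt0 ?subr_ge0 ?lerB//; exact: ltW.
Qed.

Lemma affine01 (x y t : R) : x < y -> 0 <= t <= 1 -> x <= x + (y - x) * t <= y.
Proof.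
move=> xy /andP[t0 t1]; have h1 : 0 <= (y - x) * t by rewrite mulr_ge0// subr_ge0 ltW.
have h2 : (y - x) * t <= y - x by rewrite -[leRHS]mulr1 ler_wpM2l// subr_ge0 ltW.
by lra.
Qed.

Lemma Gam_box (s : 'I_N.+1 -> R) : (forall i, 0 <= s i <= 1) -> box a b ax bx (Gam s).
Proof.
by move=> s01; split => /=; [exact: affine01|move=> i; rewrite mxE; exact: affine01].
Qed.

Lemma pdist_le_sum (p q : R * 'rV[R]_N) : pdist p q <= `|p.1 - q.1| + \sum_(i < N) `|p.2 0 i - q.2 0 i|.
Proof.
rewrite /pdist lerD2l; apply: (le_trans (enormf_le_sum (fun i => (p.2 - q.2) 0 i))).
by apply: ler_sum => i _; rewrite !mxE.
Qed.

Definition Lip : R := (b - a) + \sum_(i < N) (bx 0 i - ax 0 i).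

Lemma Lip_gt0 : 0 < Lip.
Proof. by rewrite ltr_wpDr ?subr_gt0// sumr_ge0// => i _; rewrite subr_ge0 ltW. Qed.

Lemma Gam_lip (s s' : 'I_N.+1 -> R) (e : R) : (forall i, `|s i - s' i| <= e) ->
  pdist (Gam s) (Gam s') <= Lip * e.
Proof.
move=> h; apply: (le_trans (pdist_le_sum _ _)); rewrite mulrDl; apply: lerD => /=.
  rewrite opprD addrACA subrr add0r -mulrBr normrM gtr0_norm ?subr_gt0//.
  by rewrite ler_wpM2l// subr_ge0 ltW.
rewrite mulr_suml; apply: ler_sum => i _; rewrite !mxE opprD addrACA subrr add0r -mulrBr normrM gtr0_norm ?subr_gt0//.
by rewrite ler_wpM2l// subr_ge0 ltW.
Qed.

Definition colip : R := 1 + (b - a)^-1 + \sum_(i < N) (bx 0 i - ax 0 i)^-1.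

Lemma colip_ge1 : 1 <= colip.
Proof.
rewrite /colip -addrA lerDl addr_ge0 ?invr_ge0 ?subr_ge0 ?(ltW ab)//.
by rewrite sumr_ge0// => i _; rewrite invr_ge0 subr_ge0 ltW.
Qed.

Lemma coords_lip p q i : `|coords p i - coords q i| <= colip * pdist p q.
Proof.
have s0 (A : pred 'I_N) : 0 <= \sum_(i < N | A i) (bx 0 i - ax 0 i)^-1.
  by rewrite sumr_ge0// => j _; rewrite invr_ge0 subr_ge0 ltW.
have b0 : 0 <= (b - a)^-1 by rewrite invr_ge0 subr_ge0 ltW.
have e0 : 0 <= enorm (p.2 - q.2) by exact: sqrtr_ge0.
case: (unliftP ord0 i) => [j ->|->].
  rewrite !coords_lift -mulrBl opprD addrACA opprK addNr addr0 normrM.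
  have hb := abx j; have i0 : 0 <= (bx 0 j - ax 0 j)^-1 by rewrite invr_ge0 subr_ge0 ltW.
  rewrite (ger0_norm i0) mulrC; apply: ler_pM => //.
    rewrite /colip (bigD1 j)//=; have := s0 (fun i => i != j); lra.
  rewrite /pdist; apply: (@le_trans _ _ (enorm (p.2 - q.2))); last by rewrite lerDr.
  by have := enormf_coord (fun i => (p.2 - q.2) 0 i) j; rewrite !mxE.
rewrite !coords0 -mulrBl opprD addrACA opprK addNr addr0 normrM (ger0_norm b0) mulrC.
apply: ler_pM => //; last by rewrite /pdist lerDl.
by rewrite /colip; have := s0 xpredT; lra.
Qed.

(** Truncation at 1 sends every index tuple into the box, so grid points carry no range
    condition. *)
Definition gpt (n : nat) (k : 'I_N.+1 -> nat) := Gam (fun i => Num.min ((k i)%:R / 2 ^+ n) 1).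

Definition flk (n : nat) (p : R * 'rV[R]_N) (i : 'I_N.+1) : nat := Num.truncn (2 ^+ n * coords p i).

(** One sequence running through the grids of all dyadic levels; codes that do not decode are sent
    to a corner. *)
Definition grid_pt (i : nat) : R * 'rV[R]_N :=
  if unpickle i is Some (n, k) then gpt n (tnth (k : N.+1.-tuple nat)) else gpt 0 (fun=> 0%N).

Let p2 n : 0 < 2 ^+ n :> R. Proof. by rewrite exprn_gt0. Qed.

Lemma gpt_box n k : box a b ax bx (gpt n k).
Proof.
apply: Gam_box => i; rewrite ge_min lexx orbT andbT le_min ler01 andbT.
by rewrite divr_ge0// ltW.
Qed.

Lemma grid_pt_box i : box a b ax bx (grid_pt i).
Proof. by rewrite /grid_pt; case: unpickle => [[n k]|]; exact: gpt_box. Qed.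

Lemma gpt_grid n k : exists i, gpt n k = grid_pt i.
Proof.
exists (pickle (n, [tuple k i | i < N.+1])); rewrite /grid_pt pickleK /gpt /Gam.
by congr pair; rewrite ?tnth_mktuple//; apply/rowP => i; rewrite !mxE tnth_mktuple.
Qed.

Lemma flk_itv n p i : box a b ax bx p ->
  (flk n p i)%:R <= 2 ^+ n * coords p i < (flk n p i).+1%:R.
Proof.
by move=> bp; apply: truncn_itv; have := coords01 i bp => /andP[? _]; rewrite mulr_ge0// ltW.
Qed.

Lemma flk_le n p i : box a b ax bx p -> (flk n p i <= 2 ^ n)%N.
Proof.
move=> bp; have /andP[h1 _] := flk_itv n i bp; have /andP[_ c1] := coords01 i bp.
rewrite -(ler_nat R) natrX (le_trans h1)// -[leRHS]mulr1 ler_wpM2l// ltW//.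
Qed.

Lemma gpt_dist n k k' : (forall i, (k i <= (k' i).+1)%N /\ (k' i <= (k i).+1)%N) ->
  pdist (gpt n k) (gpt n k') <= Lip * 2^-1 ^+ n.
Proof.
move=> h; apply: Gam_lip => i; have [h1 h2] := h i.
have q (m m' : nat) : (m <= m'.+1)%N -> m%:R / 2 ^+ n <= m'%:R / 2 ^+ n + 2^-1 ^+ n :> R.
  by move=> mm; rewrite exprVn -[X in _ + X]mul1r -mulrDl ler_wpM2r ?invr_ge0 ?(ltW (p2 n))// natr1 ler_nat.
have := q _ _ h1; have := q _ _ h2.
have e0 : 0 <= 2^-1 ^+ n :> R by rewrite exprn_ge0.
set x := _ / _; set y := _ / _ => h3 h4.
have [hx|hx] := leP x 1; have [hy|hy] := leP y 1; rewrite ?(min_l _ _ hx) ?(min_r _ _ (ltW hx)) ?(min_l _ _ hy) ?(min_r _ _ (ltW hy)) ler_norml; lra.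
Qed.

Lemma gpt_double n k : gpt n k = gpt n.+1 (fun i => (k i).*2).
Proof.
rewrite /gpt; congr Gam; apply/funext => i; congr Num.min.
by rewrite -muln2 natrM exprSr -mulf_div divff// mulr1.
Qed.

Lemma flk_next n p i : box a b ax bx p ->
  ((flk n p i).*2 <= (flk n.+1 p i).+1)%N /\ (flk n.+1 p i <= (flk n p i).*2.+1)%N.
Proof.
move=> bp; have /andP[h1 h2] := flk_itv n i bp; have /andP[h3 h4] := flk_itv n.+1 i bp.
rewrite exprS -mulrA in h3 h4.
have e2 m : (m.*2)%:R = 2 * m%:R :> R by rewrite -muln2 natrM mulrC.
split.
  rewrite -(ler_nat R) e2; lra.
by rewrite -ltnS -(ltr_nat R) -doubleS e2; lra.
Qed.

Lemma flk_close n p q i : box a b ax bx p -> box a b ax bx q ->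
  `|coords p i - coords q i| <= 2^-1 ^+ n -> (flk n p i <= (flk n q i).+1)%N.
Proof.
move=> bp bq; rewrite ler_norml => /andP[_ h].
have /andP[h1 h2] := flk_itv n i bp; have /andP[h3 h4] := flk_itv n i bq.
have := ler_wpM2l (ltW (p2 n)) h; rewrite exprVn mulfV ?gt_eqF// => h'.
by rewrite -ltnS -(ltr_nat R) -natr1; lra.
Qed.

Lemma flk_dist n p : box a b ax bx p -> pdist (gpt n (flk n p)) p <= Lip * 2^-1 ^+ n.
Proof.
move=> bp; rewrite -{2}(GamK p); apply: Gam_lip => i.
have /andP[h1 h2] := flk_itv n i bp; have /andP[c0 c1] := coords01 i bp.
have h3 : (flk n p i)%:R / 2 ^+ n <= coords p i by rewrite ler_pdivrMr// mulrC.
rewrite min_l; last exact: le_trans h3 c1.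
rewrite distrC ger0_norm ?subr_ge0// exprVn -(ler_pM2l (p2 n)) mulrBr mulrCA !mulfV ?gt_eqF// mulr1.
by move: h2; rewrite -natr1; lra.
Qed.

Section chain.
Variables (f : R * 'rV[R]_N -> R) (e : nat -> R) (rho : R) (n0 : nat).
Hypothesis rho01 : 0 <= rho < 1.
Hypothesis e_ge0 : forall n, 0 <= e n.
Hypothesis eS : forall n, (n0 <= n)%N -> e n.+1 <= rho * e n.
Hypothesis good : forall n k k', (n0 <= n)%N -> (forall i, (k i <= 2 ^ n)%N) -> (forall i, (k' i <= 2 ^ n)%N) ->
  (forall i, (k i <= (k' i).+1)%N /\ (k' i <= (k i).+1)%N) ->
  `|f (gpt n k) - f (gpt n k')| <= e n.
Hypothesis cf : forall p, box a b ax bx p -> (fun n => f (gpt n (flk n p))) @ \oo --> f p.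

(** Telescoping along the dyadic approximations of [p]. Consecutive ones are neighbours in the finer
    grid because level [n] sits inside level [n.+1]; the errors decay geometrically, and [cf]
    identifies the limit. *)
Lemma chain_pt p n : box a b ax bx p -> (n0 <= n)%N ->
  `|f p - f (gpt n (flk n p))| <= e n / (1 - rho).
Proof.
move=> bp n0n.
have /andP[r0 r1'] := rho01; have r1 : 0 < 1 - rho by rewrite subr_gt0.
have step m : `|f (gpt (n + m) (flk (n + m) p)) - f (gpt n (flk n p))| <= e n / (1 - rho) - rho ^+ m * e n / (1 - rho)
   /\ e (n + m)%N <= rho ^+ m * e n.
  elim: m => [|m [IH1 IH2]].
    by rewrite addn0 subrr normr0 expr0 mul1r subrr.
  have nm : (n0 <= n + m)%N by rewrite (leq_trans n0n)// leq_addr.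
  have e2 : e (n + m).+1 <= rho ^+ m.+1 * e n.
    apply: (le_trans (eS nm)); rewrite exprS -mulrA ler_wpM2l//; lra.
  rewrite addnS; split=> //.
  have -> : f (gpt (n + m).+1 (flk (n + m).+1 p)) - f (gpt n (flk n p)) =
    (f (gpt (n + m).+1 (flk (n + m).+1 p)) - f (gpt (n + m) (flk (n + m) p))) +
    (f (gpt (n + m) (flk (n + m) p)) - f (gpt n (flk n p))) by ring.
  apply: (le_trans (ler_normD _ _)).
  have h : `|f (gpt (n + m).+1 (flk (n + m).+1 p)) - f (gpt (n + m) (flk (n + m) p))| <= e (n + m).+1.
    rewrite (gpt_double (n + m)); apply: good.
    - exact: leq_trans nm (leqnSn _).
    - by move=> i; exact: flk_le.
    - by move=> i; rewrite expnS mul2n leq_double; exact: flk_le.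
    - by move=> i; have [h1 h2] := flk_next (n + m) i bp.
  have E : rho ^+ m * e n / (1 - rho) - rho ^+ m.+1 * e n / (1 - rho) = rho ^+ m * e n.
    rewrite exprS; field; lra.
  have : rho ^+ m.+1 * e n <= rho ^+ m * e n.
    rewrite exprS -mulrA -[leRHS]mul1r ler_wpM2r ?mulr_ge0 ?exprn_ge0//; lra.
  lra.
have h : (fun m => `|f (gpt (m + n) (flk (m + n) p)) - f (gpt n (flk n p))|) @ \oo --> `|f p - f (gpt n (flk n p))|.
  apply: cvg_norm; apply: cvgB; last exact: cvg_cst.
  by rewrite (cvg_shiftn n (fun m => f (gpt m (flk m p)))); exact: cf.
rewrite -(cvg_lim _ h)//; apply: limr_le; first by apply: cvgP h.
near=> m; rewrite addnC; apply: le_trans (step m).1 _.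
rewrite lerBlDr lerDl divr_ge0 ?mulr_ge0 ?exprn_ge0//; lra.
Unshelve. all: end_near. Qed.

Lemma chain_modulus p q n : box a b ax bx p -> box a b ax bx q -> (n0 <= n)%N ->
  colip * pdist p q <= 2^-1 ^+ n -> `|f p - f q| <= e n * (1 + 2 / (1 - rho)).
Proof.
move=> bp bq n0n pq.
have hp := chain_pt bp n0n; have hq := chain_pt bq n0n.
have hc i : `|coords p i - coords q i| <= 2^-1 ^+ n by exact: le_trans (coords_lip _ _ _) pq.
have h : `|f (gpt n (flk n p)) - f (gpt n (flk n q))| <= e n.
  apply: good => // i; [exact: flk_le|exact: flk_le|].
  by split; apply: flk_close => //; rewrite distrC.
have -> : f p - f q = (f p - f (gpt n (flk n p))) + (f (gpt n (flk n p)) - f (gpt n (flk n q)))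
  + (f (gpt n (flk n q)) - f q) by ring.
apply: (le_trans (ler_normD _ _)); rewrite [X in _ + X]distrC.
apply: (@le_trans _ _ (e n / (1 - rho) + e n + e n / (1 - rho))); last by lra.
by apply: lerD => //; apply: (le_trans (ler_normD _ _)); exact: lerD.
Qed.

End chain.

Lemma cvg_pdist (y : nat -> R * 'rV[R]_N) p :
  (forall e, 0 < e -> \forall n \near \oo, pdist (y n) p < e) -> y @ \oo --> p.
Proof.
move=> h; apply/cvg_ballP => e e0; near=> n.
have hn : pdist (y n) p < e by near: n; exact: h.
have e2 : 0 <= enorm ((y n).2 - p.2) by exact: sqrtr_ge0.
split.
  rewrite /ball/= /ball_/= distrC; apply: le_lt_trans hn; by rewrite /pdist lerDl.
split=> // i j; rewrite (ord1 i) /ball/= /ball_/= distrC.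
apply: le_lt_trans hn; rewrite /pdist; apply: (@le_trans _ _ (enorm ((y n).2 - p.2))); last by rewrite lerDr.
by have := enormf_coord (fun i => ((y n).2 - p.2) 0 i) j; rewrite !mxE.
Unshelve. all: end_near. Qed.

Hypothesis a0 : 0 < a.

Lemma box_pos p : box a b ax bx p -> 0 <= p.1.
Proof. by move=> [/andP[h _] _]; apply: le_trans h; exact: ltW. Qed.

Lemma cvg_flk p : box a b ax bx p -> (fun n => gpt n (flk n p)) @ \oo --> p.
Proof.
move=> bp; apply: cvg_pdist => e e0.
have h : (fun n => Lip * 2^-1 ^+ n) @ \oo --> (0 : R).
  rewrite -[X in _ --> X](mulr0 Lip); apply: cvgMr; apply: cvg_expr.
  by rewrite ger0_norm ?invf_lt1// ltr1n.
near=> n; apply: (le_lt_trans (flk_dist n bp)).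
by near: n; apply: cvgr_lt h _ e0.
Unshelve. all: end_near. Qed.

Lemma cvg_within_flk (f : R * 'rV[R]_N -> R) p :
  {within [set p : R * 'rV[R]_N | 0 <= p.1], continuous f} -> box a b ax bx p ->
  (fun n => f (gpt n (flk n p))) @ \oo --> f p.
Proof.
move=> /subspace_continuousP cf bp; have h := cf p (box_pos bp).
have hw : (fun n => gpt n (flk n p)) @ \oo --> within [set p : R * 'rV[R]_N | 0 <= p.1] (nbhs p).
  move=> U hU.
  have H : \forall n \near \oo, (0 <= (gpt n (flk n p)).1 -> U (gpt n (flk n p))) by exact: (cvg_flk bp hU).
  suff : \forall n \near \oo, U (gpt n (flk n p)) by [].
  by apply: filterS H => n; apply; exact: box_pos (gpt_box _ _).
exact: cvg_comp hw h.
Qed.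

End box_param.

Section union_bound.
Context d0 (Om : measurableType d0) (R : realType) (P : probability Om R).

Lemma union_bound (T : finType) (S : set T) (A : T -> set Om) (x : R) :
  (forall i, measurable (A i)) -> (forall i, S i -> (P (A i) <= x%:E)%E) -> 0 <= x ->
  (P (\bigcup_(i in S) A i) <= (#|T|%:R * x)%:E)%E.
Proof.
move=> mA PA x0; pose B (s : seq T) := [set w | exists2 i, i \in s & S i /\ A i w].
have mS i : measurable [set w | S i /\ A i w].
  have [Si|nSi] := pselect (S i).
    by rewrite [X in measurable X](_ : _ = A i)//; apply/seteqP; split => w //= [].
  by rewrite [X in measurable X](_ : _ = set0)//; apply/seteqP; split => w //= [].
have BE i s : B (i :: s) = [set w | S i /\ A i w] `|` B s.
  apply/seteqP; split => w /=.
    by move=> [j]; rewrite inE => /orP[/eqP ->|js] h; [left|right; exists j].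
  by move=> [h|[j js h]]; [exists i => //; rewrite mem_head|exists j => //; rewrite inE js orbT].
have B0 : B [::] = set0 by apply/seteqP; split => w // [].
have mB s : measurable (B s) by elim: s => [|i s IH]; rewrite ?B0// BE; exact: measurableU.
have PB s : (P (B s) <= ((size s)%:R * x)%:E)%E.
  elim: s => [|i s IH]; first by rewrite B0 measure0 mul0r.
  rewrite BE (le_trans (measureU2 _ _ _))//= -natr1 mulrDl mul1r addrC EFinD; apply: leeD => //.
  have [Si|nSi] := pselect (S i).
    apply: le_trans (PA _ Si); apply: le_measure; rewrite ?inE// => w [].
    by [].
  by rewrite [X in P X](_ : _ = set0) ?measure0//; apply/seteqP; split => w //= [].
rewrite cardE; apply: le_trans (PB _); apply: le_measure; rewrite ?inE//.
  by apply: fin_bigcup_measurable => //; exact: finite_finset.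
by move=> w [i Si Ai]; exists i => //; rewrite mem_enum.
Qed.

End union_bound.

(** * The upper bound for the modulus by chaining *)

Section upper_bound.
Context d0 (Om : measurableType d0) (R : realType) (P : probability Om R).
Local Notation Ex := (@Ex _ _ R P).
Variables (N : nat) (a b : R) (ax bx : 'rV[R]_N).
Hypothesis a0 : 0 < a.
Hypothesis ab : a < b.
Hypothesis abx : forall i, ax 0 i < bx 0 i.
Local Notation D := [set p : R * 'rV[R]_N | 0 <= p.1].
Variables (v : R * 'rV[R]_N -> Om -> R) (K : R * 'rV[R]_N -> R * 'rV[R]_N -> \bar R) (k : R * 'rV[R]_N -> R * 'rV[R]_N -> R).
Hypothesis gv : centered_gaussian_field P D v K.
Hypothesis Kk : forall p q, D p -> D q -> K p q = (k p q)%:E.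
Hypothesis ksym : forall p q, k p q = k q p.
Hypothesis cv : forall w, {within D, continuous (fun p => v p w)}.
Variables (al C0 : R).
Hypothesis al01 : 0 < al < 1.
Hypothesis C00 : 0 < C0.
Hypothesis kinc : forall p q, box a b ax bx p -> box a b ax bx q ->
  incr_var k p q <= C0 * (pdist p q `^ al) ^+ 2.

Let r : R := 2^-1 `^ al.
Let Lp := Lip a b ax bx.
Let V0 := C0 * (Lp `^ al) ^+ 2.
(** At level [n] there are at most [4^(N+1) * 2^(2 (N+1) n)] pairs of grid points. With this [c0]
    and the [M] below, one pair fails with probability at most [2 expR (- 2 c0 n)], which beats the
    count by a further factor [2^-n] and is summable. *)
Let c0 : R := (2 * N.+1)%:R + 1.
Let M : R := Num.sqrt (4 * V0 * c0).

Let r01 : 0 < r < 1.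
Proof.
rewrite powR_gt0//= /r -[ltRHS](_ : 1 `^ al = 1); last by rewrite powR1.
case/andP: al01 => al0 _.
by apply: gt0_ltr_powR; rewrite ?nnegrE ?invf_lt1 ?ltr1n// invr_ge0.
Qed.

Let V00 : 0 < V0.
Proof. by rewrite mulr_gt0// exprn_gt0// powR_gt0// Lip_gt0. Qed.

Let c00 : 0 < c0. Proof. by rewrite /c0 ltr_wpDl. Qed.

Let M2 : M ^+ 2 = 4 * V0 * c0.
Proof. by rewrite sqr_sqrtr// mulr_ge0 ?(ltW c00)// mulr_ge0 ?(ltW V00). Qed.

Let e (n : nat) : R := M * r ^+ n * Num.sqrt n%:R.

Let F (n : nat) : set Om := \bigcup_(kk in [set kk : {ffun 'I_N.+1 -> 'I_(2 ^ n).+1} * {ffun 'I_N.+1 -> 'I_(2 ^ n).+1} |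
    forall i, (kk.1 i <= (kk.2 i).+1)%N /\ (kk.2 i <= (kk.1 i).+1)%N])
  [set w | e n < `|v (gpt a b ax bx n (fun i => kk.1 i)) w - v (gpt a b ax bx n (fun i => kk.2 i)) w|].

Let pow2r (n : nat) : (2^-1 ^+ n) `^ al = r ^+ n.
Proof. by rewrite /r -(@powR_mulrn _ (2^-1) n) ?invr_ge0// powRAC powR_mulrn ?powR_ge0. Qed.

Let gD n kk : D (gpt a b ax bx n kk).
Proof. exact: (box_pos a0 (gpt_box ab abx n kk)). Qed.

Let tail n kk kk' : (forall i, (kk i <= (kk' i).+1)%N /\ (kk' i <= (kk i).+1)%N) ->
  fine (P [set w | e n < `|v (gpt a b ax bx n kk) w - v (gpt a b ax bx n kk') w|]) <=
  2 * expR (- (2 * c0 * n%:R)).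
Proof.
move=> h; have h1 := gpt_dist ab abx n h.
set p := gpt _ _ _ _ _ _ in h1 *; set q := gpt _ _ _ _ _ _ in h1 *.
have /andP[r0 r1] := r01; have L0 := Lip_gt0 ab abx.
have pq0 : 0 <= pdist p q by rewrite addr_ge0 ?sqrtr_ge0.
have vV : incr_var k p q <= V0 * (r ^+ n) ^+ 2.
  apply: (le_trans (kinc (gpt_box ab abx _ _) (gpt_box ab abx _ _))).
  rewrite /V0 -mulrA ler_wpM2l ?(ltW C00)// -exprMn -pow2r -powRM ?exprn_ge0 ?(ltW L0)//.
  rewrite lerXn2r ?nnegrE ?powR_ge0//; apply: ge0_ler_powR; rewrite ?nnegrE//; first by case/andP: al01 => /ltW.
  by rewrite mulr_ge0 ?exprn_ge0// ltW.
have e0 : 0 <= e n by rewrite !mulr_ge0 ?sqrtr_ge0// exprn_ge0// ltW.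
have VV : 0 < V0 * (r ^+ n) ^+ 2 by rewrite mulr_gt0// !exprn_gt0.
apply: (le_trans (incr_tail gv Kk ksym (gD _ _) (gD _ _) e0 vV VV)).
rewrite ler_wpM2l// ler_expR lerN2 /e !exprMn M2 sqr_sqrtr//.
have [y0 v0] : (r ^+ n) ^+ 2 != 0 /\ V0 != 0 by rewrite !gt_eqF// !exprn_gt0.
have aux (y z c m : R) : y != 0 -> z != 0 -> 2 * c * m <= 4 * z * c * y * m / (2 * (z * y)).
  by move=> ? ?; rewrite le_eqVlt; apply/orP; left; apply/eqP; field; apply/andP.
exact: aux.
Qed.

Let mF n : measurable (F n).
Proof.
apply: fin_bigcup_measurable; first exact: finite_finset.
move=> kk _; have mX : measurable_fun [set: Om] (fun w => `|v (gpt a b ax bx n (fun i => kk.1 i)) w - v (gpt a b ax bx n (fun i => kk.2 i)) w|).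
  have m1 := gv.1 _ (gD n (fun i => kk.1 i)); have m2 := gv.1 _ (gD n (fun i => kk.2 i)).
  by apply: measurableT_comp => //; mfun.
have := mX measurableT `]e n, +oo[%classic (measurable_itv _).
by rewrite setTI; congr measurable; apply/seteqP; split => w; rewrite /= in_itv/= andbT.
Qed.

Let eN1 : expR (-1 : R) <= 2^-1.
Proof.
rewrite expRN lef_pV2 ?posrE ?expR_gt0//.
by have := @expR_ge1Dx R 1; lra.
Qed.

Let PF n : (P (F n) <= (2 * 4 ^+ N.+1 * 2^-1 ^+ n)%:E)%E.
Proof.
apply: (@le_trans _ _ ((#|{: {ffun 'I_N.+1 -> 'I_(2 ^ n).+1} * {ffun 'I_N.+1 -> 'I_(2 ^ n).+1}}|%:R * (2 * expR (- (2 * c0 * n%:R))))%:E)).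
  apply: union_bound; last by rewrite mulr_ge0// expR_ge0.
    move=> kk.
    have mX : measurable_fun [set: Om] (fun w => `|v (gpt a b ax bx n (fun i => kk.1 i)) w - v (gpt a b ax bx n (fun i => kk.2 i)) w|).
      have m1 := gv.1 _ (gD n (fun i => kk.1 i)); have m2 := gv.1 _ (gD n (fun i => kk.2 i)).
      by apply: measurableT_comp => //; mfun.
    have := mX measurableT `]e n, +oo[%classic (measurable_itv _).
    by rewrite setTI; congr measurable; apply/seteqP; split => w; rewrite /= in_itv/= andbT.
  move=> kk h; have := tail n h; rewrite -lee_fin fineK// fin_num_measure//.
  have mX : measurable_fun [set: Om] (fun w => `|v (gpt a b ax bx n (fun i => kk.1 i)) w - v (gpt a b ax bx n (fun i => kk.2 i)) w|).
    have m1 := gv.1 _ (gD n (fun i => kk.1 i)); have m2 := gv.1 _ (gD n (fun i => kk.2 i)).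
    by apply: measurableT_comp => //; mfun.
  have := mX measurableT `]e n, +oo[%classic (measurable_itv _).
  by rewrite setTI; congr measurable; apply/seteqP; split => w; rewrite /= in_itv/= andbT.
rewrite lee_fin card_prod !card_ffun !card_ord.
have h1 : ((2 ^ n).+1 <= 2 ^ n.+1)%N by rewrite expnS mul2n -addnn -addn1 leq_add2l expn_gt0.
have h2 : ((2 ^ n).+1 ^ N.+1 * (2 ^ n).+1 ^ N.+1)%:R <= (4 ^+ N.+1) * (2 ^+ n) ^+ (2 * N.+1) :> R.
  apply: (@le_trans _ _ ((2 ^ n.+1) ^ (2 * N.+1))%:R).
    by rewrite ler_nat -expnD addnn -mul2n leq_exp2r.
  rewrite !natrX exprS exprMn [in 2 ^+ (2 * _)]exprM.
  by rewrite (_ : 2 ^+ 2 = 4)//; ring.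
have h3 : expR (- (2 * c0 * n%:R)) <= (2^-1 ^+ n) ^+ (2 * N.+1).+1.
  rewrite -exprM mulnC exprM.
  have -> : - (2 * c0 * n%:R) = n%:R * ((2 * N.+1).+1%:R * (- 2)).
    by rewrite /c0 -natr1; ring.
  rewrite !expRM_natl -!exprM; apply: lerXn2r; rewrite ?nnegrE ?expR_ge0 ?invr_ge0//.
  by apply: le_trans eN1; rewrite ler_expR; lra.
apply: (le_trans (ler_pM _ _ h2 (ler_wpM2l _ h3))); rewrite ?mulr_ge0 ?expR_ge0//.
set K' := (2 * N.+1)%N.
have E : (2 ^+ n) ^+ K' * (2^-1 ^+ n) ^+ K'.+1 = 2^-1 ^+ n :> R.
  by rewrite exprSr mulrA -exprMn exprVn mulfV ?expf_neq0// expr1n mul1r.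
rewrite -[in leRHS]E le_eqVlt; apply/orP; left; apply/eqP; ring.
Qed.

(** The Borel-Cantelli lemma, with the partial sums of the geometric bound [PF] written in closed
    form. *)
Let EF : {ae P, forall w, exists n0, forall n, (n0 <= n)%N -> ~ F n w}.
Proof.
have A0 : 0 <= 2 * 4 ^+ N.+1 :> R by rewrite mulr_ge0// exprn_ge0.
have H : P (lim_sup_set F) = 0.
  apply: lim_sup_set_cvg0 => //; apply: (@le_lt_trans _ _ (2 * (2 * 4 ^+ N.+1) : R)%:E); last exact: ltry.
  apply: lime_le; first by apply: is_cvg_nneseries => n _ _; exact: measure_ge0.
  apply: nearW => n; apply: (@le_trans _ _ (2 * (2 * 4 ^+ N.+1) * (1 - 2^-1 ^+ n) : R)%:E).
    elim: n => [|n IH]; first by rewrite big_nil expr0 subrr mulr0.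
    rewrite big_nat_recr//=; apply: (le_trans (leeD IH (PF n))).
    by rewrite -EFinD lee_fin le_eqVlt (exprS 2^-1 n); apply/orP; left; apply/eqP; field.
  rewrite lee_fin -[leRHS]mulr1 ler_wpM2l//.
exists (lim_sup_set F); split => //.
  by apply: bigcap_measurable => // n _; apply: bigcup_measurable.
move=> w /= h n _; apply: contrapT => h2; apply: h; exists n => m nm Fm; apply: h2.
by exists m.
Qed.

(** The ratio of consecutive terms is [r * sqrt (1 + 1 / n)], which falls below any number above [r]
    for large [n]; [rho] is taken midway between [r] and 1. *)
Let eS : exists rho n0, [/\ 0 <= rho < 1, forall n, 0 <= e n & forall n, (n0 <= n)%N -> e n.+1 <= rho * e n].
Proof.
have /andP[r0 r1] := r01.
have e0 n : 0 <= e n by rewrite !mulr_ge0 ?sqrtr_ge0// exprn_ge0// ltW.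
pose rho := (r + 1) / 2.
have rr : 1 < rho / r by rewrite ltr_pdivlMr// mul1r /rho; lra.
pose x := (rho / r) ^+ 2 - 1.
have x0 : 0 < x by rewrite subr_gt0 exprn_egt1.
exists rho, (Num.truncn x^-1).+1; split => //; first by rewrite /rho; apply/andP; split; lra.
move=> n hn; rewrite /e exprS.
have hx : x^-1 < n%:R by apply: lt_le_trans (truncnS_gt _) _; rewrite ler_nat.
have h : Num.sqrt n.+1%:R <= rho / r * Num.sqrt n%:R.
  have rho0 : 0 <= rho by rewrite /rho; lra.
  have t0 : 0 <= rho / r * Num.sqrt n%:R.
    by apply: mulr_ge0 (sqrtr_ge0 _); apply: divr_ge0 => //; exact: ltW.
  rewrite -(ger0_norm t0).
  rewrite -sqrtr_sqr ler_wsqrtr// exprMn sqr_sqrtr//.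
  have : 1 < n%:R * x by rewrite -ltr_pdivrMr// mul1r.
  by rewrite -natr1 /x; lra.
have Mr : 0 <= M * r ^+ n.+1 by rewrite mulr_ge0 ?sqrtr_ge0// exprn_ge0// ltW.
have := ler_wpM2l Mr h.
rewrite exprS => H1; apply: (le_trans H1).
have aux (r' y s : R) : r' != 0 -> M * (r' * y) * (rho / r' * s) = rho * (M * y * s) by move=> ?; field.
by rewrite aux// gt_eqF.
Qed.

Lemma dyadic_scale (x : R) (n0 : nat) : 0 < x -> x <= 2^-1 ^+ n0 ->
  exists n, [/\ (n0 <= n)%N, x <= 2^-1 ^+ n & 2^-1 ^+ n.+1 < x].
Proof.
move=> x0 xn0.
have h : (fun n => 2^-1 ^+ n) @ \oo --> (0 : R).
  by apply: cvg_expr; rewrite ger0_norm ?invf_lt1// ltr1n.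
have ex : exists n, 2^-1 ^+ n.+1 < x.
  have [n _ hn] := cvgr_lt _ h _ x0; exists n; exact: (hn n.+1 (leqnSn _)).
have mono m m' : (m <= m')%N -> 2^-1 ^+ m' <= 2^-1 ^+ m :> R.
  by move=> mm; rewrite ler_wiXn2l// invf_le1 ?ler1n.
have [n hn hmin] := ex_minnP ex.
exists n; split => //.
  by rewrite leqNgt; apply/negP => /mono; rewrite leNgt => /negP; apply; exact: lt_le_trans hn _.
case: n hn hmin => [|n] hn hmin; first by apply: le_trans xn0 (mono _ _ _).
by rewrite leNgt; apply/negP => /hmin; rewrite ltnn.
Qed.

Lemma ln2_ge : 2^-1 <= ln 2 :> R.
Proof.
rewrite -[leLHS]expRK ler_ln ?posrE ?expR_gt0//.
have := @expR_ge1Dx R (- 2^-1); rewrite expRN => h.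
rewrite -lef_pV2 ?posrE ?expR_gt0//; lra.
Qed.

Lemma modulus_upper : exists c, {ae P, forall w, exists n, forall p q, box a b ax bx p -> box a b ax bx q ->
  pdist p q < 2^-1 ^+ n -> `|v p w - v q w| <= c * (pdist p q `^ al * Num.sqrt (ln (1 + (pdist p q)^-1)))}.
Proof.
have [rho [n0 [rho01 e0 eS']]] := eS.
have /andP[r0 r1] := r01; have /andP[al0 _] := al01.
pose B := 1 + 2 / (1 - rho); pose c := colip a b ax bx.
have c1 : 1 <= c := colip_ge1 ab abx.
have B0 : 0 <= B by rewrite addr_ge0// divr_ge0//; case/andP: rho01 => _ ?; lra.
exists (M * B * (2 * c) `^ al * Num.sqrt 2).
apply: filterS EF => w [n1 hF].
have good n kk kk' : (maxn n0 n1 <= n)%N -> (forall i, (kk i <= 2 ^ n)%N) -> (forall i, (kk' i <= 2 ^ n)%N) ->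
  (forall i, (kk i <= (kk' i).+1)%N /\ (kk' i <= (kk i).+1)%N) ->
  `|v (gpt a b ax bx n kk) w - v (gpt a b ax bx n kk') w| <= e n.
  rewrite geq_max => /andP[_ nn1] k1 k2 kk12; rewrite leNgt; apply/negP => h.
  apply: (hF n nn1); exists ([ffun i => inord (kk i)], [ffun i => inord (kk' i)]) => /=.
    by move=> i; rewrite !ffunE !inordK// ltnS.
  rewrite (_ : (fun i => _) = kk); last by apply/funext => i; rewrite ffunE inordK// ltnS.
  by rewrite [in X in _ - X](_ : (fun i => _) = kk')//; apply/funext => i; rewrite ffunE inordK// ltnS.
have cf p : box a b ax bx p -> (fun n => v (gpt a b ax bx n (flk a b ax bx n p)) w) @ \oo --> v p w.
  by move=> bp; exact: (cvg_within_flk ab abx a0 (f := v^~ w)).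
have eSm n : (maxn n0 n1 <= n)%N -> e n.+1 <= rho * e n.
  by rewrite geq_max => /andP[h _]; exact: eS'.
have CM p q n := @chain_modulus R N a b ax bx ab abx (v^~ w) e rho (maxn n0 n1) rho01 e0 eSm good cf p q n.
set n2 := maxn n0 n1 in CM *.
have [m hm] : exists m, c * 2^-1 ^+ m <= 2^-1 ^+ n2.
  have [m [_ _ h]] : exists n, [/\ (0 <= n)%N, 2^-1 ^+ n2 / c <= 2^-1 ^+ n & 2^-1 ^+ n.+1 < 2^-1 ^+ n2 / c].
    apply: dyadic_scale; first by rewrite divr_gt0 ?exprn_gt0//; exact: lt_le_trans c1.
    rewrite expr0 ler_pdivrMr; last exact: lt_le_trans c1.
    by rewrite mul1r (le_trans _ c1)// exprn_ile1// invf_le1 ?ler1n.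
  exists m.+1; rewrite mulrC -ler_pdivlMr ?ltW//; exact: lt_le_trans c1.
exists m => p q bp bq pqm.
have d0' : 0 <= pdist p q by rewrite addr_ge0 ?sqrtr_ge0.
move: d0'; rewrite le_eqVlt => /orP[/eqP d0'|dp].
  have [h1 h2] : p.1 = q.1 /\ p.2 = q.2.
    have e2 : 0 <= enorm (p.2 - q.2) by exact: sqrtr_ge0.
    have n1' := normr_ge0 (p.1 - q.1).
    have z1 : `|p.1 - q.1| = 0 by move: d0'; rewrite /pdist; lra.
    have z2 : enorm (p.2 - q.2) = 0 by move: d0'; rewrite /pdist; lra.
    split; first by apply/eqP; rewrite -subr_eq0 -normr_eq0 z1.
    apply/rowP => j; apply/eqP; rewrite -subr_eq0 -normr_eq0 -normr_le0 normr_id -z2.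
    by have := enormf_coord (fun i => (p.2 - q.2) 0 i) j; rewrite !mxE.
  have -> : p = q by case: p h1 h2 {bp pqm d0'} => ? ? /= -> ->; case: q {bq}.
  by rewrite subrr normr0 !mulr_ge0 ?sqrtr_ge0 ?powR_ge0.
have cp : 0 < c by exact: lt_le_trans c1.
(* The chain starts at the level matching the distance: then [r ^+ n] is at most
   [(2 c * pdist p q) ^ al], and since [c >= 1], [n * ln 2] is at most the logarithm in the
   gauge. *)
have [n [n2n h1 h2]] : exists n, [/\ (n2 <= n)%N, c * pdist p q <= 2^-1 ^+ n & 2^-1 ^+ n.+1 < c * pdist p q].
  apply: dyadic_scale; first exact: mulr_gt0.
  by apply: le_trans hm; rewrite ler_wpM2l// ltW.
apply: (le_trans (CM p q n bp bq n2n h1)); rewrite -/B /e.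
have k1 : r ^+ n <= (2 * c) `^ al * pdist p q `^ al.
  rewrite -pow2r -powRM ?mulr_ge0 ?(ltW cp) ?(ltW dp)//.
  apply: ge0_ler_powR; rewrite ?nnegrE ?(ltW al0)// ?mulr_ge0 ?(ltW cp) ?(ltW dp) ?exprn_ge0//.
  by move: h2; rewrite exprS; lra.
have k2 : Num.sqrt n%:R <= Num.sqrt 2 * Num.sqrt (ln (1 + (pdist p q)^-1)).
  rewrite -sqrtrM// ler_wsqrtr//.
  have h3 : n%:R * ln 2 <= ln (1 + (pdist p q)^-1).
    rewrite mulr_natl -lnXn// ler_ln ?posrE ?exprn_gt0 ?addr_gt0 ?invr_gt0//.
    apply: (@le_trans _ _ (pdist p q)^-1); last by rewrite lerDr.
    rewrite -[leLHS]invrK lef_pV2 ?posrE ?invr_gt0 ?exprn_gt0// -exprVn (le_trans _ h1)//.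
    by rewrite ler_peMl// ltW.
  have := ler_wpM2l (ler0n R n) ln2_ge; lra.
have M0 : 0 <= M by exact: sqrtr_ge0.
have rn : 0 <= r ^+ n by rewrite exprn_ge0// ltW.
have := ler_pM rn (sqrtr_ge0 _) k1 k2 => k3.
have := ler_wpM2l (mulr_ge0 M0 B0) k3; lra.
Qed.

End upper_bound.

(** * A second moment bound for weakly correlated increments *)

Lemma incr_set_meas d0 (Om : measurableType d0) (R : realType) (m : nat) (X Y : 'I_m -> Om -> R) (x : R) :
  (forall i, measurable_fun [set: Om] (X i)) -> (forall i, measurable_fun [set: Om] (Y i)) ->
  measurable [set w | exists i, x <= X i w - Y i w].
Proof.
move=> mX mY; rewrite (_ : mkset _ = \bigcup_(i in [set: 'I_m]) [set w | x <= X i w - Y i w]).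
  apply: fin_bigcup_measurable; first exact: finite_finset.
  move=> i _; have m1 := mX i; have m2 := mY i.
  have mZ : measurable_fun [set: Om] (fun w => X i w - Y i w) by mfun.
  have := mZ measurableT `[x, +oo[%classic (measurable_itv _).
  by rewrite setTI; congr measurable; apply/seteqP; split => w; rewrite /= in_itv/= andbT.
apply/seteqP; split => w /=; first by move=> [i ?]; exists i.
by move=> [i _ ?]; exists i.
Qed.

Section second_moment.
Context d0 (Om : measurableType d0) (R : realType) (P : probability Om R).
Local Notation Ex := (@Ex _ _ R P).
Variables (T : Type) (D : set T) (v : T -> Om -> R) (K : T -> T -> \bar R) (k : T -> T -> R).
Hypothesis gv : centered_gaussian_field P D v K.
Hypothesis Kk : forall p q, D p -> D q -> K p q = (k p q)%:E.
Hypothesis ksym : forall p q, k p q = k q p.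

Definition icov (p q p' q' : T) : R := k p p' - k p q' - k q p' + k q q'.

Lemma two_incr_mgf p q p' q' (t : R) : D p -> D q -> D p' -> D q' ->
  Int P (fun w => expR (t * (v p w - v q w)) * expR (t * (v p' w - v q' w))) /\
  Ex (fun w => expR (t * (v p w - v q w)) * expR (t * (v p' w - v q' w))) =
    expR (t ^+ 2 * (incr_var k p q + 2 * icov p q p' q' + incr_var k p' q') / 2).
Proof.
move=> Dp Dq Dp' Dq'; pose pts (i : 'I_4) := nth p [:: p; q; p'; q'] i.
pose a (i : 'I_4) : R := nth 0 [:: 1; -1; 1; -1] i.
have Dpts i : D (pts i) by case: i => -[|[|[|[|]]]].
have := comb_mgf gv Kk a Dpts t.
have -> : (fun w => expR (t * \sum_(i < 4) a i * v (pts i) w)) =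
   (fun w => expR (t * (v p w - v q w)) * expR (t * (v p' w - v q' w))).
  apply/funext => w; rewrite !big_ord_recl big_ord0 /a /pts /= -expRD.
  by congr expR; ring.
rewrite !big_ord_recl !big_ord0 /a /pts /= => -[h1 h2]; split => //; rewrite h2; congr expR.
rewrite /incr_var /icov (ksym q p) (ksym q' p') (ksym p' p) (ksym p' q) (ksym q' p) (ksym q' q).
by ring.
Qed.

Variables (m : nat) (p q : 'I_m -> T) (s2 lam n : R).
Hypothesis Dp : forall i, D (p i).
Hypothesis Dq : forall i, D (q i).
Hypothesis s20 : 0 < s2.
Hypothesis vs2 : forall i, incr_var k (p i) (q i) = s2.
Hypothesis decor : forall i j, i != j -> `|icov (p i) (q i) (p j) (q j)| <= s2 / n.
Hypothesis lam4 : 4 <= lam ^+ 2.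
Hypothesis lam0 : 0 < lam.
Hypothesis lamn : lam ^+ 2 <= n / 2.
Hypothesis lamm : expR (lam ^+ 2) <= m%:R.

Let sg := Num.sqrt s2.
Let sg0 : 0 < sg. Proof. by rewrite sqrtr_gt0. Qed.
Let sg2 : sg ^+ 2 = s2. Proof. by rewrite sqr_sqrtr// ltW. Qed.
Let t := lam / sg.
Let mu : R := expR (lam ^+ 2 / 2).
Let mu0 : 0 < mu. Proof. exact: expR_gt0. Qed.
Let m0 : (0 : R) < m%:R. Proof. by apply: lt_le_trans lamm; exact: expR_gt0. Qed.
Let n0 : 0 < n. Proof. by move: lam4 lamn; lra. Qed.

Let Y i w := expR (t * (v (p i) w - v (q i) w)).
Let Nn w := m%:R^-1 * \sum_(i < m) Y i w.

Let t2 : t ^+ 2 * s2 = lam ^+ 2.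
Proof. by rewrite /t expr_div_n sg2 divfK// gt_eqF. Qed.

Let YI i : Int P (Y i) /\ Ex (Y i) = mu.
Proof.
have [h1 h2] := incr_mgf gv Kk ksym t (Dp i) (Dq i).
by split=> //; rewrite h2 vs2 t2.
Qed.

Let e1 : expR (2^-1 : R) <= 2.
Proof.
rewrite -[leLHS]invrK -expRN invf_ple ?posrE ?expR_gt0//.
by have := @expR_ge1Dx R (- 2^-1); lra.
Qed.

(** Off the diagonal the correlation contributes the factor [expR (t^2 * icov)], whose exponent is
    at most [lam^2 / n <= 1/2]. On the diagonal the second moment is [mu ^+ 4]. *)
Let YYI i j : Int P (fun w => Y i w * Y j w) /\
  Ex (fun w => Y i w * Y j w) <= mu ^+ 2 * ((i == j)%:R * mu ^+ 2 + 2).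
Proof.
have [h1 h2] := two_incr_mgf t (Dp i) (Dq i) (Dp j) (Dq j).
split=> //; rewrite h2 !vs2.
have mu2 : mu ^+ 2 = expR (lam ^+ 2) by rewrite /mu -expRM_natl; congr expR; field.
have [->|ij] := eqVneq i j.
  have -> : icov (p j) (q j) (p j) (q j) = s2 by rewrite -(vs2 j) /icov /incr_var (ksym (q j)); ring.
  have -> : t ^+ 2 * (s2 + 2 * s2 + s2) / 2 = lam ^+ 2 + lam ^+ 2 by rewrite -t2; field.
  by rewrite expRD -mu2 mul1r mulrDr lerDl mulr_ge0// sqr_ge0.
rewrite mul0r add0r mu2; have hd := decor ij.
set c := icov _ _ _ _ in hd *.
have -> : t ^+ 2 * (s2 + 2 * c + s2) / 2 = lam ^+ 2 + t ^+ 2 * c by rewrite -t2; field.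
rewrite expRD ler_wpM2l ?expR_ge0//; apply: le_trans e1; rewrite ler_expR.
apply: (@le_trans _ _ (t ^+ 2 * (s2 / n))).
  by rewrite ler_wpM2l ?sqr_ge0//; apply: le_trans hd; exact: ler_norm.
rewrite mulrA t2 ler_pdivrMr//; move: lamn; lra.
Qed.

Let NI : Int P Nn. Proof. by apply: IntZ; apply: IntS => i; case: (YI i). Qed.

Let EN : Ex Nn = mu.
Proof.
rewrite /Ex /Nn RintegralZl//; last by apply: IntS => i; case: (YI i).
have -> : \int[P]_x \sum_(i < m) Y i x = \sum_(i < m) mu.
  rewrite -[LHS]/(Ex _) Ex_sumInt; last by move=> i; case: (YI i).
  by apply: eq_bigr => i _; case: (YI i).
by rewrite sumr_const card_ord -[mu *+ m]mulr_natl mulrA mulVf ?mul1r// gt_eqF.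
Qed.

Let N2E w : Nn w ^+ 2 = m%:R^-2 * \sum_(i < m) \sum_(j < m) Y i w * Y j w.
Proof.
rewrite /Nn exprMn exprVn; congr (_ * _); rewrite expr2 mulr_suml; apply: eq_bigr => i _.
by rewrite mulr_sumr.
Qed.

Let N2I : Int P (fun w => Nn w ^+ 2).
Proof.
rewrite (_ : (fun w => _) = fun w => m%:R^-2 * \sum_(i < m) \sum_(j < m) Y i w * Y j w); last by apply/funext.
by apply: IntZ; apply: IntS => i; apply: IntS => j; case: (YYI i j).
Qed.

Let EN2 : Ex (fun w => Nn w ^+ 2) <= 4 * mu ^+ 2.
Proof.
have -> : Ex (fun w => Nn w ^+ 2) = m%:R^-2 * \sum_(i < m) \sum_(j < m) Ex (fun w => Y i w * Y j w).
  rewrite (eq_Ex _ N2E) /Ex RintegralZl//; last by apply: IntS => i; apply: IntS => j; case: (YYI i j).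
  congr (_ * _); rewrite -[LHS]/(Ex _) Ex_sumInt; last by move=> i; apply: IntS => j; case: (YYI i j).
  by apply: eq_bigr => i _; rewrite Ex_sumInt// => j; case: (YYI i j).
have S : \sum_(i < m) \sum_(j < m) Ex (fun w => Y i w * Y j w) <= mu ^+ 2 * (m%:R * mu ^+ 2 + 2 * m%:R ^+ 2).
  apply: (@le_trans _ _ (\sum_(i < m) (mu ^+ 2 * (mu ^+ 2 + 2 * m%:R)))).
    apply: ler_sum => i _; apply: (@le_trans _ _ (\sum_(j < m) (mu ^+ 2 * ((i == j)%:R * mu ^+ 2 + 2)))).
      by apply: ler_sum => j _; case: (YYI i j).
    rewrite -mulr_sumr big_split/= sumr_const card_ord -[2 *+ m]mulr_natr.
    rewrite (bigD1 i)//= eqxx mul1r big1 ?addr0//.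
    by move=> j ji; rewrite eq_sym (negbTE ji) mul0r.
  rewrite sumr_const card_ord -mulr_natl le_eqVlt; apply/orP; left; apply/eqP; ring.
have mu2 : mu ^+ 2 <= m%:R by rewrite /mu -expRM_natl (_ : 2 * _ = lam ^+ 2)//; field.
have i2 : 0 <= (m%:R^-2 : R) by rewrite invr_ge0 sqr_ge0.
apply: (le_trans (ler_wpM2l i2 S)).
have -> : m%:R^-2 * (mu ^+ 2 * (m%:R * mu ^+ 2 + 2 * m%:R ^+ 2)) = mu ^+ 2 * (mu ^+ 2 / m%:R + 2).
  by field; rewrite gt_eqF.
have : mu ^+ 2 / m%:R <= 1 by rewrite ler_pdivrMr// mul1r.
have := sqr_ge0 mu; nra.
Qed.

Let A : set Om := [set w | exists i, lam / 4 * sg <= v (p i) w - v (q i) w].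

Let mA : measurable A. Proof. by apply: incr_set_meas => i; apply: gv.1. Qed.

(** A Paley-Zygmund argument for the average [Nn] of tilted exponentials. Its mean is [mu], and its
    second moment is at most [4 * mu ^+ 2] because [m >= mu ^+ 2] tames the diagonal terms. *)
Lemma second_moment_max : 16^-1 <= fine (P A).
Proof.
(* On [A] this follows from [(Nn - 8 mu)^2 >= 0]. Off [A] every exponential is at most [expR (lam^2
   / 4) <= expR (lam^2 / 2 - 1) <= mu / 2], by [lam4]. Taking expectations,
   [mu <= mu / 2 + mu / 4 + 4 mu P(A)], which is where [1/16] comes from. *)
have pw w : Nn w <= mu / 2 + (16 * mu)^-1 * Nn w ^+ 2 + 4 * mu * \1_A w.
  have NN : 0 <= (16 * mu)^-1 * Nn w ^+ 2 by apply: mulr_ge0 (sqr_ge0 _); rewrite invr_ge0 mulr_ge0// ltW.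
  rewrite indicE; case: (boolP (w \in A)) => [_|/negP wA].
    rewrite mulr1; have : Nn w <= (16 * mu)^-1 * Nn w ^+ 2 + 4 * mu.
      rewrite -subr_ge0; have -> : (16 * mu)^-1 * Nn w ^+ 2 + 4 * mu - Nn w = (16 * mu)^-1 * (Nn w - 8 * mu) ^+ 2.
        by field; rewrite gt_eqF.
      by apply: mulr_ge0 (sqr_ge0 _); rewrite invr_ge0 mulr_ge0// ltW.
    by have := mu0; lra.
  have : Nn w <= mu / 2.
    rewrite /Nn mulrC ler_pdivrMr//; apply: (@le_trans _ _ (\sum_(i < m) (mu / 2))).
      apply: ler_sum => i _; rewrite leNgt; apply/negP => h; apply: wA; rewrite inE; exists i.
      have : expR (lam ^+ 2 / 2 - 1) < Y i w.
        apply: le_lt_trans h; rewrite expRD ler_wpM2l ?expR_ge0// expRN lef_pV2 ?posrE ?expR_gt0//.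
        by have := @expR_ge1Dx R 1; lra.
      rewrite ltr_expR => h'.
      have : lam ^+ 2 / 4 <= t * (v (p i) w - v (q i) w) by move: lam4; lra.
      have -> : t * (v (p i) w - v (q i) w) = lam * (v (p i) w - v (q i) w) / sg by rewrite /t mulrAC.
      rewrite ler_pdivlMr//.
      have -> : lam ^+ 2 / 4 * sg = lam * (lam / 4 * sg) by ring.
      by rewrite ler_pM2l.
    by rewrite sumr_const card_ord -[(mu / 2) *+ m]mulr_natr.
  by rewrite mulr0 addr0; lra.
have IR : Int P (fun w => mu / 2 + (16 * mu)^-1 * Nn w ^+ 2 + 4 * mu * \1_A w).
  apply: IntD; last by apply: bmeas_int; apply: bmeasZ; exact: bmeas_indic.
  by apply: IntD; [apply: bmeas_int; exact: bmeas_cst|exact: IntZ].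
have := @le_Rintegral _ _ _ P _ _ _ measurableT NI IR (fun w _ => pw w).
rewrite -[X in X <= _ -> _]/(Ex _) EN RintegralD//; last 2 first.
- by apply: IntD; [apply: bmeas_int; exact: bmeas_cst|exact: IntZ].
- by apply: bmeas_int; apply: bmeasZ; exact: bmeas_indic.
rewrite RintegralD//; [|by apply: bmeas_int; exact: bmeas_cst|exact: IntZ].
have -> : \int[P]_w (mu / 2) = mu / 2 by exact: (@Ex_cst _ _ R P).
have -> : \int[P]_w ((16 * mu)^-1 * Nn w ^+ 2) = (16 * mu)^-1 * Ex (fun w => Nn w ^+ 2) by rewrite RintegralZl.
have -> : \int[P]_w (4 * mu * \1_A w) = 4 * mu * fine (P A).
  by rewrite RintegralZl//; [congr (_ * _); exact: Ex_indic|apply: bmeas_int; exact: bmeas_indic].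
have i16 : 0 <= (16 * mu)^-1 by rewrite invr_ge0 mulr_ge0// ltW.
have := ler_wpM2l i16 EN2.
have -> : (16 * mu)^-1 * (4 * mu ^+ 2) = mu / 4 by field; rewrite gt_eqF.
move=> h1 h2; have : mu * 16^-1 <= mu * fine (P A) by lra.
by rewrite ler_pM2l.
Qed.

End second_moment.

(** * The spectral representation *)

Section param_integral.
Context d1 d2 (T1 : measurableType d1) (T2 : measurableType d2) (R : realType).
Variable m : {sigma_finite_measure set T2 -> \bar R}.
Local Open Scope ereal_scope.

(** No integrability is assumed: the positive and negative parts are treated separately by Tonelli's
    theorem. *)
Lemma measurable_param_integral (f : T1 * T2 -> \bar R) : measurable_fun setT f ->
  measurable_fun setT (fun x => \int[m]_y f (x, y)).
Proof.
move=> mf.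
have -> : (fun x => \int[m]_y f (x, y)) =
    (fun x => \int[m]_y f^\+ (x, y)) \- (fun x => \int[m]_y f^\- (x, y)).
  apply/funext => x; rewrite [LHS]integralE.
  under eq_integral do rewrite funepos_comp/=.
  by under [X in _ - X = _]eq_integral do rewrite funeneg_comp/=.
apply: emeasurable_funB; apply: measurable_fun_fubini_tonelli_F => //.
  exact: measurable_funepos.
exact: measurable_funeneg.
Qed.

End param_integral.

Lemma sigma_finite_pack d (T : measurableType d) (R : realType) (m : {measure set T -> \bar R}) :
  sigma_finite setT m -> exists m' : {sigma_finite_measure set T -> \bar R}, (m' : set T -> \bar R) = m.
Proof.
move=> sf.
pose H2 := isSFinite.Build _ _ _ (Measure.sort m) (sfinite_measure_sigma_finite sf).
pose H3 := isSigmaFinite.Build _ _ _ (Measure.sort m) sf.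
pose m' := HB.pack_for (SigmaFiniteMeasure.type T R) (Measure.sort m) H2 H3.
by exists m'.
Qed.

Section tuple_integral.
Context (R : realType).
Local Notation leb := (@lebesgue_measure R).
Local Open Scope ereal_scope.

(** The parameter space is general because the induction moves the first coordinate of the tuple
    into it. *)
Lemma int_Rn_meas n : forall d (T : measurableType d) (f : T -> n.-tuple R -> \bar R),
  measurable_fun [set: T * n.-tuple R] (fun z => f z.1 z.2) ->
  measurable_fun [set: T] (fun x => int_Rn (f x)).
Proof.
elim: n => [|n IH] d T f mf /=.
  apply: (@measurableT_comp _ _ _ _ _ _ (fun z => f z.1 z.2) _ (fun x => (x, [tuple]))) => //.
apply: (@measurable_param_integral _ _ _ _ _ leb (fun z => int_Rn (fun t : n.-tuple R => f z.1 [tuple of z.2 :: t]))).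
apply: (IH _ (T * R)%type (fun z t => f z.1 [tuple of z.2 :: t])).
apply: (@measurableT_comp _ _ _ _ _ _ (fun z => f z.1 z.2) _ (fun z : (T * R) * n.-tuple R => (z.1.1, [tuple of z.1.2 :: z.2]))) => //.
apply: measurable_fun_pair; first exact: measurableT_comp.
by apply: measurable_cons => //; exact: measurableT_comp.
Qed.

Section prod_functional.
Context d (T : measurableType d) (m : {sigma_finite_measure set T -> \bar R}).
Variable I : (T -> \bar R) -> \bar R.
Hypothesis I_ge0 : forall f, measurable_fun setT f -> (forall x, 0 <= f x) -> I f = \int[m]_x f x.
Hypothesis I_int : forall f, m.-integrable setT f -> I f = \int[m]_x f x.
Hypothesis I_meas : forall f : R -> T -> \bar R, measurable_fun setT (fun z => f z.1 z.2) ->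
  measurable_fun setT (fun a => I (f a)).

Lemma iterated_ge0 (f : R -> T -> \bar R) : measurable_fun setT (fun z => f z.1 z.2) ->
  (forall a x, 0 <= f a x) -> \int[leb]_a I (f a) = \int[leb \x m]_z f z.1 z.2.
Proof.
move=> mf f0; rewrite fubini_tonelli1//; apply: eq_integral => a _.
by rewrite I_ge0//; exact: measurableT_comp mf (pair1_measurable a).
Qed.

(** Sections of an integrable function are integrable only for almost every [a], so [I] agrees with
    the integral only there, and its measurability has to be supplied by [I_meas]. *)
Lemma iterated_int (f : R -> T -> \bar R) : (leb \x m).-integrable setT (fun z => f z.1 z.2) ->
  \int[leb]_a I (f a) = \int[leb \x m]_z f z.1 z.2.
Proof.
move=> intf; have mf := measurable_int _ intf.
rewrite -(integral12_prod_meas1 intf); apply: ae_eq_integral => //.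
- exact: I_meas.
- exact: measurable_fubini_F intf.
- have := ae_integrable1 intf; apply: filterS => a ia _.
  by rewrite I_int.
Qed.

End prod_functional.

(** In dimension [n.+1] the measure is the image under consing of the product of Lebesgue measure
    with the previous one. Having a measure makes Fubini's theorem and almost-everywhere comparison
    available for [int_Rn]. *)
Lemma int_Rn_measure n : exists m : {sigma_finite_measure set n.-tuple R -> \bar R},
  (forall f, measurable_fun setT f -> (forall x, 0 <= f x) -> int_Rn f = \int[m]_x f x) /\
  (forall f, m.-integrable setT f -> int_Rn f = \int[m]_x f x).
Proof.
elim: n => [|n [m [m0 mi]]].
  exists (dirac [tuple]); split => f mf.
    by move=> f0; rewrite integral_dirac// diracT mul1e.
  by rewrite integral_dirac ?diracT ?mul1e//; exact: measurable_int mf.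
pose c (z : R * n.-tuple R) : n.+1.-tuple R := [tuple of z.1 :: z.2].
have mc : measurable_fun setT c by apply: measurable_cons; [exact: measurable_fst|exact: measurable_snd].
pose uc (t : n.+1.-tuple R) : R * n.-tuple R := (thead t, [tuple of behead t]).
have muc : measurable_fun setT uc.
  by apply: measurable_fun_pair; [exact: measurable_tnth|exact: measurable_behead].
have ucK z : uc (c z) = z.
  by case: z => x t; rewrite /uc /c theadE; congr pair; exact: val_inj.
pose pm0 : {measure set _ -> \bar R} := pushforward (leb \x m) c.
pose pm := pm0 mc.
have sf : sigma_finite setT pm.
  have /sigma_finiteP[F [TF ndF Foo]] := sigma_finiteT leb.
  have /sigma_finiteP[G [TG ndG Goo]] := sigma_finiteT m.
  exists (fun k => uc @^-1` (F k `*` G k)).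
    apply/seteqP; split => // t _.
    have : [set: R] (thead t) by []. rewrite TF => -[k _ Fk].
    have : [set: n.-tuple R] [tuple of behead t] by []. rewrite TG => -[l _ Gl].
    exists (maxn k l) => //; split => /=.
      by have := ndF _ _ (leq_maxl k l); rewrite subsetEset; apply.
    by have := ndG _ _ (leq_maxr k l); rewrite subsetEset; apply.
  move=> k; have [m1 m2] := Foo k; have [m3 m4] := Goo k; split.
    by rewrite -[X in measurable X]setTI; apply: muc => //; exact: measurableX.
  rewrite /pm /pm0 /= /pushforward -comp_preimage (_ : uc \o c = id) ?preimage_id.
    by rewrite product_measure1E// lte_mul_pinfty// ge0_fin_numE.
  by apply/funext => z; exact: ucK.
have [pm' epm] := sigma_finite_pack sf.
have pmE (f : n.+1.-tuple R -> \bar R) : measurable_fun setT f -> (forall x, 0 <= f x) ->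
   \int[pm']_x f x = \int[leb \x m]_z f (c z).
  by move=> mf f0; rewrite epm ge0_integral_pushforward.
have imeas (f : R -> n.-tuple R -> \bar R) : measurable_fun setT (fun z => f z.1 z.2) ->
    measurable_fun setT (fun a => int_Rn (f a)) by exact: int_Rn_meas.
exists pm'; split => f.
  move=> mf f0; rewrite pmE//= (@iterated_ge0 _ _ m _ m0 (fun a t => f (c (a, t))))//.
  by apply: (@measurableT_comp _ _ _ _ _ _ f _ (fun z => c (z.1, z.2))).
move=> intf; have mf := measurable_int _ intf.
have intfc : (leb \x m).-integrable setT (f \o c).
  move/integrableP : intf => [_ intf]; apply/integrableP; split; first exact: measurableT_comp.
  apply: le_lt_trans intf; rewrite pmE//; exact: measurableT_comp.
rewrite /= (@iterated_int _ _ m _ mi imeas (fun a t => f (c (a, t)))).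
  by rewrite epm integral_pushforward.
exact: intfc.
Qed.

Lemma int_Rn_prod n (g : 'I_n -> R -> R) : (forall i x, (0 <= g i x)%R) ->
  (forall i, measurable_fun setT (g i)) ->
  int_Rn (fun t : n.-tuple R => (\prod_(i < n) g i (tnth t i))%:E) =
  \prod_(i < n) \int[leb]_x (g i x)%:E.
Proof.
elim: n g => [|n IH] g g0 mg; first by rewrite /= !big_ord0.
rewrite /= big_ord_recl -IH//.
have mI : measurable_fun setT (fun t : n.-tuple R => (\prod_(i < n) g (lift ord0 i) (tnth t i))%:E).
  apply/measurable_EFinP; apply: measurable_prod => i _.
  by apply: measurableT_comp => //; exact: measurable_tnth.
have I0 : 0 <= int_Rn (fun t : n.-tuple R => (\prod_(i < n) g (lift ord0 i) (tnth t i))%:E).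
  have [m [m0 _]] := int_Rn_measure n; rewrite m0//; first apply: integral_ge0 => t _.
    by rewrite lee_fin prodr_ge0.
  by move=> t; rewrite lee_fin prodr_ge0.
rewrite muleC -ge0_integralZl//; last first.
- by move=> x _; rewrite lee_fin.
- by apply/measurable_EFinP; exact: mg.
apply: eq_integral => a _; rewrite muleC.
have [m [m0 _]] := int_Rn_measure n; rewrite !m0//.
- rewrite -ge0_integralZl ?lee_fin//.
    apply: eq_integral => t _; rewrite big_ord_recl EFinM; congr (_ * _%:E).
    by apply: eq_bigr => i _; rewrite tnthS.
  by move=> t _; rewrite lee_fin prodr_ge0.
- by move=> t; rewrite lee_fin prodr_ge0.
- apply/measurable_EFinP; apply: measurable_prod => i _.
  apply: measurableT_comp => //.
  apply: (@measurableT_comp _ _ _ _ _ _ (fun t : n.+1.-tuple R => tnth t i)); first exact: measurable_tnth.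
  by apply: measurable_cons => //; exact: measurable_cst.
- by move=> t; rewrite lee_fin prodr_ge0.
Qed.

End tuple_integral.

Lemma sigma_finite_product d1 d2 (T1 : measurableType d1) (T2 : measurableType d2) (R : realType)
    (m1 : {sigma_finite_measure set T1 -> \bar R}) (m2 : {sigma_finite_measure set T2 -> \bar R}) :
  exists M : {sigma_finite_measure set (T1 * T2)%type -> \bar R}, (M : set (T1 * T2)%type -> \bar R) = (m1 \x m2)%E.
Proof.
apply: sigma_finite_pack.
have /sigma_finiteP[F [TF ndF Foo]] := sigma_finiteT m1.
have /sigma_finiteP[G [TG ndG Goo]] := sigma_finiteT m2.
exists (fun n => F n `*` G n).
  apply/seteqP; split => // -[x y] _; have : [set: T1] x by []. rewrite TF => -[k _ Fk].
  have : [set: T2] y by []. rewrite TG => -[l _ Gl].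
  exists (maxn k l) => //; split => /=.
    by have := ndF _ _ (leq_maxl k l); rewrite subsetEset; apply.
  by have := ndG _ _ (leq_maxr k l); rewrite subsetEset; apply.
move=> k; have [? ?] := Foo k; have [? ?] := Goo k.
split; first exact: measurableX.
rewrite [X in (X < _)%E](_ : _ = (m1 (F k) * m2 (G k))%E); last exact: product_measure1E.
by rewrite lte_mul_pinfty// ge0_fin_numE.
Qed.

(** * Integral estimates for the covariance kernel *)

Lemma ge0_integral_lincomb d (T : measurableType d) (R : realType) (m : {measure set T -> \bar R}) (c1 c2 : R) (g1 g2 : T -> R) :
  0 <= c1 -> 0 <= c2 -> measurable_fun setT g1 -> measurable_fun setT g2 -> (forall x, 0 <= g1 x) -> (forall x, 0 <= g2 x) ->
  (\int[m]_x (c1 * g1 x + c2 * g2 x)%:E = c1%:E * \int[m]_x (g1 x)%:E + c2%:E * \int[m]_x (g2 x)%:E)%E.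
Proof.
move=> c10 c20 m1 m2 g10 g20; have m1' := (measurable_EFinP _ _).2 m1; have m2' := (measurable_EFinP _ _).2 m2.
rewrite -ge0_integralZl// -?ge0_integralZl//; try by move=> x _; rewrite lee_fin.
rewrite -ge0_integralD//.
- by move=> x _; rewrite -EFinM lee_fin mulr_ge0.
- exact: measurable_funeM.
- by move=> x _; rewrite -EFinM lee_fin mulr_ge0.
- exact: measurable_funeM.
Qed.

Lemma ge0_integral_add d (T : measurableType d) (R : realType) (m : {measure set T -> \bar R}) (g1 g2 : T -> R) :
  measurable_fun setT g1 -> measurable_fun setT g2 -> (forall x, 0 <= g1 x) -> (forall x, 0 <= g2 x) ->
  (\int[m]_x (g1 x + g2 x)%:E = \int[m]_x (g1 x)%:E + \int[m]_x (g2 x)%:E)%E.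
Proof.
move=> *; have := @ge0_integral_lincomb _ _ _ m 1 1 g1 g2; rewrite !mul1e => <- //.
by apply: eq_integral => x _; rewrite !mul1r.
Qed.

Section one_dim.
Context (R : realType).
Local Notation leb := (@lebesgue_measure R).

(* Products of the profiles [Jp] in the separate coordinates dominate powers of [enorm], which replaces polar
   coordinates by one-dimensional integrals. *)
Definition Jp (a b x : R) : R := if `|x| <= 1 then `|x| `^ (- a) else `|x| `^ (- b).

Lemma Jp_ge0 a b x : 0 <= Jp a b x.
Proof. by rewrite /Jp; case: ifP => _; exact: powR_ge0. Qed.

Lemma Jp_meas a b : measurable_fun [set: R] (Jp a b).
Proof.
apply: measurable_fun_ifT.
- by apply: measurable_fun_ler => //; exact: measurableT_comp.
- by apply: (@measurableT_comp _ _ _ _ _ _ (fun x => x `^ (- a))) => //; exact: measurable_powR.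
- by apply: (@measurableT_comp _ _ _ _ _ _ (fun x => x `^ (- b))) => //; exact: measurable_powR.
Qed.

Lemma two_powR (a : R) : a < 1 -> 2 `^ a < 2.
Proof.
move=> a1; rewrite /powR (_ : (2 == 0 :> R) = false); last by rewrite pnatr_eq0.
rewrite -[ltRHS](@lnK R) ?posrE// ltr_expR.
by have := ln2_ge R; nra.
Qed.

Lemma two_powR_gt (b : R) : 1 < b -> 2 < 2 `^ b.
Proof.
move=> b1; rewrite /powR (_ : (2 == 0 :> R) = false); last by rewrite pnatr_eq0.
rewrite -[ltLHS](@lnK R) ?posrE// ltr_expR.
by have := ln2_ge R; nra.
Qed.

Lemma geom_le (u : R) n : 0 <= u < 1 -> \sum_(0 <= i < n) u ^+ i <= (1 - u)^-1.
Proof.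
move=> /andP[u0 u1]; rewrite big_mkord.
have h := subrX1 u n.
have p : 0 < 1 - u by lra.
rewrite -(ler_pM2l p) divff ?gt_eqF//.
have un : 0 <= u ^+ n by rewrite exprn_ge0.
have E : (1 - u) * \sum_(i < n) u ^+ i = - ((u - 1) * \sum_(i < n) u ^+ i) by ring.
rewrite E -h; lra.
Qed.

Lemma dyadic_above (x : R) : 1 <= x -> exists n, 2 ^+ n <= x < 2 ^+ n.+1.
Proof.
move=> x1; have x0 : 0 < x by lra.
have [n [_ h1 h2]] : exists n, [/\ (0 <= n)%N, x^-1 <= 2^-1 ^+ n & 2^-1 ^+ n.+1 < x^-1].
  by apply: dyadic_scale; rewrite ?invr_gt0// expr0 invf_le1.
exists n; move: h1 h2; rewrite !exprVn lef_pV2 ?ltf_pV2 ?posrE ?exprn_gt0//.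
by move=> -> ->.
Qed.

(** The index [k] is that of the dyadic layer containing [|x|]. Powers are thereby integrated as
    geometric series of interval lengths. *)
Lemma Jp_dyadic a b x : 0 <= a -> 0 <= b -> exists k,
  Jp a b x <= (2 `^ a) ^+ k.+1 * (`|x| <= 2^-1 ^+ k)%R%:R + ((2 `^ b) ^+ k)^-1 * (`|x| <= 2 ^+ k.+1)%R%:R.
Proof.
move=> a0 b0; rewrite /Jp; have p2 (y : R) : 0 < 2 `^ y by rewrite powR_gt0.
have pk (y : R) k : (2 `^ y) ^+ k = (2 ^+ k) `^ y.
  by rewrite -powR_mulrn ?powR_ge0// powRAC powR_mulrn.
have a1 : 1 <= 2 `^ a.
  by rewrite -[leLHS](powRr0 2); apply: ler_powR => //; rewrite ler1n.
have [x1|x1] := leP `|x| 1.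
- have [->|x0] := eqVneq x 0.
    exists 0%N; rewrite normr0 expr0 ler01 ler0n expr1 !mulr1 expr0 invr1.
    (* At the origin [powR] returns 1 for the exponent 0 and 0 otherwise, so the layer [k = 0]
       suffices. *)
    have [->|an0] := eqVneq a 0; first by rewrite oppr0 !powRr0; lra.
    by rewrite powR0 ?oppr_eq0//; lra.
  have x0' : 0 < `|x| by rewrite normr_gt0.
  have [k [_ h1 h2]] : exists k, [/\ (0 <= k)%N, `|x| <= 2^-1 ^+ k & 2^-1 ^+ k.+1 < `|x|] by exact: dyadic_scale.
  exists k; rewrite h1 mulr1 -[leLHS]addr0; apply: lerD; last by rewrite mulr_ge0// invr_ge0 exprn_ge0// ltW.
  rewrite powRN pk -[leRHS]invrK lef_pV2 ?posrE ?invr_gt0 ?powR_gt0 ?exprn_gt0//.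
  have E : (2^-1 ^+ k.+1) `^ a * (2 ^+ k.+1) `^ a = 1.
    by rewrite -powRM ?exprn_ge0// -exprMn mulVf// expr1n powR1.
  have -> : ((2 ^+ k.+1) `^ a)^-1 = (2^-1 ^+ k.+1) `^ a.
    have nz : (2 ^+ k.+1) `^ a != 0 by rewrite gt_eqF// powR_gt0// exprn_gt0.
    by apply: (mulIf nz); rewrite E mulVf.
  by apply: ge0_ler_powR; rewrite ?nnegrE ?exprn_ge0// ltW.
have [k /andP[h1 h2]] := dyadic_above (ltW x1).
exists k; rewrite (ltW h2) mulr1 -[leLHS]add0r; apply: lerD; first by rewrite mulr_ge0// exprn_ge0// ltW.
rewrite powRN pk lef_pV2 ?posrE ?powR_gt0 ?exprn_gt0//; last by lra.
by apply: ge0_ler_powR; rewrite ?nnegrE ?exprn_ge0.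
Qed.

Lemma leb_affine_ball (c rho dl : R) : 0 <= rho -> 0 < dl ->
  (\int[leb]_x ((`|dl * x - c| <= rho)%R%:R)%:E = (2 * rho / dl)%:E)%E.
Proof.
move=> r0 d0.
have E : [set x : R | `|dl * x - c| <= rho] = `[(c - rho) / dl, (c + rho) / dl]%classic.
  apply/seteqP; split => x /=; rewrite in_itv/= ler_pdivrMr// ler_pdivlMr// ler_norml => /andP[? ?]; apply/andP; split; lra.
transitivity (\int[leb]_x (\1_[set x : R | `|dl * x - c| <= rho] x)%:E)%E.
  apply: eq_integral => x _; rewrite indicE; congr (nat_of_bool _)%:R%:E.
  by apply/idP/idP; rewrite inE.
rewrite E integral_indic// setIT [LHS]lebesgue_measure_itv/= lte_fin.
case: ifPn => h; first by rewrite EFinN -EFinB; congr _%:E; field; rewrite gt_eqF.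
have -> : rho = 0; last by rewrite mulr0 mul0r.
move: h; rewrite -leNgt ler_pM2r ?invr_gt0//; lra.
Qed.

(** The contributions of the layers are geometric, with ratio [u = 2^a / 2] near the centre and
    [v = 2 / 2^b] far away, both below 1. Uniformity in the centre [c] is what later allows
    arbitrary shifts in frequency. *)
Lemma Jp_int a b : 0 <= a < 1 -> 1 < b -> exists2 C : R, 0 < C & forall dl c : R, 0 < dl ->
  (\int[leb]_x (Jp a b (dl * x - c))%:E <= (C / dl)%:E)%E.
Proof.
move=> /andP[a0 a1] b1; have b0 : 0 <= b by lra.
pose u := 2 `^ a / 2; pose v := 2 / 2 `^ b.
have ua : 0 < 2 `^ a by rewrite powR_gt0.
have ub : 0 < 2 `^ b by rewrite powR_gt0.
have u01 : 0 <= u < 1 by rewrite /u divr_ge0 ?(ltW ua)//= ltr_pdivrMr// mul1r; exact: two_powR.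
have v01 : 0 <= v < 1 by rewrite /v divr_ge0 ?(ltW ub)//= ltr_pdivrMr// mul1r; exact: two_powR_gt.
pose C := 2 * 2 `^ a * (1 - u)^-1 + 4 * (1 - v)^-1.
have C0 : 0 < C.
  case/andP: u01 => _ ?; case/andP: v01 => _ ?.
  by rewrite addr_gt0// mulr_gt0 ?invr_gt0 ?subr_gt0// mulr_gt0.
exists C => // dl c dl0.
pose f k x : R := (2 `^ a) ^+ k.+1 * (`|dl * x - c| <= 2^-1 ^+ k)%R%:R + ((2 `^ b) ^+ k)^-1 * (`|dl * x - c| <= 2 ^+ k.+1)%R%:R.
have f0 k x : 0 <= f k x by rewrite addr_ge0// mulr_ge0// ?invr_ge0 exprn_ge0// ltW.
have mb (rho : R) : measurable_fun [set: R] (fun x => (`|dl * x - c| <= rho)%R%:R : R).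
  rewrite (_ : (fun _ => _) = fun x => if `|dl * x - c| <= rho then 1 else 0); last by apply/funext => x; case: ifP.
  apply: measurable_fun_ifT => //; apply: measurable_fun_ler => //.
  by apply: measurableT_comp => //; apply: measurable_funB => //; exact: measurable_funM.
have mf k : measurable_fun [set: R] (f k).
  by apply: measurable_funD; apply: measurable_funM.
have fint k : (\int[leb]_x (f k x)%:E = ((2 * 2 `^ a * u ^+ k + 4 * v ^+ k) / dl)%:E)%E.
  rewrite ge0_integral_lincomb ?exprn_ge0 ?invr_ge0 ?(ltW ua) ?(ltW ub) ?exprn_ge0 ?(ltW ub)//.
  rewrite !leb_affine_ball ?exprn_ge0// -!EFinM -EFinD; congr _%:E.
  rewrite /u /v !expr_div_n !exprVn.
  have p2 : (2 : R) ^+ k != 0 by rewrite expf_neq0.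
  have p3 : (2 `^ b) ^+ k != 0 by rewrite expf_neq0// gt_eqF.
  have p4 : dl != 0 by rewrite gt_eqF.
  by rewrite !exprS; field; rewrite p2 p3 p4.
  exact: mb.
  exact: mb.
apply: (@le_trans _ _ (\int[leb]_x (\sum_(k <oo) (f k x)%:E))%E).
  apply: ge0_le_integral => //.
  - by move=> x _; rewrite lee_fin Jp_ge0.
  - apply/measurable_EFinP; apply: measurableT_comp; first exact: Jp_meas.
    by apply: measurable_funB => //; exact: measurable_funM.
  - by apply: ge0_emeasurable_sum => // k; [move=> x _ _; rewrite lee_fin|move=> _; apply/measurable_EFinP; exact: mf].
  - move=> x _; have [k hk] := Jp_dyadic (dl * x - c) a0 b0.
    apply: (@le_trans _ _ (\sum_(0 <= i < k.+1) (f i x)%:E)%E).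
      rewrite big_nat_recr//= -[leLHS]add0e; apply: leeD; last by rewrite lee_fin.
      by apply: sume_ge0 => i _; rewrite lee_fin.
    by apply: nneseries_lim_ge => i _ _; rewrite lee_fin.
rewrite integral_nneseries//; [|by move=> n; apply/measurable_EFinP; exact: mf|by move=> n x _; rewrite lee_fin].
apply: lime_le; first by apply: is_cvg_nneseries => n _ _; apply: integral_ge0 => x _; rewrite lee_fin.
apply: nearW => n; under eq_bigr do rewrite fint.
rewrite sumEFin lee_fin -mulr_suml ler_pM2r ?invr_gt0// big_split/= -!mulr_sumr.
by apply: lerD; rewrite ler_pM2l ?mulr_gt0//; exact: geom_le.
Qed.

(* Bounds the modulus of [int_0^T e^(i s th) ds], i.e. of the divided differences occurring in [Fg], for
   [th != 0]; at [th = 0], where [2 / 0 = 0], it is [0] like those quotients. *)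
Definition Phi (T th : R) : R := Num.min T (2 / `|th|).

Lemma Phi_ge0 T th : 0 <= T -> 0 <= Phi T th.
Proof. by move=> T0; rewrite /Phi le_min T0 divr_ge0. Qed.

Lemma Phi_meas T (c : R) : measurable_fun [set: R] (fun x => Phi T (x + c)).
Proof.
apply: measurable_minr => //; apply: measurable_funM => //.
rewrite (_ : (fun _ => _) = fun x => `|x + c| `^ (-1)); last by apply/funext => x; rewrite powR_inv1.
apply: (@measurableT_comp _ _ _ _ _ _ (fun x => x `^ (-1))) => //.
by apply: measurableT_comp => //; exact: measurable_funD.
Qed.

Lemma Phi_sqr_le T s th : 0 <= T -> 0 <= s < 1 ->
  Phi T th ^+ 2 <= (T + 2) ^+ 2 * Jp 0 2 th /\
  `|th| `^ s * Phi T th ^+ 2 <= (T + 2) ^+ 2 * Jp 0 (2 - s) th.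
Proof.
move=> T0 /andP[s0 s1]; rewrite /Jp oppr0 !powRr0.
have P0 := Phi_ge0 th T0.
have h1 : Phi T th <= T by rewrite /Phi ge_min lexx.
have h2 : Phi T th <= 2 / `|th| by rewrite /Phi ge_min lexx orbT.
have K4 : 4 <= (T + 2) ^+ 2 by rewrite sqrrD; nra.
have [t1|t1] := leP `|th| 1.
  have hP : Phi T th ^+ 2 <= (T + 2) ^+ 2 by rewrite lerXn2r ?nnegrE//; lra.
  rewrite !mulr1; split=> //.
  have : `|th| `^ s <= 1.
    by have <- : 1 `^ s = 1 :> R; [rewrite powR1|apply: ge0_ler_powR; rewrite ?nnegrE].
  by have := sqr_ge0 (Phi T th); have := powR_ge0 `|th| s; nra.
have t0 : 0 < `|th| by lra.
have hP : Phi T th ^+ 2 <= (T + 2) ^+ 2 * `|th| `^ (- 2).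
  apply: (@le_trans _ _ ((2 / `|th|) ^+ 2)); first by rewrite lerXn2r ?nnegrE// divr_ge0.
  rewrite expr_div_n powRN (powR_mulrn 2)// ler_wpM2r ?invr_ge0//.
  by move: K4; rewrite -natrX.
split=> //; have -> : - (2 - s) = s + (- 2) by ring.
rewrite powRD; last by apply/implyP => _; rewrite gt_eqF.
by rewrite [leRHS]mulrCA; apply: ler_wpM2l => //; exact: powR_ge0.
Qed.

(** Since [r <= |tau| + |th|], one of the two is at least [r / 2] and pays for [r ^ s]. If it is
    [tau], this uses up the weight. If it is [th], the decay exponent of [Phi ^+ 2] drops from 2 to
    [2 - s], still above 1, and the singular weight matters only for [|tau| <= 1]. *)
Lemma Phi_weight T s r tau th : 0 <= T -> 0 <= s < 1 -> 0 < r -> r <= `|tau| + `|th| ->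
  r `^ s * (Phi T th ^+ 2 * `|tau| `^ (- s)) <=
  2 * (T + 2) ^+ 2 * (Jp 0 2 th + Jp 0 (2 - s) th + Jp s 2 tau).
Proof.
move=> T0 /[dup] s01 /andP[s0 s1] r0 hr; have [h1 h2] := Phi_sqr_le th T0 s01.
set K := (T + 2) ^+ 2 in h1 h2 *.
have K0 : 0 <= K by exact: sqr_ge0.
have j1 := Jp_ge0 0 2 th; have j2 := Jp_ge0 0 (2 - s) th; have j3 := Jp_ge0 s 2 tau.
have P2 := sqr_ge0 (Phi T th).
have two : 2 `^ s <= 2 by apply: ltW; exact: two_powR.
have sc (y : R) : 0 <= y -> r <= 2 * y -> r `^ s <= 2 * y `^ s.
  move=> y0 ry; apply: (@le_trans _ _ ((2 * y) `^ s)).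
    by apply: ge0_ler_powR; rewrite ?nnegrE ?mulr_ge0// ltW.
  by rewrite powRM// ler_wpM2r// powR_ge0.
have [tt|tt] := leP `|th| `|tau|.
  have t0 : 0 < `|tau| by lra.
  have h3 : r `^ s * `|tau| `^ (- s) <= 2.
    rewrite powRN ler_pdivrMr ?powR_gt0//; apply: sc => //; lra.
  have := ler_wpM2l P2 h3.
  have -> : r `^ s * (Phi T th ^+ 2 * `|tau| `^ (- s)) = Phi T th ^+ 2 * (r `^ s * `|tau| `^ (- s)) by ring.
  have := mulr_ge0 K0 j2; have := mulr_ge0 K0 j3; lra.
have t0 : 0 < `|th| by apply: le_lt_trans tt.
have h3 : r `^ s <= 2 * `|th| `^ s by apply: sc => //; lra.
have g0 := powR_ge0 `|tau| (- s).
have h4 : r `^ s * (Phi T th ^+ 2 * `|tau| `^ (- s)) <= 2 * (`|th| `^ s * Phi T th ^+ 2) * `|tau| `^ (- s).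
  have -> : 2 * (`|th| `^ s * Phi T th ^+ 2) * `|tau| `^ (- s) = 2 * `|th| `^ s * (Phi T th ^+ 2 * `|tau| `^ (- s)) by ring.
  by rewrite ler_wpM2r// mulr_ge0.
apply: (le_trans h4).
have [t1|t1] := leP `|tau| 1.
  have e3 : Jp s 2 tau = `|tau| `^ (- s) by rewrite /Jp t1.
  have h5 : Jp 0 (2 - s) th <= 1.
    rewrite /Jp oppr0 powRr0; case: ifPn => //; rewrite -ltNge => th1.
    rewrite -[leRHS](powRr0 `|th|) ; apply: ler_powR; [exact: ltW|lra].
  have h6 : `|th| `^ s * Phi T th ^+ 2 <= K by apply: (le_trans h2); rewrite -[leRHS]mulr1 ler_wpM2l.
  rewrite -e3 in g0 *.
  have := ler_wpM2r j3 h6; have := mulr_ge0 K0 j1; have := mulr_ge0 K0 j2; lra.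
have h5 : `|tau| `^ (- s) <= 1.
  by rewrite -[leRHS](powRr0 `|tau|); apply: ler_powR; [exact: ltW|lra].
have p0 : 0 <= `|th| `^ s * Phi T th ^+ 2 by rewrite mulr_ge0// powR_ge0.
have := ler_wpM2l p0 h5; have := mulr_ge0 K0 j1; have := mulr_ge0 K0 j3; lra.
Qed.

(** Up to the factor [r ^- 2], the bound for the squared modulus of [Fg]: one term for each of the
    two resonances [tau = - r] and [tau = r] of the wave operator. *)
Definition Psi (T r tau : R) : R := Phi T (tau + r) ^+ 2 + Phi T (tau - r) ^+ 2.

Lemma Psi_ge0 T r tau : 0 <= Psi T r tau.
Proof. by rewrite addr_ge0// sqr_ge0. Qed.

Lemma Psi_meas T r : measurable_fun [set: R] (Psi T r).
Proof. by apply: measurable_funD; apply: measurable_funX; exact: Phi_meas. Qed.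

Lemma absX_meas s : measurable_fun [set: R] (fun x : R => `|x| `^ s).
Proof.
by apply: (@measurableT_comp _ _ _ _ _ _ (fun x => x `^ s)) => //; exact: measurable_powR.
Qed.

(** Because [Psi] is concentrated near [|tau| = r], integrating out the time frequency turns the
    noise weight [|tau| ^ -s] into [r ^ -s]. *)
Lemma tau_int T s : 0 <= T -> 0 <= s < 1 -> exists2 C : R, 0 < C & forall r : R, 0 < r ->
  (\int[leb]_tau (Psi T r tau * `|tau| `^ (- s))%:E <= (C * r `^ (- s))%:E)%E.
Proof.
move=> T0 /[dup] s01 /andP[s0 s1].
have [C1 C10 i1] : exists2 C : R, 0 < C & forall dl c : R, 0 < dl ->
  (\int[leb]_x (Jp 0 2 (dl * x - c))%:E <= (C / dl)%:E)%E by apply: Jp_int; rewrite ?lexx ?ltr01 ?ltr1n.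
have [C2 C20 i2] : exists2 C : R, 0 < C & forall dl c : R, 0 < dl ->
  (\int[leb]_x (Jp 0 (2 - s) (dl * x - c))%:E <= (C / dl)%:E)%E by apply: Jp_int; [rewrite lexx ltr01|lra].
have [C3 C30 i3] : exists2 C : R, 0 < C & forall dl c : R, 0 < dl ->
  (\int[leb]_x (Jp s 2 (dl * x - c))%:E <= (C / dl)%:E)%E by apply: Jp_int; rewrite ?ltr1n.
pose K := 2 * (T + 2) ^+ 2.
have K0 : 0 < K by rewrite mulr_gt0// exprn_gt0//; lra.
have C0 : 0 < C1 + C2 + C3 by lra.
exists (2 * K * (C1 + C2 + C3)); first by rewrite mulr_gt0// mulr_gt0.
move=> r r0.
pose g (c : R) tau := Jp 0 2 (1 * tau - c) + Jp 0 (2 - s) (1 * tau - c) + Jp s 2 (1 * tau - 0).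
have g0 c tau : 0 <= g c tau by rewrite !addr_ge0// Jp_ge0.
have mJ a b c : measurable_fun [set: R] (fun x => Jp a b (1 * x - c)).
  apply: measurableT_comp; first exact: Jp_meas.
  by apply: measurable_funB => //; exact: measurable_funM.
have mg c : measurable_fun [set: R] (g c) by apply: measurable_funD => //; apply: measurable_funD.
have ig c : (\int[leb]_x (g c x)%:E <= (C1 + C2 + C3)%:E)%E.
  have j0 a b c' x : 0 <= Jp a b (1 * x - c') by exact: Jp_ge0.
  rewrite /g ge0_integral_add; [|exact: measurable_funD (mJ _ _ _) (mJ _ _ _)|exact: mJ|by move=> x; exact: addr_ge0|by move=> x].
  rewrite ge0_integral_add; [|exact: mJ|exact: mJ|by move=> x|by move=> x].
  have := i1 1 c ltr01; have := i2 1 c ltr01; have := i3 1 0 ltr01; rewrite !divr1 => h1 h2 h3.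
  by rewrite !EFinD; apply: leeD => //; apply: leeD.
have rs : 0 < r `^ s by rewrite powR_gt0.
apply: (@le_trans _ _ (\int[leb]_x (K * r `^ (- s) * g (- r) x + K * r `^ (- s) * g r x)%:E)%E).
  apply: ge0_le_integral => //.
  - by move=> x _; rewrite lee_fin mulr_ge0 ?Psi_ge0 ?powR_ge0.
  - by apply/measurable_EFinP; apply: measurable_funM; [exact: Psi_meas|exact: absX_meas].
  - by apply/measurable_EFinP; apply: measurable_funD; apply: measurable_funM => //; exact: mg.
  - move=> x _; have aux y z : r `^ s * y <= K * z -> y <= K * r `^ (- s) * z.
      by move=> h; rewrite powRN mulrAC ler_pdivlMr// mulrC.
    rewrite lee_fin /Psi mulrDl; apply: lerD; apply: aux; rewrite /g mul1r ?opprK subr0; apply: Phi_weight => //.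
      by have := ler_normB (x + r) x; rewrite addrAC subrr add0r (gtr0_norm r0); lra.
    by have := ler_normB x (x - r); rewrite opprB addrC subrK (gtr0_norm r0); lra.
have kr : (0 <= K * r `^ (- s)) by apply: mulr_ge0; [exact: ltW|exact: powR_ge0].
rewrite ge0_integral_lincomb; [|exact: kr|exact: kr|exact: mg|exact: mg|exact: g0|exact: g0].
have := lee_wpmul2l _ (ig r) => /(_ (K * r `^ (- s))%:E).
have := lee_wpmul2l _ (ig (- r)) => /(_ (K * r `^ (- s))%:E).
rewrite lee_fin => /(_ kr) h1 /(_ kr) h2.
apply: (le_trans (leeD h1 h2)); rewrite -!EFinM -EFinD lee_fin le_eqVlt; apply/orP; left; apply/eqP; ring.
Qed.

End one_dim.

(** * Pointwise bounds for the transformed wave kernel *)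

Section trig_lip.
Context (R : realType).

Lemma mvt_le (f df : R -> R) (M x y : R) : (forall z : R, is_derive z (1 : R) f (df z)) ->
  (forall z : R, Num.min x y <= z <= Num.max x y -> `|df z| <= M) -> `|f x - f y| <= M * `|x - y|.
Proof.
move=> hd; wlog xy : x y / x <= y.
  move=> H hM; case: (leP x y) => [xy|/ltW yx]; first exact: H.
  by rewrite distrC [X in M * X]distrC; apply: H => // z; rewrite minC maxC; exact: hM.
move: xy; rewrite le_eqVlt => /orP[/eqP ->|xy] hM; first by rewrite !subrr normr0 mulr0.
have cf : {within `[x, y], continuous f}.
  apply: continuous_subspaceT => z; apply: differentiable_continuous.
  by apply/derivable1_diffP; have [] := hd z.
have [c cxy E] := MVT xy (fun z _ => hd z) cf.
rewrite distrC E normrM [X in _ <= _ * X]distrC ler_wpM2r//; apply: hM.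
move: cxy; rewrite in_itv/= => /andP[h1 h2]; rewrite (min_l (ltW xy)) (max_r (ltW xy)) !ltW//.
Qed.

Lemma sin_lip (x y : R) : `|sin x - sin y| <= `|x - y|.
Proof.
rewrite -[leRHS]mul1r; apply: (@mvt_le (@sin R) (@cos R)) => z _.
by rewrite ler_norml cos_geN1 cos_le1.
Qed.

Lemma cos_lip (x y : R) : `|cos x - cos y| <= `|x - y|.
Proof.
rewrite -[leRHS]mul1r; apply: (@mvt_le (@cos R) (fun z => - sin z)) => z _.
by rewrite normrN ler_norml sin_geN1 sin_le1.
Qed.

Lemma sin_dist2 (x y : R) : `|sin x - sin y| <= 2.
Proof. have := sin_le1 x; have := sin_geN1 x; have := sin_le1 y; have := sin_geN1 y; rewrite ler_norml; lra. Qed.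

Lemma cos_dist2 (x y : R) : `|cos x - cos y| <= 2.
Proof. have := cos_le1 x; have := cos_geN1 x; have := cos_le1 y; have := cos_geN1 y; rewrite ler_norml; lra. Qed.

Lemma Phi_quot (T z th : R) : 0 <= T -> `|z| <= 2 -> `|z| <= T * `|th| -> `|z / th| <= Phi T th.
Proof.
move=> T0 z2 zT; rewrite normrM normfV /Phi le_min.
have [->|t0] := eqVneq th 0; first by rewrite normr0 invr0 !mulr0 T0 lexx.
by rewrite ler_pdivrMr ?normr_gt0// zT ler_wpM2r// invr_ge0.
Qed.

(* [gA + i gB] is [Fg] without its phase [e^(- i x . xi)]. *)
Definition gA (t r tau : R) : R := (cos (t * tau) - cos (t * r)) / (2 * r) * ((tau + r)^-1 - (tau - r)^-1).
Definition gB (t r tau : R) : R :=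
  ((sin (t * tau) - sin (t * r)) / (tau - r) - (sin (t * tau) + sin (t * r)) / (tau + r)) / (2 * r).

Definition Sg (T r tau : R) : R := Phi T (tau + r) + Phi T (tau - r).

Lemma Sg_ge0 T r tau : 0 <= T -> 0 <= Sg T r tau.
Proof. by move=> T0; rewrite addr_ge0// Phi_ge0. Qed.

Lemma Sg_sqr T r tau : Sg T r tau ^+ 2 <= 2 * Psi T r tau.
Proof. rewrite /Sg /Psi; have := sqr_ge0 (Phi T (tau + r) - Phi T (tau - r)); rewrite sqrrB sqrrD; lra. Qed.

Section quotients.
Variables (T t r tau : R).
Hypothesis tT : 0 <= t <= T.

Let T0 : 0 <= T. Proof. by case/andP: tT; exact: le_trans. Qed.
Let lipT x y : `|t * x - t * y| <= T * `|x - y|.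
Proof. by case/andP: tT => t0 h; rewrite -mulrBr normrM (ger0_norm t0) ler_wpM2r. Qed.

Lemma quot_sinB : `|(sin (t * tau) - sin (t * r)) / (tau - r)| <= Phi T (tau - r).
Proof. by apply: Phi_quot; [exact: T0|exact: sin_dist2|exact: le_trans (sin_lip _ _) (lipT _ _)]. Qed.

Lemma quot_sinD : `|(sin (t * tau) + sin (t * r)) / (tau + r)| <= Phi T (tau + r).
Proof.
have -> : sin (t * tau) + sin (t * r) = sin (t * tau) - sin (t * - r) by rewrite mulrN sinN opprK.
rewrite -[in X in _ / X](opprK r) -[in X in _ <= X](opprK r).
apply: Phi_quot; [exact: T0|exact: sin_dist2|exact: le_trans (sin_lip _ _) (lipT _ _)].
Qed.

Lemma quot_cosB : `|(cos (t * tau) - cos (t * r)) / (tau - r)| <= Phi T (tau - r).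
Proof. by apply: Phi_quot; [exact: T0|exact: cos_dist2|exact: le_trans (cos_lip _ _) (lipT _ _)]. Qed.

Lemma quot_cosD : `|(cos (t * tau) - cos (t * r)) / (tau + r)| <= Phi T (tau + r).
Proof.
have -> : cos (t * r) = cos (t * - r) by rewrite mulrN cosN.
rewrite -[in X in _ / X](opprK r) -[in X in _ <= X](opprK r).
apply: Phi_quot; [exact: T0|exact: cos_dist2|exact: le_trans (cos_lip _ _) (lipT _ _)].
Qed.

Hypothesis r0 : 0 < r.

Lemma gA_le : `|gA t r tau| <= Sg T r tau / (2 * r).
Proof.
have -> : gA t r tau = ((cos (t * tau) - cos (t * r)) / (tau + r) - (cos (t * tau) - cos (t * r)) / (tau - r)) / (2 * r).
  by rewrite /gA; ring.
rewrite normrM (ger0_norm (_ : 0 <= (2 * r)^-1)) ?invr_ge0 ?mulr_ge0 ?(ltW r0)//.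
rewrite ler_wpM2r ?invr_ge0 ?mulr_ge0 ?(ltW r0)//.
by apply: (le_trans (ler_normB _ _)); apply: lerD; [exact: quot_cosD|exact: quot_cosB].
Qed.

Lemma gB_le : `|gB t r tau| <= Sg T r tau / (2 * r).
Proof.
rewrite normrM (ger0_norm (_ : 0 <= (2 * r)^-1)) ?invr_ge0 ?mulr_ge0 ?(ltW r0)//.
rewrite ler_wpM2r ?invr_ge0 ?mulr_ge0 ?(ltW r0)//.
apply: (le_trans (ler_normB _ _)); rewrite addrC; apply: lerD; [exact: quot_sinD|exact: quot_sinB].
Qed.

End quotients.

Section time_increments.
Variables (T t s r tau : R).
Hypothesis tT : 0 <= t <= T.
Hypothesis sT : 0 <= s <= T.
Hypothesis r0 : 0 < r.
Hypothesis tr1 : tau + r != 0.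
Hypothesis tr2 : tau - r != 0.

Let zT z : Num.min t s <= z <= Num.max t s -> 0 <= z <= T.
Proof.
case/andP: tT => t0 t1; case/andP: sT => s0 s1 /andP[h1 h2]; apply/andP; split.
  by apply: le_trans h1; rewrite le_min t0 s0.
by apply: (le_trans h2); rewrite ge_max t1 s1.
Qed.

Let rn : r != 0. Proof. by rewrite gt_eqF. Qed.

(** Differentiating in time brings down [tau] and [r], and the partial fractions recombine without
    the prefactor [1 / (2 r)]: the derivative is half a sum of two quotients bounded by [Phi]. The
    same happens for [gB]. *)
Lemma gA_lip : `|gA t r tau - gA s r tau| <= Sg T r tau / 2 * `|t - s|.
Proof.
apply: (@mvt_le (fun z => gA z r tau) (fun z => ((sin (z * tau) + sin (z * r)) / (tau + r) +
   (sin (z * tau) - sin (z * r)) / (tau - r)) / 2)) => z.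
  rewrite /gA; apply: is_derive_eq; rewrite /GRing.scale/=.
  field; by rewrite rn tr1 tr2.
move=> /zT z0T; rewrite normrM (ger0_norm (_ : 0 <= 2^-1)) ?invr_ge0// ler_wpM2r ?invr_ge0//.
apply: (le_trans (ler_normD _ _)); apply: lerD; [exact: quot_sinD|exact: quot_sinB].
Qed.

Lemma gB_lip : `|gB t r tau - gB s r tau| <= Sg T r tau / 2 * `|t - s|.
Proof.
apply: (@mvt_le (fun z => gB z r tau) (fun z => ((cos (z * tau) - cos (z * r)) / (tau + r) +
   (cos (z * tau) - cos (z * r)) / (tau - r)) / 2)) => z.
  rewrite /gB; apply: is_derive_eq; rewrite /GRing.scale/=.
  field; by rewrite rn tr1 tr2.
move=> /zT z0T; rewrite normrM (ger0_norm (_ : 0 <= 2^-1)) ?invr_ge0// ler_wpM2r ?invr_ge0//.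
apply: (le_trans (ler_normD _ _)); apply: lerD; [exact: quot_cosD|exact: quot_cosB].
Qed.

End time_increments.
End trig_lip.

Section spectral_pointwise.
Context (R : realType) (N : nat).
Implicit Types (t s tau T : R) (x y xi : 'rV[R]_N).

Definition FRe (p : R * 'rV[R]_N) tau xi : R :=
  cos (dotp p.2 xi) * gA p.1 (enorm xi) tau + sin (dotp p.2 xi) * gB p.1 (enorm xi) tau.
Definition FIm (p : R * 'rV[R]_N) tau xi : R :=
  cos (dotp p.2 xi) * gB p.1 (enorm xi) tau - sin (dotp p.2 xi) * gA p.1 (enorm xi) tau.

Lemma FgE p tau xi : Fg p.1 p.2 tau xi = (FRe p tau xi +i* FIm p tau xi)%C.
Proof.
rewrite /Fg /cexpi -!fmorphV /= /FRe /FIm /gA /gB !cosN !sinN.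
apply/eqP; rewrite eq_complex /=.
apply/andP; split; apply/eqP; ring.
Qed.

Lemma Fg_re p q tau xi :
  complex.Re (Fg p.1 p.2 tau xi * (Fg q.1 q.2 tau xi)^*%C) = FRe p tau xi * FRe q tau xi + FIm p tau xi * FIm q tau xi.
Proof. by rewrite !FgE /=; ring. Qed.

Lemma dotp_le x y xi : `|dotp x xi - dotp y xi| <= enorm (x - y) * enorm xi.
Proof.
have -> : dotp x xi - dotp y xi = \sum_(i < N) (x - y) 0 i * xi 0 i.
  by rewrite /dotp -sumrB; apply: eq_bigr => i _; rewrite !mxE mulrBl.
rewrite -sqrtr_sqr /enorm -sqrtrM; last by apply: sumr_ge0 => i _; exact: sqr_ge0.
by apply: ler_wsqrtr; exact: sum_CS.
Qed.

(** The two competing bounds for an increment over a distance [dl] at frequency [r]: Lipschitz at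
    low frequency, the size [1 / r] of the kernel at high frequency. *)
Definition mu_min (dl r : R) : R := Num.min dl r^-1.

Lemma mu_min_ge0 dl r : 0 <= dl -> 0 <= r -> 0 <= mu_min dl r.
Proof. by move=> d0 r0; rewrite /mu_min le_min d0 invr_ge0. Qed.

(** The increments of real and imaginary part split into four terms each, two from time and two from
    phase, all at most [mu_min * Sg]. Two squares of [4 * mu_min * Sg] together with
    [Sg ^+ 2 <= 2 * Psi] give 64. *)
Lemma F_incr T p q tau xi : 0 <= p.1 <= T -> 0 <= q.1 <= T -> 0 < enorm xi ->
  tau + enorm xi != 0 -> tau - enorm xi != 0 ->
  (FRe p tau xi - FRe q tau xi) ^+ 2 + (FIm p tau xi - FIm q tau xi) ^+ 2 <=
  64 * mu_min (pdist p q) (enorm xi) ^+ 2 * Psi T (enorm xi) tau.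
Proof.
move=> pT qT; set r := enorm xi => r0 h1 h2.
have T0 : 0 <= T by case/andP: pT; exact: le_trans.
set m := mu_min _ _; set S := Sg T r tau.
have S0 : 0 <= S by exact: Sg_ge0.
have d0 : 0 <= pdist p q by rewrite addr_ge0// sqrtr_ge0.
have ri : 0 < r^-1 by rewrite invr_gt0.
have e0 : 0 <= enorm (p.2 - q.2) by exact: sqrtr_ge0.
have tp : `|p.1 - q.1| <= pdist p q by rewrite lerDl.
have xp : enorm (p.2 - q.2) <= pdist p q by rewrite lerDr.
have i2 : (2 * r)^-1 = r^-1 / 2 by rewrite invfM mulrC.
have mS z : z <= S / 2 * `|p.1 - q.1| -> z <= S / r -> z <= m * S.
  move=> z1 z2; rewrite /m /mu_min; case: (leP (pdist p q) r^-1) => hm; last by rewrite mulrC.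
  by apply: (le_trans z1); nra.
have dA : `|gA p.1 r tau - gA q.1 r tau| <= m * S.
  apply: mS; first exact: gA_lip.
  have := gA_le tau pT r0; have := gA_le tau qT r0; rewrite i2 -/S => a1 a2.
  by apply: (le_trans (ler_normB _ _)); lra.
have dB : `|gB p.1 r tau - gB q.1 r tau| <= m * S.
  apply: mS; first exact: gB_lip.
  have := gB_le tau pT r0; have := gB_le tau qT r0; rewrite i2 -/S => a1 a2.
  by apply: (le_trans (ler_normB _ _)); lra.
have dphi : `|dotp p.2 xi - dotp q.2 xi| <= pdist p q * r.
  by apply: (le_trans (dotp_le _ _ _)); rewrite ler_wpM2r// ltW.
have mP z g : 0 <= z -> 0 <= g -> z <= 2 -> z <= pdist p q * r -> g <= S / (2 * r) -> g * z <= m * S.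
  move=> z0 g0 z2 zd gS; apply: (@le_trans _ _ (S / (2 * r) * z)); first by rewrite ler_wpM2r.
  rewrite /m /mu_min; case: (leP (pdist p q) r^-1) => hm; rewrite i2.
    have -> : S * (r^-1 / 2) * z = S / 2 * (z / r) by ring.
    have : z / r <= pdist p q by rewrite ler_pdivrMr.
    have : 0 <= z / r by rewrite divr_ge0// ltW.
    by nra.
  have : S * r^-1 * z <= S * r^-1 * 2 by rewrite ler_wpM2l// mulr_ge0// ltW.
  lra.
have c1 := cos_dist2 (dotp p.2 xi) (dotp q.2 xi).
have c2 : `|cos (dotp p.2 xi) - cos (dotp q.2 xi)| <= pdist p q * r by exact: le_trans (cos_lip _ _) dphi.
have s1 := sin_dist2 (dotp p.2 xi) (dotp q.2 xi).
have s2 : `|sin (dotp p.2 xi) - sin (dotp q.2 xi)| <= pdist p q * r by exact: le_trans (sin_lip _ _) dphi.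
have mAc := mP _ _ (normr_ge0 _) (normr_ge0 _) c1 c2 (gA_le tau qT r0).
have mBc := mP _ _ (normr_ge0 _) (normr_ge0 _) c1 c2 (gB_le tau qT r0).
have mAs := mP _ _ (normr_ge0 _) (normr_ge0 _) s1 s2 (gA_le tau qT r0).
have mBs := mP _ _ (normr_ge0 _) (normr_ge0 _) s1 s2 (gB_le tau qT r0).
have mS0 : 0 <= m * S by rewrite mulr_ge0// mu_min_ge0// ltW.
have b1 (c g : R) : `|c| <= 1 -> `|g| <= m * S -> `|c * g| <= m * S.
  by move=> hc hg; rewrite normrM -[leRHS]mul1r ler_pM.
have nc z : `|cos z : R| <= 1 by rewrite ler_norml cos_geN1 cos_le1.
have ns z : `|sin z : R| <= 1 by rewrite ler_norml sin_geN1 sin_le1.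
have RE : `|FRe p tau xi - FRe q tau xi| <= 4 * (m * S).
  have -> : FRe p tau xi - FRe q tau xi =
    cos (dotp p.2 xi) * (gA p.1 r tau - gA q.1 r tau) + gA q.1 r tau * (cos (dotp p.2 xi) - cos (dotp q.2 xi)) +
    (sin (dotp p.2 xi) * (gB p.1 r tau - gB q.1 r tau) + gB q.1 r tau * (sin (dotp p.2 xi) - sin (dotp q.2 xi))).
    by rewrite /FRe -/r; ring.
  apply: (le_trans (ler_normD _ _)); have := ler_normD (cos (dotp p.2 xi) * (gA p.1 r tau - gA q.1 r tau)) (gA q.1 r tau * (cos (dotp p.2 xi) - cos (dotp q.2 xi))).
  have := ler_normD (sin (dotp p.2 xi) * (gB p.1 r tau - gB q.1 r tau)) (gB q.1 r tau * (sin (dotp p.2 xi) - sin (dotp q.2 xi))).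
  have := b1 _ _ (nc (dotp p.2 xi)) dA; have := b1 _ _ (ns (dotp p.2 xi)) dB; move: mAc mBs; rewrite -!normrM; lra.
have IE : `|FIm p tau xi - FIm q tau xi| <= 4 * (m * S).
  have -> : FIm p tau xi - FIm q tau xi =
    cos (dotp p.2 xi) * (gB p.1 r tau - gB q.1 r tau) + gB q.1 r tau * (cos (dotp p.2 xi) - cos (dotp q.2 xi)) -
    (sin (dotp p.2 xi) * (gA p.1 r tau - gA q.1 r tau) + gA q.1 r tau * (sin (dotp p.2 xi) - sin (dotp q.2 xi))).
    by rewrite /FIm -/r; ring.
  apply: (le_trans (ler_normB _ _)); have := ler_normD (cos (dotp p.2 xi) * (gB p.1 r tau - gB q.1 r tau)) (gB q.1 r tau * (cos (dotp p.2 xi) - cos (dotp q.2 xi))).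
  have := ler_normD (sin (dotp p.2 xi) * (gA p.1 r tau - gA q.1 r tau)) (gA q.1 r tau * (sin (dotp p.2 xi) - sin (dotp q.2 xi))).
  have := b1 _ _ (nc (dotp p.2 xi)) dB; have := b1 _ _ (ns (dotp p.2 xi)) dA; move: mBc mAs; rewrite -!normrM; lra.
have sq z : `|z| <= 4 * (m * S) -> z ^+ 2 <= 16 * (m ^+ 2 * S ^+ 2).
  move=> hz; rewrite -[leLHS]real_normK ?num_real//.
  have -> : 16 * (m ^+ 2 * S ^+ 2) = (4 * (m * S)) ^+ 2 by ring.
  by rewrite lerXn2r ?nnegrE// mulr_ge0.
have := sq _ RE; have := sq _ IE.
have := ler_wpM2l (sqr_ge0 m) (Sg_sqr T r tau); rewrite -/S; lra.
Qed.

(** Both functions vanish at time 0, so their values are increments over a time of length at most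
    [T]. *)
Lemma gAB_le T t tau (r : R) : 0 <= t <= T -> 0 < r -> tau + r != 0 -> tau - r != 0 ->
  gA t r tau ^+ 2 + gB t r tau ^+ 2 <= 4 * (T + 1) ^+ 2 * mu_min 1 r ^+ 2 * Psi T r tau.
Proof.
move=> tT r0 h1 h2; have /andP[t0 t1] := tT; have T0 := le_trans t0 t1.
set S := Sg T r tau; have S0 : 0 <= S by exact: Sg_ge0.
have zT : 0 <= (0 : R) <= T by rewrite lexx T0.
have ri : 0 < r^-1 by rewrite invr_gt0.
have i2 : (2 * r)^-1 = r^-1 / 2 by rewrite invfM mulrC.
have A0 : gA 0 r tau = 0 by rewrite /gA !mul0r subrr !mul0r.
have B0 : gB 0 r tau = 0 by rewrite /gB !mul0r sin0 subrr addr0 !mul0r subrr mul0r.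
have aux z : z <= S / 2 * `|t - 0| -> z <= S / (2 * r) -> z <= (T + 1) * (mu_min 1 r * S).
  rewrite subr0 (ger0_norm t0) i2 => z1 z2; rewrite /mu_min; case: (leP 1 r^-1) => hm; first by apply: (le_trans z1); nra.
  by apply: (le_trans z2); have := mulr_ge0 S0 (ltW ri); nra.
have a1 : `|gA t r tau| <= (T + 1) * (mu_min 1 r * S).
  by apply: aux; [have := gA_lip tT zT r0 h1 h2; rewrite A0 subr0|exact: gA_le].
have a2 : `|gB t r tau| <= (T + 1) * (mu_min 1 r * S).
  by apply: aux; [have := gB_lip tT zT r0 h1 h2; rewrite B0 subr0|exact: gB_le].
have sq z : `|z| <= (T + 1) * (mu_min 1 r * S) -> z ^+ 2 <= (T + 1) ^+ 2 * mu_min 1 r ^+ 2 * S ^+ 2.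
  move=> hz; rewrite -[leLHS]real_normK ?num_real// -!exprMn -mulrA.
  by rewrite lerXn2r ?nnegrE//; apply: le_trans hz.
have := sq _ a1; have := sq _ a2.
have := ler_wpM2l (mulr_ge0 (sqr_ge0 (T + 1)) (sqr_ge0 (mu_min 1 r))) (Sg_sqr T r tau); rewrite -/S; lra.
Qed.

End spectral_pointwise.

Lemma enorm_gt0 (R : realType) N (x : 'rV[R]_N) i : x 0 i != 0 -> 0 < enorm x.
Proof.
by move=> xi; apply: lt_le_trans (enormf_coord (fun j => x 0 j) i); rewrite normr_gt0.
Qed.

Lemma pdist_eq0 (R : realType) N (p q : R * 'rV[R]_N) : pdist p q = 0 -> p = q.
Proof.
move=> d0'; have e2 : 0 <= enorm (p.2 - q.2) by exact: sqrtr_ge0.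
have n1' := normr_ge0 (p.1 - q.1).
have z1 : `|p.1 - q.1| = 0 by move: d0'; rewrite /pdist; lra.
have z2 : enorm (p.2 - q.2) = 0 by move: d0'; rewrite /pdist; lra.
have h1 : p.1 = q.1 by apply/eqP; rewrite -subr_eq0 -normr_eq0 z1.
have h2 : p.2 = q.2.
  apply/rowP => j; apply/eqP; rewrite -subr_eq0 -normr_eq0 -normr_le0 normr_id -z2.
  by have := enormf_coord (fun i => (p.2 - q.2) 0 i) j; rewrite !mxE.
by case: p h1 h2 {d0' e2 n1' z1 z2} => ? ? /= -> ->; case: q.
Qed.

Lemma int_Rn_prod_le (R : realType) n (g : 'I_n -> R -> R) (C : 'I_n -> R) :
  (forall i x, 0 <= g i x) -> (forall i, measurable_fun setT (g i)) ->
  (forall i, (\int[@lebesgue_measure R]_x (g i x)%:E <= (C i)%:E)%E) ->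
  (int_Rn (fun t : n.-tuple R => (\prod_(i < n) g i (tnth t i))%:E) <= (\prod_(i < n) C i)%:E)%E.
Proof.
move=> g0 mg gC; rewrite int_Rn_prod//.
suff : (0 <= \prod_(i < n) \int[@lebesgue_measure R]_x (g i x)%:E)%E /\
  (\prod_(i < n) \int[@lebesgue_measure R]_x (g i x)%:E <= (\prod_(i < n) C i)%:E)%E by case.
have i0 i : (0 <= \int[@lebesgue_measure R]_x (g i x)%:E)%E by apply: integral_ge0 => x _; rewrite lee_fin.
elim/big_ind2 : _ => //.
- move=> x1 x2 y1 y2 [h1 h2] [h3 h4]; split; first exact: mule_ge0.
  by rewrite EFinM; apply: lee_pmul.
Qed.

Section nonzero.
Context (R : realType) (N : nat) (m : {sigma_finite_measure set N.-tuple R -> \bar R}).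
Hypothesis m0 : forall f, measurable_fun setT f -> (forall x, (0 <= f x)%E) -> int_Rn f = (\int[m]_x f x)%E.

(** Coordinate hyperplanes are null because [int_Rn_prod] has a vanishing factor there. Outside them
    negative powers are genuine rather than default values. *)
Lemma tuple_nz_ae : {ae m, forall t : N.-tuple R, forall i, tnth t i != 0}.
Proof.
apply: filter_forall => i.
pose A := [set t : N.-tuple R | tnth t i = 0].
have mA : measurable A.
  by rewrite -[A]setTI; apply: (measurable_tnth i _ (measurable_set1 (0 : R))).
exists A; split => //; last by move=> t /= /negP; rewrite negbK => /eqP.
pose g j (x : R) : R := if j == i then \1_[set 0 : R] x else 1.
have g0 j x : 0 <= g j x by rewrite /g; case: ifP.
have mg j : measurable_fun [set: R] (g j).
  by rewrite /g; case: (j == i); [exact: measurable_indic|exact: measurable_cst].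
have := int_Rn_prod g0 mg.
have -> : (\prod_(j < N) \int[@lebesgue_measure R]_x (g j x)%:E = 0)%E.
  have Z : (\int[@lebesgue_measure R]_x (g i x)%:E = 0)%E.
    by rewrite /g eqxx integral_indic// setIT; exact: lebesgue_measure_set1.
  by rewrite (bigD1 i)//= Z mul0e.
rewrite m0.
- move=> <-; transitivity (\int[m]_t (\1_A t)%:E)%E; first by rewrite integral_indic// setIT.
  apply: eq_integral => t _; congr _%:E.
  rewrite (bigD1 i)//= [X in _ = _ * X]big1 ?mulr1; last by move=> j ji; rewrite /g (negbTE ji).
  by rewrite /g eqxx !indicE; congr (nat_of_bool _)%:R; apply/idP/idP; rewrite !inE.
- apply/measurable_EFinP; apply: measurable_prod => j _.
  by apply: measurableT_comp => //; exact: measurable_tnth.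
- by move=> t; rewrite lee_fin prodr_ge0.
Qed.

End nonzero.

Section spectral_meas.
Context (R : realType) (N : nat).
Local Notation TT := (R * N.-tuple R)%type.

Lemma measurable_invr d (T : measurableType d) (f : T -> R) : measurable_fun setT f ->
  measurable_fun setT (fun x => (f x)^-1).
Proof.
move=> mf; rewrite (_ : (fun _ => _) = fun x => f x * (f x ^+ 2) `^ (-1)).
  apply: measurable_funM => //; apply: (@measurableT_comp _ _ _ _ _ _ (fun x => x `^ (-1))) => //.
  exact: measurable_funX.
apply/funext => x; rewrite powR_inv1 ?sqr_ge0//.
by have [->|h] := eqVneq (f x) 0; [rewrite invr0 mul0r|field].
Qed.

Lemma coord_meas i : measurable_fun [set: N.-tuple R] (fun t => tup2row t 0 i).
Proof.
rewrite (_ : (fun _ => _) = fun t => tnth t i); first exact: measurable_tnth.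
by apply/funext => t; rewrite mxE.
Qed.

Lemma enorm_meas : measurable_fun [set: N.-tuple R] (fun t => enorm (tup2row t)).
Proof. by apply: (@enormf_meas R _ _ N (fun i t => tup2row t 0 i)) => i; exact: coord_meas. Qed.

Lemma dotp_meas x : measurable_fun [set: N.-tuple R] (fun t => dotp x (tup2row t)).
Proof.
by apply: measurable_sum => i; apply: measurable_funM => //; exact: coord_meas.
Qed.

Let mr : measurable_fun [set: TT] (fun z => enorm (tup2row z.2)).
Proof. by apply: (measurableT_comp enorm_meas). Qed.
Let mcos (f : TT -> R) : measurable_fun setT f -> measurable_fun setT (fun z => cos (f z)).
Proof. by move=> mf; apply: (measurableT_comp (@measurable_cos R)). Qed.
Let msin (f : TT -> R) : measurable_fun setT f -> measurable_fun setT (fun z => sin (f z)).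
Proof. by move=> mf; apply: (measurableT_comp (@measurable_sin R)). Qed.

Lemma gA_meas (t : R) : measurable_fun [set: TT] (fun z => gA t (enorm (tup2row z.2)) z.1).
Proof.
apply: measurable_funM; [apply: measurable_funM|apply: measurable_funB]; try apply: measurable_invr.
- by apply: measurable_funB; apply: mcos; exact: measurable_funM.
- exact: measurable_funM.
- exact: measurable_funD.
- exact: measurable_funB.
Qed.

Lemma gB_meas (t : R) : measurable_fun [set: TT] (fun z => gB t (enorm (tup2row z.2)) z.1).
Proof.
apply: measurable_funM; last by apply: measurable_invr; exact: measurable_funM.
apply: measurable_funB; apply: measurable_funM; try apply: measurable_invr.
- by apply: measurable_funB; apply: msin; exact: measurable_funM.
- exact: measurable_funB.
- by apply: measurable_funD; apply: msin; exact: measurable_funM.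
- exact: measurable_funD.
Qed.

Let mdot x : measurable_fun [set: TT] (fun z => dotp x (tup2row z.2)).
Proof. exact: (measurableT_comp (dotp_meas x)). Qed.

Lemma FRe_meas p : measurable_fun [set: TT] (fun z => FRe p z.1 (tup2row z.2)).
Proof.
by apply: measurable_funD; apply: measurable_funM; try exact: gA_meas; try exact: gB_meas; [exact: mcos|exact: msin].
Qed.

Lemma FIm_meas p : measurable_fun [set: TT] (fun z => FIm p z.1 (tup2row z.2)).
Proof.
by apply: measurable_funB; apply: measurable_funM; try exact: gA_meas; try exact: gB_meas; [exact: mcos|exact: msin].
Qed.

End spectral_meas.

(** * Integration over time and space frequencies *)

Section spectral_bound.
Context (R : realType) (N : nat) (m : {sigma_finite_measure set N.-tuple R -> \bar R}).
Hypothesis m0 : forall f, measurable_fun setT f -> (forall x, (0 <= f x)%E) -> int_Rn f = (\int[m]_x f x)%E.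
Hypothesis N0 : (0 < N)%N.
Local Notation leb := (@lebesgue_measure R).
Local Notation TT := (R * N.-tuple R)%type.
Variables (T s : R).
Hypothesis T0 : 0 <= T.
Hypothesis s01 : 0 <= s < 1.

(** The time frequency is integrated first, at fixed space frequency, by [tau_int]. The pointwise
    bound may fail at the resonances and where a coordinate vanishes, both null sets. *)
Lemma tonelli_bound : exists2 C : R, 0 < C & forall (F : TT -> R) (B : N.-tuple R -> R),
  measurable_fun setT F -> (forall z, 0 <= F z) -> measurable_fun setT B -> (forall t, 0 <= B t) ->
  (forall t tau, (forall i, tnth t i != 0) -> let r := enorm (tup2row t) in
     tau + r != 0 -> tau - r != 0 -> F (tau, t) <= B t * (Psi T r tau * `|tau| `^ (- s))) ->
  (\int[leb \x m]_z (F z)%:E <= \int[m]_t (C * (B t * enorm (tup2row t) `^ (- s)))%:E)%E.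
Proof.
have [C C0 hC] := tau_int T0 s01; exists C => // F B mF F0 mB B0 FB.
have mFE : measurable_fun setT (EFin \o F) by apply/measurable_EFinP.
rewrite fubini_tonelli2//.
apply: ae_ge0_le_integral => //.
- by move=> t _; apply: integral_ge0 => x _; rewrite lee_fin.
- exact: measurable_fun_fubini_tonelli_G.
- by move=> t _; rewrite lee_fin !mulr_ge0 ?powR_ge0// ltW.
- apply/measurable_EFinP; apply: measurable_funM => //; apply: measurable_funM => //.
  apply: (@measurableT_comp _ _ _ _ _ _ (fun x => x `^ (- s))) => //; exact: enorm_meas.
apply: filterS (tuple_nz_ae m0) => t nz _.
have r0 : 0 < enorm (tup2row t).
  by apply: (@enorm_gt0 _ _ _ (Ordinal N0)); rewrite mxE.
set r := enorm _ in r0 *.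
have mPs : measurable_fun [set: R] (fun tau => Psi T r tau * `|tau| `^ (- s)).
  by apply: measurable_funM; [exact: Psi_meas|exact: absX_meas].
apply: (@le_trans _ _ (\int[leb]_tau (B t * (Psi T r tau * `|tau| `^ (- s)))%:E)%E).
  apply: ae_ge0_le_integral => //.
  - by move=> x _; rewrite lee_fin.
  - by apply/measurable_EFinP; exact: (measurableT_comp mF (pair2_measurable t)).
  - by move=> x _; rewrite lee_fin !mulr_ge0 ?Psi_ge0 ?powR_ge0.
  - by apply/measurable_EFinP; apply: measurable_funM.
  exists ([set r] `|` [set - r]); split.
  - by apply: measurableU; exact: measurable_set1.
  - by apply: null_set_setU => //; exact: lebesgue_measure_set1.
  - move=> x /= h; have [->|xr] := eqVneq x r; first by left.
    have [->|xr'] := eqVneq x (- r); first by right.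
    exfalso; apply: h => _; rewrite lee_fin; apply: FB => //; first by rewrite addr_eq0.
    by rewrite subr_eq0.
under eq_integral do rewrite EFinM.
rewrite ge0_integralZl//.
- rewrite mulrCA EFinM; apply: lee_wpmul2l; [by rewrite lee_fin|exact: hC].
- by apply/measurable_EFinP.
- by move=> x _; rewrite lee_fin mulr_ge0 ?Psi_ge0 ?powR_ge0.
- by rewrite lee_fin.
Qed.

Lemma powR_neg_le (e y x : R) : 0 <= e -> 0 < x -> x <= y -> y `^ (- e) <= x `^ (- e).
Proof.
move=> e0 x0 xy; rewrite !powRN lef_pV2 ?posrE ?powR_gt0//; last exact: lt_le_trans xy.
by apply: ge0_ler_powR; rewrite ?nnegrE ?(ltW x0)// (le_trans _ xy)// ltW.
Qed.

(** Every coordinate is at most [r] in absolute value, so each factor is at least [(dl * r) ^ -e],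
    and [N] of them rebuild the radial power. For [dl * r > 1] a coordinate may fall in the inner
    zone, where the exponent [a = 0] gives the value 1, still large enough. *)
Lemma Jp_prod_le (a b e y dl : R) (t : N.-tuple R) (r := enorm (tup2row t)) : (forall i, tnth t i != 0) -> 0 < dl ->
  0 <= e -> (dl * r <= 1 -> a = e) -> (1 < dl * r -> a = 0 /\ b = e) ->
  (dl * r) `^ (- (e * N%:R)) <= \prod_(i < N) Jp a b (dl * tnth t i - 0).
Proof.
move=> nz d0 e0 h1 h2; have r0 : 0 < r by apply: (@enorm_gt0 _ _ _ (Ordinal N0)); rewrite mxE.
rewrite -mulNr powRrM powR_mulrn ?powR_ge0// -[X in _ ^+ X]card_ord -prodr_const.
apply: ler_prod => i _; rewrite powR_ge0/= subr0 /Jp.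
have xr : `|dl * tnth t i| <= dl * r.
  rewrite normrM (gtr0_norm d0) ler_wpM2l ?(ltW d0)//.
  by have := enormf_coord (fun i => tup2row t 0 i) i; rewrite mxE.
have x0 : 0 < `|dl * tnth t i| by rewrite normr_gt0 mulf_neq0// gt_eqF.
have [h|h] := leP (dl * r) 1.
  by rewrite (le_trans xr h) (h1 h); exact: powR_neg_le.
have [-> ->] := h2 h; case: ifPn => hx; last exact: powR_neg_le.
rewrite oppr0 powRr0 -[leRHS](powRr0 (dl * r)); apply: ler_powR; [exact: ltW|lra].
Qed.

End spectral_bound.

Section structure_function.
Context (R : realType) (N : nat) (m : {sigma_finite_measure set N.-tuple R -> \bar R}).
Hypothesis m0 : forall f, measurable_fun setT f -> (forall x, (0 <= f x)%E) -> int_Rn f = (\int[m]_x f x)%E.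
Hypothesis N0 : (0 < N)%N.
Local Notation TT := (R * N.-tuple R)%type.
Variables (s be al : R).
Hypothesis s01 : 0 <= s < 1.
Hypothesis be0 : 0 < be.
Hypothesis al01 : 0 < al < 1.
Hypothesis alE : 2 * al = s + 2 - N%:R + be.

Let N1 : (0 : R) < N%:R. Proof. by rewrite ltr0n. Qed.

(** Convergence is exactly the condition [0 < al < 1]: by [alE], the exponent
    [s + be = N - 2 (1 - al)] is below [N] at the origin, and [s + be + 2 = N + 2 al] is above [N]
    at infinity. Scaling by [dl] produces the power [2 al]. *)
Lemma radial_bound : exists2 C : R, 0 < C & forall dl : R, 0 < dl ->
  (\int[m]_t (mu_min dl (enorm (tup2row t)) ^+ 2 * enorm (tup2row t) `^ (- (s + be)))%:E <= (C * dl `^ (2 * al))%:E)%E.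
Proof.
have /andP[s0 s1] := s01; have /andP[al0 al1] := al01.
pose e1 := (s + be) / N%:R; pose e2 := 1 + 2 * al / N%:R.
have e10 : 0 <= e1 by rewrite divr_ge0 ?(ltW N1)// addr_ge0// ltW.
have e11 : e1 < 1 by rewrite /e1 ltr_pdivrMr// mul1r; move: alE al1; lra.
have e21 : 1 < e2 by rewrite /e2 ltrDl divr_gt0//; lra.
have [C1 C10 i1] : exists2 C : R, 0 < C & forall dl c : R, 0 < dl ->
  (\int[@lebesgue_measure R]_x (Jp e1 2 (dl * x - c))%:E <= (C / dl)%:E)%E by apply: Jp_int; rewrite ?e10 ?ltr1n.
have [C2 C20 i2] : exists2 C : R, 0 < C & forall dl c : R, 0 < dl ->
  (\int[@lebesgue_measure R]_x (Jp 0 e2 (dl * x - c))%:E <= (C / dl)%:E)%E by apply: Jp_int; rewrite ?lexx ?ltr01.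
exists (C1 ^+ N + C2 ^+ N); first by rewrite addr_gt0// exprn_gt0.
move=> dl d0; pose g a b t := \prod_(i < N) Jp a b (dl * tnth t i - 0).
have g0 a b t : 0 <= g a b t by apply: prodr_ge0 => i _; exact: Jp_ge0.
have mJ a b : measurable_fun [set: R] (fun x => Jp a b (dl * x - 0)).
  apply: measurableT_comp; first exact: Jp_meas.
  by apply: measurable_funB => //; exact: measurable_funM.
have mg a b : measurable_fun setT (g a b).
  apply: measurable_prod => i _; apply: (measurableT_comp (mJ a b)); exact: measurable_tnth.
have ig a b C : (forall dl c : R, 0 < dl -> (\int[@lebesgue_measure R]_x (Jp a b (dl * x - c))%:E <= (C / dl)%:E)%E) ->
   (\int[m]_t (g a b t)%:E <= ((C / dl) ^+ N)%:E)%E.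
  move=> h; rewrite -m0; [|by apply/measurable_EFinP|by move=> t; rewrite lee_fin].
  have -> : (C / dl) ^+ N = \prod_(i < N) (C / dl) by rewrite prodr_const card_ord.
  apply: (@int_Rn_prod_le R N (fun _ x => Jp a b (dl * x - 0))) => // [i x|i].
    exact: Jp_ge0.
  exact: h.
pose D := dl `^ (2 + s + be).
have D0 : 0 <= D by exact: powR_ge0.
apply: (@le_trans _ _ (\int[m]_t (D * g e1 2 t + D * g 0 e2 t)%:E)%E); last first.
  rewrite ge0_integral_lincomb//.
  apply: (@le_trans _ _ (D%:E * ((C1 / dl) ^+ N)%:E + D%:E * ((C2 / dl) ^+ N)%:E)%E).
    by apply: leeD; apply: lee_wpmul2l; rewrite ?lee_fin//; exact: ig.
  rewrite -!EFinM -EFinD lee_fin -mulrDr !expr_div_n -mulrDl.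
  have -> : D = dl `^ (2 * al) * dl ^+ N.
    rewrite -powR_mulrn ?(ltW d0)// -powRD; last by apply/implyP => _; rewrite gt_eqF.
    by rewrite /D; congr (_ `^ _); move: alE; lra.
  have dn : dl ^+ N != 0 by rewrite expf_neq0// gt_eqF.
  by rewrite le_eqVlt; apply/orP; left; apply/eqP; field.
have mr := @enorm_meas R N.
apply: ae_ge0_le_integral => //.
- by move=> t _; rewrite lee_fin mulr_ge0 ?sqr_ge0 ?powR_ge0.
- apply/measurable_EFinP; apply: measurable_funM.
    by apply: measurable_funX; apply: measurable_minr => //; exact: measurable_invr.
  by apply: (@measurableT_comp _ _ _ _ _ _ (fun x => x `^ (- (s + be)))).
- by move=> t _; rewrite lee_fin addr_ge0// mulr_ge0.
- by apply/measurable_EFinP; apply: measurable_funD; apply: measurable_funM.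
apply: filterS (tuple_nz_ae m0) => t nz _; rewrite lee_fin.
have r0 : 0 < enorm (tup2row t) by apply: (@enorm_gt0 _ _ _ (Ordinal N0)); rewrite mxE.
have h1 := @Jp_prod_le R N N0 e1 2 e1 0 dl t nz d0 e10.
have h2 := @Jp_prod_le R N N0 0 e2 e2 0 dl t nz d0 (ltW (lt_trans ltr01 e21)).
set r := enorm _ in r0 h1 h2 *.
have dr : 0 < dl * r by rewrite mulr_gt0.
have DE : D = dl `^ 2 * dl `^ (s + be).
  by rewrite -powRD ?addrA//; apply/implyP => _; rewrite gt_eqF.
rewrite /mu_min; have [h|h] := leP dl r^-1.
  have h' : dl * r <= 1 by rewrite -ler_pdivlMr// mul1r.
  have {h2}h1 : (dl * r) `^ (- (e1 * N%:R)) <= g e1 2 t by apply: h1 => // hh; rewrite ltNge h' in hh.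
  have ee : e1 * N%:R = s + be by rewrite /e1 divfK// gt_eqF.
  rewrite ee in h1; rewrite -[leLHS]addr0; apply: lerD; last exact: mulr_ge0.
  apply: le_trans (ler_wpM2l D0 h1); rewrite powRM ?(ltW d0) ?(ltW r0)// DE !powRN (powR_mulrn 2) ?(ltW d0)//.
  have n1 : dl `^ (s + be) != 0 by rewrite gt_eqF// powR_gt0.
  have n2 : r `^ (s + be) != 0 by rewrite gt_eqF// powR_gt0.
  by rewrite le_eqVlt; apply/orP; left; apply/eqP; field; rewrite n1 n2.
have h' : 1 < dl * r by rewrite -ltr_pdivrMr// mul1r.
have {h1}h2 : (dl * r) `^ (- (e2 * N%:R)) <= g 0 e2 t by apply: h2 => // hh; rewrite leNgt h' in hh.
have ee : e2 * N%:R = 2 + s + be by rewrite /e2 mulrDl divfK ?gt_eqF//; move: alE; lra.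
rewrite ee in h2; rewrite -[leLHS]add0r; apply: lerD; first exact: mulr_ge0.
apply: le_trans (ler_wpM2l D0 h2); rewrite powRM ?(ltW d0) ?(ltW r0)// /D !powRN.
have -> : r `^ (2 + s + be) = r ^+ 2 * r `^ (s + be).
  rewrite -powR_mulrn ?(ltW r0)// -powRD ?addrA//; apply/implyP => _; by rewrite gt_eqF.
have n1 : dl `^ (2 + s + be) != 0 by rewrite gt_eqF// powR_gt0.
have n2 : r `^ (s + be) != 0 by rewrite gt_eqF// powR_gt0.
have n3 : r != 0 by rewrite gt_eqF.
by rewrite le_eqVlt; apply/orP; left; apply/eqP; field; rewrite n1 n2 n3.
Qed.

End structure_function.

(** * The covariance of the field as a spectral integral *)

Section gaussian_square.
Context d0 (Om : measurableType d0) (R : realType) (P : probability Om R).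

Lemma sqr_le_exp (y : R) : y ^+ 2 <= 4 * (expR (1 * y) + expR (-1 * y)).
Proof.
rewrite mul1r mulN1r.
have h : (`|y| / 2) ^+ 2 <= expR `|y|.
  have -> : expR `|y| = expR (`|y| / 2) ^+ 2 by rewrite -expRM_natl; congr expR; field.
  rewrite lerXn2r ?nnegrE ?expR_ge0 ?divr_ge0//.
  by have := @expR_ge1Dx R (`|y| / 2); lra.
have h2 : expR `|y| <= expR y + expR (- y).
  have := expR_ge0 y; have := expR_ge0 (- y); case: (ger0P y); lra.
have : (`|y| / 2) ^+ 2 = y ^+ 2 / 4 by rewrite expr_div_n real_normK ?num_real// -natrX.
lra.
Qed.

Lemma gaussian_rv_sqInt (Y : Om -> R) : measurable_fun [set: Om] Y -> gaussian_rv P Y ->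
  Int P (fun w => Y w * Y w).
Proof.
move=> mY [[mu [s [s0 law]]]|[c Yc]].
  apply: (Int_dom _ (IntZ 4 (IntD (normal_expInt mY s0 law 1) (normal_expInt mY s0 law (-1))))).
    by mfun.
  by move=> w; rewrite -expr2 ger0_norm ?sqr_ge0//; exact: sqr_le_exp.
apply/integrableP; split; first by apply/measurable_EFinP; mfun.
rewrite (@ae_eq_integral _ _ _ P _ (fun=> (`|c * c|)%:E))//.
- rewrite [X in (X < _)%E](_ : _ = (`|c * c|)%:E) ?ltry// integral_cst// -[RHS]mule1.
  congr (_ * _)%E; exact: probability_setT.
- by apply/measurable_EFinP; apply: measurableT_comp => //; mfun.
- by apply: filterS Yc => w Yw _; rewrite /= Yw.
Qed.

Variables (T : Type) (D : set T) (v : T -> Om -> R) (K : T -> T -> \bar R).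
Hypothesis gv : centered_gaussian_field P D v K.

(** Defined as an expectation, the kernel is real-valued and symmetric from the outset; [kernE]
    identifies it with the prescribed one. *)
Definition kern p q := Ex P (fun w => v p w * v q w).

Lemma kernC p q : kern p q = kern q p.
Proof. by apply: eq_Ex => w; rewrite mulrC. Qed.

Lemma kernE p q : D p -> D q -> K p q = (kern p q)%:E.
Proof.
move=> Dp Dq; rewrite -gv.2.2.2// unlock EFin_Ex//.
have sq p' : D p' -> Int P (fun w => v p' w * v p' w).
  move=> Dp'; apply: gaussian_rv_sqInt; first exact: gv.1.
  have := gv.2.1 1%N (fun=> p') (fun=> 1) (fun=> Dp').
  rewrite (_ : (fun w => _) = v p')//.
  by apply/funext => w; rewrite big_ord_recl big_ord0 addr0 mul1r.
apply: (Int_dom _ (IntD (sq p Dp) (sq q Dq))).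
  by have := gv.1 p Dp; have := gv.1 q Dq; move=> ? ?; mfun.
move=> w; rewrite normrM -!expr2 -[X in _ <= X + _]real_normK ?num_real//.
rewrite -[X in _ <= _ + X]real_normK ?num_real//.
have := sqr_ge0 (`|v p w| - `|v q w|).
have := sqr_ge0 (`|v p w| + `|v q w|).
by rewrite sqrrB sqrrD => *; lra.
Qed.

End gaussian_square.

Section integrable_EFin.
Context d (T : measurableType d) (R : realType) (m : {measure set T -> \bar R}).
Local Notation I f := (m.-integrable setT (EFin \o f)).

Lemma integrable_EFinD (f g : T -> R) : I f -> I g -> I (fun x => f x + g x).
Proof.
move=> h1 h2; rewrite (_ : EFin \o _ = ((EFin \o f) \+ (EFin \o g))%E); first exact: integrableD.
by apply/funext => x.
Qed.

Lemma integrable_EFinZ c (f : T -> R) : I f -> I (fun x => c * f x).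
Proof.
move=> h1; rewrite (_ : EFin \o _ = (fun x => c%:E * (EFin \o f) x)%E); first exact: integrableZl.
by apply/funext => x.
Qed.

Lemma integrable_EFinB (f g : T -> R) : I f -> I g -> I (fun x => f x - g x).
Proof.
move=> h1 h2; rewrite (_ : (fun x => f x - g x) = fun x => f x + (-1) * g x).
  by apply: integrable_EFinD => //; exact: integrable_EFinZ.
by apply/funext => x; rewrite mulN1r.
Qed.

End integrable_EFin.

Section spectral_rep.
Context d0 (Om : measurableType d0) (R : realType) (P : probability Om R).
Variables (N : nat) (H cH : R) (h : 'rV[R]_N -> R) (v : R * 'rV[R]_N -> Om -> R).
Local Notation D := [set p : R * 'rV[R]_N | 0 <= p.1].
Local Notation TT := (R * N.-tuple R)%type.
Local Notation leb := (@lebesgue_measure R).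
Hypothesis gv : centered_gaussian_field P D v (cov_kernel H cH h).
Hypothesis cH0 : 0 < cH.
Hypothesis mh : measurable_fun [set: N.-tuple R] (fun t => h (tup2row t)).
Hypothesis h0 : forall xi, 0 <= h xi.
Variable m : {sigma_finite_measure set N.-tuple R -> \bar R}.
Hypothesis m0 : forall f, measurable_fun setT f -> (forall x, (0 <= f x)%E) -> int_Rn f = (\int[m]_x f x)%E.
Hypothesis mi : forall f, m.-integrable setT f -> int_Rn f = (\int[m]_x f x)%E.

Local Notation MM := (leb \x m)%E.
Local Notation k := (kern P v).

Definition wgt (z : TT) : R := `|z.1| `^ (1 - 2 * H) * h (tup2row z.2).
Definition Wf (p q : R * 'rV[R]_N) (z : TT) : R :=
  (FRe p z.1 (tup2row z.2) * FRe q z.1 (tup2row z.2) + FIm p z.1 (tup2row z.2) * FIm q z.1 (tup2row z.2)) * wgt z.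

Lemma wgt_ge0 z : 0 <= wgt z.
Proof. by rewrite mulr_ge0// powR_ge0. Qed.

Lemma wgt_meas : measurable_fun setT wgt.
Proof.
apply: measurable_funM; last exact: (measurableT_comp mh).
by apply: (measurableT_comp (absX_meas _)).
Qed.

Lemma Wf_meas p q : measurable_fun setT (Wf p q).
Proof.
apply: measurable_funM; last exact: wgt_meas.
by apply: measurable_funD; apply: measurable_funM; try exact: FRe_meas; exact: FIm_meas.
Qed.

Lemma Wf_diag_ge0 p z : 0 <= Wf p p z.
Proof. by rewrite mulr_ge0 ?wgt_ge0// addr_ge0// -expr2 sqr_ge0. Qed.

Lemma cov_kernelE p q :
  cov_kernel H cH h p q = (cH%:E * \int[leb]_tau int_Rn (fun t : N.-tuple R => (Wf p q (tau, t))%:E))%E.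
Proof.
congr (_ * _)%E; apply: eq_integral => tau _; congr int_Rn; apply/funext => t.
by rewrite Fg_re /Wf /wgt mulrA.
Qed.

Let mW p q : measurable_fun [set: TT] (fun z => (Wf p q (z.1, z.2))%:E).
Proof.
apply/measurable_EFinP; rewrite (_ : (fun _ => _) = Wf p q); first exact: Wf_meas.
by apply/funext => -[].
Qed.

(** Integrability comes from probability: the left side of the covariance identity is finite by
    [kernE], and [cH > 0] transfers this to the nonnegative integral. *)
Lemma Wf_diag_int p : D p -> MM.-integrable setT (EFin \o Wf p p).
Proof.
move=> Dp; apply/integrableP; split; first by apply/measurable_EFinP; exact: Wf_meas.
have := kernE gv Dp Dp; rewrite cov_kernelE (iterated_ge0 m0 (f := fun tau t => (Wf p p (tau, t))%:E))//; last first.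
  by move=> a x; rewrite lee_fin Wf_diag_ge0.
under [X in (X < _)%E]eq_integral do rewrite /= ger0_norm ?Wf_diag_ge0//.
rewrite (_ : \int[MM]_z (Wf p p (z.1, z.2))%:E = \int[MM]_z (Wf p p z)%:E)%E; last by apply: eq_integral => -[].
have : (0 <= \int[MM]_z (Wf p p z)%:E)%E by apply: integral_ge0 => z _; rewrite lee_fin Wf_diag_ge0.
case: (\int[MM]_z (Wf p p z)%:E)%E => [r _ _|_|//]; first exact: ltry.
by rewrite gt0_muley.
Qed.

Lemma Wf_int p q : D p -> D q -> MM.-integrable setT (EFin \o Wf p q).
Proof.
move=> Dp Dq; apply: (@le_integrable _ _ _ MM setT measurableT _ (fun z => (Wf p p z + Wf q q z)%:E)).
- by apply/measurable_EFinP; exact: Wf_meas.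
- move=> z _ /=; rewrite lee_fin (ger0_norm (addr_ge0 (Wf_diag_ge0 p z) (Wf_diag_ge0 q z))).
  rewrite /Wf -mulrDl normrM (ger0_norm (wgt_ge0 z)) ler_wpM2r ?wgt_ge0//.
  set a := FRe p _ _; set b := FRe q _ _; set c := FIm p _ _; set e := FIm q _ _.
  have := sqr_ge0 (a - b); have := sqr_ge0 (a + b); have := sqr_ge0 (c - e); have := sqr_ge0 (c + e).
  by rewrite ler_norml; nra.
- by apply: integrable_EFinD; exact: Wf_diag_int.
Qed.

Lemma kern_spec p q : D p -> D q -> k p q = cH * \int[MM]_z Wf p q z.
Proof.
move=> Dp Dq; have := kernE gv Dp Dq; have iW := Wf_int Dp Dq.
have iW' : MM.-integrable setT (fun z => (Wf p q (z.1, z.2))%:E).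
  by rewrite (_ : (fun z => _) = EFin \o Wf p q)//; apply/funext => -[].
rewrite cov_kernelE (iterated_int mi _ (f := fun tau t => (Wf p q (tau, t))%:E))//; last by move=> f; exact: int_Rn_meas.
rewrite (_ : \int[MM]_z (Wf p q (z.1, z.2))%:E = \int[MM]_z (Wf p q z)%:E)%E; last by apply: eq_integral => -[].
have fi : (\int[MM]_z (Wf p q z)%:E)%E \is a fin_num by exact: integrable_fin_num.
by rewrite -(fineK fi) -EFinM => -[->].
Qed.

Definition dW p q (z : TT) : R :=
  ((FRe p z.1 (tup2row z.2) - FRe q z.1 (tup2row z.2)) ^+ 2 + (FIm p z.1 (tup2row z.2) - FIm q z.1 (tup2row z.2)) ^+ 2) * wgt z.

Lemma dW_ge0 p q z : 0 <= dW p q z.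
Proof. by rewrite mulr_ge0 ?wgt_ge0// addr_ge0// sqr_ge0. Qed.

Lemma dW_meas p q : measurable_fun setT (dW p q).
Proof.
apply: measurable_funM; last exact: wgt_meas.
apply: measurable_funD; apply: measurable_funX; apply: measurable_funB; try exact: FRe_meas; exact: FIm_meas.
Qed.

Lemma dWE p q z : dW p q z = Wf p p z - 2 * Wf p q z + Wf q q z.
Proof. by rewrite /dW /Wf; ring. Qed.

Lemma incr_spec p q : D p -> D q ->
  ((incr_var k p q)%:E = cH%:E * \int[MM]_z (dW p q z)%:E)%E.
Proof.
move=> Dp Dq; have i1 := Wf_diag_int Dp; have i2 := Wf_int Dp Dq; have i3 := Wf_diag_int Dq.
have iZ : MM.-integrable setT (EFin \o (fun z => 2 * Wf p q z)) by exact: integrable_EFinZ.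
have iB : MM.-integrable setT (EFin \o (fun z => Wf p p z - 2 * Wf p q z)) by exact: integrable_EFinB.
have iD : MM.-integrable setT (EFin \o dW p q).
  rewrite (_ : dW p q = fun z => Wf p p z - 2 * Wf p q z + Wf q q z); first exact: integrable_EFinD.
  by apply/funext => z; rewrite dWE.
have fi : (\int[MM]_z (dW p q z)%:E)%E \is a fin_num by exact: integrable_fin_num.
rewrite -(fineK fi) -EFinM; congr _%:E; rewrite /incr_var !kern_spec//.
have -> : fine (\int[MM]_z (dW p q z)%:E)%E = \int[MM]_z (Wf p p z - 2 * Wf p q z + Wf q q z).
  by congr fine; apply: eq_integral => z _; rewrite dWE.
by rewrite RintegralD// RintegralB// RintegralZl//; ring.
Qed.

Section upper.
Variables (be c2 al : R).
Hypothesis N0 : (0 < N)%N.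
Hypothesis H01 : 0 <= 2 * H - 1 < 1.
Hypothesis be0 : 0 < be.
Hypothesis al01 : 0 < al < 1.
Hypothesis alE : al = (2 * H + 1 - N%:R + be) / 2.
Hypothesis c20 : 0 < c2.
Hypothesis hle : forall xi, xi != 0 -> h xi <= c2 * enorm xi `^ (- be).

(** [F_incr] bounds the integrand, [tonelli_bound] removes the time frequency, and [radial_bound]
    with [dl = pdist p q] yields the power [2 al]. *)
Lemma structure_upper (T : R) : 0 <= T -> exists2 C0 : R, 0 < C0 & forall p q, 0 <= p.1 <= T -> 0 <= q.1 <= T ->
  incr_var k p q <= C0 * (pdist p q `^ al) ^+ 2.
Proof.
move=> T0; have [C1 C10 hC1] := tonelli_bound m0 N0 T0 H01.
have alE' : 2 * al = (2 * H - 1) + 2 - N%:R + be by move: alE; lra.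
have [C2 C20 hC2] := radial_bound m0 N0 H01 be0 al01 alE'.
exists (cH * (C1 * (64 * c2) * C2)); first by rewrite !mulr_gt0.
move=> p q pT qT.
have : 0 <= pdist p q by rewrite addr_ge0 ?sqrtr_ge0.
have /andP[al0 _] := al01.
rewrite le_eqVlt => /orP[/eqP d0'|dp].
  rewrite -d0' powR0 ?gt_eqF// expr0n mulr0 (pdist_eq0 (esym d0')) /incr_var; lra.
have /andP[p0 _] := pT; have /andP[q0 _] := qT.
rewrite -lee_fin (incr_spec p0 q0).
pose B (t : N.-tuple R) := 64 * c2 * (mu_min (pdist p q) (enorm (tup2row t)) ^+ 2 * enorm (tup2row t) `^ (- be)).
have mmu : measurable_fun setT (fun t : N.-tuple R => mu_min (pdist p q) (enorm (tup2row t))).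
  by apply: measurable_minr => //; apply: measurable_invr; exact: enorm_meas.
have mpow y : measurable_fun setT (fun t : N.-tuple R => enorm (tup2row t) `^ y).
  apply: (@measurableT_comp _ _ _ _ _ _ (fun x => x `^ y)) => //; exact: enorm_meas.
have hI : (\int[MM]_z (dW p q z)%:E <= \int[m]_t (C1 * (B t * enorm (tup2row t) `^ (- (2 * H - 1))))%:E)%E.
  apply: hC1.
  - exact: dW_meas.
  - exact: dW_ge0.
  - apply: measurable_funM => //; apply: measurable_funM => //; exact: measurable_funX.
  - by move=> t; rewrite mulr_ge0 ?(mulr_ge0 _ (ltW c20))// mulr_ge0 ?sqr_ge0 ?powR_ge0.
  move=> t tau nz r h1 h2.
  have r0 : 0 < r by apply: (@enorm_gt0 _ _ _ (Ordinal N0)); rewrite mxE.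
  have x0 : tup2row t != 0.
    by apply: contraTneq (nz (Ordinal N0)) => /rowP /(_ (Ordinal N0)); rewrite !mxE => ->; rewrite eqxx.
  have FI := F_incr pT qT r0 h1 h2; have hh := hle x0.
  rewrite /dW /wgt /= (_ : 1 - 2 * H = - (2 * H - 1)); last by ring.
  have pt := powR_ge0 `|tau| (- (2 * H - 1)).
  have := ler_pM (addr_ge0 (sqr_ge0 _) (sqr_ge0 _)) (mulr_ge0 pt (h0 (tup2row t))) FI (ler_wpM2l pt hh).
  by rewrite /B -/r => h3; apply: (le_trans h3); rewrite le_eqVlt; apply/orP; left; apply/eqP; ring.
have hJ : (\int[m]_t (C1 * (B t * enorm (tup2row t) `^ (- (2 * H - 1))))%:E <= (C1 * (64 * c2) * (C2 * pdist p q `^ (2 * al)))%:E)%E.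
  rewrite (_ : \int[m]_t _ = \int[m]_t ((C1 * (64 * c2))%:E * (mu_min (pdist p q) (enorm (tup2row t)) ^+ 2 * enorm (tup2row t) `^ (- (2 * H - 1 + be)))%:E))%E.
    rewrite ge0_integralZl//.
    - by rewrite [leRHS]EFinM; apply: lee_wpmul2l; [rewrite lee_fin mulr_ge0 ?(ltW C10)// mulr_ge0// ltW|exact: hC2].
    - by apply/measurable_EFinP; apply: measurable_funM => //; exact: measurable_funX.
    - by move=> t _; rewrite lee_fin mulr_ge0 ?sqr_ge0 ?powR_ge0.
    - by rewrite lee_fin mulr_ge0 ?(ltW C10)// mulr_ge0// ltW.
  apply: eq_integral => t _; rewrite -EFinM; congr _%:E.
  have [r0|r0] := eqVneq (enorm (tup2row t)) 0.
    rewrite /B r0 /mu_min invr0 min_r; last exact: ltW.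
    by rewrite expr0n !(mul0r, mulr0).
  rewrite (_ : - (2 * H - 1 + be) = - (2 * H - 1) + - be); last by ring.
  rewrite powRD; last by apply/implyP.
  by rewrite /B; ring.
apply: le_trans (lee_wpmul2l _ (le_trans hI hJ)) _; first by rewrite lee_fin ltW.
rewrite -EFinM lee_fin -powR_mulrn ?powR_ge0// -powRrM (mulrC al).
by rewrite le_eqVlt; apply/orP; left; apply/eqP; ring.
Qed.

End upper.
End spectral_rep.

(** * Choosing weakly correlated points *)

Section averaging.
Context d (Z : measurableType d) (R : realType) (nu : {sigma_finite_measure set Z -> \bar R}).
Variables (w x0 : Z -> R).
Hypothesis w0 : forall z, 0 <= w z.
Hypothesis iw : nu.-integrable setT (EFin \o w).
Hypothesis mx0 : measurable_fun setT x0.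

Local Notation ga := (normal_prob (0 : R) 1).
Local Notation Eg f := (@Ex _ (measurableTypeR R) R ga f).

(** The covariance function of a stationary process whose spectral measure is the image under [x0]
    of [w] times [nu]. *)
Definition Rf (s : R) : R := \int[nu]_z (w z * cos (s * x0 z)).

Let mw : measurable_fun setT w. Proof. by have /measurable_EFinP := measurable_int _ iw. Qed.

Lemma Rf_int s : nu.-integrable setT (EFin \o (fun z => w z * cos (s * x0 z))).
Proof.
apply: (@le_integrable _ _ _ nu setT measurableT _ (EFin \o w)) => //.
- apply/measurable_EFinP; apply: measurable_funM => //; apply: (measurableT_comp (@measurable_cos R)).
  exact: measurable_funM.
- move=> z _ /=; rewrite lee_fin normrM (ger0_norm (w0 z)) -[leRHS]mulr1 ler_wpM2l//.
  by rewrite ler_norml cos_geN1 cos_le1.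
Qed.

Lemma RfN s : Rf (- s) = Rf s.
Proof. by apply: eq_Rintegral => z _; rewrite mulNr cosN. Qed.

Lemma Rf0E : Rf 0 = \int[nu]_z w z.
Proof. by apply: eq_Rintegral => z _; rewrite mul0r cos0 mulr1. Qed.

Lemma Rf_le s : `|Rf s| <= Rf 0.
Proof.
rewrite Rf0E; apply: (le_trans (le_normr_Rintegral measurableT (Rf_int s))).
apply: le_Rintegral => //.
  rewrite (_ : EFin \o _ = abse \o (EFin \o (fun z => w z * cos (s * x0 z)))); first exact: integrable_abse (Rf_int s).
  by apply/funext.
move=> z _ /=; rewrite normrM (ger0_norm (w0 z)) -[leRHS]mulr1 ler_wpM2l//.
by rewrite ler_norml cos_geN1 cos_le1.
Qed.

Lemma Rf_meas : measurable_fun [set: measurableTypeR R] Rf.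
Proof.
apply/measurable_EFinP.
rewrite (_ : EFin \o Rf = fun s => (\int[nu]_z (w z * cos (s * x0 z))%:E)%E).
  apply: (@measurable_param_integral _ _ _ _ _ nu (fun sz : measurableTypeR R * Z => (w sz.2 * cos (sz.1 * x0 sz.2))%:E)).
  apply/measurable_EFinP; apply: measurable_funM; first exact: (measurableT_comp mw).
  apply: (measurableT_comp (@measurable_cos R)); apply: measurable_funM; first exact: measurable_fst.
  exact: (measurableT_comp mx0).
apply/funext => s /=; rewrite fineK//; apply: integrable_fin_num => //; exact: Rf_int.
Qed.

Lemma std_cf l th : Eg (fun s => cos (l * s + th)) = cos th * expR (- (l ^+ 2 / 2)).
Proof.
have := @normal_cf _ (measurableTypeR R) R ga id 0 1 _ ltr01 _ erefl l th.
rewrite expr1n mulr1; apply => //.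
Qed.

Variable c : R.

Lemma avg_exchange (b : R -> R) : @bmeas _ (measurableTypeR R) R b ->
  nu.-integrable setT (EFin \o (fun z => w z * Eg (fun s => b s * cos ((s - c) * x0 z)))) /\
  Eg (fun s => b s * Rf (s - c)) = \int[nu]_z (w z * Eg (fun s => b s * cos ((s - c) * x0 z))).
Proof.
move=> [mb [B hB]].
pose F (sz : measurableTypeR R * Z) : \bar R := (b sz.1 * (w sz.2 * cos ((sz.1 - c) * x0 sz.2)))%:E.
have mF : measurable_fun setT F.
  apply/measurable_EFinP; apply: measurable_funM; first exact: (measurableT_comp mb).
  apply: measurable_funM; first exact: (measurableT_comp mw).
  apply: (measurableT_comp (@measurable_cos R)); apply: measurable_funM; last exact: (measurableT_comp mx0).
  by apply: measurable_funB; [exact: measurable_fst|exact: measurable_cst].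
have B0 : 0 <= B by exact: le_trans (hB 0).
have iF : (ga \x nu)%E.-integrable setT F.
  apply/integrableP; split => //.
  apply: (@le_lt_trans _ _ (\int[(ga \x nu)%E]_z (B * w z.2)%:E)%E).
    apply: ge0_le_integral => //.
    - exact: measurableT_comp.
    - by apply/measurable_EFinP; apply: measurable_funM => //; exact: (measurableT_comp mw).
    - move=> z _; rewrite lee_fin normrM; apply: ler_pM => //.
      rewrite normrM (ger0_norm (w0 _)) -[leRHS]mulr1 ler_wpM2l//.
      by rewrite ler_norml cos_geN1 cos_le1.
  rewrite fubini_tonelli1//; last first.
  - by move=> z; rewrite lee_fin mulr_ge0.
  - by apply/measurable_EFinP; apply: measurable_funM => //; exact: (measurableT_comp mw).
  rewrite /fubini_F /=.
  have -> : (\int[nu]_y (B * w y)%:E = (B * \int[nu]_y w y)%:E)%E.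
    by rewrite -RintegralZl// fineK//; apply: integrable_fin_num => //; exact: integrable_EFinZ.
  rewrite integral_cst// (_ : (_ * _)%E = (B * \int[nu]_y w y)%:E) ?ltry//.
  rewrite -[RHS]mule1; congr (_ * _)%E; exact: probability_setT.
have mc z : @bmeas _ (measurableTypeR R) R (fun s => b s * cos ((s - c) * x0 z)).
  apply: bmeasM; first by split => //; exists B.
  apply: bmeas_cos; apply: measurable_funM => //; exact: measurable_funB.
have := Fubini iF.
rewrite /F /= => E.
have L : (\int[ga]_x \int[nu]_y (b x * (w y * cos ((x - c) * x0 y)))%:E = (Eg (fun s => b s * Rf (s - c)))%:E)%E.
  rewrite fineK; last first.
    apply: integrable_fin_num => //; apply: bmeas_int; apply: bmeasM; first by split => //; exists B.
    split; first by apply: (measurableT_comp Rf_meas); exact: measurable_funB.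
    by exists (Rf 0) => s; exact: Rf_le.
  apply: eq_integral => s _; rewrite /= /Rf -RintegralZl//; last exact: Rf_int.
  by rewrite fineK//; apply: integrable_fin_num => //; apply: integrable_EFinZ; exact: Rf_int.
have Rp z : (\int[ga]_x (b x * (w z * cos ((x - c) * x0 z)))%:E =
   (w z * Eg (fun s => b s * cos ((s - c) * x0 z)))%:E)%E.
  rewrite -ExZ// fineK; last first.
    by apply: integrable_fin_num => //; apply: bmeas_int; exact: bmeasZ.
  by apply: eq_integral => s _; rewrite /= mulrCA.
split.
  apply: (@le_integrable _ _ _ nu setT measurableT _ (EFin \o (fun z => B * w z))); last exact: integrable_EFinZ.
    rewrite (_ : EFin \o _ = fubini_G ga F); first exact: measurable_fubini_G iF.
    by apply/funext => z; rewrite /= -Rp.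
  move=> z _ /=; rewrite lee_fin normrM (ger0_norm (w0 z)) (ger0_norm (mulr_ge0 B0 (w0 z))) mulrC ler_wpM2r//.
  have hb s : `|b s * cos ((s - c) * x0 z)| <= B.
    by rewrite normrM -[leRHS]mulr1 ler_pM// ler_norml cos_geN1 cos_le1.
  rewrite ler_norml -[X in - X <= _](@Ex_cst _ (measurableTypeR R) R ga) -[X in _ && (_ <= X)](@Ex_cst _ (measurableTypeR R) R ga).
  rewrite -mulN1r -ExZ; last exact: bmeas_cst.
  apply/andP; split; apply: le_Ex => //; try exact: bmeas_cst.
    by move=> s; rewrite mulN1r; have := hb s; rewrite ler_norml => /andP[].
  by move=> s; have := hb s; rewrite ler_norml => /andP[].
rewrite /Rintegral -(eq_integral _ _ (fun z _ => Rp z)).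
by move: E; rewrite L => /(congr1 fine).
Qed.

Variable M : R.
Hypothesis hM : forall y, (\int[nu]_z (w z * expR (- ((x0 z - y) ^+ 2 / 2)))%:E <= M%:E)%E.

Let iexp y : nu.-integrable setT (EFin \o (fun z => w z * expR (- ((x0 z - y) ^+ 2 / 2)))).
Proof.
apply: (@le_integrable _ _ _ nu setT measurableT _ (EFin \o w)) => //.
- apply/measurable_EFinP; apply: measurable_funM => //; apply: (measurableT_comp (@measurable_expR R)).
  by apply: measurable_funN; apply: measurable_funM => //; apply: measurable_funX; exact: measurable_funB.
- move=> z _ /=; rewrite lee_fin normrM (ger0_norm (w0 z)) -[leRHS]mulr1 ler_wpM2l//.
  by rewrite ger0_norm ?expR_ge0// -[leRHS]expR0 ler_expR oppr_le0 divr_ge0// sqr_ge0.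
Qed.

Let iexp_le y : \int[nu]_z (w z * expR (- ((x0 z - y) ^+ 2 / 2))) <= M.
Proof.
rewrite -lee_fin fineK; first exact: hM.
by apply: integrable_fin_num => //; exact: iexp.
Qed.

(* Averaging [cos ((s - c) y) * Rf (s - c)] over a standard Gaussian [s] turns the spectral measure into its Gaussian
   smoothing, which is at most [M]; taking [y = x0 z] and integrating [w z] bounds the mean of [Rf ^+ 2]. *)
Lemma avg_cos y : Eg (fun s => cos ((s - c) * y) * Rf (s - c)) <= M.
Proof.
have bcy : @bmeas _ (measurableTypeR R) R (fun s => cos ((s - c) * y)).
  by apply: bmeas_cos; apply: measurable_funM => //; exact: measurable_funB.
have [iG ->] := avg_exchange bcy.
(* The product of cosines splits into frequencies [x0 z - y] and [x0 z + y]. The Gaussian mean of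
   each is a Gaussian in that frequency times the cosine of a phase depending on [c]; bounding this
   cosine by 1 makes the estimate uniform in [c]. *)
have pw z : Eg (fun s => cos ((s - c) * y) * cos ((s - c) * x0 z)) <=
    2^-1 * expR (- ((x0 z - y) ^+ 2 / 2)) + 2^-1 * expR (- ((x0 z - (- y)) ^+ 2 / 2)).
  have -> : Eg (fun s => cos ((s - c) * y) * cos ((s - c) * x0 z)) =
     Eg (fun s => 2^-1 * cos ((x0 z - y) * s + - (c * (x0 z - y))) + 2^-1 * cos ((x0 z - (- y)) * s + - (c * (x0 z - (- y))))).
    apply: eq_Ex => s.
    have -> : (x0 z - y) * s + - (c * (x0 z - y)) = (s - c) * x0 z - (s - c) * y by ring.
    have -> : (x0 z - - y) * s + - (c * (x0 z - - y)) = (s - c) * x0 z + (s - c) * y by ring.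
    by rewrite cosB cosD; field.
  have bc l th : @bmeas _ (measurableTypeR R) R (fun s => 2^-1 * cos (l * s + th)).
    by apply: bmeasZ; apply: bmeas_cos; apply: measurable_funD => //; exact: measurable_funM.
  have bc' l th : @bmeas _ (measurableTypeR R) R (fun s => cos (l * s + th)).
    by apply: bmeas_cos; apply: measurable_funD => //; exact: measurable_funM.
  rewrite ExD// !ExZ// !std_cf.
  have e1 l : 0 <= expR (- (l ^+ 2 / 2)) :> R by exact: expR_ge0.
  have cl th l : cos th * expR (- (l ^+ 2 / 2)) <= expR (- (l ^+ 2 / 2)) :> R.
    by rewrite -[leRHS]mul1r ler_wpM2r// cos_le1.
  by apply: lerD; rewrite ler_wpM2l ?invr_ge0.
apply: (@le_trans _ _ (\int[nu]_z (2^-1 * (w z * expR (- ((x0 z - y) ^+ 2 / 2))) + 2^-1 * (w z * expR (- ((x0 z - (- y)) ^+ 2 / 2)))))).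
  apply: le_Rintegral => //.
  - by apply: integrable_EFinD; apply: integrable_EFinZ; exact: iexp.
  - move=> z _; apply: (le_trans (ler_wpM2l (w0 z) (pw z))).
    by rewrite le_eqVlt; apply/orP; left; apply/eqP; ring.
rewrite RintegralD//; [|by apply: integrable_EFinZ; exact: iexp|by apply: integrable_EFinZ; exact: iexp].
rewrite !RintegralZl//; try exact: iexp.
have := iexp_le y; have := iexp_le (- y); lra.
Qed.

Lemma avg_sqr : Eg (fun s => Rf (s - c) ^+ 2) <= M * Rf 0.
Proof.
have bR : @bmeas _ (measurableTypeR R) R (fun s => Rf (s - c)).
  split; first by apply: (measurableT_comp Rf_meas); exact: measurable_funB.
  by exists (Rf 0) => s; exact: Rf_le.
rewrite [leLHS](_ : _ = Eg (fun s => Rf (s - c) * Rf (s - c))); last by apply: eq_Ex => s; rewrite expr2.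
have [iG ->] := avg_exchange bR.
rewrite Rf0E -RintegralZl//; apply: le_Rintegral => //.
- exact: integrable_EFinZ.
- move=> z _; rewrite mulrC ler_wpM2r//.
  by apply: le_trans (avg_cos (x0 z)); rewrite le_eqVlt; apply/orP; left; apply/eqP; apply: eq_Ex => s; rewrite mulrC.
Qed.

(** Chebyshev's inequality for [avg_sqr]: it measures the points badly correlated with a given
    centre [c]. *)
Lemma avg_tail (th : R) : 0 < th ->
  (ga [set s | (th < `|Rf (s - c)|)%R] <= (M * Rf 0 / th ^+ 2)%:E)%E.
Proof.
move=> th0; have mR : measurable_fun [set: measurableTypeR R] (fun s => Rf (s - c)).
  by apply: (measurableT_comp Rf_meas); exact: measurable_funB.
pose A := [set s : measurableTypeR R | th < `|Rf (s - c)|].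
have mA : measurable A.
  have mX : measurable_fun [set: measurableTypeR R] (fun s => `|Rf (s - c)|) by exact: measurableT_comp.
  have := mX measurableT `]th, +oo[%classic (measurable_itv _).
  by rewrite setTI; congr measurable; apply/seteqP; split => x; rewrite /= in_itv/= andbT.
have fA : ga A = (fine (ga A))%:E by rewrite fineK// fin_num_measure.
rewrite -/A fA lee_fin ler_pdivlMr ?exprn_gt0// -Ex_indic// mulrC -ExZ; last exact: bmeas_indic.
apply: le_trans avg_sqr; apply: le_Ex.
- by apply: bmeasZ; exact: bmeas_indic.
- by apply: bmeasX; split => //; exists (Rf 0) => s; exact: Rf_le.
- move=> s; rewrite indicE; case: (boolP (s \in A)) => [|_]; last by rewrite mulr0 sqr_ge0.
  rewrite inE /A /= mulr1 => h; rewrite -[leRHS]real_normK ?num_real//.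
  by rewrite lerXn2r ?nnegrE// ltW.
Qed.

End averaging.

Section greedy.
Context (R : realType).
Local Notation ga := (normal_prob (0 : R) 1).
Variables (rho : R -> R) (l th q : R).
Hypothesis rho_even : forall s, rho (- s) = rho s.
Hypothesis rho_meas : measurable_fun [set: measurableTypeR R] rho.
Hypothesis q0 : 0 <= q.
Hypothesis rho_tail : forall c, (ga [set s | (th < `|rho (s - c)|)%R] <= q%:E)%E.

Let I : set (measurableTypeR R) := `[0, l]%classic.

(** Each point already chosen excludes a set of Gaussian measure at most [q], and fewer than [k]
    such sets cannot cover [[0, l]]. *)
Lemma greedy_points (k : nat) : ((k%:R * q)%:E < ga I)%E ->
  exists sg : 'I_k -> R, (forall i, 0 <= sg i <= l) /\ forall i j, i != j -> `|rho (sg i - sg j)| <= th.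
Proof.
move=> hk.
suff [s [ss s0 sp]] : exists s : seq R, [/\ size s = k, forall x, x \in s -> 0 <= x <= l &
    pairwise (fun x y => `|rho (x - y)| <= th) s].
  exists (fun i => nth 0 s i); split=> [i|i j ij]; first by apply: s0; rewrite mem_nth// ss.
  have sym x y : `|rho (x - y)| <= th -> `|rho (y - x)| <= th by rewrite -rho_even opprB.
  move/(pairwiseP 0): sp => sp.
  move: ij; rewrite -(inj_eq val_inj) neq_ltn => /orP[ij|ij]; last apply: sym.
    by apply: sp; rewrite ?inE ?ss.
  by apply: sp; rewrite ?inE ?ss.
have : forall k', (k' <= k)%N -> exists s : seq R, [/\ size s = k', forall x, x \in s -> 0 <= x <= l &
    pairwise (fun x y => `|rho (x - y)| <= th) s].
  elim=> [|k' IH] kk; first by exists [::].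
  have [s [ss s0 sp]] := IH (ltnW kk).
  pose bad c := [set x : measurableTypeR R | th < `|rho (x - c)|].
  have mbad c : measurable (bad c).
    have mX : measurable_fun [set: measurableTypeR R] (fun x => `|rho (x - c)|).
      by apply: measurableT_comp => //; apply: (measurableT_comp rho_meas); exact: measurable_funB.
    have := mX measurableT `]th, +oo[%classic (measurable_itv _).
    by rewrite setTI; congr measurable; apply/seteqP; split => x; rewrite /= in_itv/= andbT.
  pose U := \bigcup_(i in [set: 'I_k']) bad (nth 0 s i).
  have UB := @union_bound _ _ R ga 'I_k' setT (fun i => bad (nth 0 s i)) q (fun i => mbad _) (fun i _ => rho_tail _) q0.
  have [x [xl xU]] : exists x, (0 <= x <= l) /\ ~ U x.
    apply: contrapT => /forallNP hx.
    suff : (ga I <= (k%:R * q)%:E)%E by rewrite leNgt hk.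
    apply: (@le_trans _ _ (ga U)).
      apply: le_measure; rewrite ?inE//; first exact: measurable_itv.
        by apply: fin_bigcup_measurable => //; exact: finite_finset.
      move=> x; rewrite /I /= in_itv/= => xl; apply: contrapT => xU; exact: (hx x).
    apply: (le_trans UB); rewrite lee_fin card_ord ler_wpM2r// ler_nat; exact: ltnW.
  exists (x :: s); split => /=; first by rewrite ss.
    by move=> y; rewrite inE => /orP[/eqP ->//|]; exact: s0.
  rewrite sp andbT; apply/allP => y ys; rewrite leNgt; apply/negP => hy; apply: xU.
  have iy : (index y s < k')%N by rewrite -ss index_mem.
  by exists (Ordinal iy) => //=; rewrite nth_index.
by apply.
Qed.

End greedy.

Lemma normal_itv_gt0 (R : realType) (l : R) (I : set (measurableTypeR R) := `[0, l]%classic) : 0 < l -> (0 < normal_prob (0 : R) 1 I)%E.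
Proof.
move=> l0; rewrite /normal_prob.
pose c := normal_pdf 0 1 l.
have cE (x : R) : normal_pdf 0 1 x = normal_peak 1 * normal_fun 0 1 x by rewrite normal_pdfE// oner_eq0.
have pk : 0 < normal_peak (1 : R) by rewrite normal_peak_gt0// oner_eq0.
have c0 : 0 < c by rewrite /c cE mulr_gt0// expR_gt0.
have mI : measurable I by exact: measurable_itv.
apply: (@lt_le_trans _ _ (\int[lebesgue_measure]_(x in I) c%:E)%E).
  rewrite integral_cst// mule_gt0//.
  by rewrite [X in (_ < X)%E]lebesgue_measure_itv /= lte_fin l0 -EFinB lte_fin subr_gt0.
apply: ge0_le_integral => //.
- by move=> x _; rewrite lee_fin ltW.
- by apply/measurable_EFinP; apply: measurable_funTS; exact: measurable_normal_pdf.
- move=> x; rewrite /I /= in_itv/= => /andP[x0 xl].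
  rewrite lee_fin /c !cE ler_wpM2l ?(ltW pk)// /normal_fun ler_expR !subr0.
  rewrite ler_wpM2r ?invr_ge0// ?mulrn_wge0 ?expr1n// lerN2 lerXn2r ?nnegrE// ltW//.
Qed.

(** * Increments along a line *)

Lemma cos_le0_pihalf_pi (R : realType) (x : R) : pi / 2 <= x <= pi -> cos x <= 0.
Proof.
move=> /andP[h1 h2]; have -> : x = (x - pi) + pi by rewrite subrK.
rewrite cosDpi oppr_le0; apply: cos_ge0_pihalf; have := pi_gt0 R; lra.
Qed.

(** On this window [cos (T (tau - r)) <= 0], so the resonant quotient has squared modulus at least
    [2 (T / pi)^2], while the other has at most [(T / pi)^2 / 4] because
    [tau + r >= 2 r >= 4 pi / T]. The conclusion follows from [(x - y)^2 >= x^2 / 2 - y^2]. *)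
Lemma gAB_ge (R : realType) (T r tau : R) : 0 < T -> 2 * pi <= r * T -> pi / 2 <= T * (tau - r) <= pi ->
  T ^+ 2 / (8 * pi ^+ 2 * r ^+ 2) <= gA T r tau ^+ 2 + gB T r tau ^+ 2.
Proof.
move=> T0 rT tr; have pi0 := pi_gt0 R.
have r0 : 0 < r by rewrite -(pmulr_lgt0 _ T0); lra.
have u0 : 0 < tau - r by rewrite -(pmulr_rgt0 _ T0); case/andP: tr; lra.
have w0 : 0 < tau + r by lra.
have cu := cos_le0_pihalf_pi tr.
have cw := cos_geN1 (T * (tau + r)).
have dT := cos2Dsin2 (T * tau); have dr := cos2Dsin2 (T * r).
have cuE : cos (T * (tau - r)) = cos (T * tau) * cos (T * r) + sin (T * tau) * sin (T * r) by rewrite mulrBr cosB.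
have cwE : cos (T * (tau + r)) = cos (T * tau) * cos (T * r) - sin (T * tau) * sin (T * r) by rewrite mulrDr cosD.
rewrite /gA /gB.
set ct := cos (T * tau) in dT cuE cwE *; set st := sin (T * tau) in dT cuE cwE *.
set cr := cos (T * r) in dr cuE cwE *; set sr := sin (T * r) in dr cuE cwE *.
set u := tau - r in u0 tr cu cuE *; set w := tau + r in w0 cw cwE *.
have uT : u <= pi / T by rewrite ler_pdivlMr// mulrC; case/andP: tr.
have hx : 2 * (T / pi) ^+ 2 <= ((ct - cr) / u) ^+ 2 + ((st - sr) / u) ^+ 2.
  apply: (@le_trans _ _ (2 * u^-1 ^+ 2)).
    rewrite ler_wpM2l// lerXn2r ?nnegrE ?divr_ge0 ?invr_ge0 ?(ltW T0) ?(ltW pi0) ?(ltW u0)//.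
    by rewrite -[leLHS]invf_div lef_pV2 ?posrE ?divr_gt0.
  rewrite !expr_div_n -mulrDl exprVn ler_wpM2r ?invr_ge0 ?sqr_ge0//.
  by rewrite !sqrrB; nra.
have hy : ((ct - cr) / w) ^+ 2 + ((st + sr) / w) ^+ 2 <= (T / pi) ^+ 2 / 4.
  apply: (@le_trans _ _ (4 * w^-1 ^+ 2)).
    rewrite !expr_div_n -mulrDl exprVn ler_wpM2r ?invr_ge0 ?sqr_ge0//.
    by rewrite sqrrB sqrrD; nra.
  have -> : (T / pi) ^+ 2 / 4 = 4 * (T / (4 * pi)) ^+ 2.
    have aux (a b : R) : b != 0 -> (a / b) ^+ 2 / 4 = 4 * (a / (4 * b)) ^+ 2 by move=> ?; field.
    by apply: aux; rewrite gt_eqF.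
  rewrite ler_wpM2l// lerXn2r ?nnegrE ?invr_ge0 ?(ltW w0)//; first by rewrite divr_ge0 ?mulr_ge0 ?(ltW T0) ?(ltW pi0).
  rewrite -[leRHS]invf_div lef_pV2 ?posrE ?divr_gt0 ?mulr_gt0// ler_pdivrMr//.
  have w2 : 2 * r <= w by move: u0; rewrite /u /w; lra.
  have : T * (2 * r) <= T * w by rewrite ler_wpM2l ?(ltW T0).
  lra.
have sq2 (a b : R) : a ^+ 2 / 2 - b ^+ 2 <= (a - b) ^+ 2.
  by have := sqr_ge0 (a - 2 * b); rewrite !sqrrB exprMn; lra.
have E : ((ct - cr) / (2 * r) * (w^-1 - u^-1)) ^+ 2 + (((st - sr) / u - (st + sr) / w) / (2 * r)) ^+ 2 =
  ((((ct - cr) / u - (ct - cr) / w) ^+ 2) + ((st - sr) / u - (st + sr) / w) ^+ 2) / (4 * r ^+ 2).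
  have [? [? ?]] : r != 0 /\ u != 0 /\ w != 0 by rewrite !gt_eqF.
  by field; apply/and3P.
rewrite E; have -> : T ^+ 2 / (8 * pi ^+ 2 * r ^+ 2) = ((T / pi) ^+ 2 / 2) / (4 * r ^+ 2).
  have aux (a b c : R) : b != 0 -> c != 0 -> a ^+ 2 / (8 * b ^+ 2 * c ^+ 2) = (a / b) ^+ 2 / 2 / (4 * c ^+ 2).
    by move=> ? ?; field; apply/andP.
  by apply: aux; rewrite gt_eqF.
apply: ler_wpM2r; first by rewrite invr_ge0; exact: mulr_ge0 (ler0n _ 4) (sqr_ge0 _).
have := sq2 ((ct - cr) / u) ((ct - cr) / w); have := sq2 ((st - sr) / u) ((st + sr) / w).
have := sqr_ge0 (T / pi); lra.
Qed.

Section line_increments.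
Context d0 (Om : measurableType d0) (R : realType) (P : probability Om R).
Variables (N : nat) (H cH : R) (h : 'rV[R]_N -> R) (v : R * 'rV[R]_N -> Om -> R).
Local Notation D := [set p : R * 'rV[R]_N | 0 <= p.1].
Local Notation TT := (R * N.-tuple R)%type.
Local Notation leb := (@lebesgue_measure R).
Hypothesis gv : centered_gaussian_field P D v (cov_kernel H cH h).
Hypothesis cH0 : 0 < cH.
Hypothesis mh : measurable_fun [set: N.-tuple R] (fun t => h (tup2row t)).
Hypothesis h0 : forall xi, 0 <= h xi.
Variable m : {sigma_finite_measure set N.-tuple R -> \bar R}.
Hypothesis m0 : forall f, measurable_fun setT f -> (forall x, (0 <= f x)%E) -> int_Rn f = (\int[m]_x f x)%E.
Hypothesis mi : forall f, m.-integrable setT f -> int_Rn f = (\int[m]_x f x)%E.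
Local Notation MM := (leb \x m)%E.
Local Notation k := (kern P v).
Variable MS : {sigma_finite_measure set (measurableTypeR R * N.-tuple R)%type -> \bar R}.
Hypothesis MSE : forall f : TT -> \bar R, (\int[MS]_z f z = \int[MM]_z f z)%E.

Variables (T : R) (xb : 'rV[R]_N) (i0 : 'I_N).
Hypothesis T0 : 0 < T.

(** A line at fixed time, because the field is stationary in space but starts from zero data in
    time. *)
Definition lpt (s : R) : R * 'rV[R]_N := (T, xb + s *: delta_mx 0 i0).
Definition xi0 (z : TT) : R := tnth z.2 i0.
Definition W0 (z : TT) : R :=
  cH * ((gA T (enorm (tup2row z.2)) z.1 ^+ 2 + gB T (enorm (tup2row z.2)) z.1 ^+ 2) * wgt H h z).
(* Spectral density of the increments of step [e] in the direction of [i0]; the coordinate [xi0] is their frequency. *)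
Definition weps (e : R) (z : TT) : R := W0 z * (2 * (1 - cos (e * xi0 z))).

Lemma xi0_meas : measurable_fun setT xi0.
Proof. apply: (@measurableT_comp _ _ _ _ _ _ (fun t : N.-tuple R => tnth t i0)) => //; exact: measurable_tnth. Qed.

Lemma W0_ge0 z : 0 <= W0 z.
Proof. by rewrite mulr_ge0 ?(ltW cH0)// mulr_ge0 ?wgt_ge0// addr_ge0// sqr_ge0. Qed.

Lemma Wf_line s s' z : cH * Wf H h (lpt s) (lpt s') z = W0 z * cos ((s - s') * xi0 z).
Proof.
rewrite /Wf /W0 /FRe /FIm /=.
have dE y : dotp (xb + y *: delta_mx 0 i0) (tup2row z.2) = dotp xb (tup2row z.2) + y * xi0 z.
  rewrite /dotp (eq_bigr (fun i => xb 0 i * tup2row z.2 0 i + y * ((i == i0)%:R * tup2row z.2 0 i))); last first.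
    by move=> i _; rewrite !mxE eqxx /=; ring.
  rewrite big_split/= -mulr_sumr; congr (_ + _ * _).
  rewrite (bigD1 i0)//= eqxx mul1r big1 ?addr0 ?mxE// => i ii.
  by rewrite (negbTE ii) mul0r.
rewrite !dE; have -> : (s - s') * xi0 z = (dotp xb (tup2row z.2) + s * xi0 z) - (dotp xb (tup2row z.2) + s' * xi0 z) by ring.
by rewrite cosB; ring.
Qed.

Let DT s : D (lpt s). Proof. exact: ltW. Qed.

Lemma W0_int : MM.-integrable setT (EFin \o W0).
Proof.
rewrite (_ : W0 = fun z => cH * Wf H h (lpt 0) (lpt 0) z).
  by apply: integrable_EFinZ; exact: (Wf_int gv cH0 mh h0 m0 (DT 0) (DT 0)).
by apply/funext => z; rewrite Wf_line subrr mul0r cos0 mulr1.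
Qed.

Let mW0 : measurable_fun setT W0. Proof. by have /measurable_EFinP := measurable_int _ W0_int. Qed.

Lemma kern_line s s' : k (lpt s) (lpt s') = \int[MM]_z (W0 z * cos ((s - s') * xi0 z)).
Proof.
rewrite (kern_spec gv cH0 mh h0 m0 mi (DT s) (DT s')) -RintegralZl//; last exact: (Wf_int gv cH0 mh h0 m0 (DT s) (DT s')).
by apply: eq_Rintegral => z _; rewrite Wf_line.
Qed.

Lemma weps_ge0 e z : 0 <= weps e z.
Proof. by rewrite mulr_ge0 ?W0_ge0// mulr_ge0// subr_ge0 cos_le1. Qed.

Lemma weps_meas e : measurable_fun setT (weps e).
Proof.
apply: measurable_funM => //; apply: measurable_funM => //; apply: measurable_funB => //.
apply: (measurableT_comp (@measurable_cos R)); apply: measurable_funM => //; exact: xi0_meas.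
Qed.

Lemma weps_int e : MM.-integrable setT (EFin \o weps e).
Proof.
apply: (@le_integrable _ _ _ MM setT measurableT _ (EFin \o (fun z => 4 * W0 z))).
- by apply/measurable_EFinP; exact: weps_meas.
- move=> z _ /=; rewrite lee_fin (ger0_norm (weps_ge0 e z)) (ger0_norm (mulr_ge0 _ (W0_ge0 z)))//.
  by rewrite /weps mulrC; apply: ler_wpM2r; [exact: W0_ge0|have := cos_geN1 (e * xi0 z); lra].
- by apply: integrable_EFinZ; exact: W0_int.
Qed.

(** Taking the difference in both arguments multiplies the spectral density by [|exp (i e xi0) -
    1|^2 = 2 (1 - cos (e xi0))], and leaves a function of [s - s']. *)
Lemma incr_cov_line e s s' :
  k (lpt (s + e)) (lpt (s' + e)) - k (lpt (s + e)) (lpt s') - k (lpt s) (lpt (s' + e)) + k (lpt s) (lpt s') =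
  Rf MS (weps e) xi0 (s - s').
Proof.
have iW u : MM.-integrable setT (EFin \o (fun z => W0 z * cos (u * xi0 z))).
  apply: (@le_integrable _ _ _ MM setT measurableT _ (EFin \o W0)); last exact: W0_int.
    apply/measurable_EFinP; apply: measurable_funM => //; apply: (measurableT_comp (@measurable_cos R)).
    by apply: measurable_funM => //; exact: xi0_meas.
  move=> z _ /=; rewrite lee_fin normrM (ger0_norm (W0_ge0 z)) -[leRHS]mulr1 ler_wpM2l ?W0_ge0//.
  by rewrite ler_norml cos_geN1 cos_le1.
rewrite !kern_line -!RintegralB//; last exact: integrable_EFinB.
rewrite -RintegralD//; last by apply: integrable_EFinB => //; exact: integrable_EFinB.
transitivity (\int[MM]_z (weps e z * cos ((s - s') * xi0 z))); last first.
  by rewrite /Rf /Rintegral MSE.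
apply: eq_Rintegral => z _; rewrite /weps.
have -> : (s + e - (s' + e)) * xi0 z = (s - s') * xi0 z by ring.
have -> : (s + e - s') * xi0 z = (s - s') * xi0 z + e * xi0 z by ring.
have -> : (s - (s' + e)) * xi0 z = (s - s') * xi0 z - e * xi0 z by ring.
by rewrite cosB cosD; ring.
Qed.

Section bounds.
Variables (be c1 c2 al : R).
Hypothesis N0 : (0 < N)%N.
Hypothesis H01 : 0 <= 2 * H - 1 < 1.
Hypothesis be0 : 0 < be.
Hypothesis al01 : 0 < al < 1.
Hypothesis alE : al = (2 * H + 1 - N%:R + be) / 2.
Hypothesis c10 : 0 < c1.
Hypothesis c20 : 0 < c2.
Hypothesis hle : forall xi, xi != 0 -> h xi <= c2 * enorm xi `^ (- be).
Hypothesis hge : forall xi, xi != 0 -> c1 * enorm xi `^ (- be) <= h xi.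

(** Interpolation between the bounds [x^2] and 4; the exponent [1 + al] is dictated by
    [marginal_bound]. *)
Lemma one_sub_cos_le (x : R) : 2 * (1 - cos x) <= 4 * `|x| `^ (1 + al).
Proof.
have /andP[a0 a1] := al01.
have h1 : 2 * (1 - cos x) <= `|x| ^+ 2.
  have := sin_lip (x / 2) 0; rewrite sin0 !subr0 => hs.
  have : `|sin (x / 2)| ^+ 2 <= `|x / 2| ^+ 2 by rewrite lerXn2r ?nnegrE.
  have -> : cos x = 1 - 2 * sin (x / 2) ^+ 2.
    rewrite {1}(_ : x = x / 2 + x / 2); last by field.
    by rewrite cosD -!expr2; have := cos2Dsin2 (x / 2); lra.
  rewrite real_normK ?num_real// normrM (ger0_norm (_ : 0 <= 2^-1)) ?invr_ge0// exprMn; lra.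
have [x1|x1] := leP `|x| 1.
  apply: (le_trans h1); have [->|x0] := eqVneq x 0.
    by rewrite normr0 expr0n /= mulr_ge0// powR_ge0.
  apply: (@le_trans _ _ (`|x| `^ (1 + al))); last by have := powR_ge0 `|x| (1 + al); lra.
  rewrite -powR_mulrn//; apply: ger_powR => //; last by lra.
  by rewrite normr_gt0 x0.
have : 1 <= `|x| `^ (1 + al).
  rewrite -[leLHS](powRr0 `|x|); apply: ler_powR; [exact: ltW|lra].
by have := cos_geN1 x; lra.
Qed.

Lemma gauss_le_Jp (x : R) : expR (- (x ^+ 2 / 2)) <= 2 * Jp 0 2 x.
Proof.
rewrite /Jp oppr0 powRr0; case: ifPn => hx.
  rewrite mulr1; apply: (@le_trans _ _ 1); last by lra.
  by rewrite -[leRHS]expR0 ler_expR oppr_le0 divr_ge0// sqr_ge0.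
rewrite -ltNge in hx.
have x0 : 0 < x ^+ 2 by rewrite -real_normK ?num_real// exprn_gt0//; lra.
rewrite expRN powRN (powR_mulrn 2)// real_normK ?num_real//.
have -> : 2 * (x ^+ 2)^-1 = (x ^+ 2 / 2)^-1 by rewrite invf_div.
rewrite lef_pV2 ?posrE ?expR_gt0 ?divr_gt0//.
have := @expR_ge1Dx R (x ^+ 2 / 2); lra.
Qed.

Let N1 : (0 : R) < N%:R. Proof. by rewrite ltr0n. Qed.

(** Inside the unit ball the radial power is spread over all coordinates. Outside, direction [i0]
    keeps the Gaussian factor alone, and the remaining power [- (N - 1) - al] of [r] is spread over
    the other [N - 1] coordinates with exponent [1 + al / N] each, above 1. *)
Lemma radial_product (t : N.-tuple R) (y : R) (r := enorm (tup2row t)) : (forall i, tnth t i != 0) ->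
  `|tnth t i0| `^ (1 + al) * mu_min 1 r ^+ 2 * r `^ (- (2 * H - 1 + be)) * expR (- ((tnth t i0 - y) ^+ 2 / 2)) <=
  \prod_(i < N) Jp ((2 * H - 1 + be) / N%:R) 2 (1 * tnth t i - 0) +
  \prod_(i < N) (if i == i0 then 2 * Jp 0 2 (1 * tnth t i - y) else Jp 0 (1 + al / N%:R) (1 * tnth t i - 0)).
Proof.
move=> nz; have r0 : 0 < r by apply: (@enorm_gt0 _ _ _ i0); rewrite mxE.
have /andP[a0 a1] := al01.
have xr : `|tnth t i0| <= r.
  by have := enormf_coord (fun i => tup2row t 0 i) i0; rewrite mxE.
have e01 : 0 <= expR (- ((tnth t i0 - y) ^+ 2 / 2)) <= 1.
  by rewrite expR_ge0 -[leRHS]expR0 ler_expR oppr_le0 divr_ge0// sqr_ge0.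
have p1 : 0 <= \prod_(i < N) Jp ((2 * H - 1 + be) / N%:R) 2 (1 * tnth t i - 0).
  by apply: prodr_ge0 => i _; exact: Jp_ge0.
have p2 : 0 <= \prod_(i < N) (if i == i0 then 2 * Jp 0 2 (1 * tnth t i - y) else Jp 0 (1 + al / N%:R) (1 * tnth t i - 0)).
  by apply: prodr_ge0 => i _; case: ifP => _; rewrite ?mulr_ge0 ?Jp_ge0.
have xg : `|tnth t i0| `^ (1 + al) <= r `^ (1 + al).
  by apply: ge0_ler_powR; rewrite ?nnegrE ?(ltW r0)//; lra.
have g0 : 0 <= `|tnth t i0| `^ (1 + al) by exact: powR_ge0.
have sb : 0 <= 2 * H - 1 + be by case/andP: H01 => ? _; rewrite addr_ge0// ltW.
have [r1|r1] := leP r 1.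
  rewrite -[leLHS]addr0; apply: lerD => //.
  have h1 := @Jp_prod_le R N N0 ((2 * H - 1 + be) / N%:R) 2 ((2 * H - 1 + be) / N%:R) 0 1 t nz ltr01.
  rewrite mul1r divfK ?gt_eqF// in h1.
  apply: le_trans (h1 _ _ _) => //; first last.
  - by rewrite -/r ltNge r1.
  - by rewrite divr_ge0// ltW.
  have -> : mu_min 1 r = 1 by rewrite /mu_min min_l// invf_ge1.
  have q0 : 0 <= r `^ (- (2 * H - 1 + be)) by exact: powR_ge0.
  have x1 : `|tnth t i0| `^ (1 + al) <= 1.
    apply: (le_trans xg); apply: (@le_trans _ _ (1 `^ (1 + al))); last by rewrite powR1.
    by apply: ge0_ler_powR; rewrite ?nnegrE ?(ltW r0)//; lra.
  rewrite expr1n mulr1 -/r; case/andP: e01 => E0 E1.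
  apply: (@le_trans _ _ (1 * r `^ (- (2 * H - 1 + be)) * 1)); last by rewrite mul1r mulr1.
  by rewrite ler_pM ?mulr_ge0// ler_wpM2r.
rewrite -[leLHS]add0r; apply: lerD => //.
have -> : mu_min 1 r = r^-1 by rewrite /mu_min min_r// invf_le1// ltW.
rewrite (bigD1 i0)//= eqxx mulrC mul1r; apply: ler_pM.
- exact: expR_ge0.
- by rewrite mulr_ge0 ?powR_ge0// mulr_ge0// sqr_ge0.
- exact: gauss_le_Jp.
pose b := 1 + al / N%:R.
have b0 : 0 <= b by rewrite addr_ge0// divr_ge0// ltW.
apply: (@le_trans _ _ (\prod_(i < N | i != i0) r `^ (- b))); last first.
  apply: ler_prod => i /negbTE ii; rewrite powR_ge0 ii mul1r subr0 /Jp /=.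
  have xir : `|tnth t i| <= r by have := enormf_coord (fun i => tup2row t 0 i) i; rewrite mxE.
  have xi_0 : 0 < `|tnth t i| by rewrite normr_gt0.
  case: ifPn => hx; last exact: powR_neg_le.
  rewrite oppr0 powRr0 -[leRHS](powRr0 r); apply: ler_powR; [exact: ltW|lra].
have -> : \prod_(i < N | i != i0) r `^ (- b) = (r `^ (- b)) ^+ N.-1.
  transitivity (\prod_(i in predC1 i0) r `^ (- b)); first exact: eq_bigl.
  by rewrite prodr_const cardC1 card_ord.
rewrite -(powR_mulrn N.-1 (powR_ge0 r (- b))) -powRrM.
have N11 : N.-1%:R = N%:R - 1 :> R by rewrite -subn1 natrB.
apply: (@le_trans _ _ (r `^ (1 + al) * r^-1 ^+ 2 * r `^ (- (2 * H - 1 + be)))).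
  by rewrite ler_wpM2r ?powR_ge0// ler_wpM2r ?sqr_ge0.
have -> : r^-1 ^+ 2 = r `^ (- 2) by rewrite powRN (powR_mulrn 2) ?(ltW r0)// exprVn.
have rn : r != 0 by rewrite gt_eqF.
rewrite -!powRD; try by apply/implyP.
apply: ler_powR; first exact: ltW.
rewrite N11 /b.
have h1 : al / N%:R * N%:R = al by rewrite divfK// gt_eqF.
have h2 : 0 <= al / N%:R by rewrite divr_ge0// ltW.
move: alE h1 h2; set q := al / N%:R; lra.
Qed.

(** The exponent [1 + al] lies midway between [2 al] and 2. Exceeding [2 al] makes the mass near any
    frequency small against the variance; staying below [1 + 2 al] keeps the integrals over the
    other coordinates convergent. *)
Lemma marginal_bound : exists2 C : R, 0 < C & forall e y : R, 0 < e ->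
  (\int[MM]_z (weps e z * expR (- ((xi0 z - y) ^+ 2 / 2)))%:E <= (C * e `^ (1 + al))%:E)%E.
Proof.
have /andP[a0 a1] := al01.
have [C1 C10 hC1] := tonelli_bound m0 N0 (ltW T0) H01.
pose e1 := (2 * H - 1 + be) / N%:R; pose e2 := 1 + al / N%:R.
have sb : 0 <= 2 * H - 1 + be by case/andP: H01 => ? _; rewrite addr_ge0// ltW.
have e11 : 0 <= e1 < 1.
  rewrite divr_ge0 ?(ltW N1)//= /e1 ltr_pdivrMr// mul1r; move: alE a1; lra.
have e21 : 1 < e2 by rewrite /e2 ltrDl divr_gt0.
have [Ca Ca0 ia] : exists2 C : R, 0 < C & forall dl c : R, 0 < dl ->
  (\int[leb]_x (Jp e1 2 (dl * x - c))%:E <= (C / dl)%:E)%E by apply: Jp_int; rewrite ?ltr1n.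
have [Cb Cb0 ib] : exists2 C : R, 0 < C & forall dl c : R, 0 < dl ->
  (\int[leb]_x (Jp 0 e2 (dl * x - c))%:E <= (C / dl)%:E)%E by apply: Jp_int; rewrite ?lexx ?ltr01.
have [Cc Cc0 ic] : exists2 C : R, 0 < C & forall dl c : R, 0 < dl ->
  (\int[leb]_x (Jp 0 2 (dl * x - c))%:E <= (C / dl)%:E)%E by apply: Jp_int; rewrite ?lexx ?ltr01 ?ltr1n.
pose K := cH * (4 * (T + 1) ^+ 2) * c2 * 4.
have K0 : 0 < K by rewrite !mulr_gt0//; move: T0; lra.
pose Pa := \prod_(i < N) Ca; pose Pb := \prod_(i < N) (if i == i0 then 2 * Cc else Cb).
have Pa0 : 0 < Pa by apply: prodr_gt0.
have Pb0 : 0 < Pb by apply: prodr_gt0 => i _; case: ifP => _ //; rewrite mulr_gt0.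
exists (C1 * K * (Pa + Pb)); first by rewrite !mulr_gt0// addr_gt0.
move=> e y ep.
pose E (t : N.-tuple R) : R := expR (- ((tnth t i0 - y) ^+ 2 / 2)).
pose B (t : N.-tuple R) := K * e `^ (1 + al) *
   (`|tnth t i0| `^ (1 + al) * mu_min 1 (enorm (tup2row t)) ^+ 2 * enorm (tup2row t) `^ (- be) * E t).
have mE : measurable_fun setT E.
  apply: (measurableT_comp (@measurable_expR R)); apply: measurable_funN; apply: measurable_funM => //.
  by apply: measurable_funX; apply: measurable_funB => //; exact: measurable_tnth.
have mmu : measurable_fun setT (fun t : N.-tuple R => mu_min 1 (enorm (tup2row t))).
  by apply: measurable_minr => //; apply: measurable_invr; exact: enorm_meas.
have mpow z : measurable_fun setT (fun t : N.-tuple R => enorm (tup2row t) `^ z).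
  apply: (@measurableT_comp _ _ _ _ _ _ (fun x => x `^ z)) => //; exact: enorm_meas.
have mxi : measurable_fun setT (fun t : N.-tuple R => `|tnth t i0| `^ (1 + al)).
  exact: (measurableT_comp (absX_meas (1 + al)) (measurable_tnth i0)).
have B0 t : 0 <= B t.
  rewrite mulr_ge0 ?(mulr_ge0 (ltW K0) (powR_ge0 _ _))// mulr_ge0 ?expR_ge0// mulr_ge0 ?powR_ge0//.
  by rewrite mulr_ge0 ?powR_ge0 ?sqr_ge0.
have hI : (\int[MM]_z (weps e z * expR (- ((xi0 z - y) ^+ 2 / 2)))%:E <= \int[m]_t (C1 * (B t * enorm (tup2row t) `^ (- (2 * H - 1))))%:E)%E.
  apply: (hC1 (fun z => weps e z * E z.2)) => //.
  - by apply: measurable_funM; [exact: weps_meas|exact: (measurableT_comp mE)].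
  - by move=> z; rewrite mulr_ge0 ?weps_ge0 ?expR_ge0.
  - apply: measurable_funM => //; apply: measurable_funM => //; apply: measurable_funM => //; apply: measurable_funM => //.
    exact: measurable_funX.
  move=> t tau nz r h1 h2.
  have r0 : 0 < r by apply: (@enorm_gt0 _ _ _ i0); rewrite mxE.
  have x0 : tup2row t != 0.
    by apply: contraTneq (nz i0) => /rowP /(_ i0); rewrite !mxE => ->; rewrite eqxx.
  have TT0 : 0 <= T <= T by rewrite lexx ltW.
  have AB := gAB_le TT0 r0 h1 h2; have hh := hle x0.
  have cc := one_sub_cos_le (e * tnth t i0).
  rewrite normrM (gtr0_norm ep) powRM ?(ltW ep)// in cc.
  rewrite /weps /W0 /wgt /xi0 /= -/r (_ : 1 - 2 * H = - (2 * H - 1)); last by ring.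
  have pt := powR_ge0 `|tau| (- (2 * H - 1)).
  have ab0 : 0 <= gA T r tau ^+ 2 + gB T r tau ^+ 2 by rewrite addr_ge0// sqr_ge0.
  have s1 := ler_pM ab0 (mulr_ge0 pt (h0 (tup2row t))) AB (ler_wpM2l pt hh).
  have cos0 : 0 <= 2 * (1 - cos (e * tnth t i0)) by rewrite mulr_ge0// subr_ge0 cos_le1.
  have s2 := ler_pM (mulr_ge0 ab0 (mulr_ge0 pt (h0 (tup2row t)))) cos0 s1 cc.
  have s3 := ler_wpM2r (expR_ge0 (- ((tnth t i0 - y) ^+ 2 / 2))) (ler_wpM2l (ltW cH0) s2).
  rewrite /B -/r /E /K; apply: le_trans (le_trans _ s3) _; rewrite le_eqVlt; apply/orP; left; apply/eqP; ring.
apply: (le_trans hI).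
pose ga t := \prod_(i < N) Jp e1 2 (1 * tnth t i - 0).
pose gb t := \prod_(i < N) (if i == i0 then 2 * Jp 0 2 (1 * tnth t i - y) else Jp 0 e2 (1 * tnth t i - 0)).
have mJ a b c : measurable_fun [set: R] (fun x => Jp a b (1 * x - c)).
  apply: measurableT_comp; first exact: Jp_meas.
  by apply: measurable_funB => //; exact: measurable_funM.
pose gbi (i : 'I_N) (x : R) := if i == i0 then 2 * Jp 0 2 (1 * x - y) else Jp 0 e2 (1 * x - 0).
have mgbi i : measurable_fun setT (gbi i).
  by rewrite /gbi; case: (i == i0); [apply: measurable_funM => //|]; exact: mJ.
have gbi0 i x : 0 <= gbi i x by rewrite /gbi; case: ifP => _; rewrite ?mulr_ge0 ?Jp_ge0.
have mga : measurable_fun setT ga.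
  apply: measurable_prod => i _; apply: (measurableT_comp (mJ _ _ _)); exact: measurable_tnth.
have mgb : measurable_fun setT gb.
  apply: measurable_prod => i _; apply: (measurableT_comp (mgbi i)); exact: measurable_tnth.
have ga0 t : 0 <= ga t by apply: prodr_ge0 => i _; exact: Jp_ge0.
have gb0 t : 0 <= gb t by apply: prodr_ge0 => i _; exact: gbi0.
have iga : (\int[m]_t (ga t)%:E <= Pa%:E)%E.
  rewrite -m0; [|by apply/measurable_EFinP|by move=> t; rewrite lee_fin].
  apply: (@int_Rn_prod_le R N (fun _ x => Jp e1 2 (1 * x - 0))) => // [i x|i]; first exact: Jp_ge0.
  by have := ia 1 0 ltr01; rewrite divr1.
have igb : (\int[m]_t (gb t)%:E <= Pb%:E)%E.
  rewrite -m0; [|by apply/measurable_EFinP|by move=> t; rewrite lee_fin].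
  apply: (@int_Rn_prod_le R N gbi) => // i; rewrite /gbi; case: ifP => _; last by have := ib 1 0 ltr01; rewrite divr1.
  under eq_integral do rewrite EFinM.
  rewrite ge0_integralZl//.
  - by rewrite EFinM; apply: lee_wpmul2l => //; have := ic 1 y ltr01; rewrite divr1.
  - by apply/measurable_EFinP; exact: mJ.
  - by move=> x _; rewrite lee_fin Jp_ge0.
pose Q := C1 * K * e `^ (1 + al).
have Q0 : 0 <= Q by apply: mulr_ge0 (powR_ge0 _ _); apply: ltW; exact: mulr_gt0.
apply: (@le_trans _ _ (\int[m]_t (Q * ga t + Q * gb t)%:E)%E); last first.
  rewrite ge0_integral_lincomb//.
  apply: (@le_trans _ _ (Q%:E * Pa%:E + Q%:E * Pb%:E)%E).
    by apply: leeD; apply: lee_wpmul2l; rewrite ?lee_fin.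
  by rewrite -!EFinM -EFinD lee_fin /Q le_eqVlt; apply/orP; left; apply/eqP; ring.
apply: ae_ge0_le_integral => //.
- by move=> t _; rewrite lee_fin mulr_ge0 ?(ltW C10)// mulr_ge0 ?powR_ge0.
- apply/measurable_EFinP; apply: measurable_funM => //; apply: measurable_funM => //.
  apply: measurable_funM => //; apply: measurable_funM => //; apply: measurable_funM => //; apply: measurable_funM => //.
  exact: measurable_funX.
- by move=> t _; rewrite lee_fin addr_ge0// mulr_ge0.
- by apply/measurable_EFinP; apply: measurable_funD; apply: measurable_funM.
apply: filterS (tuple_nz_ae m0) => t nz _; rewrite lee_fin -mulrDr.
have := ler_wpM2l Q0 (radial_product y nz).
have r0 : enorm (tup2row t) != 0.
  by rewrite gt_eqF//; apply: (@enorm_gt0 _ _ _ i0); rewrite mxE.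
have -> : enorm (tup2row t) `^ (- (2 * H - 1 + be)) = enorm (tup2row t) `^ (- be) * enorm (tup2row t) `^ (- (2 * H - 1)).
  by rewrite -powRD; [congr (_ `^ _); ring|apply/implyP].
move=> hh; apply: le_trans hh; rewrite /Q /B /E le_eqVlt; apply/orP; left; apply/eqP; ring.
Qed.

Let bl (c rho x : R) : R := (`|1 * x - c| <= rho)%R%:R.

Let bl_meas c rho : measurable_fun [set: R] (bl c rho).
Proof.
rewrite (_ : bl c rho = fun x => if `|1 * x - c| <= rho then 1 else 0); last by apply/funext => x; rewrite /bl; case: ifP.
apply: measurable_fun_ifT => //; apply: measurable_fun_ler => //.
by apply: measurableT_comp => //; apply: measurable_funB => //; exact: measurable_funM.
Qed.

Let bl_int c rho : 0 <= rho -> (\int[leb]_x (bl c rho x)%:E = (2 * rho)%:E)%E.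
Proof. by move=> r0; rewrite leb_affine_ball// divr1. Qed.

(** One region carries enough mass: [xi0] between [pi / (2 e)] and [pi / e], where
    [1 - cos (e xi0) >= 1], the other coordinates in [[0, 1 / e]], and [tau] in the window of
    [gAB_ge]. There [r] is of order [1 / e], the density at least of order [e ^ X], the volume of
    order [e ^ -N], and [X - N = 2 al]. *)
Lemma variance_lower : exists2 c : R, 0 < c & forall e : R, 0 < e -> e <= T / 4 ->
  ((c * e `^ (2 * al))%:E <= \int[MM]_z (weps e z)%:E)%E.
Proof.
have pi0 := pi_gt0 R; have pi2 := pi_ge2 R.
pose CN := N%:R * (pi + 1) : R.
have CN0 : 0 < CN by rewrite mulr_gt0//; lra.
pose X := 2 + (2 * H - 1) + be.
pose K := cH * (T ^+ 2 / (8 * pi ^+ 2)) * 2 `^ (- (2 * H - 1)) * c1 * 2 * CN `^ (- X).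
have K0 : 0 < K.
  rewrite /K mulr_gt0 ?powR_gt0// mulr_gt0// mulr_gt0// mulr_gt0 ?powR_gt0// mulr_gt0// divr_gt0 ?exprn_gt0//.
  by rewrite mulr_gt0// exprn_gt0.
exists (K * (pi / (2 * T))); first by rewrite mulr_gt0// divr_gt0// mulr_gt0.
move=> e e0 eT.
pose ci (i : 'I_N) : R := if i == i0 then 3 * pi / (4 * e) else 1 / (2 * e).
pose ri (i : 'I_N) : R := if i == i0 then pi / (4 * e) else 1 / (2 * e).
pose G (z : TT) : R := bl (enorm (tup2row z.2) + 3 * pi / (4 * T)) (pi / (4 * T)) z.1 * \prod_(i < N) bl (ci i) (ri i) (tnth z.2 i).
have ri0 i : 0 <= ri i.
  by rewrite /ri; case: ifP => _; rewrite divr_ge0 ?mulr_ge0 ?(ltW e0) ?(ltW pi0).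
have bl0 c rho x : 0 <= bl c rho x by rewrite /bl ler0n.
have G0 z : 0 <= G z by rewrite mulr_ge0// prodr_ge0.
have mp : measurable_fun setT (fun t : N.-tuple R => \prod_(i < N) bl (ci i) (ri i) (tnth t i)).
  apply: measurable_prod => i _; apply: (measurableT_comp (bl_meas _ _)); exact: measurable_tnth.
have mG : measurable_fun setT G.
  apply: measurable_funM; last exact: (measurableT_comp mp).
  rewrite (_ : (fun z => _) = fun z : TT => bl (3 * pi / (4 * T)) (pi / (4 * T)) (z.1 - enorm (tup2row z.2))).
    apply: (measurableT_comp (bl_meas _ _)); apply: measurable_funB; first exact: measurable_fst.
    exact: (measurableT_comp (@enorm_meas R N)).
  by apply/funext => z; rewrite /bl; congr (nat_of_bool (`|_| <= _))%:R; ring.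
have pw z : K * e `^ X * G z <= weps e z.
  have [inI|/forallPn[i hi]] := boolP [forall i, `|1 * tnth z.2 i - ci i| <= ri i]; last first.
    rewrite /G (bigD1 i)//= {2}/bl (negbTE hi) mul0r mulr0 mulr0; exact: weps_ge0.
  rewrite /G /bl; case: (boolP (_ <= pi / (4 * T))) => hz; last by rewrite mul0r mulr0 weps_ge0.
  rewrite mul1r big1 ?mulr1; last by move=> i _; rewrite (forallP inI i).
  set r := enorm _ in hz *.
  have x0i : pi / (2 * e) <= tnth z.2 i0 <= pi / e.
    have := forallP inI i0; rewrite /ci /ri eqxx mul1r ler_norml.
    have -> : 3 * pi / (4 * e) = 3 * (pi / (4 * e)) by rewrite mulrA.
    have -> : pi / (2 * e) = 2 * (pi / (4 * e)) by field; rewrite gt_eqF.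
    have -> : pi / e = 4 * (pi / (4 * e)) by field; rewrite gt_eqF.
    lra.
  have /andP[x1 x2] := x0i.
  have px : 0 < pi / (2 * e) by rewrite divr_gt0// mulr_gt0.
  have rx : tnth z.2 i0 <= r.
    have := enormf_coord (fun i => tup2row z.2 0 i) i0; rewrite mxE -/(enorm _) -/r.
    by apply: le_trans; exact: ler_norm.
  have r0 : 0 < r by lra.
  (* Here [e <= T / 4] enters: [r >= pi / (2 e)] brings the frequency into the range of [gAB_ge]. *)
  have rT : 2 * pi <= r * T.
    apply: (@le_trans _ _ (pi / (2 * e) * T)); last by rewrite ler_wpM2r ?(ltW T0)//; lra.
    rewrite mulrAC ler_pdivlMr ?mulr_gt0//.
    have : pi * (4 * e) <= pi * T by rewrite ler_wpM2l ?(ltW pi0)//; lra.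
    lra.
  have rC : r <= CN / e.
    apply: (le_trans (enormf_le_sum (fun i => tup2row z.2 0 i))).
    apply: (@le_trans _ _ (\sum_(i < N) ((pi + 1) / e))); last first.
      by rewrite sumr_const card_ord -mulr_natl mulrA.
    apply: ler_sum => i _; rewrite mxE.
    have ie : 0 < e^-1 by rewrite invr_gt0.
    have pe : 0 < pi / e by rewrite divr_gt0.
    have : (pi + 1) / e = pi / e + e^-1 by rewrite mulrDl mul1r.
    have [->|ii] := eqVneq i i0; first by rewrite ler_norml; lra.
    have := forallP inI i; rewrite /ci /ri (negbTE ii) mul1r !ler_norml.
    have -> : 1 / (2 * e) = e^-1 / 2 by field; rewrite gt_eqF.
    lra.
  have tr : pi / 2 <= T * (z.1 - r) <= pi.
    move: hz; rewrite mul1r ler_norml.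
    have -> : 3 * pi / (4 * T) = 3 * (pi / (4 * T)) by rewrite mulrA.
    move=> /andP[h1 h2].
    have E1 : T * (pi / (4 * T)) = pi / 4 by field; rewrite gt_eqF.
    have q1 : 2 * (pi / (4 * T)) <= z.1 - r by lra.
    have q2 : z.1 - r <= 4 * (pi / (4 * T)) by lra.
    have := ler_wpM2l (ltW T0) q1; have := ler_wpM2l (ltW T0) q2.
    by rewrite mulrCA (mulrCA T 2) E1 => *; apply/andP; split; lra.
  have AB := gAB_ge T0 rT tr.
  have tau0 : 0 < z.1 by have := r0; have : 0 < z.1 - r by [rewrite -(pmulr_rgt0 _ T0); case/andP: tr; lra]; lra.
  have taur : z.1 <= 2 * r.
    have : T * (z.1 - r) <= T * r by case/andP: tr => _ hT; rewrite (le_trans hT)// mulrC; lra.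
    by rewrite ler_pM2l//; lra.
  have x0 : tup2row z.2 != 0.
    have nz : tnth z.2 i0 != 0 by rewrite gt_eqF//; lra.
    by apply: contraTneq nz => /rowP /(_ i0); rewrite !mxE => ->; rewrite eqxx.
  have hh := hge x0; rewrite -/r in hh.
  have s0 : 0 <= 2 * H - 1 by case/andP: H01.
  have wt : 2 `^ (- (2 * H - 1)) * r `^ (- (2 * H - 1)) <= `|z.1| `^ (1 - 2 * H).
    rewrite (_ : 1 - 2 * H = - (2 * H - 1)); last by ring.
    by rewrite -powRM ?(ltW r0)// (gtr0_norm tau0); exact: powR_neg_le.
  have co : 2 <= 2 * (1 - cos (e * xi0 z)).
    have : cos (e * xi0 z) <= 0.
      apply: cos_le0_pihalf_pi; rewrite /xi0.
      have := ler_wpM2l (ltW e0) x1; have := ler_wpM2l (ltW e0) x2.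
      have -> : e * (pi / e) = pi by field; rewrite gt_eqF.
      have -> : e * (pi / (2 * e)) = pi / 2 by field; rewrite gt_eqF.
      by move=> -> ->.
    lra.
  have rX : CN `^ (- X) * e `^ X <= r `^ (- X).
    have -> : CN `^ (- X) * e `^ X = (CN / e) `^ (- X).
      rewrite powRM ?invr_ge0 ?(ltW e0) ?(ltW CN0)//; congr (_ * _).
      by rewrite -powR_inv1 ?(ltW e0)// -powRrM mulN1r opprK.
    by apply: powR_neg_le => //; rewrite /X -addrA; apply: addr_ge0 => //; apply: addr_ge0 => //; exact: ltW.
  have XE : r `^ (- X) = r^-1 ^+ 2 * r `^ (- (2 * H - 1)) * r `^ (- be).
    rewrite (_ : r^-1 ^+ 2 = r `^ (- 2)); last by rewrite powRN (powR_mulrn 2) ?(ltW r0)// exprVn.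
    have rn0 : r != 0 by rewrite gt_eqF.
    rewrite -powRD; last by apply/implyP.
    rewrite -powRD; last by apply/implyP.
    by congr (_ `^ _); rewrite /X; ring.
  rewrite /weps /W0 /wgt -/r.
  have m1 := ler_pM (mulr_ge0 (powR_ge0 _ _) (powR_ge0 _ _)) (mulr_ge0 (ltW c10) (powR_ge0 _ _)) wt hh.
  have p8 : 0 <= T ^+ 2 / (8 * pi ^+ 2 * r ^+ 2) by apply: divr_ge0 (sqr_ge0 _) (mulr_ge0 (mulr_ge0 (ler0n _ 8) (sqr_ge0 _)) (sqr_ge0 _)).
  have mm0 : 0 <= 2 `^ (- (2 * H - 1)) * r `^ (- (2 * H - 1)) * (c1 * r `^ (- be)).
    by rewrite mulr_ge0 ?mulr_ge0 ?powR_ge0 ?(ltW c10).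
  have m2 := ler_wpM2l (ltW cH0) (ler_pM p8 mm0 AB m1).
  have m3 := ler_pM (mulr_ge0 (ltW cH0) (mulr_ge0 p8 mm0)) (ler0n R 2) m2 co.
  apply: le_trans m3.
  have KK : 0 <= cH * (T ^+ 2 / (8 * pi ^+ 2)) * 2 `^ (- (2 * H - 1)) * c1 * 2.
    apply: mulr_ge0 => //; apply: mulr_ge0 (ltW c10); apply: mulr_ge0 (powR_ge0 _ _).
    apply: mulr_ge0 (ltW cH0) _; exact: divr_ge0 (sqr_ge0 _) (mulr_ge0 (ler0n _ 8) (sqr_ge0 _)).
  have := ler_wpM2l KK rX; rewrite XE /K.
  have rn : r != 0 by rewrite gt_eqF.
  have pn : (pi : R) != 0 by rewrite gt_eqF.
  move=> hq; apply: le_trans (le_trans _ hq) _; first by rewrite le_eqVlt; apply/orP; left; apply/eqP; ring.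
  have aux (a b c f q g y k' : R) : c != 0 -> b != 0 ->
      k' * (a / (8 * b)) * f * q * 2 * (c^-1 ^+ 2 * g * y) = k' * (a / (8 * b * c ^+ 2) * (f * g * (q * y))) * 2.
    by move=> ? ?; field; apply/andP.
  by rewrite le_eqVlt; apply/orP; left; apply/eqP; apply: aux => //; rewrite expf_neq0.
have KX : 0 <= K * e `^ X by rewrite mulr_ge0 ?(ltW K0)// powR_ge0.
apply: (@le_trans _ _ (\int[MM]_z (K * e `^ X * G z)%:E)%E); last first.
  apply: ge0_le_integral => //.
  - by move=> z _; rewrite lee_fin mulr_ge0.
  - by apply/measurable_EFinP; apply: measurable_funM.
  - by apply/measurable_EFinP; exact: weps_meas.
  - by move=> z _; rewrite lee_fin.
under eq_integral do rewrite EFinM.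
have mGE : measurable_fun setT (EFin \o G) by apply/measurable_EFinP.
rewrite ge0_integralZl//; last by move=> z _; rewrite lee_fin.
rewrite fubini_tonelli2//.
have inner t : (\int[leb]_x (G (x, t))%:E = (pi / (2 * T))%:E * (\prod_(i < N) bl (ci i) (ri i) (tnth t i))%:E)%E.
  rewrite /G /=; under eq_integral do rewrite EFinM muleC.
  rewrite ge0_integralZl//.
  - rewrite bl_int ?divr_ge0 ?mulr_ge0 ?(ltW pi0) ?(ltW T0)// muleC; congr (_%:E * _)%E.
    by field; rewrite gt_eqF.
  - by apply/measurable_EFinP; exact: bl_meas.
  - by move=> x _; rewrite lee_fin.
  - by rewrite lee_fin prodr_ge0.
have piT : 0 <= pi / (2 * T) by rewrite divr_ge0 ?mulr_ge0 ?(ltW pi0) ?(ltW T0).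
rewrite /fubini_G; under eq_integral do rewrite inner.
rewrite ge0_integralZl//; last 2 first.
- by apply/measurable_EFinP.
- by move=> t _; rewrite lee_fin prodr_ge0.
rewrite -m0; [|by apply/measurable_EFinP|by move=> t; rewrite lee_fin prodr_ge0].
rewrite (int_Rn_prod (g := fun i x => bl (ci i) (ri i) x))//.
under eq_bigr do rewrite bl_int//.
rewrite prodEFin -!EFinM lee_fin.
have pr : e^-1 ^+ N <= \prod_(i < N) (2 * ri i).
  rewrite -[X in _ ^+ X]card_ord -prodr_const; apply: ler_prod => i _.
  rewrite invr_ge0 (ltW e0)/= /ri; case: ifP => _; last first.
    by rewrite le_eqVlt; apply/orP; left; apply/eqP; field; rewrite gt_eqF.
  have -> : 2 * (pi / (4 * e)) = pi / 2 * e^-1 by field; rewrite gt_eqF.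
  by rewrite -[leLHS]mul1r ler_wpM2r ?invr_ge0 ?(ltW e0)// pihalf_ge1.
have -> : e `^ (2 * al) = e `^ X * e^-1 ^+ N.
  have -> : e^-1 ^+ N = e `^ (- N%:R) by rewrite powRN powR_mulrn ?(ltW e0)// exprVn.
  rewrite -powRD; last by apply/implyP => _; rewrite gt_eqF.
  by congr (_ `^ _); rewrite /X; move: alE; lra.
have := ler_wpM2l (mulr_ge0 KX piT) pr.
move=> hq; apply: le_trans (le_trans _ hq) _; rewrite le_eqVlt; apply/orP; left; apply/eqP; ring.
Qed.

End bounds.
End line_increments.

(** * Exponentially many weakly correlated increments at one dyadic scale *)

Lemma expR_cube_ge (R : realType) (y : R) : 0 <= y -> (y / 3) ^+ 3 <= expR y.
Proof.
move=> y0; have -> : expR y = expR (y / 3) ^+ 3 by rewrite -expRM_natl; congr expR; field.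
rewrite lerXn2r ?nnegrE ?expR_ge0 ?divr_ge0//.
by have := @expR_ge1Dx R (y / 3); lra.
Qed.

Lemma sqr_exp_decay (R : realType) (y C g : R) : 0 < y -> 0 <= C -> 0 < g ->
  exists n0 : nat, forall n : nat, (n0 <= n)%N -> C * (n%:R ^+ 2 * expR (- (y * n%:R))) < g.
Proof.
move=> y0 C0 g0; pose z := C * 27 / (y ^+ 3 * g).
exists (Num.truncn z).+1 => n hn.
have zn : z < n%:R by apply: lt_le_trans (truncnS_gt _) _; rewrite ler_nat.
have z0 : 0 <= z by rewrite divr_ge0 ?mulr_ge0 ?exprn_ge0 ?(ltW y0) ?(ltW g0).
have n0 : (0 : R) < n%:R by apply: le_lt_trans zn.
have yn : 0 < y * n%:R by rewrite mulr_gt0.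
have h := expR_cube_ge (ltW yn).
have c0 : 0 < (y * n%:R / 3) ^+ 3 by rewrite exprn_gt0// divr_gt0.
have : expR (- (y * n%:R)) <= ((y * n%:R / 3) ^+ 3)^-1 by rewrite expRN lef_pV2 ?posrE ?expR_gt0.
have Cn : 0 <= C * n%:R ^+ 2 by rewrite mulr_ge0// sqr_ge0.
move=> /(ler_wpM2l Cn); rewrite mulrA => h1; apply: (le_lt_trans h1).
have [yn0 nn0] : y != 0 /\ (n%:R : R) != 0 by rewrite !gt_eqF.
have -> : C * n%:R ^+ 2 * ((y * n%:R / 3) ^+ 3)^-1 = C * 27 / (y ^+ 3) / n%:R by field; rewrite yn0 nn0.
rewrite ltr_pdivrMr//; move: zn; rewrite /z invfM mulrA ltr_pdivrMr//; lra.
Qed.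

Lemma dyadic_powR (R : realType) (n : nat) (x : R) : (2^-1 ^+ n) `^ x = expR (- (x * ln 2 * n%:R)).
Proof.
rewrite /powR gt_eqF ?exprn_gt0//; congr expR.
by rewrite lnXn// lnV ?posrE// -mulr_natr; ring.
Qed.

(** With threshold [s2 / n], the set excluded by one point has measure of order
    [n^2 2^(- (1 - al) n)], from the gap between [1 + al] and [2 al]. Half of this decay is spent on
    the number of points and the other half beats [n^2]. The cap [2^-1] on [kap] later gives
    [lam ^+ 2 <= n / 2]. *)
Lemma sparse_count (R : realType) (al C c g : R) : 0 < al < 1 -> 0 <= C -> 0 < c -> 0 < g ->
  exists2 kap : R, 0 < kap <= 2^-1 & exists n0 : nat, forall n : nat, (n0 <= n)%N -> (0 < n)%N ->
    exists m : nat, expR (kap * n%:R) <= m%:R /\ forall s2, c * (2^-1 ^+ n) `^ (2 * al) <= s2 ->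
      m%:R * (C * (2^-1 ^+ n) `^ (1 + al) * s2 / (s2 / n%:R) ^+ 2) < g.
Proof.
move=> /andP[al0 al1] C0 c0 g0; pose x : R := (1 - al) * ln 2.
have x0 : 0 < x by rewrite mulr_gt0// ?subr_gt0//; have := ln2_ge R; lra.
pose kap := Num.min 2^-1 (x / 2).
have k0 : 0 < kap by rewrite lt_min; apply/andP; split; [lra|lra].
have kx : kap <= x / 2 by rewrite ge_min lexx orbT.
exists kap; first by rewrite k0 ge_min lexx.
have y0 : 0 < x / 2 by lra.
have C1 : 0 <= 2 * C / c by rewrite divr_ge0 ?mulr_ge0// ltW.
have [n0 hn0] := sqr_exp_decay y0 C1 g0.
exists n0 => n hn np; exists (Num.truncn (expR (kap * n%:R))).+1.
split; first exact: ltW (truncnS_gt _).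
move=> s2 hs2; set m := (_.+1)%:R.
have n1 : (0 : R) < n%:R by rewrite ltr0n.
have ea0 : 0 < (2^-1 ^+ n) `^ (2 * al) :> R by apply: powR_gt0; rewrite exprn_gt0.
have s20 : 0 < s2 by apply: lt_le_trans hs2; rewrite mulr_gt0.
have mle : m <= 2 * expR (kap * n%:R).
  have : 1 <= expR (kap * n%:R).
    by have := expR_ge1Dx (kap * n%:R); have := mulr_gt0 k0 n1; lra.
  have /andP[+ _] := truncn_itv (expR_ge0 (kap * n%:R)).
  by rewrite /m -natr1; lra.
have e1 : 0 <= (2^-1 ^+ n) `^ (1 + al) :> R by exact: powR_ge0.
have -> : C * (2^-1 ^+ n) `^ (1 + al) * s2 / (s2 / n%:R) ^+ 2 = C * (2^-1 ^+ n) `^ (1 + al) * n%:R ^+ 2 / s2.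
  by field; rewrite !gt_eqF.
apply: le_lt_trans (hn0 n hn).
apply: (@le_trans _ _ (2 * expR (kap * n%:R) * (C * (2^-1 ^+ n) `^ (1 + al) * n%:R ^+ 2 / (c * (2^-1 ^+ n) `^ (2 * al))))).
  have cn0 : 0 <= C * (2^-1 ^+ n) `^ (1 + al) * n%:R ^+ 2 by apply: mulr_ge0 (sqr_ge0 _); rewrite mulr_ge0.
  apply: (ler_pM (ler0n _ _) _ mle); first exact: divr_ge0 cn0 (ltW s20).
  apply: ler_wpM2l; first by apply: mulr_ge0 (sqr_ge0 _); rewrite mulr_ge0.
  by rewrite lef_pV2 ?posrE// mulr_gt0.
rewrite !dyadic_powR.
have aux (A B D E n2 : R) : c != 0 -> D != 0 -> 2 * A * (C * B * n2 / (c * D)) = 2 * C / c * (n2 * (A * B * D^-1)).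
  by move=> ? ?; field; apply/andP.
rewrite aux ?gt_eqF ?expR_gt0//; apply: ler_wpM2l => //; apply: ler_wpM2l; first exact: sqr_ge0.
rewrite -expRN opprK -!expRD ler_expR.
have : kap * n%:R <= x / 2 * n%:R by rewrite ler_pM2r.
by rewrite /x; lra.
Qed.

Lemma dyadic_ln (R : realType) (n : nat) : (0 < n)%N -> ln (1 + (2^-1 ^+ n)^-1) <= 2 * n%:R :> R.
Proof.
move=> n0; have n1 : (1 : R) <= n%:R by rewrite ler1n.
rewrite exprVn invrK; apply: (@le_trans _ _ (ln (2 ^+ n.+1))).
  have : (1 : R) <= 2 ^+ n by rewrite exprn_ege1// ler1n.
  by move=> h; rewrite ler_ln ?posrE ?exprS; lra.
have l1 : ln 2 <= 1 :> R by have := @le_ln1Dx R 1; rewrite (_ : 1 + 1 = 2); [apply; lra|lra].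
rewrite lnXn// -[ln 2 *+ _]mulr_natr -[n.+1%:R]natr1; 
apply: (@le_trans _ _ (1 * (n%:R + 1))); last by lra.
by apply: ler_wpM2r => //; lra.
Qed.

Section modulus_lower.
Context d0 (Om : measurableType d0) (R : realType) (P : probability Om R).
Variables (N : nat) (H cH be c1 c2 al : R) (h : 'rV[R]_N -> R) (v : R * 'rV[R]_N -> Om -> R).
Local Notation D := [set p : R * 'rV[R]_N | 0 <= p.1].
Hypothesis gv : centered_gaussian_field P D v (cov_kernel H cH h).
Hypothesis cH0 : 0 < cH.
Hypothesis mh : measurable_fun [set: N.-tuple R] (fun t => h (tup2row t)).
Hypothesis h0 : forall xi, 0 <= h xi.
Hypothesis N0 : (0 < N)%N.
Hypothesis H01 : 0 <= 2 * H - 1 < 1.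
Hypothesis be0 : 0 < be.
Hypothesis al01 : 0 < al < 1.
Hypothesis alE : al = (2 * H + 1 - N%:R + be) / 2.
Hypothesis c10 : 0 < c1.
Hypothesis c20 : 0 < c2.
Hypothesis hle : forall xi, xi != 0 -> h xi <= c2 * enorm xi `^ (- be).
Hypothesis hge : forall xi, xi != 0 -> c1 * enorm xi `^ (- be) <= h xi.
Variables (a b : R) (ax bx : 'rV[R]_N).
Hypothesis a0 : 0 < a.
Hypothesis ab : a < b.
Hypothesis abx : forall i, ax 0 i < bx 0 i.

Local Notation k := (kern P v).
Let i0 : 'I_N := Ordinal N0.
Let pt := lpt a ax i0.

Let pt_box s : 0 <= s -> s <= bx 0 i0 - ax 0 i0 -> box a b ax bx (pt s).
Proof.
move=> s0 s1; split; first by rewrite /= lexx ltW.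
move=> i; rewrite !mxE eqxx /=; have := abx i; have [->|ii] := eqVneq i i0.
  by rewrite mulr1; lra.
by rewrite mulr0 addr0 lexx => /ltW.
Qed.

Let pt_dist s e : 0 <= e -> pdist (pt (s + e)) (pt s) = e.
Proof.
move=> e0; rewrite /pdist subrr normr0 add0r /enorm /=.
rewrite (bigD1 i0)//= !mxE !eqxx big1.
  by rewrite !mulr1 addr0 (_ : _ - _ = e) ?sqrtr_sqr ?ger0_norm//; ring.
move=> i ii; rewrite !mxE (negbTE ii) !eqxx /= !mulr0 !addr0 subrr expr0n //.
Qed.

(** On a segment in the face [t = a], the second moment bound is applied with [lam ^+ 2 = kap * n]
    to about [expR (kap * n)] increments of step [2^-n]. The largest is then of order
    [sqrt (n * s2)], and [n] plays the part of the logarithm in the gauge. *)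
Lemma modulus_lower : exists2 c : R, 0 < c & exists n1 : nat, forall n : nat, (n1 <= n)%N ->
  exists A : set Om, [/\ measurable A, 16^-1 <= fine (P A) & forall w, A w -> exists p q,
    [/\ box a b ax bx p, box a b ax bx q, pdist p q = 2^-1 ^+ n &
      c * ((2^-1 ^+ n) `^ al * Num.sqrt (ln (1 + (2^-1 ^+ n)^-1))) <= v p w - v q w]].
Proof.
have /andP[al0 al1] := al01.
have [m [m0 mi]] := @int_Rn_measure R N.
have [MS hMS] := @sigma_finite_product _ _ _ _ R (@lebesgue_measure R) m.
have MSE f : (\int[MS]_z f z = \int[(@lebesgue_measure R \x m)%E]_z f z)%E by rewrite hMS.
have [Cm Cm0 hCm] := marginal_bound gv cH0 mh h0 m0 ax i0 a0 N0 H01 be0 al01 alE c20 hle.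
have [cl cl0 hcl] := variance_lower gv cH0 mh h0 m0 ax i0 a0 N0 H01 be0 alE c10 hge.
pose I : set (measurableTypeR R) := `[0, (bx 0 i0 - ax 0 i0) / 2]%classic.
pose g := fine (normal_prob (0 : R) 1 I).
have l0 : 0 < (bx 0 i0 - ax 0 i0) / 2 by have := abx i0; lra.
have gE : normal_prob (0 : R) 1 I = g%:E.
  by rewrite /g fineK//; apply: fin_num_measure; exact: measurable_itv.
have g0 : 0 < g by rewrite -lte_fin -gE normal_itv_gt0.
have [kap /andP[k0 k1] [n0 hn0]] := sparse_count al01 (ltW Cm0) cl0 g0.
(* The square of the threshold is [kap * n * s2 / 16]; with [s2 >= cl * e^(2 al)] and
   [ln (1 + 1 / e) <= 2 n] this leaves [kap * cl / 32]. *)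
exists (Num.sqrt (kap * cl / 32)); first by rewrite sqrtr_gt0 !mulr_gt0.
(* These thresholds ensure [kap * n >= 4] for the second moment bound, [e <= a / 4] for
   [variance_lower], and a step [e] that fits into the second half of the side, the points being
   chosen in the first half. *)
pose n1 : nat := (Num.truncn (4 / kap)).+1; pose n2 : nat := (Num.truncn (4 / a)).+1.
pose n3 : nat := (Num.truncn ((bx 0 i0 - ax 0 i0) / 2)^-1).+1.
exists (n0 + n1 + n2 + n3)%N => n hn.
have nn0 : (n0 <= n)%N by apply: leq_trans hn; rewrite -!addnA leq_addr.
have nn1 : (n1 <= n)%N by apply: leq_trans hn; rewrite -[X in (_ <= X)%N]addnA -[X in (_ <= X)%N]addnA addnCA leq_addr.
have nn2 : (n2 <= n)%N by apply: leq_trans hn; rewrite addnAC leq_addl.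
have nn3 : (n3 <= n)%N by apply: leq_trans hn; rewrite leq_addl.
have np : (0 < n)%N by apply: leq_trans nn1.
have np1 : (0 : R) < n%:R by rewrite ltr0n.
have kn4 : 4 <= kap * n%:R.
  rewrite mulrC -ler_pdivrMr//; apply: ltW; apply: lt_le_trans (truncnS_gt _) _.
  by rewrite ler_nat.
pose e : R := 2^-1 ^+ n.
have e0 : 0 < e by rewrite exprn_gt0.
have en x : 0 < x -> (Num.truncn x^-1 < n)%N -> e <= x.
  move=> x0 hx; rewrite /e exprVn invf_ple ?posrE ?exprn_gt0//.
  apply: ltW; apply: lt_trans (truncnS_gt _) _; rewrite -natrX ltr_nat.
  by apply: (leq_ltn_trans hx); exact: ltn_expl.
have ea : e <= a / 4 by apply: en; [rewrite divr_gt0|rewrite invf_div].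
have el : e <= (bx 0 i0 - ax 0 i0) / 2 by apply: en.
have [m' [hm1 hm2]] := hn0 n nn0 np.
pose w := weps H cH h a i0 e; pose x0 := @xi0 R N i0.
pose rho := Rf MS w x0.
have iw0 := weps_int gv cH0 mh h0 m0 ax i0 a0 e.
have mw := weps_meas gv cH0 mh h0 m0 ax i0 a0 e.
have w0 z : 0 <= w z by exact: weps_ge0.
have iw : MS.-integrable setT (EFin \o w).
  apply/integrableP; split; first by apply/measurable_EFinP.
  by rewrite MSE; have /integrableP[] := iw0.
have mx0 := @xi0_meas R N i0.
pose s2 := rho 0.
have s2E : (s2%:E = \int[(@lebesgue_measure R \x m)%E]_z (w z)%:E)%E.
  rewrite /s2 /rho Rf0E /Rintegral fineK ?MSE//.
  exact: integrable_fin_num iw0.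
have hs2 : cl * e `^ (2 * al) <= s2 by rewrite -lee_fin s2E; exact: hcl.
have s20 : 0 < s2 by apply: lt_le_trans hs2; rewrite mulr_gt0// powR_gt0.
have th0 : 0 < s2 / n%:R by rewrite divr_gt0.
have tail c : (normal_prob (0%R : R) 1 [set s | (s2 / n%:R < `|rho (s - c)|)%R] <=
   (Cm * e `^ (1 + al) * s2 / (s2 / n%:R) ^+ 2)%:E)%E.
  apply: avg_tail => // y; rewrite MSE; exact: hCm.
have mq : ((m'%:R * (Cm * e `^ (1 + al) * s2 / (s2 / n%:R) ^+ 2))%:E < normal_prob (0 : R) 1 I)%E.
  by rewrite gE lte_fin; exact: hm2.
have q0 : 0 <= Cm * e `^ (1 + al) * s2 / (s2 / n%:R) ^+ 2.
  by apply: mulr_ge0; [apply: mulr_ge0 (ltW s20); apply: mulr_ge0 (powR_ge0 _ _); exact: ltW|rewrite invr_ge0 sqr_ge0].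
have mrho : measurable_fun [set: measurableTypeR R] rho by apply: Rf_meas.
have Nrho s : rho (- s) = rho s by exact: RfN.
have [sg [sg1 sg2]] := greedy_points Nrho mrho q0 tail mq.
have Ep i : box a b ax bx (pt (sg i + e)) 
  by have /andP[h1 h2] := sg1 i; apply: pt_box; [apply: addr_ge0 (ltW e0)|rewrite [leRHS]splitr lerD].
have Eq i : box a b ax bx (pt (sg i)) 
  by have /andP[h1 h2] := sg1 i; apply: pt_box; rewrite // [leRHS]splitr ler_wpDr// ltW.
have bD p : box a b ax bx p -> D p by move=> [/andP[h1 _] _] /=; apply: le_trans h1; exact: ltW.
pose lam := Num.sqrt (kap * n%:R).
have lam2 : lam ^+ 2 = kap * n%:R by rewrite sqr_sqrtr// mulr_ge0// ltW.
have incrE := incr_cov_line gv cH0 mh h0 m0 mi MSE ax i0 a0.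
have vs2 i : incr_var k (pt (sg i + e)) (pt (sg i)) = s2.
  have := incrE e (sg i) (sg i); rewrite subrr -/pt -/w -/x0 -/rho -/s2 => <-.
  by rewrite /incr_var (kernC P v (pt (sg i))); ring.
have dec i j : i != j -> `|icov k (pt (sg i + e)) (pt (sg i)) (pt (sg j + e)) (pt (sg j))| <= s2 / n%:R.
  move=> ij; rewrite /icov incrE; exact: sg2.
have lamn : lam ^+ 2 <= n%:R / 2 by rewrite lam2 mulrC ler_wpM2l.
have lam4 : 4 <= lam ^+ 2 by rewrite lam2.
have lam0 : 0 < lam by rewrite sqrtr_gt0 mulr_gt0.
have lamm : expR (lam ^+ 2) <= m'%:R by rewrite lam2.
exists [set w' | exists i : 'I_m', lam / 4 * Num.sqrt s2 <= v (pt (sg i + e)) w' - v (pt (sg i)) w'].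
split.
- by apply: incr_set_meas => // i; apply: gv.1; apply: bD.
- exact: (second_moment_max gv (kernE gv) (kernC P v) (fun i => bD _ (Ep i)) (fun i => bD _ (Eq i)) s20 vs2 dec lam4 lam0 lamn lamm).
move=> w' [i hi]; exists (pt (sg i + e)), (pt (sg i)); split=> //; first by apply: pt_dist; exact: ltW.
apply: le_trans hi; rewrite -/e.
have -> : e `^ al = Num.sqrt (e `^ (2 * al)).
  by rewrite mulrC powRrM powR_mulrn ?powR_ge0// sqrtr_sqr ger0_norm ?powR_ge0.
have -> : lam / 4 * Num.sqrt s2 = Num.sqrt (kap * n%:R / 16 * s2).
  rewrite sqrtrM ?divr_ge0 ?mulr_ge0 ?(ltW k0)// sqrtrM ?mulr_ge0 ?(ltW k0)//; congr (_ * _ * _).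
  have -> : (16^-1 : R) = (4^-1) ^+ 2 by field.
  by rewrite sqrtr_sqr ger0_norm.
have kc : 0 <= kap * cl / 32 by rewrite divr_ge0 ?mulr_ge0 ?ltW.
rewrite -sqrtrM ?powR_ge0// -sqrtrM// ler_sqrt; last by rewrite mulr_ge0 ?divr_ge0 ?mulr_ge0 ?ltW.
have hL := dyadic_ln R np; rewrite -/e in hL.
apply: (@le_trans _ _ (kap * cl / 32 * (e `^ (2 * al) * (2 * n%:R)))).
  by apply: ler_wpM2l => //; apply: ler_wpM2l => //; exact: powR_ge0.
have -> : kap * cl / 32 * (e `^ (2 * al) * (2 * n%:R)) = kap * n%:R / 16 * (cl * e `^ (2 * al)) by field.
by apply: ler_wpM2l => //; rewrite divr_ge0 ?mulr_ge0 ?(ltW k0).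
Qed.

End modulus_lower.

(** * The exact modulus *)

Lemma cvg_enormf (R : realType) (n : nat) (x : nat -> 'I_n -> R) (y : 'I_n -> R) :
  (forall i, (fun k => x k i) @ \oo --> y i) -> (fun k => enormf (x k)) @ \oo --> enormf y.
Proof.
move=> h; apply: (@cvg_comp _ _ _ (fun k => \sum_(i < n) x k i ^+ 2) (@Num.sqrt R)); last exact: sqrt_continuous.
elim: (index_enum _) => [|i r IH]; first by rewrite big_nil; under eq_cvg do rewrite big_nil; exact: cvg_cst.
by rewrite big_cons; under eq_cvg do rewrite big_cons; apply: cvgD IH; rewrite expr2; apply: cvgM.
Qed.

(** * Reading the modulus on the dyadic grid *)

Section dense_modulus.
Context (R : realType) (N d : nat) (a b al : R) (ax bx : 'rV[R]_N).
Hypothesis a0 : 0 < a.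
Hypothesis ab : a < b.
Hypothesis abx : forall i, ax 0 i < bx 0 i.
Hypothesis al0 : 0 < al.

Definition gauge (x : R) : R := x `^ al * Num.sqrt (ln (1 + x^-1)).

Let ln_pos (x : R) : 0 < x -> 0 < ln (1 + x^-1).
Proof. by move=> x0; rewrite ln_gt0// ltrDl invr_gt0. Qed.

Lemma gauge_gt0 (x : R) : 0 < x -> 0 < gauge x.
Proof. by move=> x0; rewrite mulr_gt0 ?powR_gt0// sqrtr_gt0 ln_pos. Qed.

Lemma gauge0 : gauge 0 = 0.
Proof. by rewrite /gauge powR0 ?mul0r// gt_eqF. Qed.

Lemma gauge_ge0 (x : R) : 0 <= x -> 0 <= gauge x.
Proof. by rewrite le_eqVlt => /orP[/eqP <-|/gauge_gt0/ltW//]; rewrite gauge0. Qed.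

Lemma gauge_cvg (y : nat -> R) (x : R) : 0 < x -> y @ \oo --> x -> (fun n => gauge (y n)) @ \oo --> gauge x.
Proof.
move=> x0 yx; apply: cvgM.
  have -> : x `^ al = expR (al * ln x) by rewrite /powR gt_eqF.
  have H : (fun n => expR (al * ln (y n))) @ \oo --> expR (al * ln x).
    apply: (@cvg_comp _ _ _ (fun n => al * ln (y n)) (@expR R)); last exact: continuous_expR.
    by apply: cvgMr; apply: cvg_comp yx _; exact: continuous_ln.
  apply: cvg_trans H; apply: near_eq_cvg; near=> n.
  by rewrite /powR gt_eqF//; near: n; exact: cvgr_gt yx _ x0.
apply: (@cvg_comp _ _ _ (fun n => ln (1 + (y n)^-1)) (@Num.sqrt R)); last exact: sqrt_continuous.
apply: (@cvg_comp _ _ _ (fun n => 1 + (y n)^-1) (@ln R)); last by apply: continuous_ln; rewrite addr_gt0 ?invr_gt0.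
by apply: cvgD; [exact: cvg_cst|apply: cvgV => //; rewrite gt_eqF].
Unshelve. all: end_near. Qed.

Local Notation gp := (gpt a b ax bx).
Local Notation fl := (flk a b ax bx).

Lemma pdist_cvg p q : box a b ax bx p -> box a b ax bx q ->
  (fun n => pdist (gp n (fl n p)) (gp n (fl n q))) @ \oo --> pdist p q.
Proof.
move=> bp bq.
have c1 r : box a b ax bx r -> (fun n => (gp n (fl n r)).1) @ \oo --> r.1.
  move=> br; apply: (cvg_within_flk ab abx a0 (f := fst)) => //.
  by apply: continuous_subspaceT => z; exact: cvg_fst.
have c2 r i : box a b ax bx r -> (fun n => (gp n (fl n r)).2 0 i) @ \oo --> r.2 0 i.
  move=> br; apply: (cvg_within_flk ab abx a0 (f := fun r => r.2 0 i)) => //.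
  apply: continuous_subspaceT => z; apply: (@cvg_comp _ _ _ snd (fun y : 'rV[R]_N => y 0 i)); first exact: cvg_snd.
  exact: coord_continuous.
apply: cvgD; first by apply: cvg_norm; apply: cvgB; exact: c1.
apply: (@cvg_enormf R N (fun n i => ((gp n (fl n p)).2 - (gp n (fl n q)).2) 0 i) (fun i => (p.2 - q.2) 0 i)) => i.
have E (r s : 'rV[R]_N) : (r - s) 0 i = r 0 i - s 0 i by rewrite mxE [X in _ + X]mxE.
rewrite E (_ : (fun n => _) = fun n => (gp n (fl n p)).2 0 i - (gp n (fl n q)).2 0 i); last by apply/funext => n; rewrite E.
by apply: cvgB; exact: c2.
Qed.

Variable U : 'I_d -> R * 'rV[R]_N -> R.
Hypothesis cU : forall j, {within [set p : R * 'rV[R]_N | 0 <= p.1], continuous (U j)}.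
Local Notation g := (grid_pt a b ax bx).

(** The strict inequality [pdist p q < e] passes to the grid approximations of [p] and [q], and
    positivity of the distance makes the gauge continuous there. *)
Lemma modulus_dense (e x : R) :
  (forall i j, pdist (g i) (g j) < e -> enormf (fun l => U l (g i) - U l (g j)) <= x * gauge (pdist (g i) (g j))) ->
  forall p q, box a b ax bx p -> box a b ax bx q -> 0 < pdist p q -> pdist p q < e ->
    enormf (fun l => U l p - U l q) <= x * gauge (pdist p q).
Proof.
move=> h p q bp bq pq0 pqe.
have cd := pdist_cvg bp bq.
have cl : (fun n => enormf (fun l => U l (gp n (fl n p)) - U l (gp n (fl n q)))) @ \oo --> enormf (fun l => U l p - U l q).
  by apply: cvg_enormf => l; apply: cvgB; apply: cvg_within_flk.
have cr : (fun n => x * gauge (pdist (gp n (fl n p)) (gp n (fl n q)))) @ \oo --> x * gauge (pdist p q).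
  by apply: cvgMr; apply: gauge_cvg.
apply: (ler_cvg_to cl cr); near=> n.
have [i ii] := gpt_grid a b ax bx n (fl n p); have [j ji] := gpt_grid a b ax bx n (fl n q).
suff : pdist (gp n (fl n p)) (gp n (fl n q)) < e by rewrite ii ji; exact: h.
by near: n; exact: cvgr_lt cd _ pqe.
Unshelve. all: end_near. Qed.

Local Notation M := (mod_sup al (box a b ax bx) U).

Lemma mod_sup_le (e x : R) (n : nat) : e < 2^-1 ^+ n ->
  (forall i j, pdist (g i) (g j) < 2^-1 ^+ n -> enormf (fun l => U l (g i) - U l (g j)) <= x * gauge (pdist (g i) (g j))) ->
  (M e <= x%:E)%E.
Proof.
move=> en h; apply: ge_ereal_sup => _ [[p q] /= [bp [bq /andP[pq0 pqe]]] <-].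
rewrite lee_fin ler_pdivrMr; last exact: gauge_gt0.
by apply: (modulus_dense h) => //; exact: le_lt_trans en.
Qed.

Lemma le_mod_sup (e x : R) (n : nat) : 2^-1 ^+ n <= e -> (M e <= x%:E)%E ->
  forall i j, pdist (g i) (g j) < 2^-1 ^+ n -> enormf (fun l => U l (g i) - U l (g j)) <= x * gauge (pdist (g i) (g j)).
Proof.
move=> en h i j ij; have : 0 <= pdist (g i) (g j) by rewrite addr_ge0// sqrtr_ge0.
rewrite le_eqVlt => /orP[/eqP/esym d0|dp].
  (* Different indices may name the same grid point; the supremum skips such pairs, but both sides
     vanish. *)
  rewrite d0 (pdist_eq0 d0) gauge0 mulr0.
  by rewrite /enormf big1 ?sqrtr0// => l _; rewrite subrr expr0n.
rewrite -ler_pdivrMr; last exact: gauge_gt0.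
rewrite -lee_fin; apply: le_trans h; apply: ereal_sup_ubound; exists (g i, g j) => //=.
split; first exact: grid_pt_box.
by split; [exact: grid_pt_box|rewrite dp/=; apply: le_trans en; exact: ltW].
Qed.

End dense_modulus.

(** Continuity from above: every tail union already has probability at least [x]. *)
Lemma limsup_ge d0 (Om : measurableType d0) (R : realType) (P : probability Om R) (A : nat -> set Om) (x : R) :
  (forall n, measurable (A n)) -> (forall n, x <= fine (P (A n))) -> (x%:E <= P (lim_sup_set A))%E.
Proof.
move=> mA hA.
have mU n : measurable (\bigcup_(k >= n) A k) by apply: bigcup_measurable.
have fin0 : (P (\bigcup_(k >= 0) A k) < +oo)%E by apply: (le_lt_trans (probability_le1 P (mU 0%N))); exact: ltry.
have c := lim_sup_set_cvg P A mA fin0.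
rewrite -(cvg_lim _ c)//; apply: lime_ge; first by apply/cvg_ex; eexists; exact: c.
apply: nearW => n; apply: (@le_trans _ _ (P (A n))).
  by rewrite -[leRHS]fineK ?lee_fin// fin_num_measure.
by apply: le_measure; rewrite ?inE//; apply: bigcup_sup => /=.
Qed.

(** After cancelling [x ^ al] the logarithm has to exceed [C0 / eta^2]; below [2^-n] it is at least
    [n * ln 2 >= n / 2]. *)
Lemma gauge_dominates (R : realType) (al C0 eta : R) : 0 < al -> 0 < C0 -> 0 < eta ->
  exists n : nat, forall x : R, 0 <= x -> x < 2^-1 ^+ n -> Num.sqrt C0 * x `^ al <= eta * gauge al x.
Proof.
move=> al0 C00 e0; pose n := (Num.truncn (2 * (C0 / eta ^+ 2))).+1; exists n => x.
rewrite le_eqVlt => /orP[/eqP <- _|x0 xn]; first by rewrite gauge0// powR0 ?mulr0// gt_eqF.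
rewrite /gauge [leLHS]mulrC mulrCA; apply: ler_wpM2l; first exact: powR_ge0.
have -> : eta = Num.sqrt (eta ^+ 2) by rewrite sqrtr_sqr gtr0_norm.
rewrite -sqrtrM ?sqr_ge0//; apply: ler_wsqrtr; rewrite mulrC -ler_pdivrMr ?exprn_gt0//.
have hn : 2 * (C0 / eta ^+ 2) < n%:R by exact: truncnS_gt.
apply: (@le_trans _ _ (ln (2 ^+ n))).
  by rewrite lnXn// -[ln 2 *+ _]mulr_natr; have := ln2_ge R; move: (ln 2) => l l2; have := ler_wpM2r (ler0n R n) l2; lra.
rewrite ler_ln ?posrE ?exprn_gt0//; last by rewrite addr_gt0// invr_gt0.
apply: (@le_trans _ _ x^-1); last by rewrite lerDr.
by rewrite -[leLHS]invrK lef_pV2 ?posrE ?invr_gt0 ?exprn_gt0// -exprVn ltW.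
Qed.

(** The factor 2 on the lower side reflects [mod_event]: failure at level [C - k.+1%:R^-1], tested
    with slack index [k], costs another [k.+1%:R^-1]. *)
Lemma cvg_at_right_pinch (R : realType) (M : R -> \bar R) (C : R) :
  (forall k : nat, exists2 e0 : R, 0 < e0 & forall e, 0 < e -> e < e0 ->
    ((C - 2 * k.+1%:R^-1)%:E < M e)%E /\ (M e <= (C + k.+1%:R^-1)%:E)%E) ->
  M @ at_right 0 --> C%:E.
Proof.
move=> h.
have F (k : nat) : \forall e \near 0^'+, ((C - 2 * k.+1%:R^-1)%:E < M e)%E /\ (M e <= (C + k.+1%:R^-1)%:E)%E.
  have [e0 e00 he] := h k; near=> e; apply: he; first by near: e; exact: nbhs_right_gt.
  by near: e; exact: nbhs_right_lt.
have fin e k : ((C - 2 * k.+1%:R^-1)%:E < M e)%E -> (M e <= (C + k.+1%:R^-1)%:E)%E -> M e \is a fin_num.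
  by case: (M e).
have aux (m c et i : R) : 2 * i <= et -> 0 < i -> c - 2 * i < m -> m <= c + i -> `|c - m| <= et.
  by move=> *; rewrite ler_norml; apply/andP; split; lra.
apply/fine_cvgP; split; first by apply: filterS (F 0%N) => e [? ?]; exact: (@fin e 0%N).
apply/cvgrPdist_le => eta eta0.
pose k := Num.truncn (2 / eta).
have hk : 2 * k.+1%:R^-1 <= eta.
  by rewrite -ler_pdivlMl// mulrC -[leRHS]invrK lef_pV2 ?posrE ?invr_gt0 ?divr_gt0// invf_div ltW// truncnS_gt.
have k0 : (0 : R) < k.+1%:R^-1 by rewrite invr_gt0.
apply: filterS (F k) => e [h1 h2]; have f := fin _ _ h1 h2.
move: h1 h2; rewrite -(fineK f) lte_fin lee_fin /= => h1 h2.
exact: aux hk k0 h1 h2.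
Unshelve. all: end_near. Qed.

Lemma ae_prob1 d0 (Om : measurableType d0) (R : realType) (P : probability Om R) (A : set Om) :
  measurable A -> {ae P, forall w, A w} -> P A = 1%E.
Proof.
move=> mA h; have PC : P (~` A) = 0%E by apply/(measure_negligible (measurableC mA)).
by have := probability_setC P (measurableC mA); rewrite setCK PC sube0.
Qed.

Lemma prob1_ae d0 (Om : measurableType d0) (R : realType) (P : probability Om R) (A : set Om) :
  measurable A -> P A = 1%E -> {ae P, forall w, A w}.
Proof.
move=> mA h; exists (~` A); split=> //; first exact: measurableC.
by rewrite probability_setC// h subee.
Qed.

Section conclusion.
Context (R : realType) (N d : nat) (H beta c1 c2 cH : R) (h : 'rV[R]_N -> R).
Context (dO : measure_display) (Om : measurableType dO) (P : probability Om R).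
Variable u : 'I_d -> R * 'rV[R]_N -> Om -> R.
Local Notation D := [set p : R * 'rV[R]_N | 0 <= p.1].
Hypothesis N0 : (0 < N)%N.
Hypothesis d0 : (0 < d)%N.
Hypothesis H01 : 0 <= 2 * H - 1 < 1.
Hypothesis be0 : 0 < beta.
Variable al : R.
Hypothesis al01 : 0 < al < 1.
Hypothesis alE : al = (2 * H + 1 - N%:R + beta) / 2.
Hypothesis c10 : 0 < c1.
Hypothesis c20 : 0 < c2.
Hypothesis cH0 : 0 < cH.
Hypothesis mh : measurable_fun [set: N.-tuple R] (fun t => h (tup2row t)).
Hypothesis h0 : forall xi, 0 <= h xi.
Hypothesis hge : forall xi, xi != 0 -> c1 * enorm xi `^ (- beta) <= h xi.
Hypothesis hle : forall xi, xi != 0 -> h xi <= c2 * enorm xi `^ (- beta).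
Hypothesis gu : forall j, centered_gaussian_field P D (u j) (cov_kernel H cH h).
Hypothesis iu : independent_fields P D u.
Hypothesis cu : forall j w, {within D, continuous (fun p => u j p w)}.
Variables (a b : R) (ax bx : 'rV[R]_N).
Hypothesis a0 : 0 < a.
Hypothesis ab : a < b.
Hypothesis abx : forall i, ax 0 i < bx 0 i.

Local Notation g := (grid_pt a b ax bx).
Local Notation psi := (gauge al).
Let Ev := mod_event g (@pdist R N) psi (fun l i => u l (g i)).
Let j0 : 'I_d := Ordinal d0.
Let k := kern P (u j0).
Let Kk p q : D p -> D q -> cov_kernel H cH h p q = (k p q)%:E.
Proof. move=> Dp Dq; exact: (kernE (gu j0) Dp Dq). Qed.
Let ksym p q : k p q = k q p := kernC P (u j0) p q.
Let al0 : 0 < al. Proof. by case/andP: al01. Qed.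

Let Dg i : D (g i).
Proof. exact: box_pos a0 _ (grid_pt_box ab abx i). Qed.

Let Ev_meas c : measurable (Ev c).
Proof. by apply: mod_event_meas => l i; apply: (gu l).1; exact: Dg. Qed.

Let pdist_ge0 (p q : R * 'rV[R]_N) : 0 <= pdist p q.
Proof. by rewrite addr_ge0// sqrtr_ge0. Qed.

Let kinc : exists2 C0 : R, 0 < C0 & forall p q, box a b ax bx p -> box a b ax bx q ->
  incr_var k p q <= C0 * (pdist p q `^ al) ^+ 2.
Proof.
have [m [m0 mi]] := @int_Rn_measure R N.
have b0 : 0 <= b by rewrite ltW// (lt_trans a0).
have [C0 C00 hC] := structure_upper (gu j0) cH0 mh h0 m0 mi N0 H01 be0 al01 alE c20 hle b0.
exists C0 => // p q bp bq; apply: hC; [rewrite (box_pos a0 bp)|rewrite (box_pos a0 bq)].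
  by case: bp => /andP[].
by case: bq => /andP[].
Qed.

Let Ev01 c : P (Ev c) = 0%E \/ P (Ev c) = 1%E.
Proof.
have [C0 C00 hC] := kinc.
apply: (zero_one (phi := fun x => Num.sqrt C0 * x `^ al) _ _ _ gu Kk iu ksym Dg).
- exact: pdist_ge0.
- by move=> x x0; rewrite mulr_ge0 ?sqrtr_ge0 ?powR_ge0.
- by move=> eta e0; exact: gauge_dominates.
- move=> i j; rewrite exprMn (sqr_sqrtr (ltW C00)); exact: (hC _ _ (grid_pt_box ab abx i) (grid_pt_box ab abx j)).
Qed.

Let Ev_mono c c' : c <= c' -> Ev c `<=` Ev c'.
Proof.
move=> cc w [n [m hw]]; exists n, m => i j ij; apply: (le_trans (hw i j ij)).
by apply: ler_wpM2r; [exact: gauge_ge0|exact: lerB].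
Qed.

Let Ev_upper : exists c, P (Ev c) = 1%E.
Proof.
have [C0 C00 hC] := kinc.
have hu j : exists c, {ae P, forall w, exists n : nat, forall p q, box a b ax bx p -> box a b ax bx q ->
    pdist p q < 2^-1 ^+ n -> `|u j p w - u j q w| <= c * psi (pdist p q)}.
  by have [c hc] := modulus_upper a0 ab abx (gu j) Kk ksym (@cu j) al01 C00 hC; exists c; exact: hc.
have [c hc] := choice hu.
(* The extra 1 is the slack of [mod_event] for [m = 0]; the sum bounds the Euclidean norm by the
   coordinates. *)
exists (1 + \sum_(j < d) c j).
apply: ae_prob1 (Ev_meas _) _.
have hc' : {ae P, forall w, forall n : nat, forall j : 'I_d, val j = n -> exists n : nat, forall p q, box a b ax bx p -> box a b ax bx q ->
    pdist p q < 2^-1 ^+ n -> `|u j p w - u j q w| <= c j * psi (pdist p q)}.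
  apply: ae_foralln => n; have [nd|dn] := ltnP n d.
    apply: filterS (hc (Ordinal nd)) => w hw j jn.
    by rewrite (_ : j = Ordinal nd)//; exact: val_inj.
  by apply: aeW => w j jn; have := ltn_ord j; rewrite jn ltnNge dn.
apply: filterS hc' => w hw.
have [n hn] := choice (fun j => hw _ j erefl).
exists (\max_(j < d) n j)%N, 0%N => i j ij; apply: (le_trans (enormf_le_sum _)).
rewrite invr1 addrAC subrr add0r mulr_suml; apply: ler_sum => l _.
apply: hn; [exact: grid_pt_box|exact: grid_pt_box|].
apply: (lt_le_trans ij); rewrite ler_iXn2l ?invr_gt0// ?invf_lt1//; last exact: ltr1n.
by rewrite leq_bigmax.
Qed.

(** The limsup of the events from [modulus_lower], which control the single component [j0], is
    disjoint from [Ev c] and has probability at least [1/16]. So [Ev c] has not probability 1, and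
    [Ev01] leaves 0. *)
Let Ev_lower : exists2 c, 0 < c & P (Ev c) = 0%E.
Proof.
have [c c0 [n1 hn]] := modulus_lower (gu j0) cH0 mh h0 N0 H01 be0 al01 alE c10 c20 hle hge a0 ab abx.
have [A hA] := choice (fun n => hn (n + n1)%N (leq_addl _ _)).
exists c => //; case: (Ev01 c) => // Ev1.
have mA n : measurable (A n) by case: (hA n).
have L := limsup_ge (P := P) mA (fun n => let: And3 _ x _ := hA n in x).
have mL : measurable (lim_sup_set A) by apply: bigcap_measurable => // i _; apply: bigcup_measurable.
have dis : lim_sup_set A `<=` ~` Ev c.
  move=> w Lw [n [m hw]]; have [n' /= nn' Aw] := Lw n.+1 I.
  have [_ _ /(_ w Aw) [p [q [bp bq pq hpq]]]] := hA n'.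
  have e0 : (0 : R) < 2^-1 ^+ (n' + n1) by rewrite exprn_gt0.
  have pl : pdist p q < 2^-1 ^+ n.
    by rewrite pq ltr_iXn2l ?invr_gt0 ?invf_lt1 ?ltr1n//; apply: leq_trans nn' (leq_addr _ _).
  have pq0 : 0 < pdist p q by rewrite pq.
  have := modulus_dense a0 ab abx (fun l => @cu l w) hw bp bq pq0 pl.
  apply/negP; rewrite -ltNge; apply: (@lt_le_trans _ _ (c * psi (pdist p q))).
    by rewrite ltr_pM2r ?gauge_gt0// ltrBlDr ltrDl invr_gt0.
  rewrite {1}pq; apply: (le_trans hpq); apply: (le_trans (ler_norm _)).
  exact: (enormf_coord (fun l => u l p w - u l q w) j0).
have PC : P (~` Ev c) = 0%E by have -> := probability_setC P (Ev_meas c); rewrite Ev1 subee.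
have : ((16^-1)%:E <= P (~` Ev c))%E.
  by apply: (le_trans L); apply: le_measure => //; rewrite inE//; exact: measurableC.
by rewrite PC lee_fin lt_geF// invr_gt0.
Qed.

Lemma modulus_limit : exists C : R, 0 < C /\ {ae P, forall w,
  (fun eps => mod_sup al (box a b ax bx) (fun j p => u j p w) eps) @ at_right 0 --> C%:E}.
Proof.
have [cu' Pu] := Ev_upper; have [cl cl0 Pl] := Ev_lower.
pose S := [set c | P (Ev c) = 1%E].
have lbS : lbound S cl.
  move=> c Sc; rewrite leNgt; apply/negP => ccl.
  have : (P (Ev c) <= P (Ev cl))%E by apply: le_measure; rewrite ?inE//; apply: Ev_mono; exact: ltW.
  by rewrite Sc Pl lee_fin ler10.
have infS : has_inf S by split; [exists cu'|exists cl].
pose C := inf S.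
have C0 : 0 < C by apply: lt_le_trans cl0 _; apply: lb_le_inf => //; exists cu'.
exists C; split=> //.
have P1 x : C < x -> {ae P, forall w, Ev x w}.
  rewrite -subr_gt0 => Cx; have [c Sc cx] := inf_adherent Cx infS.
  apply: filterS (prob1_ae (Ev_meas c) Sc); apply: Ev_mono; apply: ltW.
  by move: cx; rewrite addrC subrK.
have P0 x : x < C -> {ae P, forall w, ~ Ev x w}.
  move=> xC; case: (Ev01 x) => Px; last first.
    have : C <= x by apply: inf_lbound => //; exists cl.
    by rewrite leNgt xC.
  by exists (Ev x); split=> // w /= /contrapT.
(* The almost sure statements are collected along the countable sequence of levels at distance
   [k.+1%:R^-1] from [C], one exceptional set for all of them. *)
have Q1 : {ae P, forall w, forall k : nat, Ev (C + k.+1%:R^-1) w}.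
  by apply: ae_foralln => i; apply: P1; rewrite ltrDl invr_gt0.
have Q0 : {ae P, forall w, forall k : nat, ~ Ev (C - k.+1%:R^-1) w}.
  by apply: ae_foralln => i; apply: P0; rewrite ltrBlDr ltrDl invr_gt0.
apply: filterS2 Q1 Q0 => w w1 w0; apply: cvg_at_right_pinch => i.
have [n [m hw]] := w1 i; exists (2^-1 ^+ n); first by rewrite exprn_gt0.
move=> e e0 en; split.
  rewrite ltNge; apply/negP => he; apply: (w0 i).
  have [n' hn'] : exists n', (2^-1 ^+ n' : R) <= e.
    exists (Num.truncn e^-1); rewrite exprVn invf_ple ?posrE ?exprn_gt0//.
    apply: ltW; apply: lt_le_trans (truncnS_gt _) _; rewrite -natrX ler_nat; exact: ltn_expl.
  exists n', i => i' j'; have -> : C - i.+1%:R^-1 - i.+1%:R^-1 = C - 2 * i.+1%:R^-1 by ring.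
  by apply: (le_mod_sup (U := fun l p => u l p w) ab abx al0 hn' he).
have hw' i' j' : pdist (g i') (g j') < 2^-1 ^+ n ->
    enormf (fun l => u l (g i') w - u l (g j') w) <= (C + i.+1%:R^-1) * psi (pdist (g i') (g j')).
  move=> ij; apply: (le_trans (hw i' j' ij)); apply: ler_wpM2r; first exact: gauge_ge0.
  by rewrite lerBlDr lerDl invr_ge0.
exact: (mod_sup_le a0 ab abx (fun l => @cu l w) en hw').
Qed.

End conclusion.

Unset Implicit Arguments.

Theorem theorem3p7
  (R : realType) (N d : nat) (H beta c1 c2 cH : R)
  (h : 'rV[R]_N -> R)
  (dO : measure_display) (Om : measurableType dO) (P : probability Om R)
  (u : 'I_d -> R * 'rV[R]_N -> Om -> R) :
  (0 < N)%N -> (0 < d)%N ->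
  1 / 2 <= H -> H < 1 -> 0 < beta -> beta < N%:R ->
  N%:R - 2 * H - 1 < beta -> beta < N%:R - 2 * H + 1 ->
  0 < c1 -> c1 <= c2 -> 0 < cH ->
  measurable_fun [set: N.-tuple R] (fun t => h (tup2row t)) ->
  (forall xi, 0 <= h xi) ->
  (forall xi, xi != 0 ->
     c1 * powR (enorm xi) (- beta) <= h xi <= c2 * powR (enorm xi) (- beta)) ->
  (* u_1, ..., u_d : i.i.d. centered Gaussian fields on [0,oo) x R^N with the
     prescribed covariance, having continuous sample paths *)
  (forall j, centered_gaussian_field P [set p | 0 <= p.1] (u j)
                                     (cov_kernel H cH h)) ->
  independent_fields P [set p | 0 <= p.1] u ->
  (forall j w, {within [set p : R * 'rV[R]_N | 0 <= p.1],
                continuous (fun p => u j p w)}) ->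
  let alpha := (2 * H + 1 - N%:R + beta) / 2 in
  forall (a b : R) (ax bx : 'rV[R]_N),
    0 < a -> a < b -> (forall i, ax 0 i < bx 0 i) ->
    exists C : R, 0 < C /\
      {ae P, forall w,
         (fun eps => mod_sup alpha (box a b ax bx) (fun j p => u j p w) eps)
           @ at_right 0 --> C%:E}.
Proof.
move=> N0 d0 H1 H2 be0 beN be1 be2 c10 c12 cH0 mh h0 hb gu iu cu al a b ax bx a0 ab abx.
apply: (@modulus_limit R N d H beta c1 c2 cH h dO Om P u) => //.
- by apply/andP; split; lra.
- by rewrite /al; apply/andP; split; lra.
- exact: lt_le_trans c12.
- by move=> xi /hb /andP[].
- by move=> xi /hb /andP[].
Qed.
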